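(* If $\mathrm{ZF}$ is consistent, then so is $\mathrm{ZFC} + (Imp \models \neg \mathrm{CH})$.
   Context: For a transitive set $X$, a subset $S \subseteq X$ is implicitly definable over $X$ if for some formula $\varphi(x_1,\dots,x_n)$ in the language of set theory augmented by a one-place predicate symbol, and some parameters $a_1,\dots,a_n \in X$, $S$ is the unique subset of $X$ such that $(X,\in,S) \models \varphi(a_1,\dots,a_n)$. The implicitly constructible universe $Imp$ is defined by $Imp_0=\emptyset$, $Imp_{\alpha+1} = \{S : S \text{ is implicitly definable over } Imp_\alpha\}$, $Imp_\lambda = \bigcup_{\alpha<\lambda} Imp_\alpha$ for limit $\lambda$, and $Imp = \bigcup_{\alpha \in \mathrm{Ord}} Imp_\alpha$. *)

(* Defs.v *)
From Stdlib Require Import List Arith.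
Import ListNotations.

(** * First-order logic with equality in the language {∈} *)

(* Variables are de Bruijn indices; the language is relational, so variables
   are the only terms. The remaining connectives are the classical
   abbreviations. *)
Inductive form : Set :=
| fMem (i j : nat)
| fEq (i j : nat)
| fBot
| fImp (A B : form)
| fAll (A : form).

Definition up (r : nat -> nat) (i : nat) : nat :=
  match i with 0 => 0 | S k => S (r k) end.

Fixpoint ren (r : nat -> nat) (A : form) : form :=
  match A with
  | fMem i j => fMem (r i) (r j)
  | fEq i j => fEq (r i) (r j)
  | fBot => fBot
  | fImp A B => fImp (ren r A) (ren r B)
  | fAll A => fAll (ren (up r) A)
  end.

Definition inst (t : nat) (i : nat) : nat :=
  match i with 0 => t | S k => k end.

Inductive prv : list form -> form -> Prop :=
| prv_ctx G A : In A G -> prv G A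
| prv_impI G A B : prv (A :: G) B -> prv G (fImp A B)
| prv_impE G A B : prv G (fImp A B) -> prv G A -> prv G B
| prv_raa G A : prv (fImp A fBot :: G) fBot -> prv G A
| prv_allI G A : prv (map (ren S) G) A -> prv G (fAll A)
| prv_allE G A t : prv G (fAll A) -> prv G (ren (inst t) A)
| prv_eqI G t : prv G (fEq t t)
| prv_eqE G A s t :
    prv G (fEq s t) -> prv G (ren (inst s) A) -> prv G (ren (inst t) A).

Definition theory := form -> Prop.

Definition proves (T : theory) (A : form) : Prop :=
  exists G, (forall B, In B G -> T B) /\ prv G A.

Definition consistent (T : theory) : Prop := ~ proves T fBot.

Definition extend (T : theory) (A : form) : theory := fun B => T B \/ B = A.

Fixpoint bound (A : form) : nat :=
  match A with
  | fMem i j | fEq i j => Nat.max (S i) (S j)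
  | fBot => 0
  | fImp A B => Nat.max (bound A) (bound B)
  | fAll A => pred (bound A)
  end.

Definition uclose (A : form) : form := Nat.iter (bound A) fAll A.

(* [C] is a formula whose only free variable is index 0, so it needs no
   renaming under binders. *)
Fixpoint relativize (C A : form) : form :=
  match A with
  | fAll A => fAll (fImp C (relativize C A))
  | fImp A B => fImp (relativize C A) (relativize C B)
  | fMem _ _ | fEq _ _ | fBot => A
  end.

(** * Writing formulas with named binders *)

(* An [fml] is a formula awaiting the number of binders it sits under. The
   binders below bind Rocq variables of type [lvar]; these are de Bruijn
   levels, which stay valid at every greater depth and are turned into indices
   at the atoms. *)
Definition fml := nat -> form.

Variant lvar := Lvl (k : nat).

Definition idx (d : nat) (x : lvar) : nat := let (k) := x in d - S k.

Definition sentence (A : fml) : form := A 0.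

Declare Scope fml_scope.
Delimit Scope fml_scope with fml.
Bind Scope fml_scope with fml.
Local Open Scope fml_scope.

Definition implF (A B : fml) : fml := fun d => fImp (A d) (B d).
Definition botF : fml := fun _ => fBot.
Definition allF (P : lvar -> fml) : fml := fun d => fAll (P (Lvl d) (S d)).

Notation "A ⇒ B" := (implF A B) (at level 90, right associativity) : fml_scope.
Notation "¬ A" := (implF A botF) (at level 75, right associativity) : fml_scope.

Definition orF (A B : fml) : fml := ¬ A ⇒ B.
Definition andF (A B : fml) : fml := ¬ (A ⇒ ¬ B).

Notation "A ∨ B" := (orF A B) (at level 85, right associativity) : fml_scope.
Notation "A ∧ B" := (andF A B) (at level 80, right associativity) : fml_scope.

Definition iffF (A B : fml) : fml := (A ⇒ B) ∧ (B ⇒ A).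
Definition exF (P : lvar -> fml) : fml := ¬ allF (fun x => ¬ P x).

Notation "A ⇔ B" := (iffF A B) (at level 95, no associativity) : fml_scope.
Notation "∀ x .. y , P" := (allF (fun x => .. (allF (fun y => P)) ..))
  (at level 10, x binder, y binder, P at level 200) : fml_scope.
Notation "∃ x .. y , P" := (exF (fun x => .. (exF (fun y => P)) ..))
  (at level 10, x binder, y binder, P at level 200) : fml_scope.

(* [The P] is the definite description "the x such that P x", eliminated
   à la Russell at the atom in which it occurs. [bind] eliminates it earlier,
   which avoids copying the description. *)
Variant term :=
| Var (x : lvar)
| The (P : lvar -> fml).
Coercion Var : lvar >-> term.

Definition bind (t : term) (K : lvar -> fml) : fml :=
  match t with
  | Var x => K x
  | The P => ∃ x, P x ∧ K x
  end.

Definition memF (s t : term) : fml :=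
  bind s (fun x => bind t (fun y => fun d => fMem (idx d x) (idx d y))).
Definition eqF (s t : term) : fml :=
  bind s (fun x => bind t (fun y => fun d => fEq (idx d x) (idx d y))).

Notation "s ∈ t" := (memF s t) (at level 70, no associativity) : fml_scope.
Notation "s ≡ t" := (eqF s t) (at level 70, no associativity) : fml_scope.
Notation "∀[ x ∈ t ] P" := (allF (fun x => memF x t ⇒ P))
  (at level 10, x name, t at level 69, P at level 200) : fml_scope.
Notation "∃[ x ∈ t ] P" := (exF (fun x => memF x t ∧ P))
  (at level 10, x name, t at level 69, P at level 200) : fml_scope.

Definition exuF (P : lvar -> fml) : fml := ∃ x, P x ∧ ∀ y, P y ⇒ y ≡ x.

Notation "∃! x , P" := (exuF (fun x => P))
  (at level 10, x name, P at level 200) : fml_scope.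

(* The formula [A] with its free indices 0, 1, ... replaced by the variables
   [xs]; the free indices beyond [length xs] remain free, as parameters. *)
Definition subst (A : form) (xs : list lvar) : fml := fun d =>
  ren (fun i => nth i (map (idx d) xs) (d + (i - length xs))) A.

(** * Basic set-theoretic vocabulary *)

Definition subset (s t : term) : fml := ∀[x ∈ s] x ∈ t.
Notation "s ⊆ t" := (subset s t) (at level 70, no associativity) : fml_scope.

Definition Empty : term := The (fun e => ∀ z, ¬ z ∈ e).
Definition UPair (s t : term) : term :=
  The (fun p => bind s (fun x => bind t (fun y => ∀ z, z ∈ p ⇔ z ≡ x ∨ z ≡ y))).
Definition OPair (s t : term) : term :=
  The (fun p => bind s (fun x => bind t (fun y => p ≡ UPair (UPair x x) (UPair x y)))).
Definition Succ (s : term) : term :=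
  The (fun u => bind s (fun x => ∀ z, z ∈ u ⇔ z ∈ x ∨ z ≡ x)).
Definition Pow (s : term) : term :=
  The (fun p => bind s (fun x => ∀ z, z ∈ p ⇔ z ⊆ x)).

Notation "⟨ s , t ⟩" := (OPair s t) (at level 0, format "⟨ s ,  t ⟩") : fml_scope.

Fixpoint Num (k : nat) : term :=
  match k with 0 => Empty | S k => Succ (Num k) end.

Definition transitive (s : term) : fml := ∀[x ∈ s] x ⊆ s.
Definition ordinal (s : term) : fml := transitive s ∧ ∀[x ∈ s] transitive x.
Definition successor (s : term) : fml := ∃ x, s ≡ Succ x.
Definition limit (s : term) : fml := ordinal s ∧ ¬ s ≡ Empty ∧ ¬ successor s.
Definition natural (s : term) : fml := ordinal s ∧ ∀[x ∈ Succ s] x ≡ Empty ∨ successor x.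
Definition Omega : term := The (fun w => ∀ n, n ∈ w ⇔ natural n).

Definition function_on (f D : term) : fml :=
  (∀[p ∈ f] ∃[x ∈ D] ∃ y, p ≡ ⟨x, y⟩) ∧ ∀[x ∈ D] ∃! y, ⟨x, y⟩ ∈ f.
Definition function (f X Y : term) : fml :=
  function_on f X ∧ ∀ x y, ⟨x, y⟩ ∈ f ⇒ y ∈ Y.
Definition injection (f X Y : term) : fml :=
  function f X Y ∧ ∀ x x' y, ⟨x, y⟩ ∈ f ⇒ ⟨x', y⟩ ∈ f ⇒ x ≡ x'.
Definition bijection (f X Y : term) : fml :=
  injection f X Y ∧ ∀[y ∈ Y] ∃ x, ⟨x, y⟩ ∈ f.
Definition App (f x : term) : term := The (fun y => ⟨x, y⟩ ∈ f).

(** * ZF and ZFC *)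

Definition extensionality : fml := ∀ x y, (∀ z, z ∈ x ⇔ z ∈ y) ⇒ x ≡ y.
Definition foundation : fml :=
  ∀ a, (∃ x, x ∈ a) ⇒ ∃[x ∈ a] ¬ ∃ z, z ∈ x ∧ z ∈ a.
Definition pairing : fml := ∀ x y, ∃ p, ∀ z, z ∈ p ⇔ z ≡ x ∨ z ≡ y.
Definition union : fml := ∀ a, ∃ u, ∀ z, z ∈ u ⇔ ∃[x ∈ a] z ∈ x.
Definition powerset : fml := ∀ a, ∃ p, ∀ z, z ∈ p ⇔ z ⊆ a.
Definition infinity : fml := ∃ w, Empty ∈ w ∧ ∀[x ∈ w] Succ x ∈ w.

(* In [A], index 0 is z and the higher indices are parameters. *)
Definition separation (A : form) : fml :=
  ∀ a, ∃ b, ∀ z, z ∈ b ⇔ z ∈ a ∧ subst A [z].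

(* In [A], index 0 is x, index 1 is y and the higher indices are parameters. *)
Definition replacement (A : form) : fml :=
  (∀ x y y', subst A [x; y] ⇒ subst A [x; y'] ⇒ y ≡ y') ⇒
  ∀ a, ∃ b, ∀ y, y ∈ b ⇔ ∃[x ∈ a] subst A [x; y].

Inductive ZF : theory :=
| ZF_extensionality : ZF (sentence extensionality)
| ZF_foundation : ZF (sentence foundation)
| ZF_pairing : ZF (sentence pairing)
| ZF_union : ZF (sentence union)
| ZF_powerset : ZF (sentence powerset)
| ZF_infinity : ZF (sentence infinity)
| ZF_separation A : ZF (uclose (separation A 0))
| ZF_replacement A : ZF (uclose (replacement A 0)).

Definition choice : fml :=
  ∀ a, (∀[x ∈ a] ∃ z, z ∈ x) ⇒
       (∀[x ∈ a] ∀[y ∈ a] (∃ z, z ∈ x ∧ z ∈ y) ⇒ x ≡ y) ⇒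
       ∃ c, ∀[x ∈ a] ∃! z, z ∈ x ∧ z ∈ c.

Definition ZFC : theory := extend ZF (sentence choice).

(** * The continuum hypothesis, 2^ℵ₀ = ℵ₁ *)

Definition countable (s : term) : fml := ∃ f, injection f s Omega.
Definition Omega1 : term :=
  The (fun k => ordinal k ∧ ¬ countable k ∧ ∀[b ∈ k] countable b).
Definition CH : fml := ∃ f, bijection f (Pow Omega) Omega1.

(** * Implicit definability and Imp, inside set theory *)

(* Codes of formulas in the language of set theory with an extra one-place
   predicate symbol. The variables of a formula are numbers; in a formula with
   free variables among x_0, ..., x_{n-1}, the outermost quantifier binds x_n. *)
Definition cMem (i j : term) : term := ⟨Num 0, ⟨i, j⟩⟩.
Definition cEq (i j : term) : term := ⟨Num 1, ⟨i, j⟩⟩.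
Definition cPred (i : term) : term := ⟨Num 2, i⟩.
Definition cBot : term := ⟨Num 3, Empty⟩.
Definition cImp (c d : term) : term := ⟨Num 4, ⟨c, d⟩⟩.
Definition cAll (c : term) : term := ⟨Num 5, c⟩.

Definition code_closed (Z : term) : fml :=
  ∀[n ∈ Omega]
    (∀[i ∈ n] ∀[j ∈ n] ⟨n, cMem i j⟩ ∈ Z ∧ ⟨n, cEq i j⟩ ∈ Z) ∧
    (∀[i ∈ n] ⟨n, cPred i⟩ ∈ Z) ∧
    ⟨n, cBot⟩ ∈ Z ∧
    (∀ c d, ⟨n, c⟩ ∈ Z ⇒ ⟨n, d⟩ ∈ Z ⇒ ⟨n, cImp c d⟩ ∈ Z) ∧
    (∀ c, ⟨Succ n, c⟩ ∈ Z ⇒ ⟨n, cAll c⟩ ∈ Z).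

(* c codes a formula with free variables among x_0, ..., x_{n-1}. *)
Definition formula_code (n c : term) : fml := ∀ Z, code_closed Z ⇒ ⟨n, c⟩ ∈ Z.

(* For a function a with domain n, this is the tuple a followed by x. *)
Definition Snoc (a n x : term) : term :=
  The (fun b => ∀ p, p ∈ b ⇔ p ∈ a ∨ p ≡ ⟨n, x⟩).

(* T is a satisfaction relation for the structure (X, ∈, S); it relates codes
   of formulas in n free variables to n-tuples from X. Finite tuples are used,
   rather than assignments of all variables, so that X may be empty. *)
Definition satisfaction_relation (T X S : term) : fml :=
  ∀[n ∈ Omega] ∀ a, function a n X ⇒
    (∀[i ∈ n] ∀[j ∈ n] ⟨cMem i j, a⟩ ∈ T ⇔ App a i ∈ App a j) ∧
    (∀[i ∈ n] ∀[j ∈ n] ⟨cEq i j, a⟩ ∈ T ⇔ App a i ≡ App a j) ∧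
    (∀[i ∈ n] ⟨cPred i, a⟩ ∈ T ⇔ App a i ∈ S) ∧
    ¬ ⟨cBot, a⟩ ∈ T ∧
    (∀ c d, formula_code n c ⇒ formula_code n d ⇒
       (⟨cImp c d, a⟩ ∈ T ⇔ (⟨c, a⟩ ∈ T ⇒ ⟨d, a⟩ ∈ T))) ∧
    (∀ c, formula_code (Succ n) c ⇒
       (⟨cAll c, a⟩ ∈ T ⇔ ∀[x ∈ X] ⟨c, Snoc a n x⟩ ∈ T)).

Definition satisfies (X S c a : term) : fml :=
  ∃ T, satisfaction_relation T X S ∧ ⟨c, a⟩ ∈ T.

Definition implicitly_definable (S X : term) : fml :=
  S ⊆ X ∧
  ∃[n ∈ Omega] ∃ c a, formula_code n c ∧ function a n X ∧
    satisfies X S c a ∧ ∀ S', S' ⊆ X ⇒ satisfies X S' c a ⇒ S' ≡ S.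

(* f is the sequence of the Imp_β for β ≤ α. *)
Definition Imp_sequence (f α : term) : fml :=
  function_on f (Succ α) ∧
  ∀ β Y, ⟨β, Y⟩ ∈ f ⇒
    (β ≡ Empty ⇒ Y ≡ Empty) ∧
    (∀ γ X, β ≡ Succ γ ⇒ ⟨γ, X⟩ ∈ f ⇒
       ∀ S, S ∈ Y ⇔ implicitly_definable S X) ∧
    (limit β ⇒ ∀ z, z ∈ Y ⇔ ∃[γ ∈ β] z ∈ App f γ).

Definition in_Imp (x : term) : fml :=
  ∃ α f, ordinal α ∧ Imp_sequence f α ∧ x ∈ App f α.

Definition Imp_class : form := in_Imp (Lvl 0) 1.

(* "Imp ⊨ A", for a proper class, is the relativization of A to Imp. *)
Definition Imp_models (A : fml) : form := relativize Imp_class (sentence A).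

(* Main.v *)
(* A countable model of ZF yields its constructible universe N, and N a generic extension W by a
   poset Q of pairs of a finite partial assignment of literals "n ∈ r_ξ" (ξ < λ) and of promises.
   The literals generate an index set I: below every index i hangs a tree of binary sequences of
   length < κ_i, whose nodes are again indices, and a promise commits the generic set Γ ⊆ I of
   switched-on indices to follow one branch of the tree below i as soon as i itself is switched on.
   Thus below a switched-on index W contains an N-generic branch, whereas below an index that
   is switched off it contains none: promises at indices that are constructed later are closed under
   long increasing unions, those constructed earlier are too few, and promises below i have become
   irrelevant. Hence Γ is the only set in W that solves a system of clauses lying in N, so Γ is
   implicitly definable over a level of Imp that contains this system. Since every constructible set
   is in Imp, all the reals r_ξ are in Imp. As Q adds neither an injection of λ into μ nor one of μ
   into ω, for N-cardinals ω < μ < λ, the continuum hypothesis fails in Imp. *)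
From Stdlib Require Import Arith Cantor Classical ClassicalEpsilon FunctionalExtensionality Lia List PropExtensionality.
Require Import Defs.
Import ListNotations.

(** * Models and completeness *)

(** Clauses cannot name the generic filter, so an on index must be recognised by a witness: a branch
    meeting every dense set of N can be demanded by clauses in N, and W can be made to contain one
    exactly below the on indices. But the branch is new itself and must be pinned down by the same
    clauses. This is why nodes are indices with trees of their own, a regress that closes after ω
    steps. The absence of branches below off indices rests on a count: the data of earlier indices
    must be too few to predict the bits of a branch, while later trees must be closed under unions
    of chains indexed by these data. Tree lengths are therefore least ordinals that are not images
    of A^ω, where A collects the earlier data. Images of A^ω are closed under A-indexed unions, so
    regularity, the pigeonhole principle and the chain condition need no cardinal arithmetic. For
    the same reason μ and λ are not ω_1 and ω_2 but the first ordinals that are not images of ω^ω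
    and (ω ∪ μ)^ω. *)

Record str := Str { dom :> Type; mem : dom -> dom -> Prop; prd : dom -> Prop }.
Arguments mem {s}. Arguments prd {s}.

Definition scons {A} (x : A) (r : nat -> A) (i : nat) : A :=
  match i with 0 => x | S k => r k end.
Notation "x .: r" := (scons x r) (at level 55, right associativity).

Fixpoint sat (M : str) (r : nat -> M) (A : form) : Prop :=
  match A with
  | fMem i j => mem (r i) (r j)
  | fEq i j => r i = r j
  | fBot => False
  | fImp A B => sat M r A -> sat M r B
  | fAll A => forall x, sat M (x .: r) A
  end.

Lemma scons_eta {A} (r : nat -> A) : r 0 .: (fun i => r (S i)) = r.
Proof. extensionality i; destruct i; reflexivity. Qed.

Lemma scons_comp {A B} (f : A -> B) x r :
  (fun i => f ((x .: r) i)) = f x .: (fun i => f (r i)).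
Proof. extensionality i; destruct i; reflexivity. Qed.

Lemma scons_up {A} (x : A) r (s : nat -> nat) :
  (fun i => (x .: r) (up s i)) = x .: (fun i => r (s i)).
Proof. extensionality i; destruct i; reflexivity. Qed.

Lemma sat_ren M A : forall s r, sat M r (ren s A) <-> sat M (fun i => r (s i)) A.
Proof.
  induction A; intros s r; simpl; try tauto.
  - rewrite IHA1, IHA2; tauto.
  - split; intros H x; specialize (H x).
    + rewrite IHA, scons_up in H; exact H.
    + rewrite IHA, scons_up; exact H.
Qed.

Lemma sat_bound M A : forall r r', (forall i, i < bound A -> r i = r' i) ->
  (sat M r A <-> sat M r' A).
Proof.
  induction A; intros r r' H; simpl in *.
  1,2: rewrite (H i), (H j) by lia; tauto.
  - tauto.
  - rewrite (IHA1 r r'), (IHA2 r r') by (intros; apply H; lia); tauto.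
  - split; intros K x; specialize (K x); revert K; apply IHA;
      intros [|i] Hi; simpl; auto; [symmetry|]; apply H; lia.
Qed.

Lemma inst_sat {A} t (r : nat -> A) : (fun i => r (inst t i)) = r t .: r.
Proof. extensionality i; destruct i; reflexivity. Qed.

Lemma soundness G A : prv G A -> forall M r, (forall B, In B G -> sat M r B) -> sat M r A.
Proof.
  induction 1; intros M r H'.
  - auto.
  - intros K. apply IHprv. intros C [<-|HC]; auto.
  - apply (IHprv1 M r H' (IHprv2 M r H')).
  - apply NNPP. intros K. apply (IHprv M r). intros C [<-|HC]; auto.
  - intros x. apply IHprv. intros C HC. apply in_map_iff in HC as (D & <- & HD).
    apply sat_ren. apply H'; auto.
  - apply sat_ren. rewrite inst_sat. apply (IHprv M r H').
  - reflexivity.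
  - specialize (IHprv1 M r H'). specialize (IHprv2 M r H'). simpl in IHprv1.
    rewrite sat_ren, inst_sat in IHprv2. rewrite sat_ren, inst_sat.
    rewrite <- IHprv1. exact IHprv2.
Qed.

Lemma weaken G A : prv G A -> forall G', incl G G' -> prv G' A.
Proof.
  induction 1; intros G' HG.
  - apply prv_ctx; auto.
  - apply prv_impI, IHprv. intros C [<-|HC]; [left|right]; auto.
  - eapply prv_impE; eauto.
  - apply prv_raa, IHprv. intros C [<-|HC]; [left|right]; auto.
  - apply prv_allI, IHprv. intros C HC. apply in_map_iff in HC as (D & <- & HD).
    apply in_map; auto.
  - apply prv_allE; auto.
  - apply prv_eqI.
  - eapply prv_eqE; eauto.
Qed.

Lemma ren_ren A : forall s t, ren t (ren s A) = ren (fun i => t (s i)) A.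
Proof.
  induction A; intros s t; simpl; f_equal; auto.
  rewrite IHA. f_equal. extensionality i. destruct i; reflexivity.
Qed.

Lemma ren_bound A : forall s t, (forall i, i < bound A -> s i = t i) -> ren s A = ren t A.
Proof.
  induction A; intros s t H; simpl in *; f_equal; auto;
    try (apply H; lia); try (apply IHA1 || apply IHA2; intros; apply H; lia).
  apply IHA. intros [|i] Hi; simpl; auto. f_equal. apply H. lia.
Qed.

Lemma ren_id A : ren (fun i => i) A = A.
Proof.
  induction A; simpl; f_equal; auto.
  rewrite <- IHA at 2. f_equal. extensionality i; destruct i; reflexivity.
Qed.

Lemma ren_inst s t A : ren s (ren (inst t) A) = ren (inst (s t)) (ren (up s) A).
Proof. rewrite !ren_ren. f_equal. extensionality i; destruct i; reflexivity. Qed.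

Lemma prv_ren G A : prv G A -> forall f, prv (map (ren f) G) (ren f A).
Proof.
  induction 1; intros f; simpl.
  - apply prv_ctx, in_map; auto.
  - apply prv_impI, IHprv.
  - eapply prv_impE; [apply IHprv1|apply IHprv2].
  - apply prv_raa, IHprv.
  - apply prv_allI. specialize (IHprv (up f)). rewrite map_map in *.
    erewrite map_ext; [exact IHprv|]. intros B; simpl. rewrite !ren_ren. reflexivity.
  - rewrite ren_inst. apply prv_allE, IHprv.
  - apply prv_eqI.
  - rewrite ren_inst. eapply prv_eqE; [apply IHprv1|]. rewrite <- ren_inst. apply IHprv2.
Qed.

(** * Quotients by a congruence *)

Section Quotient.
Context (D : Type) (E Q : D -> D -> Prop).
Context (Qr : forall x, Q x x) (Qs : forall x y, Q x y -> Q y x)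
  (Qt : forall x y z, Q x y -> Q y z -> Q x z)
  (QE : forall x y x' y', Q x x' -> Q y y' -> E x y -> E x' y').

(** Classes are predicates, so that extensionality turns equivalent elements into equal ones: [sat]
    reads [fEq] as equality in Rocq. *)
Definition qdom := {P : D -> Prop | exists x, P = Q x}.
Definition cls (x : D) : qdom := exist _ (Q x) (ex_intro _ x eq_refl).
Definition qstr : str :=
  Str qdom (fun a b => exists x y, a = cls x /\ b = cls y /\ E x y) (fun _ => False).

Lemma cls_eq x y : cls x = cls y <-> Q x y.
Proof.
  split; intros H.
  - apply (f_equal (@proj1_sig _ _)) in H. simpl in H. rewrite H. apply Qr.
  - assert (K : Q x = Q y).
    { extensionality z. apply propositional_extensionality. split; eauto. }
    unfold cls. apply eq_sig_hprop; [intros; apply proof_irrelevance|exact K].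
Qed.

Lemma cls_surj (a : qstr) : exists x, a = cls x.
Proof.
  destruct a as [P [x Hx]]. exists x. subst P. reflexivity.
Qed.

Lemma cls_mem x y : @mem qstr (cls x) (cls y) <-> E x y.
Proof.
  split.
  - intros (x' & y' & H1 & H2 & H3). apply cls_eq in H1, H2. eapply QE; [| |exact H3]; auto.
  - intros H. exists x, y. auto.
Qed.

Fixpoint ssat (r : nat -> D) (A : form) : Prop :=
  match A with
  | fMem i j => E (r i) (r j)
  | fEq i j => Q (r i) (r j)
  | fBot => False
  | fImp A B => ssat r A -> ssat r B
  | fAll A => forall x, ssat (x .: r) A
  end.

Lemma ssat_q A : forall r, sat qstr (fun i => cls (r i)) A <-> ssat r A.
Proof.
  induction A; intros r; simpl.
  - apply (cls_mem (r i) (r j)).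
  - apply cls_eq.
  - tauto.
  - rewrite IHA1, IHA2; tauto.
  - split; intros H x.
    + apply IHA. rewrite scons_comp. apply H.
    + destruct (cls_surj x) as [y ->]. rewrite <- (scons_comp cls). apply IHA. auto.
Qed.
End Quotient.

(** * Enumeration of the formulas *)

Fixpoint flist (n : nat) : list form :=
  match n with
  | 0 => []
  | S n => flist n ++ [fBot]
      ++ flat_map (fun i => flat_map (fun j => [fMem i j; fEq i j]) (seq 0 n)) (seq 0 n)
      ++ flat_map (fun A => map (fImp A) (flist n)) (flist n) ++ map fAll (flist n)
  end.

Lemma flist_mono n m A : n <= m -> In A (flist n) -> In A (flist m).
Proof. induction 1; auto. intros HA. simpl. apply in_or_app. left. auto. Qed.

Lemma flist_all A : exists n, In A (flist n).
Proof.
  induction A as [i j|i j| |A [n IHA] B [m IHB]|A [n IHA]].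
  1,2: exists (S (S (i + j))); cbn [flist]; do 2 (apply in_or_app; right); apply in_or_app; left;
    apply in_flat_map; exists i; split; [apply in_seq; lia|];
    apply in_flat_map; exists j; split; [apply in_seq; lia|simpl; auto].
  - exists 1. simpl. auto.
  - exists (S (n + m)). cbn [flist]. do 3 (apply in_or_app; right). apply in_or_app; left.
    apply in_flat_map. exists A. split; [eapply flist_mono; [|eassumption]; lia|].
    apply in_map. eapply flist_mono; [|eassumption]; lia.
  - exists (S n). cbn [flist]. do 4 (apply in_or_app; right). apply in_map; auto.
Qed.

(** The pair coded by [n] is a stage and a position in its list; positions beyond the end give
    [fBot], which does no harm in an enumeration. *)
Definition fenum (n : nat) : form := let (a, b) := of_nat n in nth b (flist a) fBot.

Lemma fenum_surj A : exists n, fenum n = A.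
Proof.
  destruct (flist_all A) as [a Ha]. apply In_nth with (d := fBot) in Ha as (b & _ & Hb).
  exists (to_nat (a, b)). unfold fenum. rewrite cancel_of_to. exact Hb.
Qed.

(** * Henkin's construction, with variables as constants *)

Section Completeness.
Context (T : theory) (Tclosed : forall A, T A -> bound A = 0) (Tcon : consistent T).

(** [T] enters through finite lists of its members only, so that [G] stays finite and always leaves
    a fresh variable. *)
Definition Con (G : list form) := ~ exists H, (forall B, In B H -> T B) /\ prv (G ++ H) fBot.

Lemma Con_neg G A : Con G -> ~ Con (A :: G) -> Con (fImp A fBot :: G).
Proof.
  intros HG HA (H & HT & HP). apply NNPP in HA as (H' & HT' & HP').
  apply HG. exists (H ++ H'). split.
  { intros B HB. apply in_app_or in HB as [|]; auto. }
  apply prv_impE with A; [apply prv_impI|apply prv_raa].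
  - eapply weaken; [exact HP'|]. intros B. simpl. rewrite !in_app_iff. tauto.
  - eapply weaken; [exact HP|]. intros B. simpl. rewrite !in_app_iff. tauto.
Qed.

Definition fresh (G : list form) := fold_right (fun A n => Nat.max (bound A) n) 0 G.

Lemma fresh_spec G A : In A G -> bound A <= fresh G.
Proof. induction G; simpl; [tauto|]. intros [<-|H]; [|apply IHG in H]; lia. Qed.

(** Members of [T] are closed, so a variable [c] beyond those of [G] is as good as a new constant:
    refuting the negated instance at [c] proves the instance, and generalizing proves [fAll B]. *)
Lemma Con_wit G B c : Con (fImp (fAll B) fBot :: G) ->
  (forall A, In A (fAll B :: G) -> bound A <= c) ->
  Con (fImp (ren (inst c) B) fBot :: fImp (fAll B) fBot :: G).
Proof.
  intros HG Hc (H & HT & HP). apply HG. exists H. split; auto.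
  apply prv_impE with (fAll B).
  { apply prv_ctx. left; auto. }
  set (G' := (fImp (fAll B) fBot :: G) ++ H) in *.
  assert (HP' : prv G' (ren (inst c) B)) by (apply prv_raa; exact HP).
  (* Sending [c] to the bound index and shifting all other variables turns the instance back into
     [B], and acts like [S] on formulas without [c]. *)
  set (s := fun i => if Nat.eq_dec i c then 0 else S i).
  apply (prv_ren _ _) with (f := s) in HP'.
  apply prv_allI. replace B with (ren s (ren (inst c) B)).
  - replace (map (ren S) G') with (map (ren s) G'); auto.
    apply map_ext_in. intros A HA. apply ren_bound. intros i Hi. unfold s.
    destruct (Nat.eq_dec i c); auto. exfalso. unfold G' in HA. simpl in HA.
    destruct HA as [<-|HA].
    + specialize (Hc (fAll B) (or_introl eq_refl)). simpl in *. lia.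
    + apply in_app_or in HA as [HA|HA].
      * specialize (Hc A (or_intror HA)). lia.
      * apply HT, Tclosed in HA. lia.
  - rewrite ren_ren. rewrite <- (ren_id B) at 2. apply ren_bound. intros [|i] Hi; simpl; unfold s.
    + destruct (Nat.eq_dec c c); lia.
    + destruct (Nat.eq_dec i c); auto. exfalso.
      specialize (Hc (fAll B) (or_introl eq_refl)). simpl in *. lia.
Qed.

(** When a universal formula is rejected, a counterexample at a fresh variable is recorded at once;
    the limit is then maximal and has witnesses. *)
Definition hstep (A : form) (G : list form) : list form :=
  if excluded_middle_informative (Con (A :: G)) then A :: G else
  match A with
  | fAll B => fImp (ren (inst (fresh (A :: G))) B) fBot :: fImp A fBot :: G
  | _ => fImp A fBot :: G
  end.

Fixpoint hen (n : nat) : list form :=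
  match n with 0 => [] | S n => hstep (fenum n) (hen n) end.

Lemma hen_con n : Con (hen n).
Proof.
  induction n; simpl.
  - intros (H & HT & HP). apply Tcon. exists H. auto.
  - unfold hstep. destruct (excluded_middle_informative _) as [|HC]; auto.
    pose proof (Con_neg _ _ IHn HC) as K. destruct (fenum n); auto.
    apply Con_wit; auto. intros A' HA. apply fresh_spec. exact HA.
Qed.

Lemma hen_mono n m A : n <= m -> In A (hen n) -> In A (hen m).
Proof.
  induction 1; auto. intros HA. simpl. unfold hstep.
  destruct (excluded_middle_informative _); [right; auto|].
  destruct (fenum m); simpl; auto.
Qed.

Definition Hk (A : form) := exists n, In A (hen n).

Lemma Hk_list H : (forall B, In B H -> Hk B) -> exists n, forall B, In B H -> In B (hen n).
Proof.
  induction H as [|A H IH]; intros HH.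
  - exists 0. simpl. tauto.
  - destruct IH as [n Hn]; [intros; apply HH; right; auto|].
    destruct (HH A (or_introl eq_refl)) as [m Hm]. exists (n + m).
    intros B [<-|HB]; [eapply hen_mono; [|exact Hm]|eapply hen_mono; [|apply Hn; exact HB]]; lia.
Qed.

Lemma Hk_bot H K : (forall B, In B H -> Hk B) -> (forall B, In B K -> T B) -> ~ prv (H ++ K) fBot.
Proof.
  intros HH HK HP. apply Hk_list in HH as [n Hn]. apply (hen_con n). exists K. split; auto.
  eapply weaken; [exact HP|]. intros B. rewrite !in_app_iff. intuition.
Qed.

Lemma Hk_dec A : Hk A \/ (Hk (fImp A fBot) /\ forall B, A = fAll B -> exists c, Hk (fImp (ren (inst c) B) fBot)).
Proof.
  destruct (fenum_surj A) as [n <-].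
  destruct (excluded_middle_informative (Con (fenum n :: hen n))) as [HC|HC].
  - left. exists (S n). simpl. unfold hstep.
    destruct (excluded_middle_informative _); [left; auto|tauto].
  - right. split.
    + exists (S n). simpl. unfold hstep. destruct (excluded_middle_informative _); [tauto|].
      destruct (fenum n); simpl; auto.
    + intros B HB. exists (fresh (fenum n :: hen n)). exists (S n). simpl. unfold hstep.
      destruct (excluded_middle_informative _); [tauto|]. rewrite HB. left. auto.
Qed.

Lemma Hk_closed H K A : (forall B, In B H -> Hk B) -> (forall B, In B K -> T B) ->
  prv (H ++ K) A -> Hk A.
Proof.
  intros HH HK HP. destruct (Hk_dec A) as [|[HA _]]; auto. exfalso.
  apply (Hk_bot (fImp A fBot :: H) K); auto.
  - intros B [<-|HB]; auto.
  - eapply prv_impE; [apply prv_ctx; left; reflexivity|].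
    eapply weaken; [exact HP|]. intros B HB. right. auto.
Qed.

Lemma Hk_ded H A : (forall B, In B H -> Hk B) -> prv H A -> Hk A.
Proof. intros HH HP. apply (Hk_closed H []); [auto|simpl; tauto|rewrite app_nil_r; auto]. Qed.

(** Maximality takes care of implication, the recorded counterexamples of the quantifier. The domain
    is [nat] because variables are the only terms. *)
Lemma Hk_truth A : forall r, ssat nat (fun i j => Hk (fMem i j)) (fun i j => Hk (fEq i j)) r A
  <-> Hk (ren r A).
Proof.
  induction A; intros r; simpl; try tauto.
  - split; [tauto|]. intros H. exfalso. apply (Hk_bot [fBot] []).
    + intros B [<-|[]]; auto.
    + simpl; tauto.
    + apply prv_ctx; left; auto.
  - rewrite IHA1, IHA2. split.
    + intros H. destruct (Hk_dec (ren r A1)) as [HA|[HA _]].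
      * apply (Hk_ded [ren r A2]); [intros B [<-|[]]; auto|].
        apply prv_impI, prv_ctx. right; left; auto.
      * apply (Hk_ded [fImp (ren r A1) fBot]); [intros B [<-|[]]; auto|].
        apply prv_impI, prv_raa. eapply prv_impE; apply prv_ctx; simpl; eauto.
    + intros H1 H2. apply (Hk_ded [fImp (ren r A1) (ren r A2); ren r A1]).
      * intros B [<-|[<-|[]]]; auto.
      * eapply prv_impE; apply prv_ctx; simpl; eauto.
  - assert (E : forall x, ren (inst x) (ren (up r) A) = ren (x .: r) A).
    { intros x. rewrite ren_ren. f_equal. extensionality i; destruct i; reflexivity. }
    split.
    + intros H. destruct (Hk_dec (fAll (ren (up r) A))) as [|[_ HA]]; auto.
      destruct (HA _ eq_refl) as [c Hc]. exfalso. specialize (H c). apply IHA in H.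
      rewrite E in Hc. apply (Hk_bot [fImp (ren (c .: r) A) fBot; ren (c .: r) A] []).
      * intros B [<-|[<-|[]]]; auto.
      * simpl; tauto.
      * eapply prv_impE; apply prv_ctx; simpl; eauto.
    + intros H x. apply IHA. rewrite <- E. apply (Hk_ded [fAll (ren (up r) A)]).
      * intros B [<-|[]]; auto.
      * apply prv_allE, prv_ctx. left; auto.
Qed.

(** The enumeration of the model is kept: countability yields the generic filter, and it lets one
    assignment supply all parameters of a formula. *)
Lemma completeness : exists M : str,
  (exists e : nat -> M, forall x, exists n, e n = x) /\
  forall A r, T A -> sat M r A.
Proof.
  set (Q := fun i j => Hk (fEq i j)). set (E := fun i j => Hk (fMem i j)).
  assert (sub : forall s t A, Q s t -> Hk (ren (inst s) A) -> Hk (ren (inst t) A)).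
  { intros s t A H1 H2. apply (Hk_ded [fEq s t; ren (inst s) A]).
    - intros B [<-|[<-|[]]]; auto.
    - eapply prv_eqE; apply prv_ctx; simpl; eauto. }
  assert (Qr : forall x, Q x x) by (intros; apply (Hk_ded []); [simpl; tauto|apply prv_eqI]).
  assert (Qs : forall x y, Q x y -> Q y x).
  { intros x y H. apply (sub x y (fEq 0 (S x)) H), Qr. }
  assert (Qt : forall x y z, Q x y -> Q y z -> Q x z).
  { intros x y z H1 H2. apply (sub y z (fEq (S x) 0) H2 H1). }
  assert (QE : forall x y x' y', Q x x' -> Q y y' -> E x y -> E x' y').
  { intros x y x' y' H1 H2 H. apply (sub y y' (fMem (S x') 0) H2), (sub x x' (fMem 0 (S y)) H1 H). }
  exists (qstr nat E Q). split.
  - exists (cls nat Q). intros x. destruct (cls_surj nat E Q x) as [n ->]. eauto.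
  - intros A r HA.
    apply (sat_bound _ _ r (fun i => cls nat Q i)); [intros i Hi; rewrite (Tclosed A HA) in Hi; lia|].
    apply (ssat_q nat E Q Qr Qs Qt QE A (fun i => i)), Hk_truth.
    rewrite ren_id. apply (Hk_closed [] [A]); simpl; [tauto|intros B [<-|[]]; auto|apply prv_ctx; left; auto].
Qed.
End Completeness.

(** * Definability with parameters *)

Inductive tm (M : Type) := V (i : nat) | K (x : M).
Arguments V {M}. Arguments K {M}.

(** Parameters are constants inside the formula. The predicate symbol is the one of implicit
    definability. *)
Inductive pform (M : Type) :=
| pMem (s t : tm M) | pEq (s t : tm M) | pPrd (s : tm M) | pBot
| pImp (A B : pform M) | pAll (A : pform M).
Arguments pMem {M}. Arguments pEq {M}. Arguments pPrd {M}. Arguments pBot {M}.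
Arguments pImp {M}. Arguments pAll {M}.

Definition tval {M : Type} (e : nat -> M) (t : tm M) : M :=
  match t with V i => e i | K x => x end.

Fixpoint psat {M : str} (e : nat -> M) (A : pform M) : Prop :=
  match A with
  | pMem s t => mem (tval e s) (tval e t)
  | pEq s t => tval e s = tval e t
  | pPrd s => prd (tval e s)
  | pBot => False
  | pImp A B => psat e A -> psat e B
  | pAll A => forall x, psat (x .: e) A
  end.

Definition tren {M} (r : nat -> nat) (t : tm M) := match t with V i => V (r i) | K x => K x end.
Definition tsub {M} (s : nat -> tm M) (t : tm M) := match t with V i => s i | K x => K x end.

Fixpoint psub {M} (s : nat -> tm M) (A : pform M) : pform M :=
  match A with
  | pMem t u => pMem (tsub s t) (tsub s u)
  | pEq t u => pEq (tsub s t) (tsub s u)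
  | pPrd t => pPrd (tsub s t)
  | pBot => pBot
  | pImp A B => pImp (psub s A) (psub s B)
  | pAll A => pAll (psub (fun i => match i with 0 => V 0 | S k => tren S (s k) end) A)
  end.

Lemma psat_sub (M : str) (A : pform M) : forall s e, psat e (psub s A) <-> psat (fun i => tval e (s i)) A.
Proof.
  assert (T : forall s e (t : tm M), tval e (tsub s t) = tval (fun i => tval e (s i)) t)
    by (intros ? ? []; reflexivity).
  induction A; intros r e; simpl; rewrite ?T; try tauto.
  - rewrite IHA1, IHA2; tauto.
  - assert (E : forall x, (fun i => tval (x .: e) (match i with 0 => V 0 | S k => tren S (r k) end))
      = x .: (fun i => tval e (r i))).
    { intros x. extensionality i. destruct i; auto. simpl. destruct (r i); reflexivity. }
    split; intros H x; specialize (H x); [rewrite IHA, E in H|rewrite IHA, E]; exact H.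
Qed.

Definition shift {M : Type} (e : nat -> M) : nat -> M := fun i => e (S i).

(** Definability is a property of predicates on assignments. Closure lemmas then replace the writing
    of formulas: [def] proves definability by following the shape of a predicate stated in Rocq. *)
Definition DefP {M : str} (P : (nat -> M) -> Prop) := exists A, forall e, P e <-> psat e A.
Definition DefT {M : str} (t : (nat -> M) -> M) := DefP (fun e => e 0 = t (fun i => e (S i))).
Definition D1 {M : str} (P : M -> Prop) := DefP (fun e => P (e 0)).
Definition D2 {M : str} (P : M -> M -> Prop) := DefP (fun e => P (e 0) (e 1)).
Definition D3 {M : str} (P : M -> M -> M -> Prop) := DefP (fun e => P (e 0) (e 1) (e 2)).
Definition D4 {M : str} (P : M -> M -> M -> M -> Prop) := DefP (fun e => P (e 0) (e 1) (e 2) (e 3)).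
Definition F1 {M : str} (f : M -> M) := DefT (fun e => f (e 0)).
Definition F2 {M : str} (f : M -> M -> M) := DefT (fun e => f (e 0) (e 1)).
Definition F3 {M : str} (f : M -> M -> M -> M) := DefT (fun e => f (e 0) (e 1) (e 2)).
Definition F4 {M : str} (f : M -> M -> M -> M -> M) := DefT (fun e => f (e 0) (e 1) (e 2) (e 3)).

Section Def.
Context {M : str}.
Implicit Types (P Q : (nat -> M) -> Prop) (s t : (nat -> M) -> M).

Lemma DefP_iff P Q : (forall e, P e <-> Q e) -> DefP P -> DefP Q.
Proof. intros H [A HA]. exists A. intros e. rewrite <- H. apply HA. Qed.

Lemma DefP_subst P (s : nat -> tm M) : DefP P -> DefP (fun e => P (fun i => tval e (s i))).
Proof. intros [A HA]. exists (psub s A). intros e. rewrite psat_sub. apply HA. Qed.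

Lemma DefP_ren P r : DefP P -> DefP (fun e => P (fun i => e (r i))).
Proof. apply (DefP_subst P (fun i => V (r i))). Qed.

Lemma DefP_imp P Q : DefP P -> DefP Q -> DefP (fun e => P e -> Q e).
Proof. intros [A HA] [B HB]. exists (pImp A B). intros e. simpl. rewrite HA, HB. tauto. Qed.

Lemma DefP_bot : DefP (fun _ : nat -> M => False).
Proof. exists pBot. simpl. tauto. Qed.

Lemma DefP_const (X : Prop) : DefP (fun _ : nat -> M => X).
Proof.
  destruct (classic X).
  - apply (DefP_iff (fun _ => False -> False)); [tauto|]. apply DefP_imp; apply DefP_bot.
  - apply (DefP_iff (fun _ => False)); [tauto|]. apply DefP_bot.
Qed.

Lemma DefP_not P : DefP P -> DefP (fun e => ~ P e).
Proof. intros H. apply DefP_imp; auto. apply DefP_bot. Qed.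

Lemma DefP_and P Q : DefP P -> DefP Q -> DefP (fun e => P e /\ Q e).
Proof.
  intros HP HQ. apply (DefP_iff (fun e => ~ (P e -> ~ Q e))).
  - intros e. tauto.
  - apply DefP_not, DefP_imp; auto. apply DefP_not; auto.
Qed.

Lemma DefP_or P Q : DefP P -> DefP Q -> DefP (fun e => P e \/ Q e).
Proof.
  intros HP HQ. apply (DefP_iff (fun e => ~ P e -> Q e)).
  - intros e. tauto.
  - apply DefP_imp; auto. apply DefP_not; auto.
Qed.

Lemma DefP_iff' P Q : DefP P -> DefP Q -> DefP (fun e => P e <-> Q e).
Proof. intros HP HQ. apply DefP_and; apply DefP_imp; auto. Qed.

Lemma DefP_all (P : (nat -> M) -> M -> Prop) :
  DefP (fun e => P (fun i => e (S i)) (e 0)) -> DefP (fun e => forall x, P e x).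
Proof. intros [A HA]. exists (pAll A). intros e. simpl. split; intros H x; apply (HA (x .: e)), H. Qed.

Lemma DefP_ex (P : (nat -> M) -> M -> Prop) :
  DefP (fun e => P (fun i => e (S i)) (e 0)) -> DefP (fun e => exists x, P e x).
Proof.
  intros H. apply (DefP_iff (fun e => ~ forall x, ~ P e x)).
  - intros e. split; intros K; [apply NNPP; firstorder|firstorder].
  - apply DefP_not, DefP_all. apply DefP_not; auto.
Qed.

Lemma DefT_ren t r : DefT t -> DefT (fun e => t (fun i => e (r i))).
Proof. intros H. apply (DefP_ren _ (up r)) in H. exact H. Qed.

Lemma DefT_var n : DefT (fun e : nat -> M => e n).
Proof. exists (pEq (V 0) (V (S n))). simpl. tauto. Qed.

Lemma DefT_K (x : M) : DefT (fun _ => x).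
Proof. exists (pEq (V 0) (K x)). simpl. tauto. Qed.

(** The syntax has no function symbols, so substitution of a definable term becomes a quantifier
    over its value. *)
Lemma DefP_sub (P : (nat -> M) -> M -> Prop) t :
  DefP (fun e => P (fun i => e (S i)) (e 0)) -> DefT t -> DefP (fun e => P e (t e)).
Proof.
  intros HP Ht. apply (DefP_iff (fun e => forall x, x = t e -> P e x)).
  - intros e. split; [auto|intros H x ->; auto].
  - apply DefP_all. apply DefP_imp; auto.
Qed.

Lemma DefP_app1 (R : M -> Prop) s : D1 R -> DefT s -> DefP (fun e => R (s e)).
Proof. intros HR Hs. apply (DefP_sub (fun _ x => R x)); auto. Qed.

Lemma DefP_app2 (R : M -> M -> Prop) s t : D2 R -> DefT s -> DefT t -> DefP (fun e => R (s e) (t e)).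
Proof.
  intros HR Hs Ht. apply (DefP_sub (fun e x => R x (t e)) s); auto.
  apply (DefP_sub (fun e y => R (e 0) y) (fun e => t (fun i => e (S i)))).
  - apply (DefP_ren _ (fun i => match i with 0 => 1 | _ => 0 end) HR).
  - apply DefT_ren; auto.
Qed.

Lemma DefP_app3 (R : M -> M -> M -> Prop) s t u :
  D3 R -> DefT s -> DefT t -> DefT u -> DefP (fun e => R (s e) (t e) (u e)).
Proof.
  intros HR Hs Ht Hu. apply (DefP_sub (fun e x => R x (t e) (u e)) s); auto.
  apply (DefP_sub (fun e y => R (e 0) y (u (fun i => e (S i)))) (fun e => t (fun i => e (S i)))).
  2: apply DefT_ren; auto.
  apply (DefP_sub (fun e y => R (e 1) (e 0) y) (fun e => u (fun i => e (S (S i))))).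
  2: apply (DefT_ren u (fun i => S (S i))); auto.
  apply (DefP_ren _ (fun i => match i with 0 => 2 | 1 => 1 | _ => 0 end) HR).
Qed.

Lemma DefP_app4 (R : M -> M -> M -> M -> Prop) s t u v :
  D4 R -> DefT s -> DefT t -> DefT u -> DefT v -> DefP (fun e => R (s e) (t e) (u e) (v e)).
Proof.
  intros HR Hs Ht Hu Hv. apply (DefP_sub (fun e x => R x (t e) (u e) (v e)) s); auto.
  apply (DefP_sub (fun e y => R (e 0) y (u (fun i => e (S i))) (v (fun i => e (S i)))) (fun e => t (fun i => e (S i)))).
  2: apply DefT_ren; auto.
  apply (DefP_sub (fun e y => R (e 1) (e 0) y (v (fun i => e (S (S i))))) (fun e => u (fun i => e (S (S i))))).
  2: apply (DefT_ren u (fun i => S (S i))); auto.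
  apply (DefP_sub (fun e y => R (e 2) (e 1) (e 0) y) (fun e => v (fun i => e (S (S (S i)))))).
  2: apply (DefT_ren v (fun i => S (S (S i)))); auto.
  apply (DefP_ren _ (fun i => match i with 0 => 3 | 1 => 2 | 2 => 1 | _ => 0 end) HR).
Qed.

Lemma D2_mem : D2 (@mem M).
Proof. exists (pMem (V 0) (V 1)). simpl. tauto. Qed.
Lemma D2_eq : D2 (@eq M).
Proof. exists (pEq (V 0) (V 1)). simpl. tauto. Qed.
Lemma D1_prd : D1 (@prd M).
Proof. exists (pPrd (V 0)). simpl. tauto. Qed.

Lemma DefT_app1 (f : M -> M) s : F1 f -> DefT s -> DefT (fun e => f (s e)).
Proof.
  intros Hf Hs. apply (DefP_app2 (fun y x => y = f x)); [exact Hf|apply DefT_var|apply DefT_ren; auto].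
Qed.
Lemma DefT_app2 (f : M -> M -> M) s t : F2 f -> DefT s -> DefT t -> DefT (fun e => f (s e) (t e)).
Proof.
  intros Hf Hs Ht.
  apply (DefP_app3 (fun y x z => y = f x z)); [exact Hf|apply DefT_var| |]; apply DefT_ren; auto.
Qed.
Lemma DefT_app3 (f : M -> M -> M -> M) s t u :
  F3 f -> DefT s -> DefT t -> DefT u -> DefT (fun e => f (s e) (t e) (u e)).
Proof.
  intros Hf Hs Ht Hu.
  apply (DefP_app4 (fun y x z w => y = f x z w)); [exact Hf|apply DefT_var| | |]; apply DefT_ren; auto.
Qed.

Lemma DefT_desc t (R : (nat -> M) -> M -> Prop) : (forall e y, y = t e <-> R e y) ->
  DefP (fun e => R (fun i => e (S i)) (e 0)) -> DefT t.
Proof. intros H. apply DefP_iff. intros e. symmetry. apply H. Qed.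

Lemma DefP_inst (P : (nat -> M) -> M -> Prop) e :
  DefP (fun e => P (fun i => e (S i)) (e 0)) -> D1 (P e).
Proof.
  intros H. apply (DefP_subst _ (fun i => match i with 0 => V 0 | S k => K (e k) end)) in H. exact H.
Qed.
End Def.

Create HintDb def.
#[export] Hint Resolve D2_mem D2_eq D1_prd : def.

Ltac defstep :=
  lazymatch goal with
  | |- D1 _ => first [solve [auto 2 with def nocore] | unfold D1]
  | |- D2 _ => first [solve [auto 2 with def nocore] | unfold D2]
  | |- D3 _ => first [solve [auto 2 with def nocore] | unfold D3]
  | |- D4 _ => first [solve [auto 2 with def nocore] | unfold D4]
  | |- F1 _ => first [solve [auto 2 with def nocore] | unfold F1]
  | |- F2 _ => first [solve [auto 2 with def nocore] | unfold F2]
  | |- F3 _ => first [solve [auto 2 with def nocore] | unfold F3]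
  | |- F4 _ => first [solve [auto 2 with def nocore] | unfold F4]
  | |- @DefP ?M (fun e => forall x : dom ?M, @?B e x) => apply (DefP_all B)
  | |- @DefP ?M (fun e => exists x : dom ?M, @?B e x) => apply (DefP_ex B)
  | |- DefP (fun e => ~ @?A e) => apply (DefP_not A)
  | |- DefP (fun e => @?A e -> @?B e) => apply (DefP_imp A B)
  | |- DefP (fun e => @?A e /\ @?B e) => apply (DefP_and A B)
  | |- DefP (fun e => @?A e \/ @?B e) => apply (DefP_or A B)
  | |- DefP (fun e => @?A e <-> @?B e) => apply (DefP_iff' A B)
  | |- DefP (fun _ => ?X) => apply (DefP_const X)
  | |- DefT (fun e => e ?n) => apply (DefT_var n)
  | |- DefT (fun _ => ?x) => apply (DefT_K x)
  | |- _ => defleaf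
  end
with defhook := fail
with defleaf :=
  first
  [ match goal with
    | H : DefT ?t |- DefT (fun e => ?t (fun i => e (@?r i))) => exact (DefT_ren t r H)
    | H : DefT ?t |- DefT ?t => exact H
    | H : DefP ?t |- DefP (fun e => ?t (fun i => e (@?r i))) => exact (DefP_ren t r H)
    | H : DefP ?t |- DefP ?t => exact H
    end
  | solve [auto 1 with deft nocore]
  | match goal with
    | |- DefP (fun e => ?R (@?s e) (@?t e) (@?u e) (@?v e)) => simple apply (DefP_app4 R s t u v); [solve [auto 2 with def nocore]|..]
    | |- DefP (fun e => ?R (@?s e) (@?t e) (@?u e)) => simple apply (DefP_app3 R s t u); [solve [auto 2 with def nocore]|..]
    | |- DefP (fun e => ?R (@?s e) (@?t e)) => simple apply (DefP_app2 R s t); [solve [auto 2 with def nocore]|..]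
    | |- DefP (fun e => ?R (@?s e)) => simple apply (DefP_app1 R s); [solve [auto 2 with def nocore]|..]
    | |- DefT (fun e => ?R (@?s e) (@?t e) (@?u e)) => simple apply (DefT_app3 R s t u); [solve [auto 2 with def nocore]|..]
    | |- DefT (fun e => ?R (@?s e) (@?t e)) => simple apply (DefT_app2 R s t); [solve [auto 2 with def nocore]|..]
    | |- DefT (fun e => ?R (@?s e)) => simple apply (DefT_app1 R s); [solve [auto 2 with def nocore]|..]
    end
  | defhook ].
Create HintDb deft.
Ltac def := repeat (cbv beta; defstep).

(** * Models of ZF *)

Notation "x 'ε' y" := (mem x y) (at level 70, no associativity).

Definition subs {M : str} (x y : M) := forall z, z ε x -> z ε y.
Definition tr {M : str} (x : M) := forall y, y ε x -> subs y x.
Definition Ord {M : str} (x : M) := tr x /\ forall y, y ε x -> tr y.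

(** The schemata range over the classes definable with parameters. [ZFm_ZF] and, for enumerated
    models with empty predicate, [ZF_ZFm] connect this with the formal theory. *)
Class ZFm (M : str) : Prop := {
  zext : forall x y : M, (forall z, z ε x <-> z ε y) -> x = y;
  zfnd : forall a : M, (exists x, x ε a) -> exists x, x ε a /\ ~ exists z, z ε x /\ z ε a;
  zpair : forall x y : M, exists p, forall z, z ε p <-> z = x \/ z = y;
  zuni : forall a : M, exists u, forall z, z ε u <-> exists x, x ε a /\ z ε x;
  zpow : forall a : M, exists p, forall z, z ε p <-> subs z a;
  zinf : exists w : M, (exists o, o ε w /\ forall z, ~ z ε o) /\
           forall x, x ε w -> exists s, s ε w /\ forall z, z ε s <-> z ε x \/ z = x;
  zsep : forall P : M -> Prop, D1 P -> forall a, exists b, forall z, z ε b <-> z ε a /\ P z;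
  zrep : forall R : M -> M -> Prop, D2 R -> (forall x y y', R x y -> R x y' -> y = y') ->
           forall a, exists b, forall y, y ε b <-> exists x, x ε a /\ R x y }.

Lemma D2_subs M : D2 (@subs M). Proof. unfold subs. def. Qed.
#[export] Hint Resolve D2_subs : def.
Lemma D1_tr M : D1 (@tr M). Proof. unfold tr. def. Qed.
#[export] Hint Resolve D1_tr : def.
Lemma D1_Ord M : D1 (@Ord M). Proof. unfold Ord. def. Qed.
#[export] Hint Resolve D1_Ord : def.

Lemma zinh (M : str) : ZFm M -> inhabited M.
Proof. intros Z. destruct zinf as [w _]. exact (inhabits w). Qed.

(** * Definite descriptions in a model *)

Section Basic.
Context {M : str} {Z : ZFm M}.

Definition emp : M := epsilon (zinh M Z) (fun o => forall z, ~ z ε o).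
Lemma in_emp z : ~ z ε emp.
Proof.
  apply (epsilon_spec (zinh M Z) (fun o => forall z, ~ z ε o)).
  destruct (@zinf M _) as (w & (o & _ & H) & _). eauto.
Qed.

(* The unique element satisfying [P], and [emp] when there is none or several. *)
Definition the (P : M -> Prop) : M :=
  epsilon (zinh M Z) (fun y => unique P y \/ (~ (exists y, unique P y) /\ y = emp)).

Lemma the_spec P : unique P (the P) \/ (~ (exists y, unique P y) /\ the P = emp).
Proof.
  apply (epsilon_spec (zinh M Z) (fun y => unique P y \/ (~ (exists y, unique P y) /\ y = emp))).
  destruct (classic (exists y, unique P y)) as [[y H]|H]; eauto.
Qed.

Lemma the_eq P x : P x -> (forall y, P y -> y = x) -> the P = x.
Proof.
  intros H1 H2. destruct (the_spec P) as [[H _]|[H _]]; auto.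
  exfalso. apply H. exists x. split; auto. intros; symmetry; auto.
Qed.

Lemma the_ok (P : M -> Prop) : (exists x, P x) -> (forall x y, P x -> P y -> x = y) -> P (the P).
Proof. intros [x Hx] H. rewrite (the_eq P x); eauto. Qed.

(** Totality pays here: thanks to the default value every definable [P] gives a definable term, and
    nesting descriptions creates no side conditions. *)
Lemma DefT_the (P : (nat -> M) -> M -> Prop) :
  DefP (fun e => P (fun i => e (S i)) (e 0)) -> DefT (fun e => the (P e)).
Proof.
  intros H.
  apply (DefT_desc _ (fun e y => (P e y /\ forall z, P e z -> y = z) \/
    (~ (exists y, P e y /\ forall z, P e z -> y = z) /\ y = emp))).
  - intros e y. change (y = the (P e) <-> unique (P e) y \/ (~ (exists y, unique (P e) y) /\ y = emp)).
    split.
    + intros ->. apply the_spec.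
    + destruct (the_spec (P e)) as [K1|[K1 K2]].
      * intros [[L1 L2]|[L1 _]]; [apply L2, K1|exfalso; eauto].
      * intros [L1|[_ L1]]; [exfalso; eauto|congruence].
  - assert (H2 : DefP (fun e : nat -> M => P (fun i => e (S (S i))) (e 0)))
      by exact (DefP_ren _ (fun i => match i with 0 => 0 | S k => S (S k) end) H).
    assert (H3 : DefP (fun e : nat -> M => P (fun i => e (S (S (S i)))) (e 0)))
      by exact (DefP_ren _ (fun i => match i with 0 => 0 | S k => S (S (S k)) end) H).
    def.
Qed.
End Basic.

Ltac defhook ::=
  lazymatch goal with
  | |- DefT (fun e => the (@?P e)) => apply (DefT_the P)
  end.

Section Ops.
Context {M : str} {Z : ZFm M}.

Definition sep (a : M) (P : M -> Prop) : M := the (fun b => forall z, z ε b <-> z ε a /\ P z).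
Definition img (a : M) (f : M -> M) : M := the (fun b => forall y, y ε b <-> exists x, x ε a /\ y = f x).
Definition upair (x y : M) : M := the (fun b => forall z, z ε b <-> z = x \/ z = y).
Definition uni (a : M) : M := the (fun b => forall z, z ε b <-> exists x, x ε a /\ z ε x).
Definition pow (a : M) : M := the (fun b => forall z, z ε b <-> subs z a).

Lemma set_ok (P : M -> Prop) : (exists b, forall z, z ε b <-> P z) ->
  forall z, z ε the (fun b => forall z, z ε b <-> P z) <-> P z.
Proof.
  intros H. apply (the_ok (fun b => forall z, z ε b <-> P z)); auto.
  intros x y Hx Hy. apply zext. intros z. rewrite Hx, Hy. tauto.
Qed.

Lemma in_sep a P : D1 P -> forall z, z ε sep a P <-> z ε a /\ P z.
Proof. intros H. apply (set_ok (fun z => z ε a /\ P z)), zsep; auto. Qed.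
Lemma in_img a f : F1 f -> forall y, y ε img a f <-> exists x, x ε a /\ y = f x.
Proof.
  intros H. apply (set_ok (fun y => exists x, x ε a /\ y = f x)).
  apply (zrep (fun x y => y = f x)).
  - apply (DefP_ren _ (fun i => match i with 0 => 1 | S _ => 0 end) H).
  - congruence.
Qed.
Lemma in_upair x y z : z ε upair x y <-> z = x \/ z = y.
Proof. revert z. apply (set_ok (fun z => z = x \/ z = y)), zpair. Qed.
Lemma in_uni a z : z ε uni a <-> exists x, x ε a /\ z ε x.
Proof. revert z. apply (set_ok (fun z => exists x, x ε a /\ z ε x)), zuni. Qed.
Lemma in_pow a z : z ε pow a <-> subs z a.
Proof. revert z. apply (set_ok (fun z => subs z a)), zpow. Qed.

Lemma DefT_sep (a : (nat -> M) -> M) P : DefT a -> DefP (fun e => P (fun i => e (S i)) (e 0)) ->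
  DefT (fun e => sep (a e) (P e)).
Proof.
  intros Ha H. unfold sep. apply DefT_the.
  assert (H2 : DefP (fun e : nat -> M => P (fun i => e (S (S i))) (e 0)))
      by exact (DefP_ren _ (fun i => match i with 0 => 0 | S k => S (S k) end) H).
  def.
Qed.
Lemma DefT_img (a : (nat -> M) -> M) f : DefT a -> DefT (fun e => f (fun i => e (S i)) (e 0)) ->
  DefT (fun e => img (a e) (f e)).
Proof.
  intros Ha H. unfold img. apply DefT_the. def.
  exact (DefT_ren _ (fun i => match i with 0 => 0 | S k => S (S (S k)) end) H).
Qed.

Lemma F2_upair : F2 upair. Proof. unfold upair. def. Qed.
Lemma F1_uni : F1 uni. Proof. unfold uni. def. Qed.
Lemma F1_pow : F1 pow. Proof. unfold pow. def. Qed.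
End Ops.
#[export] Hint Resolve F2_upair F1_uni F1_pow : def.

Ltac defhook ::=
  lazymatch goal with
  | |- DefT (fun e => the (@?P e)) => apply (DefT_the P)
  | |- DefT (fun e => sep (@?a e) (@?P e)) => apply (DefT_sep a P)
  | |- DefT (fun e => img (@?a e) (@?P e)) => apply (DefT_img a P)
  end.

(** * Pairs and functions *)

Section Tools.
Context {M : str} {Z : ZFm M}.

Definition sg (x : M) := upair x x.
Definition op (x y : M) := upair (sg x) (upair x y).
Definition bun (x y : M) := uni (upair x y).
Definition suc (x : M) := bun x (sg x).
Definition pi1 (p : M) := the (fun x => exists y, p = op x y).
Definition pi2 (p : M) := the (fun y => exists x, p = op x y).
Definition app (f x : M) := the (fun y => op x y ε f).
Definition lam (a : M) (f : M -> M) := img a (fun x => op x (f x)).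
Definition res (f a : M) := sep f (fun p => exists x y, x ε a /\ p = op x y).
Definition ran (f : M) := img f pi2.
Definition prod (a b : M) := uni (img a (fun x => img b (fun y => op x y))).
Definition Fn (f a : M) := (forall p, p ε f -> exists x y, x ε a /\ p = op x y) /\
  forall x, x ε a -> exists y, op x y ε f /\ forall y', op x y' ε f -> y' = y.

Lemma F1_sg : F1 sg. Proof. unfold sg. def. Qed.
Hint Resolve F1_sg : def.
Lemma F2_op : F2 op. Proof. unfold op. def. Qed.
Hint Resolve F2_op : def.
Lemma F2_bun : F2 bun. Proof. unfold bun. def. Qed.
Hint Resolve F2_bun : def.
Lemma F1_suc : F1 suc. Proof. unfold suc. def. Qed.
Lemma F1_pi1 : F1 pi1. Proof. unfold pi1. def. Qed.
Lemma F1_pi2 : F1 pi2. Proof. unfold pi2. def. Qed.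
Hint Resolve F1_pi1 F1_pi2 : def.
Lemma F2_app : F2 app. Proof. unfold app. def. Qed.
Lemma F2_res : F2 res. Proof. unfold res. def. Qed.
Lemma F1_ran : F1 ran. Proof. unfold ran. def. Qed.
Lemma F2_prod : F2 prod. Proof. unfold prod. def. Qed.
Lemma D2_Fn : D2 Fn. Proof. unfold Fn. def. Qed.
Lemma DefT_lam (a : (nat -> M) -> M) f : DefT a -> DefT (fun e => f (fun i => e (S i)) (e 0)) ->
  DefT (fun e => lam (a e) (f e)).
Proof. intros Ha H. unfold lam. def. Qed.

Lemma in_sg x z : z ε sg x <-> z = x.
Proof. unfold sg. rewrite in_upair. tauto. Qed.
Lemma in_bun x y z : z ε bun x y <-> z ε x \/ z ε y.
Proof.
  unfold bun. rewrite in_uni. setoid_rewrite in_upair. split.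
  - intros (w & [->| ->] & H); auto.
  - intros [H|H]; eauto.
Qed.
Lemma in_suc x z : z ε suc x <-> z ε x \/ z = x.
Proof. unfold suc. rewrite in_bun, in_sg. tauto. Qed.

Lemma upair_inj x y x' y' : upair x y = upair x' y' -> (x = x' /\ y = y') \/ (x = y' /\ y = x').
Proof.
  intros H.
  assert (A : forall z, z = x \/ z = y <-> z = x' \/ z = y').
  { intros z. rewrite <- !in_upair, H. tauto. }
  pose proof (proj1 (A x) (or_introl eq_refl)). pose proof (proj1 (A y) (or_intror eq_refl)).
  pose proof (proj2 (A x') (or_introl eq_refl)). pose proof (proj2 (A y') (or_intror eq_refl)).
  intuition congruence.
Qed.
Lemma op_inj x y x' y' : op x y = op x' y' -> x = x' /\ y = y'.
Proof.
  unfold op, sg. intros H. apply upair_inj in H as [[H1 H2]|[H1 H2]];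
  apply upair_inj in H1; apply upair_inj in H2; intuition congruence.
Qed.
Lemma pi1_op x y : pi1 (op x y) = x.
Proof. apply the_eq; eauto. intros y' [z H]. apply op_inj in H as [-> _]. auto. Qed.
Lemma pi2_op x y : pi2 (op x y) = y.
Proof. apply the_eq; eauto. intros y' [z H]. apply op_inj in H as [_ ->]. auto. Qed.
Lemma in_lam a f : F1 f -> forall p, p ε lam a f <-> exists x, x ε a /\ p = op x (f x).
Proof. intros H. unfold lam. apply in_img. def. Qed.
Lemma op_lam a f x y : F1 f -> op x y ε lam a f <-> x ε a /\ y = f x.
Proof.
  intros H. rewrite in_lam by auto. split.
  - intros (z & Hz & E). apply op_inj in E as [-> ->]. auto.
  - intros [H1 ->]. eauto.
Qed.
Lemma app_lam a f x : F1 f -> x ε a -> app (lam a f) x = f x.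
Proof.
  intros H Hx. apply the_eq; [apply op_lam; auto|]. intros y Hy. apply op_lam in Hy; tauto.
Qed.
Lemma Fn_lam a f : F1 f -> Fn (lam a f) a.
Proof.
  intros H. split.
  - intros p Hp. apply in_lam in Hp as (x & Hx & ->); eauto.
  - intros x Hx. exists (f x). split; [apply op_lam; auto|]. intros y Hy. apply op_lam in Hy; tauto.
Qed.
Lemma Fn_app f a x : Fn f a -> x ε a -> op x (app f x) ε f.
Proof.
  intros [_ H] Hx. apply (the_ok (fun y => op x y ε f)); destruct (H x Hx) as (y & H1 & H2); eauto.
  intros u v Hu Hv. rewrite (H2 u), (H2 v); auto.
Qed.
Lemma Fn_op f a x y : Fn f a -> op x y ε f -> x ε a /\ y = app f x.
Proof.
  intros [H1 H2] H. destruct (H1 _ H) as (x' & y' & Hx & E). apply op_inj in E as [-> ->].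
  split; auto. symmetry. apply the_eq; auto. intros z Hz. destruct (H2 _ Hx) as (w & _ & Hw).
  rewrite (Hw _ Hz), (Hw _ H). auto.
Qed.
Lemma Fn_ext f g a : Fn f a -> Fn g a -> (forall x, x ε a -> app f x = app g x) -> f = g.
Proof.
  assert (A : forall f g, Fn f a -> Fn g a -> (forall x, x ε a -> app f x = app g x) -> subs f g).
  { intros f' g' Hf Hg H p Hp. destruct Hf as [Hf1 Hf2]. destruct (Hf1 p Hp) as (x & y & Hx & ->).
    destruct (Fn_op f' a x y (conj Hf1 Hf2) Hp) as [_ ->]. rewrite H by auto. apply (Fn_app g' a); auto. }
  intros Hf Hg H. apply zext. intros z. split; apply A; auto. intros; symmetry; auto.
Qed.
Lemma in_res f a : forall p, p ε res f a <-> p ε f /\ exists x y, x ε a /\ p = op x y.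
Proof. apply in_sep. def. Qed.
Lemma op_res f a x y : op x y ε res f a <-> op x y ε f /\ x ε a.
Proof.
  rewrite in_res. split; intros [H1 H2]; split; eauto.
  destruct H2 as (x' & y' & H & E). apply op_inj in E as [-> _]. auto.
Qed.
Lemma app_res f a x : x ε a -> app (res f a) x = app f x.
Proof.
  intros H. unfold app. f_equal. extensionality y. apply propositional_extensionality.
  rewrite op_res. tauto.
Qed.
Lemma Fn_res f a b : Fn f a -> subs b a -> Fn (res f b) b.
Proof.
  intros Hf Hb. split.
  - intros p Hp. apply in_res in Hp. tauto.
  - intros x Hx. exists (app f x). split.
    + apply op_res. split; auto. apply (Fn_app f a); auto.
    + intros y Hy. apply op_res in Hy as [Hy _]. apply (Fn_op f a) in Hy; tauto.
Qed.
Lemma in_ran f : forall y, y ε ran f <-> exists p, p ε f /\ y = pi2 p.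
Proof. apply in_img. def. Qed.
Lemma in_ran_lam a f y : F1 f -> y ε ran (lam a f) <-> exists x, x ε a /\ y = f x.
Proof.
  intros H. rewrite in_ran. split.
  - intros (p & Hp & ->). apply in_lam in Hp as (x & Hx & ->); auto. rewrite pi2_op. eauto.
  - intros (x & Hx & ->). exists (op x (f x)). rewrite pi2_op, op_lam; auto.
Qed.
Lemma in_prod a b p : p ε prod a b <-> exists x y, x ε a /\ y ε b /\ p = op x y.
Proof.
  unfold prod. rewrite in_uni. split.
  - intros (w & Hw & Hp). apply in_img in Hw as (x & Hx & ->); [|def].
    apply in_img in Hp as (y & Hy & ->); [eauto|def].
  - intros (x & y & Hx & Hy & ->). exists (img b (fun y => op x y)).
    split; (apply in_img; [def|eauto]).
Qed.
Lemma op_prod a b x y : op x y ε prod a b <-> x ε a /\ y ε b.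
Proof.
  rewrite in_prod. split.
  - intros (x' & y' & H1 & H2 & E). apply op_inj in E as [-> ->]. auto.
  - intros []; eauto.
Qed.

(** * Foundation and ordinals *)

Lemma mem_irr (x : M) : ~ x ε x.
Proof.
  intros H. destruct (zfnd (sg x)) as (y & Hy & K).
  - exists x. apply in_sg; auto.
  - apply in_sg in Hy as ->. apply K. exists x. rewrite in_sg. auto.
Qed.
Lemma mem_asym (x y : M) : x ε y -> ~ y ε x.
Proof.
  intros H1 H2. destruct (zfnd (upair x y)) as (z & Hz & K).
  - exists x. apply in_upair; auto.
  - apply K. apply in_upair in Hz as [->| ->]; [exists y|exists x]; rewrite in_upair; auto.
Qed.

Lemma Ord_in (a b : M) : Ord a -> b ε a -> Ord b.
Proof. intros [H1 H2] H. split; auto. intros c Hc. apply H2. apply (H1 b); auto. Qed.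
Lemma Ord_tr (a b c : M) : Ord a -> b ε a -> c ε b -> c ε a.
Proof. intros [H _] H1 H2. apply (H b); auto. Qed.

Lemma mem_Ord (a b : M) : b ε a -> Ord a -> Ord b.
Proof. intros; eapply Ord_in; eauto. Qed.
Lemma Ord_trans (a b c : M) : c ε b -> b ε a -> Ord a -> c ε a.
Proof. intros; eapply Ord_tr; eauto. Qed.

Lemma Ord_least (P : M -> Prop) : D1 P -> forall a, Ord a -> P a ->
  exists b, Ord b /\ P b /\ subs b (suc a) /\ forall c, c ε b -> ~ P c.
Proof.
  intros HP a Ha Pa. destruct (classic (exists c, c ε a /\ P c)) as [(c & Hc & Pc)|H].
  - destruct (zfnd (sep a P)) as (x & Hx & K).
    + exists c. apply in_sep; auto.
    + apply in_sep in Hx as [Hx1 Hx2]; auto. exists x. split; [eapply Ord_in; eauto|].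
      split; auto. split.
      * intros y Hy. apply in_suc. left. eapply Ord_tr; eauto.
      * intros y Hy Py. apply K. exists y. split; auto. apply in_sep; auto.
        split; auto. eapply Ord_tr; eauto.
  - exists a. split; auto. split; auto. split.
    + intros y Hy. apply in_suc; auto.
    + intros c Hc Pc. eauto.
Qed.

Lemma Ord_ind (P : M -> Prop) : D1 P -> (forall a, Ord a -> (forall b, b ε a -> P b) -> P a) ->
  forall a, Ord a -> P a.
Proof.
  intros HP H a Ha. apply NNPP. intros N.
  destruct (Ord_least (fun x => ~ P x)) with (a := a) as (b & Hb & Pb & _ & K); auto; [def|].
  apply Pb, H; auto. intros c Hc. apply NNPP. auto.
Qed.

Lemma Ord_tri (a b : M) : Ord a -> Ord b -> a ε b \/ a = b \/ b ε a.
Proof.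
  intros Ha. revert b. revert a Ha. apply (Ord_ind (fun a => forall b, Ord b -> a ε b \/ a = b \/ b ε a)).
  { def. }
  intros a Ha IHa. apply (Ord_ind (fun b => a ε b \/ a = b \/ b ε a)).
  { def. }
  intros b Hb IHb.
  destruct (classic (exists b', b' ε b /\ ~ b' ε a)) as [(b' & H1 & H2)|N1].
  { left. destruct (IHb b' H1) as [H|[->|H]]; [eapply Ord_tr; eauto|auto|contradiction]. }
  destruct (classic (exists a', a' ε a /\ ~ a' ε b)) as [(a' & H1 & H2)|N2].
  { right; right. destruct (IHa a' H1 b Hb) as [H|[->|H]]; [contradiction|auto|eapply Ord_tr; eauto]. }
  right; left. apply zext. intros z. split; intros H; apply NNPP; eauto.
Qed.
Lemma Ord_sub (a b : M) : Ord a -> Ord b -> subs a b -> a = b \/ a ε b.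
Proof.
  intros Ha Hb H. destruct (Ord_tri a b) as [|[|K]]; auto. exfalso. eapply mem_irr, H, K.
Qed.
Lemma Ord_emp : Ord emp.
Proof. split; intros y Hy; exfalso; eapply in_emp; eauto. Qed.
Lemma Ord_suc a : Ord a -> Ord (suc a).
Proof.
  intros Ha. split.
  - intros y Hy z Hz. apply in_suc in Hy as [Hy| ->]; apply in_suc; left; auto. eapply Ord_tr; eauto.
  - intros y Hy. apply in_suc in Hy as [Hy| ->]; [apply (proj2 Ha); auto|exact (proj1 Ha)].
Qed.
Lemma Ord_uni (x : M) : (forall a, a ε x -> Ord a) -> Ord (uni x).
Proof.
  intros H. split.
  - intros y Hy z Hz. apply in_uni in Hy as (a & Ha & Hy). apply in_uni. exists a. split; auto.
    eapply Ord_tr; eauto.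
  - intros y Hy. apply in_uni in Hy as (a & Ha & Hy). apply (proj2 (H a Ha)); auto.
Qed.
Lemma Ord_uni_ub (x a : M) : (forall a, a ε x -> Ord a) -> a ε x -> a ε suc (uni x).
Proof.
  intros H Ha. apply in_suc.
  destruct (Ord_sub a (uni x)) as [->|K]; auto; [apply Ord_uni; auto|].
  intros z Hz. apply in_uni. eauto.
Qed.
(** Burali-Forti: the successor of the supremum of a set of all ordinals would be below that
    supremum. *)
Lemma no_Ord_set (x : M) : ~ forall a, Ord a -> a ε x.
Proof.
  intros H. set (y := sep x Ord).
  assert (Hy : forall a, a ε y -> Ord a) by (intros a Ha; apply in_sep in Ha; [tauto|def]).
  assert (K : suc (uni y) ε y).
  { apply in_sep; [def|]. split; [apply H|]; apply Ord_suc, Ord_uni; auto. }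
  eapply mem_irr. apply in_uni. exists (suc (uni y)). split; [exact K|].
  apply in_suc. right. reflexivity.
Qed.
Lemma suc_lt a b : Ord a -> Ord b -> b ε a -> suc b ε suc a.
Proof.
  intros Ha Hb H. apply in_suc. destruct (Ord_tri (suc b) a) as [|[|K]]; auto using Ord_suc.
  exfalso. apply in_suc in K as [K| ->]; [eapply mem_asym; eauto|eapply mem_irr; eauto].
Qed.

(** * Natural numbers *)

Definition inductive (i : M) := emp ε i /\ forall x, x ε i -> suc x ε i.
Lemma D1_inductive : D1 inductive. Proof. unfold inductive. pose proof F1_suc. def. Qed.
Definition om : M := the (fun w => forall n, n ε w <-> forall i, inductive i -> n ε i).

Lemma in_om n : n ε om <-> forall i, inductive i -> n ε i.
Proof.
  revert n. apply (set_ok (fun n => forall i, inductive i -> n ε i)).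
  destruct (@zinf M _) as (w & (o & Ho & Eo) & Hs).
  assert (Hw : inductive w).
  { split.
    - replace emp with o; auto. apply zext. intros z. split; intros K; exfalso; [eapply Eo|eapply in_emp]; eauto.
    - intros x Hx. destruct (Hs x Hx) as (s & H1 & H2). replace (suc x) with s; auto.
      apply zext. intros z. rewrite H2, in_suc. tauto. }
  exists (sep w (fun n => forall i, inductive i -> n ε i)). pose proof D1_inductive.
  intros n. rewrite in_sep by def. split; [tauto|]. intros; split; auto.
Qed.
Lemma om_0 : emp ε om. Proof. apply in_om. intros i Hi. apply Hi. Qed.
Lemma om_S n : n ε om -> suc n ε om.
Proof. rewrite !in_om. intros H i Hi. apply Hi, H, Hi. Qed.
Lemma om_ind (P : M -> Prop) : D1 P -> P emp -> (forall n, n ε om -> P n -> P (suc n)) ->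
  forall n, n ε om -> P n.
Proof.
  intros HP H0 HS n Hn. pose proof (proj1 (in_om n) Hn) as K.
  specialize (K (sep om P)). rewrite in_sep in K by auto. apply K.
  split; [apply in_sep; auto using om_0|]. intros x Hx. apply in_sep in Hx as [Hx1 Hx2]; auto.
  apply in_sep; auto. split; auto. apply om_S; auto.
Qed.
Lemma om_Ord n : n ε om -> Ord n.
Proof. revert n. apply om_ind; [def|apply Ord_emp|]. intros n _. apply Ord_suc. Qed.
Lemma om_tr n m : n ε om -> m ε n -> m ε om.
Proof.
  intros Hn. revert m. revert n Hn. apply (om_ind (fun n => forall m, m ε n -> m ε om)); [def| |].
  - intros m Hm. exfalso; eapply in_emp; eauto.
  - intros n Hn IH m Hm. apply in_suc in Hm as [Hm| ->]; auto.
Qed.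
Lemma Ord_om : Ord om.
Proof. split; [intros n Hn m; apply om_tr; auto|]. intros y Hy. apply om_Ord in Hy. exact (proj1 Hy). Qed.
Lemma om_cases n : n ε om -> n = emp \/ exists m, m ε om /\ n = suc m.
Proof.
  revert n. pose proof F1_suc. apply om_ind; [def|auto|]. intros n Hn _. eauto.
Qed.

(** * Recursion along the ordinals *)

Section Rec.
Context (G : M -> M) (HG : F1 G).
(** [G] receives the values so far as a set of pairs; the stage can be recovered as the domain of
    that set, [img h pi1]. *)
Definition attempt (h a : M) := Fn h a /\ forall b, b ε a -> app h b = G (res h b).
Definition rec (a : M) : M := the (fun y => exists h, attempt h a /\ y = G h).

Lemma D2_attempt : D2 attempt.
Proof. unfold attempt. pose proof D2_Fn. pose proof F2_app. pose proof F2_res. def. Qed.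
Lemma F1_rec : F1 rec.
Proof. unfold rec. pose proof D2_attempt. def. Qed.

Lemma attempt_unique h h' a : Ord a -> attempt h a -> attempt h' a -> h = h'.
Proof.
  intros Ha [Hf H] [Hf' H']. apply (Fn_ext h h' a); auto.
  assert (K : forall b, Ord b -> b ε a -> app h b = app h' b).
  { pose proof F2_app. apply (Ord_ind (fun b => b ε a -> app h b = app h' b)); [def|].
    intros b Hb IH Hba. rewrite H, H' by auto. f_equal.
    assert (Sb : subs b a) by (intros c; apply Ord_tr; auto).
    apply (Fn_ext _ _ b); try (apply (Fn_res _ a); auto).
    intros c Hc. rewrite !app_res by auto. apply IH; auto. }
  intros b Hb. apply K; auto. eapply Ord_in; eauto.
Qed.

Lemma rec_attempt a : Ord a -> attempt (lam a rec) a.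
Proof.
  revert a. pose proof F1_rec as HF.
  apply (Ord_ind (fun a => attempt (lam a rec) a)).
  { pose proof D2_attempt. pose proof (fun a => DefT_lam a (fun _ => rec)) as L.
    apply (DefP_app2 attempt); auto; [|apply DefT_var].
    apply (DefT_lam (fun e => e 0) (fun _ => rec)); [apply DefT_var|def]. }
  intros a Ha IH. split; [apply Fn_lam; auto|]. intros b Hb. rewrite app_lam by auto.
  assert (Ob : Ord b) by (eapply Ord_in; eauto).
  assert (E : res (lam a rec) b = lam b rec).
  { assert (Sb : subs b a) by (intros c; apply Ord_tr; auto).
    apply (Fn_ext _ _ b); [apply (Fn_res _ a); auto; apply Fn_lam; auto|apply Fn_lam; auto|].
    intros c Hc. rewrite app_res, !app_lam; auto. }
  rewrite E. apply the_eq; [eauto|].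
  intros y (h & Hh & ->). f_equal. eapply attempt_unique; eauto.
Qed.

Lemma rec_eq a : Ord a -> rec a = G (lam a rec).
Proof.
  intros Ha. apply the_eq; [exists (lam a rec); split; auto; apply rec_attempt; auto|].
  intros y (h & Hh & ->). f_equal. eapply attempt_unique; eauto. apply rec_attempt; auto.
Qed.
End Rec.

(** * Closure of a set under a set-valued operation *)

Section Closure.
Context (a : M) (f : M -> M) (Hf : F1 f).
(** Stage [n] applies [f] to everything in all earlier stages, so zero, successor and the limit [om]
    obey the same equation. *)
Let G h := bun a (uni (img (uni (ran h)) f)).
Definition clos : M := rec G om.

Lemma clos_spec : subs a clos /\ (forall x, x ε clos -> subs (f x) clos) /\
  forall y, y ε clos -> y ε a \/ exists x, x ε clos /\ y ε f x.
Proof.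
  assert (HG : F1 G) by (unfold G; pose proof F1_ran; def).
  pose proof (F1_rec G HG) as HF.
  assert (E : forall n, Ord n -> forall y, y ε rec G n <-> y ε a \/ exists m x, m ε n /\ x ε rec G m /\ y ε f x).
  { intros n Hn y. rewrite (rec_eq G HG) by auto.
    change (y ε bun a (uni (img (uni (ran (lam n (rec G)))) f)) <->
      y ε a \/ exists m x, m ε n /\ x ε rec G m /\ y ε f x).
    rewrite in_bun, in_uni. split; (intros [H|H]; [left; auto|right]).
    - destruct H as (z & Hz & Hy). apply in_img in Hz as (x & Hx & ->); auto.
      apply in_uni in Hx as (w & Hw & Hx). apply in_ran_lam in Hw as (m & Hm & ->); eauto.
    - destruct H as (m & x & Hm & Hx & Hy). exists (f x). split; auto. apply in_img; auto.
      exists x. split; auto. apply in_uni. exists (rec G m). split; auto. apply in_ran_lam; eauto. }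
  pose proof Ord_om as Oo. unfold clos.
  assert (Sm : forall m, m ε om -> subs (rec G m) (rec G om)).
  { intros m Hm y Hy. apply E in Hy; [|eapply Ord_in; eauto].
    destruct Hy as [Hy|(k & x & Hk & Hy)]; apply E; auto. right. exists k, x. split; [eapply om_tr; eauto|]; auto. }
  split; [|split].
  - intros y Hy. apply E; auto.
  - intros x Hx y Hy. apply E in Hx as [Hx|(m & x' & Hm & Hx)]; auto.
    + apply E; auto. right. exists emp, x. split; [apply om_0|]. split; auto. apply E; auto using Ord_emp.
    + apply E; auto. right. exists (suc m), x. split; [apply om_S; auto|]. split; auto.
      apply E; [apply Ord_suc, om_Ord; auto|]. right. exists m, x'. rewrite in_suc. tauto.
  - intros y Hy. apply E in Hy as [Hy|(m & x & Hm & Hx & Hy)]; auto. right. exists x. split; auto.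
    apply (Sm m); auto.
Qed.
End Closure.
End Tools.
#[export] Hint Resolve F1_sg F2_op F2_bun F1_suc F1_pi1 F1_pi2 F2_app F2_res F1_ran F2_prod D2_Fn
  D1_inductive F1_rec D2_attempt : def.

Ltac defhook ::=
  lazymatch goal with
  | |- DefT (fun e => the (@?P e)) => apply (DefT_the P)
  | |- DefT (fun e => sep (@?a e) (@?P e)) => apply (DefT_sep a P)
  | |- DefT (fun e => img (@?a e) (@?P e)) => apply (DefT_img a P)
  | |- DefT (fun e => lam (@?a e) (@?P e)) => apply (DefT_lam a P)
  end.
#[global] Opaque the rec.

(** * Absoluteness *)

(** The number [k] lives outside the model, so the bounded quantifier is a finite disjunction. *)
Lemma DefP_fin (M : str) n (P : nat -> (nat -> M) -> Prop) :
  (forall k, DefP (P k)) -> DefP (fun e => exists k, k < n /\ P k e).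
Proof.
  intros H. induction n.
  - apply (DefP_iff (fun _ => False)); [|apply DefP_bot].
    intros e. split; [tauto|intros (k & Hk & _); lia].
  - apply (DefP_iff (fun e => P n e \/ exists k, k < n /\ P k e)).
    + intros e. split.
      * intros [K|(k & Hk & K)]; [exists n|exists k]; split; auto; lia.
      * intros (k & Hk & K). destruct (Nat.eq_dec k n) as [->|]; [auto|right; exists k; split; auto; lia].
    + apply DefP_or; auto.
Qed.

Lemma DefP_finall (M : str) n (P : nat -> (nat -> M) -> Prop) :
  (forall k, DefP (P k)) -> DefP (fun e => forall k, k < n -> P k e).
Proof.
  intros H. apply (DefP_iff (fun e => ~ exists k, k < n /\ ~ P k e)).
  - intros e. split.
    + intros N k Hk. apply NNPP. eauto.
    + intros K (k & Hk & N). auto.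
  - apply DefP_not, DefP_fin. intros k. apply DefP_not; auto.
Qed.

Ltac defhook2 := fail.
Ltac defhook ::=
  lazymatch goal with
  | |- DefT (fun e => the (@?P e)) => apply (DefT_the P)
  | |- DefT (fun e => sep (@?a e) (@?P e)) => apply (DefT_sep a P)
  | |- DefT (fun e => img (@?a e) (@?P e)) => apply (DefT_img a P)
  | |- DefT (fun e => lam (@?a e) (@?P e)) => apply (DefT_lam a P)
  | |- DefP (fun e => exists k, k < ?n /\ @?P k e) => apply (DefP_fin _ n (fun k e => P k e)); intro
  | |- DefP (fun e => forall k, k < ?n -> @?P k e) => apply (DefP_finall _ n (fun k e => P k e)); intro
  | |- _ => defhook2
  end.

(** * Formulas for the steps of the constructible hierarchy *)

Section Preds.
Context {M : str}.
(** These predicates use no term of [ZFm]. They make sense, and are absolute, in any transitive part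
    of a model, even one not known to satisfy any axiom, such as a level of Imp. *)
Definition isup (z x y : M) := forall w, w ε z <-> w = x \/ w = y.
Definition isop (p x y : M) := exists u v, u ε p /\ v ε p /\ isup u x x /\ isup v x y /\
  forall w, w ε p -> w = u \/ w = v.
Definition natS (n : M) := Ord n /\ forall x, x ε n \/ x = n ->
  (forall z, ~ z ε x) \/ exists y, forall z, z ε x <-> z ε y \/ z = y.
Definition pin (f x y : M) := exists p, p ε f /\ isop p x y.

(* Membership in the eight basic operations: pair, difference, product, domain, the
   restrictions of a set of triples ((e,u),v) to u ∈ v and to u = v, insertion of a dummy
   coordinate, and image of a point; operation [8 + k] is [k] with its arguments exchanged. *)
Fixpoint opm (k : nat) (w x y : M) : Prop :=
  match k with
  | 0 => w = x \/ w = y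
  | 1 => w ε x /\ ~ w ε y
  | 2 => exists a b, a ε x /\ b ε y /\ isop w a b
  | 3 => exists v, pin x w v
  | 4 => w ε x /\ exists c v e u, isop w c v /\ isop c e u /\ u ε v
  | 5 => w ε x /\ exists c v e, isop w c v /\ isop c e v
  | 6 => exists e u v c, pin x e v /\ u ε y /\ isop c e u /\ isop w c v
  | 7 => pin x y w
  | S (S (S (S (S (S (S (S k))))))) => opm k w y x
  end.

Definition inA (h a w : M) := exists d, d ε a /\ pin h d w.
(** Here [h] enumerates sets by ordinals. The value of operation [k] is compared with the sets
    enumerated before [a] only on members that are themselves enumerated before [a]. *)
Definition New (h a b c : M) (k : nat) := exists x y, pin h b x /\ pin h c y /\
  ~ exists z, inA h a z /\ forall w, inA h a w -> (w ε z <-> opm k w x y).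
(** The least new triple, ordered by [b], then [c], then [k]. The 16 operations are the eight basic
    ones in both argument orders, which allows [c] to be at most [b]. *)
Definition Sel (h a b c : M) (k : nat) := b ε a /\ (c ε b \/ c = b) /\ New h a b c k /\
  (forall b' c', b' ε b -> c' ε b' \/ c' = b' -> ~ exists k', k' < 16 /\ New h a b' c' k') /\
  (forall c', c' ε c -> ~ exists k', k' < 16 /\ New h a b c' k') /\
  ~ exists k', k' < k /\ New h a b c k'.
(** The members of the set number [a]. If nothing is new, this is the set of all sets enumerated
    before [a] and plays the part of a level L_α; otherwise one new set is added. The outcome is an
    enumeration of L without repetitions, hence a definable well-order. *)
Definition Gm (h a w : M) := inA h a w /\
  ((exists k, k < 16 /\ exists b c, Sel h a b c k /\ exists x y, pin h b x /\ pin h c y /\ opm k w x y) \/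
   ~ exists k, k < 16 /\ exists b c, Sel h a b c k).
(** The approximations to the enumeration: [f] is its restriction to [a], see [Att_eq]. *)
Definition Att (f a : M) := Ord a /\ (forall p, p ε f -> exists b x, b ε a /\ isop p b x) /\
  forall b, b ε a -> exists x, pin f b x /\ (forall x', pin f b x' -> x' = x) /\
    forall w, w ε x <-> Gm f b w.

Lemma D3_isup : D3 isup. Proof. unfold isup. def. Qed.
Hint Resolve D3_isup : def.
Lemma D1_natS : D1 natS. Proof. unfold natS. def. Qed.
Lemma D3_isop : D3 isop. Proof. unfold isop. def. Qed.
Hint Resolve D3_isop : def.
Lemma D3_pin : D3 pin. Proof. unfold pin. def. Qed.
Hint Resolve D3_pin : def.
Lemma opm_ind (P : nat -> Prop) : (forall k, k < 8 -> P k) -> (forall k, P k -> P (8 + k)) -> forall k, P k.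
Proof.
  intros H1 H2 k. induction k as [k IH] using lt_wf_ind. destruct (lt_dec k 8); auto.
  replace k with (8 + (k - 8)) by lia. apply H2, IH. lia.
Qed.
Lemma D3_opm k : D3 (opm k).
Proof.
  revert k. apply opm_ind.
  - intros k Hk. do 8 (destruct k as [|k]; [simpl; def|]). lia.
  - intros k H. simpl. apply (DefP_ren _ (fun i => match i with 0 => 0 | 1 => 2 | _ => 1 end) H).
Qed.
Hint Resolve D3_opm : def.
Lemma D3_inA : D3 inA. Proof. unfold inA. def. Qed.
Hint Resolve D3_inA : def.
Lemma D4_New k : D4 (fun h a b c => New h a b c k). Proof. unfold New. def. Qed.
Lemma DefP_New k (s t u v : (nat -> M) -> M) : DefT s -> DefT t -> DefT u -> DefT v ->
  DefP (fun e => New (s e) (t e) (u e) (v e) k).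
Proof. intros. apply (DefP_app4 (fun h a b c => New h a b c k)); auto. apply D4_New. Qed.
End Preds.
#[export] Hint Resolve D1_natS D3_isup D3_isop D3_pin D3_opm D3_inA : def.
Ltac defhook2 ::=
  match goal with
  | |- DefP (fun e => New (@?s e) (@?t e) (@?u e) (@?v e) ?k) => apply (DefP_New k s t u v)
  end.
Section Preds2.
Context {M : str}.
Lemma D4_Sel k : D4 (fun h a b c : M => Sel h a b c k). Proof. unfold Sel. def. Qed.
Lemma DefP_Sel k (s t u v : (nat -> M) -> M) : DefT s -> DefT t -> DefT u -> DefT v ->
  DefP (fun e => Sel (s e) (t e) (u e) (v e) k).
Proof. intros. apply (DefP_app4 (fun h a b c => Sel h a b c k)); auto. apply D4_Sel. Qed.
End Preds2.
Ltac defhook2 ::=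
  match goal with
  | |- DefP (fun e => New (@?s e) (@?t e) (@?u e) (@?v e) ?k) => apply (DefP_New k s t u v)
  | |- DefP (fun e => Sel (@?s e) (@?t e) (@?u e) (@?v e) ?k) => apply (DefP_Sel k s t u v)
  end.
Lemma D3_Gm {M : str} : D3 (@Gm M). Proof. unfold Gm. def. Qed.
#[export] Hint Resolve D3_Gm : def.
Lemma D2_Att {M : str} : D2 (@Att M). Proof. unfold Att. def. Qed.
#[export] Hint Resolve D2_Att : def.

(** Covers the inclusion of a transitive class and the embedding of a ground model into its generic
    extension alike. *)
Class temb {A B : str} (j : A -> B) : Prop := {
  t_inj : forall x y, j x = j y -> x = y;
  t_mem : forall x y, j x ε j y <-> x ε y;
  t_tr : forall x y, y ε j x -> exists z, y = j z }.

Section Abs.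
Context {A B : str} (j : A -> B) {T : temb j}.

Lemma a_eq x y : j x = j y <-> x = y.
Proof. split; [apply t_inj|congruence]. Qed.
Lemma a_down x y : y ε j x -> exists z, y = j z /\ z ε x.
Proof. intros H. destruct (t_tr x y H) as [z ->]. exists z. split; auto. apply t_mem; auto. Qed.
Lemma a_subs x y : subs (j x) (j y) <-> subs x y.
Proof.
  split; intros H z Hz.
  - apply (t_mem (j := j)), H, t_mem; auto.
  - apply a_down in Hz as (w & -> & Hw). apply t_mem; auto.
Qed.
Lemma a_trs x : tr (j x) <-> tr x.
Proof.
  split; intros H y Hy.
  - apply a_subs, H, t_mem; auto.
  - apply a_down in Hy as (w & -> & Hw). apply a_subs; auto.
Qed.
Lemma a_Ord x : Ord (j x) <-> Ord x.
Proof.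
  unfold Ord. rewrite a_trs. split; intros [H1 H2]; split; auto; intros y Hy.
  - apply a_trs, H2, t_mem; auto.
  - apply a_down in Hy as (w & -> & Hw). apply a_trs; auto.
Qed.
Lemma a_isup z x y : isup (j z) (j x) (j y) <-> isup z x y.
Proof.
  split; intros H w.
  - specialize (H (j w)). rewrite t_mem in H. rewrite H, (a_eq w x), (a_eq w y). tauto.
  - split.
    + intros Hw. apply a_down in Hw as (v & -> & Hv). rewrite !a_eq. apply H; auto.
    + intros [-> | ->]; apply t_mem, H; auto.
Qed.
Lemma a_isop p x y : isop (j p) (j x) (j y) <-> isop p x y.
Proof.
  split; intros (u & v & H1 & H2 & H3 & H4 & H5).
  - apply a_down in H1 as (u' & -> & H1), H2 as (v' & -> & H2). exists u', v'.
    rewrite a_isup in *. repeat split; auto; try apply H3; try apply H4.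
    intros w Hw. rewrite <- !a_eq. apply H5, t_mem; auto.
  - exists (j u), (j v). rewrite !a_isup, !t_mem. repeat split; auto; try apply H3; try apply H4.
    intros w Hw. apply a_down in Hw as (w' & -> & Hw). rewrite !a_eq. auto.
Qed.
Lemma a_natS n : natS (j n) <-> natS n.
Proof.
  unfold natS. rewrite a_Ord. split; intros [H1 H2]; split; auto; intros x Hx.
  - destruct (H2 (j x)) as [K|(y & K)]; [rewrite t_mem, a_eq; auto|left; intros z Hz|right].
    + apply (K (j z)), t_mem; auto.
    + destruct (a_down x y) as (y' & -> & _); [apply K; auto|]. exists y'. intros z.
      rewrite <- (t_mem (j := j) z x), (K (j z)), t_mem, a_eq. tauto.
  - assert (E : exists x', x = j x') by (destruct Hx as [Hx| ->]; [apply t_tr in Hx|]; eauto).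
    destruct E as [x' ->]. rewrite t_mem, a_eq in Hx.
    destruct (H2 x' Hx) as [K|(y & K)]; [left; intros z Hz|right].
    + apply a_down in Hz as (z' & -> & Hz). eapply K; eauto.
    + exists (j y). intros z. split.
      * intros Hz. apply a_down in Hz as (z' & -> & Hz). rewrite t_mem, a_eq. apply K; auto.
      * intros [Hz| ->]; [apply a_down in Hz as (z' & -> & Hz)|]; apply t_mem, K; auto.
Qed.
Lemma isop_down p x y : isop (j p) x y -> exists x' y', x = j x' /\ y = j y' /\ isop p x' y'.
Proof.
  intros H. assert (H' := H). destruct H as (u & v & H1 & H2 & H3 & H4 & H5).
  apply a_down in H2 as (v' & -> & H2).
  destruct (a_down v' x) as (x' & -> & _); [apply H4; auto|].
  destruct (a_down v' y) as (y' & -> & _); [apply H4; auto|].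
  exists x', y'. rewrite <- a_isop. auto.
Qed.
Lemma a_pin f x y : pin (j f) (j x) (j y) <-> pin f x y.
Proof.
  split; intros (p & H1 & H2).
  - apply a_down in H1 as (q & -> & H1). exists q. rewrite <- a_isop. auto.
  - exists (j p). rewrite a_isop, t_mem. auto.
Qed.
Lemma pin_down f x y : pin (j f) x y -> exists x' y', x = j x' /\ y = j y' /\ pin f x' y'.
Proof.
  intros (p & H1 & H2). apply a_down in H1 as (q & -> & H1).
  apply isop_down in H2 as (x' & y' & -> & -> & H2). exists x', y'. split; auto. split; auto. exists q. auto.
Qed.

Ltac adown := repeat match goal with
  | H : exists _, _ |- _ => destruct H
  | H : _ /\ _ |- _ => destruct H
  | H : isop (j _) _ _ |- _ => apply isop_down in H; destruct H as (? & ? & ? & ? & ?); subst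
  | H : pin (j _) _ _ |- _ => apply pin_down in H; destruct H as (? & ? & ? & ? & ?); subst
  | H : ?y ε j _ |- _ => apply a_down in H; destruct H as (? & ? & ?); subst
  | H : j _ = j _ |- _ => apply a_eq in H; subst
  | H : j _ ε _ |- _ => rewrite t_mem in H
  end.

Lemma a_opm k : forall w x y, opm k (j w) (j x) (j y) <-> opm k w x y.
Proof.
  revert k. apply (opm_ind (fun k => forall w x y, opm k (j w) (j x) (j y) <-> opm k w x y)).
  - intros k Hk w x y. destruct k as [|[|[|[|[|[|[|[|k]]]]]]]]; try lia; clear Hk; simpl; split; intros.
    all: repeat match goal with H : exists _, _ |- _ => destruct H | H : _ /\ _ |- _ => destruct H end.
    all: try solve [rewrite ?a_eq, ?t_mem, ?a_pin in *; tauto].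
    all: assert (U1 : forall p x y, isop p x y -> isop (j p) (j x) (j y)) by (intros; apply a_isop; auto).
    all: assert (U2 : forall p x y, pin p x y -> pin (j p) (j x) (j y)) by (intros; apply a_pin; auto).
    all: assert (U3 : forall x y, x ε y -> j x ε j y) by (intros; apply t_mem; auto).
    all: try solve [adown; eauto 12].
  - intros k H w x y. apply H.
Qed.
Lemma a_inA h a w : inA (j h) (j a) (j w) <-> inA h a w.
Proof.
  split; intros (d & H1 & H2).
  - apply a_down in H1 as (x & -> & H1). exists x. rewrite a_pin in H2. auto.
  - exists (j d). rewrite t_mem, a_pin. auto.
Qed.
Lemma inA_down h a w : inA (j h) a w -> exists w', w = j w'.
Proof. intros (d & H1 & H2). adown. eauto. Qed.
Lemma a_New h a b c k : New (j h) (j a) (j b) (j c) k <-> New h a b c k.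
Proof.
  unfold New. split.
  - intros (x & y & H1 & H2 & H3). apply pin_down in H1 as (b' & x' & E & -> & H1). apply a_eq in E as <-.
    apply pin_down in H2 as (c' & y' & E & -> & H2). apply a_eq in E as <-.
    exists x', y'. split; auto. split; auto. intros (z & Hz & K). apply H3. exists (j z). rewrite a_inA.
    split; auto. intros w Hw. destruct (inA_down _ _ _ Hw) as [w' ->]. rewrite a_inA in Hw.
    rewrite t_mem, a_opm. auto.
  - intros (x & y & H1 & H2 & H3). exists (j x), (j y). rewrite !a_pin. split; auto. split; auto.
    intros (z & Hz & K). destruct (inA_down _ _ _ Hz) as [z' ->]. rewrite a_inA in Hz. apply H3.
    exists z'. split; auto. intros w Hw. rewrite <- a_opm, <- (t_mem (j := j)). apply K, a_inA; auto.
Qed.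
Lemma a_Sel h a b c k : Sel (j h) (j a) (j b) (j c) k <-> Sel h a b c k.
Proof.
  unfold Sel. rewrite !t_mem, a_eq, a_New. setoid_rewrite a_New.
  assert (E1 : (forall b' c', b' ε j b -> c' ε b' \/ c' = b' -> ~ exists k', k' < 16 /\ New (j h) (j a) b' c' k') <->
    (forall b' c', b' ε b -> c' ε b' \/ c' = b' -> ~ exists k', k' < 16 /\ New h a b' c' k')).
  { split; intros H b' c' Hb Hc (k' & Hk & HN).
    - apply (H (j b') (j c')); [apply t_mem; auto|rewrite t_mem, a_eq; auto|].
      exists k'. rewrite a_New. auto.
    - apply a_down in Hb as (b1 & -> & Hb).
      assert (Hc' : exists c1, c' = j c1) by (destruct Hc as [Hc| ->]; adown; eauto).
      destruct Hc' as [c1 ->]. rewrite t_mem, a_eq in Hc. rewrite a_New in HN. eapply H; eauto. }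
  assert (E2 : (forall c', c' ε j c -> ~ exists k', k' < 16 /\ New (j h) (j a) (j b) c' k') <->
    (forall c', c' ε c -> ~ exists k', k' < 16 /\ New h a b c' k')).
  { split; intros H c' Hc (k' & Hk & HN).
    - apply (H (j c')); [apply t_mem; auto|]. exists k'. rewrite a_New. auto.
    - apply a_down in Hc as (c1 & -> & Hc). rewrite a_New in HN. eapply H; eauto. }
  rewrite E1, E2. tauto.
Qed.
Lemma Sel_down h a b c k : Sel h (j a) b c k -> exists b' c', b = j b' /\ c = j c'.
Proof. intros (H1 & H2 & _). adown. destruct H2 as [H2| ->]; adown; eauto. Qed.
Lemma a_Gm h a w : Gm (j h) (j a) (j w) <-> Gm h a w.
Proof.
  unfold Gm. rewrite a_inA.
  assert (E1 : (exists k, k < 16 /\ exists b c, Sel (j h) (j a) b c k) <-> (exists k, k < 16 /\ exists b c, Sel h a b c k)).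
  { split; intros (k & Hk & b & c & H).
    - destruct (Sel_down _ _ _ _ _ H) as (b' & c' & -> & ->). rewrite a_Sel in H. eauto.
    - exists k. split; auto. exists (j b), (j c). rewrite a_Sel. auto. }
  rewrite E1.
  assert (E2 : (exists k, k < 16 /\ exists b c, Sel (j h) (j a) b c k /\ exists x y, pin (j h) b x /\ pin (j h) c y /\ opm k (j w) x y) <->
    (exists k, k < 16 /\ exists b c, Sel h a b c k /\ exists x y, pin h b x /\ pin h c y /\ opm k w x y)).
  { split; intros (k & Hk & b & c & H & x & y & H1 & H2 & H3); exists k; (split; [auto|]).
    - apply pin_down in H1 as (b1 & x1 & -> & -> & H1), H2 as (c1 & y1 & -> & -> & H2).
      rewrite a_Sel in H. rewrite a_opm in H3. eauto 10.
    - exists (j b), (j c). rewrite a_Sel. split; auto. exists (j x), (j y). rewrite !a_pin, a_opm. auto. }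
  rewrite E2. tauto.
Qed.
Lemma a_Att f a : Att (j f) (j a) <-> Att f a.
Proof.
  unfold Att. rewrite a_Ord. split; intros (H0 & H1 & H2); (split; [auto|split]).
  - intros p Hp. destruct (H1 (j p)) as (b & x & Hb & Hx); [apply t_mem; auto|].
    apply isop_down in Hx as (b1 & x1 & -> & -> & Hx). rewrite t_mem in Hb. eauto.
  - intros b Hb. destruct (H2 (j b)) as (x & K1 & K2 & K3); [apply t_mem; auto|].
    apply pin_down in K1 as (b1 & x1 & E & -> & K1). apply a_eq in E as <-.
    exists x1. split; auto. split.
    + intros x' Hx'. apply a_eq, K2, a_pin; auto.
    + intros w. rewrite <- (t_mem (j := j)), K3. apply a_Gm.
  - intros p Hp. apply a_down in Hp as (p' & -> & Hp). destruct (H1 p' Hp) as (b & x & Hb & Hx).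
    exists (j b), (j x). rewrite t_mem, a_isop. auto.
  - intros b Hb. apply a_down in Hb as (b' & -> & Hb). destruct (H2 b' Hb) as (x & K1 & K2 & K3).
    exists (j x). rewrite a_pin. split; auto. split.
    + intros x' Hx'. apply pin_down in Hx' as (b1 & x1 & E & -> & Hx'). apply a_eq in E as <-. f_equal; auto.
    + intros w. split.
      * intros Hw. apply a_down in Hw as (w' & -> & Hw). apply a_Gm, K3; auto.
      * intros Hw. destruct (inA_down _ _ _ (proj1 Hw)) as [w' ->]. rewrite a_Gm in Hw. apply t_mem, K3; auto.
Qed.
End Abs.

(** * The constructible hierarchy *)

Section Constructible.
Context {M : str} {Z : ZFm M}.

Lemma isup_upair (z x y : M) : isup z x y <-> z = upair x y.
Proof.
  split.
  - intros H. apply zext. intros w. rewrite in_upair. apply H.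
  - intros -> w. apply in_upair.
Qed.
Lemma isop_op (p x y : M) : isop p x y <-> p = op x y.
Proof.
  split.
  - intros (u & v & H1 & H2 & H3 & H4 & H5). apply isup_upair in H3 as ->, H4 as ->.
    apply zext. intros w. unfold op, sg. rewrite in_upair. split; [apply H5|intros [-> | ->]; auto].
  - intros ->. exists (sg x), (upair x y). rewrite !isup_upair. unfold op. rewrite !in_upair.
    repeat split; auto. intros w Hw. apply in_upair in Hw; auto.
Qed.
Lemma natS_om (n : M) : natS n <-> n ε om.
Proof.
  split.
  - intros [On H]. apply NNPP. intros Nn.
    destruct (Ord_least (fun x => (x ε n \/ x = n) /\ ~ x ε om)) with (a := n) as (x & Ox & [Hx Nx] & _ & L);
      [def|auto|auto|].
    apply Nx. destruct (H x Hx) as [K|(y & K)].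
    + replace x with (emp : M); [apply om_0|]. apply zext. intros z. split; intros Hz; exfalso; [eapply in_emp|eapply K]; eauto.
    + replace x with (suc y); [apply om_S|apply zext; intros z; rewrite in_suc, K; tauto].
      apply NNPP. intros Ny. apply (L y); [apply K; auto|]. split; auto. left.
      assert (Hy : y ε x) by (apply K; auto). destruct Hx as [Hx| ->]; auto. eapply Ord_trans; eauto.
  - intros Hn. split; [apply om_Ord; auto|]. intros x Hx.
    assert (Hxo : x ε om) by (destruct Hx as [Hx| ->]; auto; eapply om_tr; eauto).
    destruct (om_cases x Hxo) as [->|(m & _ & ->)]; [left; apply in_emp|right].
    exists m. intros z. apply in_suc.
Qed.
Lemma pin_op (f x y : M) : pin f x y <-> op x y ε f.
Proof.
  unfold pin. split.
  - intros (p & H1 & H2). apply isop_op in H2 as ->. auto.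
  - intros H. exists (op x y). rewrite isop_op. auto.
Qed.

(** The domain of [h] is the ordinal at which the step is taken. *)
Definition Lstep (h : M) := sep (ran h) (fun w => Gm h (img h pi1) w).
Lemma F1_Lstep : F1 Lstep. Proof. unfold Lstep. def. Qed.
Definition FL := rec Lstep.
Lemma F1_FL : F1 FL. Proof. apply F1_rec, F1_Lstep. Qed.
Hint Resolve F1_FL F1_Lstep : def.

Lemma pinF a b x : pin (lam a FL) b x <-> b ε a /\ x = FL b.
Proof. rewrite pin_op. apply op_lam, F1_FL. Qed.
Lemma inAF a w : inA (lam a FL) a w <-> exists d, d ε a /\ w = FL d.
Proof.
  unfold inA. split.
  - intros (d & H1 & H2). apply pinF in H2 as [_ ->]. eauto.
  - intros (d & H1 & ->). exists d. rewrite pinF. auto.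
Qed.
Lemma in_FL a w : Ord a -> (w ε FL a <-> Gm (lam a FL) a w).
Proof.
  intros Ha. unfold FL at 1. rewrite (rec_eq _ F1_Lstep) by auto. fold FL. unfold Lstep.
  rewrite in_sep by def.
  replace (img (lam a FL) pi1) with a.
  - split; [tauto|]. intros H. split; auto. destruct H as [H _]. apply inAF in H as (d & Hd & ->).
    apply in_ran_lam; [def|eauto].
  - apply zext. intros d. rewrite in_img by def. split.
    + intros Hd. exists (op d (FL d)). rewrite pi1_op. split; auto. apply op_lam; [def|auto].
    + intros (p & Hp & ->). apply in_lam in Hp as (x & Hx & ->); [|def]. rewrite pi1_op. auto.
Qed.

Lemma Sel_unique (h a b c : M) k b' c' k' : Ord a -> k < 16 -> k' < 16 ->
  Sel h a b c k -> Sel h a b' c' k' -> b = b' /\ c = c' /\ k = k'.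
Proof.
  intros Ha Hk Hk' (H1 & H2 & H3 & H4 & H5 & H6) (H1' & H2' & H3' & H4' & H5' & H6').
  assert (Ob : Ord b) by (eapply mem_Ord; eauto). assert (Ob' : Ord b') by (eapply mem_Ord; eauto).
  assert (Oc : Ord c) by (destruct H2 as [H2| ->]; [apply (Ord_in b)|]; auto).
  assert (Oc' : Ord c') by (destruct H2' as [H2'| ->]; [apply (Ord_in b')|]; auto).
  destruct (Ord_tri b b') as [K|[<-|K]]; auto.
  { exfalso. apply (H4' b c K H2). eauto. }
  2: { exfalso. apply (H4 b' c' K H2'). eauto. }
  destruct (Ord_tri c c') as [K|[<-|K]]; auto.
  { exfalso. apply (H5' c K). eauto. }
  2: { exfalso. apply (H5 c' K). eauto. }
  split; auto. split; auto. destruct (Nat.lt_trichotomy k k') as [K|[K|K]]; auto; exfalso.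
  - apply H6'. eauto.
  - apply H6. eauto.
Qed.

Lemma Sel_exists (h a b c : M) k : Ord a -> b ε a -> c ε b \/ c = b -> k < 16 -> New h a b c k ->
  exists k, k < 16 /\ exists b c, Sel h a b c k.
Proof.
  intros Ha Hb Hc Hk HN. assert (Ob : Ord b) by (eapply mem_Ord; eauto).
  destruct (Ord_least (fun b => exists c, (c ε b \/ c = b) /\ exists k, k < 16 /\ New h a b c k)) with (a := b)
    as (b1 & Ob1 & (c1 & Hc1 & k1 & Hk1 & N1) & Sb & Lb); [def|auto|eauto 6|].
  assert (Oc1 : Ord c1) by (destruct Hc1 as [Hc1|Hc1]; [apply (Ord_in b1)|subst]; auto).
  assert (Hb1 : b1 ε a).
  { destruct (Ord_tri b1 a) as [K|[K|K]]; auto; exfalso.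
    - subst b1. apply (Lb b Hb). eauto 6.
    - apply (Lb b); [eapply Ord_trans; eauto|eauto 6]. }
  destruct (Ord_least (fun c => (c ε b1 \/ c = b1) /\ exists k, k < 16 /\ New h a b1 c k)) with (a := c1)
    as (c2 & Oc2 & (Hc2 & k2 & Hk2 & N2) & _ & Lc); [def|auto|eauto 6|].
  assert (Q : forall n, New h a b1 c2 n -> exists m, m <= n /\ New h a b1 c2 m /\ ~ exists k', k' < m /\ New h a b1 c2 k').
  { induction n as [n IH] using lt_wf_ind. intros Hn.
    destruct (classic (exists k', k' < n /\ New h a b1 c2 k')) as [(k' & L & Hk')|N].
    - destruct (IH k' L Hk') as (m & Hm & K). exists m. split; [lia|auto].
    - exists n. auto. }
  destruct (Q k2 N2) as (k3 & Hk3 & N3 & L3). exists k3. split; [lia|]. exists b1, c2.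
  repeat split; auto.
  - intros b' c' Hb' Hc' K. apply (Lb b' Hb'). eauto.
  - intros c' Hc' K. apply (Lc c' Hc'). split; auto. left.
    destruct Hc2 as [Hc2| ->]; auto. eapply Ord_trans; eauto.
Qed.

Definition NoSel a := ~ exists k, k < 16 /\ exists b c, Sel (lam a FL) a b c k.

Lemma FL_NoSel a : Ord a -> NoSel a -> forall w, w ε FL a <-> exists d, d ε a /\ w = FL d.
Proof. intros Ha N w. rewrite in_FL by auto. unfold Gm. rewrite inAF. unfold NoSel in N. tauto. Qed.

Lemma FL_Sel a b c k : Ord a -> k < 16 -> Sel (lam a FL) a b c k ->
  forall w, w ε FL a <-> (exists d, d ε a /\ w = FL d) /\ opm k w (FL b) (FL c).
Proof.
  intros Ha Hk S w. rewrite in_FL by auto. unfold Gm. rewrite inAF. split.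
  - intros [H [H'|H']]; [|exfalso; apply H'; eauto 6].
    destruct H' as (k' & Hk' & b' & c' & S' & x & y & H1 & H2 & H3).
    apply pinF in H1 as [_ ->], H2 as [_ ->].
    destruct (Sel_unique _ _ _ _ _ _ _ _ Ha Hk Hk' S S') as (Eb & Ec & Ek). subst. auto.
  - intros [H H']. split; auto. left. exists k. split; auto. exists b, c. split; auto.
    destruct S as (_ & _ & (x & y & H1 & H2 & _) & _). exists x, y. split; auto. split; auto.
    apply pinF in H1 as [_ ->], H2 as [_ ->]. auto.
Qed.

Lemma FL_tr a w : Ord a -> w ε FL a -> exists d, d ε a /\ w = FL d.
Proof. intros Ha H. apply in_FL in H as [H _]; auto. apply inAF; auto. Qed.

(** A selected set is new by definition; if nothing is selected, the set has all earlier ones as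
    members, and no set is a member of itself. *)
Lemma FL_lt a d : Ord a -> d ε a -> FL d <> FL a.
Proof.
  intros Ha Hd E.
  destruct (classic (exists k, k < 16 /\ exists b c, Sel (lam a FL) a b c k)) as [(k & Hk & b & c & S)|N].
  - pose proof (FL_Sel a b c k Ha Hk S) as K. destruct S as (_ & _ & (x & y & H1 & H2 & H3) & _).
    apply pinF in H1 as [_ ->], H2 as [_ ->]. apply H3. exists (FL a). rewrite inAF. split; eauto.
    intros w Hw. apply inAF in Hw. rewrite K. tauto.
  - apply (mem_irr (FL a)), (FL_NoSel a Ha N). exists d. auto.
Qed.
Lemma FL_inj a b : Ord a -> Ord b -> FL a = FL b -> a = b.
Proof.
  intros Ha Hb E. destruct (Ord_tri a b) as [H|[H|H]]; auto; exfalso.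
  - apply (FL_lt b a); auto.
  - apply (FL_lt a b); auto.
Qed.

Lemma FL_pre (T : M) : exists s, forall a, a ε s <-> Ord a /\ FL a ε T.
Proof.
  destruct (zrep (fun t a => Ord a /\ t = FL a)) with (a := T) as [s Hs].
  - def.
  - intros x y y' [H1 ->] [H2 H3]. apply FL_inj; auto.
  - exists s. intros a. rewrite Hs. split.
    + intros (x & Hx & H & ->). auto.
    + intros [H1 H2]. eauto.
Qed.

Lemma opm_bound k : forall x y : M, exists b, forall w, opm k w x y -> w ε b.
Proof.
  revert k. apply (opm_ind (fun k => forall x y : M, exists b, forall w, opm k w x y -> w ε b)).
  2: { intros k H x y. apply (H y x). }
  assert (Q : forall f x y : M, op x y ε f -> x ε uni (uni f) /\ y ε uni (uni f)).
  { intros f x y H. rewrite !in_uni. split; exists (upair x y); rewrite in_upair, in_uni; split; auto;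
    exists (op x y); (split; [auto|apply in_upair; auto]). }
  intros k Hk x y. destruct k as [|[|[|[|[|[|[|[|k]]]]]]]]; try lia; clear Hk; simpl.
  - exists (upair x y). intros w. apply in_upair.
  - exists x. tauto.
  - exists (prod x y). intros w (a & b & Ha & Hb & H). apply isop_op in H as ->. apply op_prod; auto.
  - exists (uni (uni x)). intros w (v & H). apply pin_op in H. apply (Q x w v H).
  - exists x. tauto.
  - exists x. tauto.
  - exists (prod (prod (uni (uni x)) y) (uni (uni x))). intros w (e & u & v & c & H1 & H2 & H3 & H4).
    apply isop_op in H3 as ->, H4 as ->. apply pin_op in H1. rewrite !op_prod.
    destruct (Q _ _ _ H1). auto.
  - exists (uni (uni x)). intros w H. apply pin_op in H. apply (Q x y w H).
Qed.
Definition opset k x y : M := the (fun b => forall w, w ε b <-> opm k w x y).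
Lemma in_opset k x y w : w ε opset k x y <-> opm k w x y.
Proof.
  revert w. apply (set_ok (fun w => opm k w x y)). destruct (opm_bound k x y) as [b Hb].
  exists (sep b (fun w => opm k w x y)). intros w. rewrite in_sep by def. intuition.
Qed.

Lemma fin_bound (C : nat -> M -> Prop) n : (forall k, exists s, forall a, C k a -> a ε s) ->
  exists s, forall a k, k < n -> C k a -> a ε s.
Proof.
  intros H. induction n as [|n [s Hs]].
  - exists emp. intros; lia.
  - destruct (H n) as [t Ht]. exists (bun s t). intros a k Hk HC. apply in_bun.
    destruct (Nat.eq_dec k n) as [->|]; [right; auto|left; eapply Hs; eauto; lia].
Qed.

Definition Sused (m : M) : M := the (fun s => forall a, a ε s <->
  Ord a /\ exists k, k < 16 /\ exists b c, b ε suc m /\ c ε suc m /\ Sel (lam a FL) a b c k).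
(** These stages form a set: at each of them [FL a] is a subset of one of set-many values of
    operations, and [FL] is injective. *)
Lemma in_Sused m a : a ε Sused m <->
  Ord a /\ exists k, k < 16 /\ exists b c, b ε suc m /\ c ε suc m /\ Sel (lam a FL) a b c k.
Proof.
  revert a. apply (set_ok (fun a => Ord a /\ exists k, k < 16 /\
     exists b c, b ε suc m /\ c ε suc m /\ Sel (lam a FL) a b c k)).
  destruct (fin_bound (fun k a => Ord a /\ k < 16 /\ exists b c, b ε suc m /\ c ε suc m /\ Sel (lam a FL) a b c k) 16)
    as [s Hs].
  - intros k. destruct (FL_pre (uni (img (suc m) (fun b => uni (img (suc m) (fun c => pow (opset k (FL b) (FL c)))))))) as [s Hs].
    assert (D : F2 (opset k)) by (unfold opset; def).
    exists s. intros a (Ha & Hk & b & c & Hb & Hc & S). apply Hs. split; auto. apply in_uni.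
    eexists. split; [apply in_img; [def|exists b; split; eauto]|]. apply in_uni.
    eexists. split; [apply in_img; [def|exists c; split; eauto]|]. apply in_pow. intros w Hw.
    apply in_opset. apply (FL_Sel a b c k Ha Hk S) in Hw. tauto.
  - exists (sep s (fun a => Ord a /\ exists k, k < 16 /\ exists b c, b ε suc m /\ c ε suc m /\ Sel (lam a FL) a b c k)).
    intros a. rewrite in_sep by def. split; [tauto|]. intros H. split; auto.
    destruct H as (Ha & k & Hk & H). apply (Hs a k Hk). auto.
Qed.

(** Close [a0] under successor and under the stages that use arguments up to [m]. At the supremum no
    triple can be selected: its arguments would lie below some [m] of the closure, and the supremum
    would be one of the stages used by [m], thus below itself. *)
Lemma NoSel_cofinal a0 : Ord a0 -> exists a, Ord a /\ a0 ε a /\ NoSel a.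
Proof.
  intros Ha0. set (f m := sep (bun (Sused m) (sg (suc m))) Ord).
  assert (Hf : F1 f) by (unfold f, Sused; def).
  destruct (clos_spec (sg a0) f Hf) as (C1 & C2 & C3). set (c := clos (sg a0) f) in *.
  assert (Inf : forall x m, x ε f m <-> (x ε Sused m \/ x = suc m) /\ Ord x).
  { intros x m. unfold f. rewrite in_sep, in_bun, in_sg by def. tauto. }
  assert (Oc : forall x, x ε c -> Ord x).
  { intros x Hx. destruct (C3 x Hx) as [H|(y & Hy & H)]; [apply in_sg in H as ->; auto|].
    apply Inf in H. tauto. }
  assert (Cu : forall x, x ε c -> x ε uni c).
  { intros x Hx. apply in_uni. exists (suc x). rewrite in_suc. split; auto.
    apply (C2 x Hx), Inf. split; auto. apply Ord_suc; auto. }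
  assert (Ou : Ord (uni c)) by (apply Ord_uni; auto).
  exists (uni c). split; [auto|]. split; [apply Cu, C1, in_sg; auto|].
  intros (k & Hk & b & d & S). assert (S' := S). destruct S' as (Hb & Hd & _).
  apply in_uni in Hb as (m & Hm & Hb).
  apply (mem_irr (uni c)), Cu, (C2 m Hm), Inf. split; auto. left. apply in_Sused. split; auto.
  exists k. split; auto. exists b, d. rewrite !in_suc. split; auto. split; auto. left.
  destruct Hd as [Hd| ->]; auto. eapply Ord_trans; eauto.
Qed.

Definition Lc (x : M) := exists a, Ord a /\ x = FL a.
Lemma D1_Lc : D1 Lc. Proof. unfold Lc. def. Qed.
Hint Resolve D1_Lc : def.
Lemma Lc_tr x y : Lc x -> y ε x -> Lc y.
Proof.
  intros (a & Ha & ->) Hy. apply FL_tr in Hy as (d & Hd & ->); auto. exists d. split; auto.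
  eapply mem_Ord; eauto.
Qed.
Lemma FL_cover (X : M) : (forall x, x ε X -> Lc x) -> exists a, Ord a /\ forall x, x ε X -> exists d, d ε a /\ x = FL d.
Proof.
  intros H. destruct (FL_pre X) as [s Hs].
  assert (Os : forall a, a ε s -> Ord a) by (intros a Ha; apply Hs in Ha; tauto).
  exists (suc (uni s)). split; [apply Ord_suc, Ord_uni; auto|]. intros x Hx.
  destruct (H x Hx) as (a & Ha & ->). exists a. split; auto. apply Ord_uni_ub; auto. apply Hs; auto.
Qed.
(** A stage beyond all indices of members of [X] at which nothing is selected collects everything
    before it. *)
Lemma Lc_cover (X : M) : (forall x, x ε X -> Lc x) -> exists A, Lc A /\ subs X A.
Proof.
  intros H. destruct (FL_cover X H) as (a & Ha & K). destruct (NoSel_cofinal a Ha) as (b & Hb & Hab & N).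
  exists (FL b). split; [exists b; auto|]. intros x Hx. apply FL_NoSel; auto.
  destruct (K x Hx) as (d & Hd & ->). exists d. split; auto. eapply Ord_trans; eauto.
Qed.
(** If the value were not constructible, it would be new at a late stage at which nothing is
    selected. *)
Lemma Lc_op k x y : k < 8 -> Lc x -> Lc y -> (forall w, opm k w x y -> Lc w) -> Lc (opset k x y).
Proof.
  intros Hk8 Hx Hy H. destruct (FL_cover (opset k x y)) as (a & Ha & K).
  { intros w Hw. apply H, in_opset; auto. }
  assert (P : forall b c k, k < 16 -> Ord b -> (c ε b \/ c = b) ->
    (forall w, opm k w (FL b) (FL c) -> exists d, d ε a /\ w = FL d) -> Lc (opset k (FL b) (FL c))).
  { clear - Ha. intros b c k Hk Hb Hc K.
    destruct (NoSel_cofinal (suc (uni (upair a b)))) as (e & He & Hae & N).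
    { apply Ord_suc, Ord_uni. intros z Hz. apply in_upair in Hz as [-> | ->]; auto. }
    assert (U : forall z, z = a \/ z = b -> z ε e).
    { intros z Hz. eapply Ord_tr; [exact He|exact Hae|]. apply Ord_uni_ub; [|apply in_upair; auto].
      intros z' Hz'. apply in_upair in Hz' as [-> | ->]; auto. }
    assert (Hae' := U a (or_introl eq_refl)). assert (Hbe := U b (or_intror eq_refl)).
    apply NNPP. intros NL. apply N. apply (Sel_exists _ _ b c k); auto.
    exists (FL b), (FL c). rewrite !pinF. split; [auto|]. split.
    { split; auto. destruct Hc as [Hc| ->]; auto. eapply Ord_trans; eauto. }
    intros (z & Hz & E). apply inAF in Hz as (d & Hd & ->). apply NL. exists d.
    split; [eapply mem_Ord; eauto|]. apply zext. intros w. rewrite in_opset. split.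
    - intros Hw. apply E; auto. apply inAF. destruct (K w Hw) as (d' & Hd' & ->). exists d'.
      split; auto. eapply Ord_trans; eauto.
    - intros Hw. apply E; auto. apply inAF. apply FL_tr in Hw as (d' & Hd' & ->); [|eapply mem_Ord; eauto].
      exists d'. split; auto. eapply Ord_trans; eauto. }
  destruct Hx as (b & Hb & ->), Hy as (c & Hc & ->).
  assert (K' : forall w, opm k w (FL b) (FL c) -> exists d, d ε a /\ w = FL d) by (intros w Hw; apply K, in_opset; auto).
  (* The argument of larger index has to come first; otherwise the exchanged operation [8 + k] is
     used. *)
  destruct (Ord_tri b c) as [Q|[->|Q]]; auto.
  2,3: apply P; auto; lia.
  replace (opset k (FL b) (FL c)) with (opset (8 + k) (FL c) (FL b)).
  - apply P; auto. lia.
  - apply zext. intros w. rewrite !in_opset. simpl. tauto.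
Qed.
Lemma Lc_upair x y : Lc x -> Lc y -> Lc (upair x y).
Proof.
  intros Hx Hy. replace (upair x y) with (opset 0 x y).
  - apply Lc_op; auto; [lia|]. simpl. intros w [-> | ->]; auto.
  - apply zext. intros w. rewrite in_opset, in_upair. simpl. tauto.
Qed.
Lemma Lc_pair x y : Lc x -> Lc y -> Lc (op x y).
Proof. intros. unfold op, sg. auto using Lc_upair. Qed.
Lemma Lc_unpair x y : Lc (op x y) -> Lc x /\ Lc y.
Proof.
  intros H. assert (K : Lc (upair x y)) by (eapply Lc_tr; [exact H|apply in_upair; auto]).
  split; (eapply Lc_tr; [exact K|apply in_upair; auto]).
Qed.
Lemma Lc_opset k x y : k < 8 -> Lc x -> Lc y -> Lc (opset k x y).
Proof.
  intros Hk Hx Hy. apply Lc_op; auto. intros w.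
  assert (Q : forall x u v, Lc x -> op u v ε x -> Lc u /\ Lc v).
  { intros x' u v H1 H2. apply Lc_unpair. eapply Lc_tr; eauto. }
  destruct k as [|[|[|[|[|[|[|[|k]]]]]]]]; try lia; clear Hk; simpl.
  - intros [-> | ->]; auto.
  - intros [H _]. apply (Lc_tr x); auto.
  - intros (a & b & Ha & Hb & H). apply isop_op in H as ->.
    apply Lc_pair; [apply (Lc_tr x)|apply (Lc_tr y)]; auto.
  - intros (v & H). apply pin_op in H. apply (Q x w v Hx H).
  - intros [H _]. apply (Lc_tr x); auto.
  - intros [H _]. apply (Lc_tr x); auto.
  - intros (e & u & v & c & H1 & H2 & H3 & H4). apply isop_op in H3 as ->, H4 as ->. apply pin_op in H1.
    destruct (Q _ _ _ Hx H1). apply Lc_pair; auto. apply Lc_pair; auto. apply (Lc_tr y); auto.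
  - intros H. apply pin_op in H. apply (Q x y w Hx H).
Qed.
End Constructible.
#[export] Hint Resolve F1_FL D1_Lc : def.

Definition sub (M : str) (C S : M -> Prop) : str :=
  Str {x : M | C x} (fun a b => proj1_sig a ε proj1_sig b) (fun a => S (proj1_sig a)).
Definition val {M : str} {C S : M -> Prop} (a : sub M C S) : M := proj1_sig a.
Definition mk {M : str} {C : M -> Prop} (S : M -> Prop) (x : M) (H : C x) : sub M C S := exist _ x H.

Lemma val_inj {M C S} (a b : sub M C S) : val a = val b -> a = b.
Proof. intros H. apply eq_sig_hprop; auto. intros; apply proof_irrelevance. Qed.

Lemma temb_val (M : str) (C S : M -> Prop) : (forall x y, C x -> y ε x -> C y) -> temb (@val M C S).
Proof.
  intros H. split.
  - apply val_inj.
  - intros x y. reflexivity.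
  - intros [x Hx] y Hy. exists (mk S y (H x y Hx Hy)). reflexivity.
Qed.

Lemma DefP_rel (M : str) (C S : M -> Prop) (P : (nat -> sub M C S) -> Prop) : D1 C -> D1 S -> DefP P ->
  exists Q, DefP Q /\ forall e, P e <-> Q (fun i => val (e i)).
Proof.
  intros HC HS [A HA].
  cut (exists Q, DefP Q /\ forall e : nat -> sub M C S, psat e A <-> Q (fun i => val (e i))).
  { intros (Q & HQ & E). exists Q. split; auto. intros e. rewrite HA. apply E. }
  clear P HA.
  assert (T : forall t : tm (sub M C S), exists t', DefT t' /\ forall e, val (tval e t) = t' (fun i => val (e i))).
  { intros [i|x]; [exists (fun e => e i); split; [def|reflexivity]|exists (fun _ => val x); split; [def|reflexivity]]. }
  induction A.
  - destruct (T s) as (s' & Hs & Es), (T t) as (t' & Ht & Et). exists (fun e => s' e ε t' e). split.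
    + apply (DefP_app2 mem); auto. def.
    + intros e. rewrite <- Es, <- Et. reflexivity.
  - destruct (T s) as (s' & Hs & Es), (T t) as (t' & Ht & Et). exists (fun e => s' e = t' e). split.
    + apply (DefP_app2 eq); auto. def.
    + intros e. rewrite <- Es, <- Et. simpl. split; [congruence|apply val_inj].
  - destruct (T s) as (s' & Hs & Es). exists (fun e => S (s' e)). split.
    + apply (DefP_app1 S); auto.
    + intros e. rewrite <- Es. reflexivity.
  - exists (fun _ => False). split; [def|simpl; tauto].
  - destruct IHA1 as (Q1 & H1 & E1), IHA2 as (Q2 & H2 & E2). exists (fun e => Q1 e -> Q2 e).
    split; [def|]. intros e. simpl. rewrite E1, E2. tauto.
  - destruct IHA as (Q & H & E). exists (fun e => forall x, C x -> Q (x .: e)). split.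
    + apply (DefP_all (fun e x => C x -> Q (x .: e))). apply DefP_imp; [exact HC|].
      apply (DefP_iff Q); auto. intros e. rewrite scons_eta. tauto.
    + intros e. simpl. split.
      * intros K x Hx. specialize (K (mk S x Hx)). rewrite E, scons_comp in K. exact K.
      * intros K [x Hx]. rewrite E, scons_comp. apply K; auto.
Qed.

(** * Collection *)

Section Collect.
Context {M : str} {Z : ZFm M} (A0 : M) (R : (nat -> M) -> Prop) (HR : DefP R).
Fixpoint Wit n (b : M) (e : nat -> M) : Prop :=
  match n with
  | 0 => (exists a, Ord a /\ R (a .: e)) -> exists a, a ε b /\ R (a .: e)
  | S n => forall x, x ε A0 -> Wit n b (x .: e)
  end.
Lemma DefP_Wit n : DefP (fun e => Wit n (e 0) (fun i => e (S i))).
Proof.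
  induction n; simpl.
  - assert (H : DefP (fun e : nat -> M => R (e 0 .: (fun i => e (S (S i)))))).
    { apply (DefP_iff (fun e => R (fun i => e (match i with 0 => 0 | S k => S (S k) end)))).
      - intros e. match goal with |- R ?a <-> R ?b => replace b with a; [tauto|] end.
        extensionality i. destruct i; reflexivity.
      - apply (DefP_ren R); auto. }
    def.
  - apply (DefP_all (fun e x => x ε A0 -> Wit n (e 0) (x .: (fun i => e (S i))))).
    apply DefP_imp; [def|].
    apply (DefP_iff (fun e => Wit n (e 1) (fun i => e (match i with 0 => 0 | S k => S (S k) end)))).
    + intros e. match goal with |- Wit n ?c ?a <-> Wit n ?c ?b => replace b with a; [tauto|] end.
      extensionality i. destruct i; reflexivity.
    + apply (DefP_ren _ (fun i => match i with 0 => 1 | 1 => 0 | S (S k) => S (S k) end)) in IHn.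
      apply (DefP_iff _ _) with (2 := IHn). intros e.
      match goal with |- Wit n ?c ?a <-> Wit n ?c ?b => replace b with a; [tauto|] end.
      extensionality i. destruct i; reflexivity.
Qed.
Lemma Wit_mono n : forall b b' e, subs b b' -> Wit n b e -> Wit n b' e.
Proof.
  induction n; simpl; intros b b' e H; eauto. intros K L. destruct (K L) as (a & Ha & Q). eauto.
Qed.
(** One bound serves all choices of [n] values from [A0]. Taking least bounds makes the assignment
    functional, so replacement applies, one variable at a time. *)
Lemma collect n : forall e, exists b, Ord b /\ Wit n b e.
Proof.
  induction n; intros e.
  - simpl. destruct (classic (exists a, Ord a /\ R (a .: e))) as [(a & Ha & K)|N].
    + exists (suc a). split; [apply Ord_suc; auto|]. intros _. exists a. rewrite in_suc. auto.
    + exists emp. split; [apply Ord_emp|tauto].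
  - assert (HW : DefP (fun f => Wit n (f 1) (f 0 .: e))).
    { pose proof (DefP_subst _ (fun i => match i with 0 => V 1 | 1 => V 0 | S (S k) => K (e k) end) (DefP_Wit n)) as H.
      apply (DefP_iff _ _) with (2 := H). intros f. simpl.
      match goal with |- Wit n ?c ?a <-> Wit n ?c ?b => replace b with a; [tauto|] end.
      extensionality i. destruct i; reflexivity. }
    destruct (zrep (fun x b => Ord b /\ Wit n b (x .: e) /\ forall c, c ε b -> ~ Wit n c (x .: e))) with (a := A0) as [s Hs].
    + assert (HW' : DefP (fun f => Wit n (f 0) (f 1 .: e)))
        by exact (DefP_ren _ (fun i => match i with 0 => 1 | _ => 0 end) HW).
      unfold D2. def.
    + intros x y y' (O1 & W1 & L1) (O2 & W2 & L2).
      destruct (Ord_tri y y') as [K|[K|K]]; auto; exfalso; [eapply L2|eapply L1]; eauto.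
    + assert (Os : forall a, a ε s -> Ord a) by (intros a Ha; apply Hs in Ha as (x & _ & O & _); auto).
      exists (uni s). split; [apply Ord_uni; auto|]. simpl. intros x Hx. destruct (IHn (x .: e)) as (b & Ob & Wb).
      destruct (Ord_least (fun b => Wit n b (x .: e))) with (a := b) as (c & Oc & Wc & _ & Lc); auto.
      { apply (DefP_inst (fun f c => Wit n c (f 0 .: e)) (fun _ => x)).
        exact (DefP_ren _ (fun i => match i with 0 => 1 | _ => 0 end) HW). }
      apply (Wit_mono n c); auto. intros z Hz. apply in_uni. exists c. split; auto. apply Hs. eauto.
Qed.
End Collect.

(** * The constructible sets satisfy ZF *)

Section LModel.
Context {M : str} {Z : ZFm M}.

(** The variable with index 0 is the outermost component, so that the domain operation is
    existential quantification over it. *)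
Fixpoint tup (l : list M) : M := match l with [] => emp | x :: l => op (tup l) x end.
Fixpoint lapp (l : list M) (e : nat -> M) : nat -> M := match l with [] => e | x :: l => x .: lapp l e end.
Definition lenv l := lapp l (fun _ => emp).
Definition inn (n : nat) (A : M) (l : list M) := length l = n /\ Forall (fun x => x ε A) l.
(** Gödel's normal form theorem stated semantically: on a constructible set, [Q] cuts out a
    constructible set of tuples. The induction on formulas follows the basic operations. *)
Definition good (Q : (nat -> M) -> Prop) := forall A n, Lc A ->
  exists E, Lc E /\ forall l, inn n A l -> (tup l ε E <-> Q (lenv l)).

Lemma inn_cons n A x l : inn (S n) A (x :: l) <-> x ε A /\ inn n A l.
Proof.
  unfold inn. simpl. split.
  - intros [H1 H2]. inversion H2; subst. auto.
  - intros (H1 & H2 & H3). split; auto.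
Qed.
Lemma inn_S n A l : inn (S n) A l -> exists x l', l = x :: l' /\ x ε A /\ inn n A l'.
Proof. destruct l; intros H; [destruct H; discriminate|]. apply inn_cons in H. eauto. Qed.
Lemma inn_mono n A B l : subs A B -> inn n A l -> inn n B l.
Proof. intros H [H1 H2]. split; auto. eapply Forall_impl; [|exact H2]. auto. Qed.

Lemma Lc_emp : Lc emp.
Proof.
  exists emp. split; [apply Ord_emp|]. apply zext. intros z. split; intros H; exfalso; [eapply in_emp; eauto|].
  apply FL_tr in H as (d & Hd & _); [|apply Ord_emp]. eapply in_emp; eauto.
Qed.

Ltac opset_tac := rewrite in_opset; simpl; rewrite ?pin_op.
Lemma in_diff x y w : w ε opset 1 x y <-> w ε x /\ ~ w ε y. Proof. opset_tac. tauto. Qed.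
Lemma in_oprod x y u v : op u v ε opset 2 x y <-> u ε x /\ v ε y.
Proof.
  opset_tac. setoid_rewrite isop_op. split.
  - intros (a & b & Ha & Hb & E). apply op_inj in E as [-> ->]. auto.
  - intros []; eauto.
Qed.
Lemma in_dom x y w : w ε opset 3 x y <-> exists v, op w v ε x.
Proof. opset_tac. setoid_rewrite pin_op. tauto. Qed.
Lemma in_memf x y e u v : op (op e u) v ε opset 4 x y <-> op (op e u) v ε x /\ u ε v.
Proof.
  opset_tac. setoid_rewrite isop_op. split; intros [H H']; split; auto.
  - destruct H' as (c & v' & e' & u' & E & -> & K). apply op_inj in E as [E ->]. apply op_inj in E as [-> ->]. auto.
  - eauto 10.
Qed.
Lemma in_eqf x y e u v : op (op e u) v ε opset 5 x y <-> op (op e u) v ε x /\ u = v.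
Proof.
  opset_tac. setoid_rewrite isop_op. split; intros [H H']; split; auto.
  - destruct H' as (c & v' & e' & E & ->). apply op_inj in E as [E ->]. apply op_inj in E as [-> ->]. auto.
  - subst. eauto 10.
Qed.
Lemma in_ins x y e u v : op (op e u) v ε opset 6 x y <-> op e v ε x /\ u ε y.
Proof.
  opset_tac. setoid_rewrite isop_op. setoid_rewrite pin_op. split.
  - intros (e' & u' & v' & c & H1 & H2 & -> & E). apply op_inj in E as [E ->]. apply op_inj in E as [-> ->]. auto.
  - intros []. eauto 10.
Qed.
Lemma in_im x y v : v ε opset 7 x y <-> op y v ε x. Proof. opset_tac. tauto. Qed.

Fixpoint pown (A : M) n := match n with 0 => sg emp | S n => opset 2 (pown A n) A end.
Lemma Lc_pown A n : Lc A -> Lc (pown A n).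
Proof.
  intros H. induction n; simpl; [apply Lc_upair; apply Lc_emp|]. apply Lc_opset; auto. lia.
Qed.
Lemma tup_pown A n : forall l, inn n A l -> tup l ε pown A n.
Proof.
  induction n; intros l Hl.
  - destruct l; [apply in_sg; auto|destruct Hl; discriminate].
  - apply inn_S in Hl as (x & l' & -> & Hx & Hl). simpl. apply in_oprod. auto.
Qed.

Definition goodT (t : (nat -> M) -> M) A := forall n,
  exists P, Lc P /\ forall l u, inn n A l -> (op (tup l) u ε P <-> u = t (lenv l)).
Lemma goodT_K c A : Lc A -> Lc c -> goodT (fun _ => c) A.
Proof.
  intros HA Hc n. exists (opset 2 (pown A n) (sg c)). split.
  - apply Lc_opset; [lia|apply Lc_pown; auto|apply Lc_upair; auto].
  - intros l u Hl. rewrite in_oprod, in_sg. pose proof (tup_pown A n l Hl). tauto.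
Qed.
Lemma goodT_V i A : Lc A -> goodT (fun e => e i) A.
Proof.
  intros HA n. revert i. induction n; intros i.
  - destruct (goodT_K emp A HA Lc_emp 0) as (P & HP & E). exists P. split; auto. intros l u Hl.
    rewrite E by auto. destruct l; [reflexivity|destruct Hl; discriminate].
  - destruct i as [|i].
    + exists (opset 5 (opset 2 (pown A (S n)) A) emp). split.
      * apply Lc_opset; [lia| |apply Lc_emp]. apply Lc_opset; [lia|apply Lc_pown; auto|auto].
      * intros l u Hl. pose proof (tup_pown A _ l Hl) as Ht. apply inn_S in Hl as (x & l' & -> & Hx & Hl).
        simpl tup in *. rewrite in_eqf, in_oprod. simpl. split; [intros [_ <-]; auto|]. intros ->. auto.
    + destruct (IHn i) as (P & HP & E). exists (opset 6 P A). split; [apply Lc_opset; auto; lia|].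
      intros l u Hl. apply inn_S in Hl as (x & l' & -> & Hx & Hl). simpl tup. rewrite in_ins, E by auto.
      simpl. tauto.
Qed.
(** Attach the values of both terms to each tuple by product, insertion and a double difference for
    intersection, filter by the relation, and project both values away. [B] is enlarged so as to
    contain the values. *)
Lemma good_atom k s t (R : M -> M -> Prop) : (k = 4 /\ R = mem) \/ (k = 5 /\ R = eq) ->
  (forall A, Lc A -> exists B, Lc B /\ subs A B /\ goodT s B /\ goodT t B /\
     forall n l, inn n A l -> s (lenv l) ε B /\ t (lenv l) ε B) ->
  good (fun e => R (s e) (t e)).
Proof.
  intros Hk H A n HA. destruct (H A HA) as (B & HB & SB & GS & GT & Hin).
  destruct (GS n) as (P & HP & EP), (GT n) as (Q & HQ & EQ).
  set (X := opset 2 P B). set (Y := opset 6 Q B). set (I := opset 1 X (opset 1 X Y)).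
  assert (LX : Lc X) by (apply Lc_opset; auto; lia). assert (LY : Lc Y) by (apply Lc_opset; auto; lia).
  assert (LI : Lc I) by (unfold I; repeat apply Lc_opset; auto; lia).
  exists (opset 3 (opset 3 (opset k I emp) emp) emp). split.
  { repeat apply Lc_opset; auto using Lc_emp; lia. }
  intros l Hl. destruct (Hin n l Hl) as [H1 H2]. assert (Hl' := inn_mono n A B l SB Hl).
  assert (EI : forall u v, op (op (tup l) u) v ε I <-> u = s (lenv l) /\ v = t (lenv l)).
  { intros u v. unfold I, X, Y. rewrite !in_diff, in_oprod, in_ins, EP, EQ by auto.
    split; [intros [[-> K1] K2]; split; auto; tauto|]. intros [-> ->]. tauto. }
  assert (EK : forall u v, op (op (tup l) u) v ε opset k I emp <-> op (op (tup l) u) v ε I /\ R u v).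
  { destruct Hk as [[-> ->]|[-> ->]]; intros; [apply in_memf|apply in_eqf]. }
  rewrite in_dom. setoid_rewrite in_dom. setoid_rewrite EK. setoid_rewrite EI. split.
  - intros (u & v & [-> ->] & K). auto.
  - intros K. eauto.
Qed.
Lemma good_imp P Q : good P -> good Q -> good (fun e => P e -> Q e).
Proof.
  intros HP HQ A n HA. destruct (HP A n HA) as (E & LE & KE), (HQ A n HA) as (F & LF & KF).
  exists (opset 1 (pown A n) (opset 1 E F)). split.
  - repeat apply Lc_opset; auto using Lc_pown; lia.
  - intros l Hl. rewrite !in_diff, KE, KF by auto. pose proof (tup_pown A n l Hl). tauto.
Qed.

Lemma lapp_app l : forall x e, lapp (l ++ [x]) e = lapp l (x .: e).
Proof. induction l; intros; simpl; f_equal; auto. Qed.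
Lemma Wit_lapp A R b l : forall e, Forall (fun x => x ε A) l -> Wit A R (length l) b e -> Wit A R 0 b (lapp l e).
Proof.
  induction l using rev_ind; intros e H K; auto. rewrite length_app, Nat.add_comm in K. simpl in K.
  apply Forall_app in H as [H1 H2]. inversion H2; subst. rewrite lapp_app. apply IHl; auto.
Qed.

(** Collection bounds the search for counterexamples, so the quantifier may be restricted to a
    constructible set [B]; what remains is the complement of the projection of a complement. *)
Lemma good_all Q : DefP Q -> good Q -> good (fun e => forall x, Lc x -> Q (x .: e)).
Proof.
  intros DQ GQ A n HA. set (R := fun e : nat -> M => ~ Q (FL (e 0) .: (fun i => e (S i)))).
  assert (DR : DefP R).
  { unfold R. apply DefP_not.
    apply (DefP_sub (fun e x => Q (x .: (fun i => e (S i)))) (fun e => FL (e 0))); [|def].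
    apply (DefP_iff (fun e => Q (fun i => e (match i with 0 => 0 | S k => S (S k) end)))).
    - intros e. match goal with |- Q ?a <-> Q ?b => replace b with a; [tauto|] end.
      extensionality i. destruct i; reflexivity.
    - apply (DefP_ren Q); auto. }
  destruct (collect A R DR n (fun _ => emp)) as (b & Hb & Wb).
  destruct (Lc_cover (bun A (img b FL))) as (B & LB & SB).
  { intros x Hx. apply in_bun in Hx as [Hx|Hx]; [eapply Lc_tr; eauto|].
    apply in_img in Hx as (d & Hd & ->); [|def]. exists d. split; auto. eapply mem_Ord; eauto. }
  destruct (GQ B (S n) LB) as (E & LE & KE).
  exists (opset 1 (pown A n) (opset 3 (opset 1 (opset 2 (pown A n) B) E) emp)). split.
  { apply Lc_opset; [lia|apply Lc_pown; auto|]. apply Lc_opset; [lia| |apply Lc_emp].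
    apply Lc_opset; [lia| |auto]. apply Lc_opset; [lia|apply Lc_pown; auto|auto]. }
  intros l Hl. pose proof (tup_pown A n l Hl) as Ht.
  assert (Hl' : inn n B l). { apply (inn_mono n A); auto. intros x Hx. apply SB, in_bun; auto. }
  rewrite in_diff, in_dom. setoid_rewrite in_diff. setoid_rewrite in_oprod. split.
  - intros [_ K] x (a & Ha & ->). apply NNPP. intros N.
    assert (W0 : Wit A R 0 b (lenv l)).
    { apply Wit_lapp; [apply Hl|]. destruct Hl as [<- _]. exact Wb. }
    destruct W0 as (d & Hd & Rd); [exists a; split; auto|]. apply K. exists (FL d).
    assert (Bd : FL d ε B) by (apply SB, in_bun; right; apply in_img; [def|eauto]).
    split; auto. intros Hin.
    apply Rd. apply (KE (FL d :: l)); [apply inn_cons; auto|exact Hin].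
  - intros K. split; auto. intros (v & [_ Hv] & N). apply N. apply (KE (v :: l)); [apply inn_cons; auto|].
    apply K. apply (Lc_tr B); auto.
Qed.

Definition LN : str := sub M Lc (fun _ => False).
Definition mkL (x : M) (H : Lc x) : LN := mk (fun _ => False) x H.
Lemma valL (x : LN) : Lc (val x).
Proof. apply (proj2_sig x). Qed.
Lemma LN_temb : temb (@val M Lc (fun _ => False)).
Proof. apply temb_val, Lc_tr. Qed.

Lemma DefP_good (P : (nat -> LN) -> Prop) : DefP P ->
  exists Q, DefP Q /\ good Q /\ forall e, P e <-> Q (fun i => val (e i)).
Proof.
  intros [A HA].
  cut (exists Q, DefP Q /\ good Q /\ forall e : nat -> LN, psat e A <-> Q (fun i => val (e i))).
  { intros (Q & HQ & GQ & E). exists Q. repeat split; auto; intros K; [apply E, HA|apply HA, E]; auto. }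
  clear P HA.
  assert (T : forall t : tm LN, exists t', DefT t' /\ (forall e, val (tval e t) = t' (fun i => val (e i))) /\
     exists c, Lc c /\ (forall A, Lc A -> goodT t' A) /\ forall A n l, inn n A l -> t' (lenv l) ε A \/ t' (lenv l) = c).
  { intros [i|x].
    - exists (fun e => e i). split; [def|]. split; [reflexivity|]. exists emp. split; [apply Lc_emp|].
      split; [intros; apply goodT_V; auto|]. intros B n l. revert i n. induction l; intros i n Hl; simpl; auto.
      destruct n; [destruct Hl; discriminate|]. apply inn_cons in Hl as [H1 H2]. destruct i; simpl; eauto.
    - exists (fun _ => val x). split; [def|]. split; [reflexivity|]. exists (val x). split; [apply (proj2_sig x)|].
      split; auto. intros; apply goodT_K; auto. apply (proj2_sig x). }
  (* Terms take values in [A] except for constants and for variables beyond the tuple, which have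
     value [emp]; these exceptional values are added to [B]. *)
  assert (TT : forall c c' A, Lc c -> Lc c' -> Lc A -> exists B, Lc B /\ subs A B /\ c ε B /\ c' ε B).
  { intros c c' B Hc Hc' HB. destruct (Lc_cover (bun B (upair c c'))) as (D & HD & SD).
    - intros x Hx. apply in_bun in Hx as [Hx|Hx]; [eapply Lc_tr; eauto|]. apply in_upair in Hx as [-> | ->]; auto.
    - exists D. split; auto. split; [intros x Hx; apply SD, in_bun; auto|].
      split; apply SD, in_bun; right; apply in_upair; auto. }
  induction A.
  - destruct (T s) as (s' & Hs & Es & c & Lcc & Gs & Is), (T t) as (t' & Ht & Et & c' & Lcc' & Gt & It).
    exists (fun e => s' e ε t' e). split; [|split].
    + apply (DefP_app2 mem); auto. def.
    + apply (good_atom 4); auto. intros A HA. destruct (TT c c' A) as (B & HB & SB & H1 & H2); auto.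
      exists B. repeat split; auto; [destruct (Is A n l H) as [K| ->]|destruct (It A n l H) as [K| ->]]; auto.
    + intros e. rewrite <- Es, <- Et. reflexivity.
  - destruct (T s) as (s' & Hs & Es & c & Lcc & Gs & Is), (T t) as (t' & Ht & Et & c' & Lcc' & Gt & It).
    exists (fun e => s' e = t' e). split; [|split].
    + apply (DefP_app2 eq); auto. def.
    + apply (good_atom 5); auto. intros A HA. destruct (TT c c' A) as (B & HB & SB & H1 & H2); auto.
      exists B. repeat split; auto; [destruct (Is A n l H) as [K| ->]|destruct (It A n l H) as [K| ->]]; auto.
    + intros e. rewrite <- Es, <- Et. simpl. split; [congruence|apply val_inj].
  - exists (fun _ => False). split; [def|]. split; [|simpl; tauto].
    intros A n HA. exists emp. split; [apply Lc_emp|]. intros l _. split; [apply in_emp|tauto].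
  - exists (fun _ => False). split; [def|]. split; [|simpl; tauto].
    intros A n HA. exists emp. split; [apply Lc_emp|]. intros l _. split; [apply in_emp|tauto].
  - destruct IHA1 as (Q1 & H1 & G1 & E1), IHA2 as (Q2 & H2 & G2 & E2). exists (fun e => Q1 e -> Q2 e).
    split; [def|]. split; [apply good_imp; auto|]. intros e. simpl. rewrite E1, E2. tauto.
  - destruct IHA as (Q & H & GQ & E). exists (fun e => forall x, Lc x -> Q (x .: e)). split; [|split].
    + apply (DefP_all (fun e x => Lc x -> Q (x .: e))). apply DefP_imp; [def|].
      apply (DefP_iff Q); auto. intros e. rewrite scons_eta. tauto.
    + apply good_all; auto.
    + intros e. simpl. split.
      * intros K x Hx. specialize (K (mkL x Hx)). rewrite E, scons_comp in K. exact K.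
      * intros K [x Hx]. rewrite E, scons_comp. apply K; auto.
Qed.

Lemma LN_sep (P : LN -> Prop) : D1 P -> forall a : LN, exists b : LN, forall z : LN, z ε b <-> z ε a /\ P z.
Proof.
  intros HP [a Ha]. destruct (DefP_good _ HP) as (Q & _ & GQ & EQ).
  destruct (GQ a 1 Ha) as (E & LE & KE).
  (* A tuple of length one is a pair with first component [emp], so the image of [emp] is the class
     in question. *)
  set (I := opset 7 E emp).
  assert (LI : Lc (opset 1 a (opset 1 a I))).
  { repeat apply Lc_opset; auto using Lc_emp; lia. }
  exists (mkL _ LI). intros [z Hz]. simpl. rewrite !in_diff. unfold I. rewrite in_im.
  cut (z ε a -> (op emp z ε E <-> P (exist _ z Hz))). { simpl. tauto. }
  intros K. rewrite (KE [z]) by (split; auto). rewrite (EQ (fun i => match i with 0 => exist _ z Hz | _ => mkL emp Lc_emp end)).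
  match goal with |- Q ?a <-> Q ?b => replace b with a; [tauto|] end.
  extensionality i. destruct i; reflexivity.
Qed.

Lemma LN_ZFm : ZFm LN.
Proof.
  pose proof LN_temb as TE.
  assert (CV : forall (X : M) , (forall x, x ε X -> Lc x) -> exists B : LN, forall x : LN, val x ε X -> x ε B).
  { intros X HX. destruct (Lc_cover X HX) as (B & LB & SB). exists (mkL B LB). intros x Hx. apply SB; auto. }
  (* A class definable over L is a set of L once its members lie in some set of [M]: cover that set,
     then separate. *)
  assert (PT : forall (P : LN -> Prop) (X : M), D1 P -> (forall x, x ε X -> Lc x) -> (forall x : LN, P x -> val x ε X) ->
     exists b : LN, forall x, x ε b <-> P x).
  { intros P X DP HX PX. destruct (CV X HX) as [B HB]. destruct (LN_sep P DP B) as [b Hb]. exists b.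
    intros x. rewrite Hb. split; [tauto|]. auto. }
  split.
  - intros [x Hx] [y Hy] H. apply val_inj. simpl. apply zext. intros z. split; intros Hz.
    + apply (proj1 (H (mkL z (Lc_tr _ _ Hx Hz))) Hz).
    + apply (proj2 (H (mkL z (Lc_tr _ _ Hy Hz))) Hz).
  - intros [a Ha] [[x Hx] Hxa]. destruct (zfnd a) as (y & Hy & K); [exists x; auto|].
    exists (mkL y (Lc_tr _ _ Ha Hy)). split; [exact Hy|]. intros ([z Hz] & H1 & H2). apply K. exists z. auto.
  - intros x y. apply (PT _ (upair (val x) (val y))); [def| |].
    + intros z Hz. apply in_upair in Hz as [-> | ->]; apply valL.
    + intros z [-> | ->]; apply in_upair; auto.
  - intros a. apply (PT _ (uni (val a))); [def| |].
    + intros z Hz. apply in_uni in Hz as (x & Hx & Hz). eapply Lc_tr; [|exact Hz].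
      eapply Lc_tr; [|exact Hx]. apply (proj2_sig a).
    + intros z (x & Hx & Hz). apply in_uni. exists (val x). auto.
  - intros a. apply (PT _ (sep (pow (val a)) Lc)); [def| |].
    + intros z Hz. apply in_sep in Hz; [tauto|def].
    + intros z Hz. apply in_sep; [def|]. split; [|apply (proj2_sig z)]. apply in_pow, (a_subs _ z a); auto.
  - assert (OL : forall n, n ε om -> Lc n).
    { apply om_ind; [def|apply Lc_emp|]. intros n Hn Ln.
      destruct (PT (fun z => val z ε n \/ val z = n) (suc n)) as [b Hb].
      - apply (DefP_iff (fun e : nat -> LN => e 0 ε mkL n Ln \/ e 0 = mkL n Ln)); [|def].
        intros e. split; (intros [K|K]; [left; exact K|right]); [rewrite K; auto|apply val_inj; exact K].
      - intros x Hx. apply in_suc in Hx as [Hx| ->]; auto. eapply Lc_tr; eauto.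
      - intros x Hx. apply in_suc; auto.
      - replace (suc n) with (val b); [apply (proj2_sig b)|]. apply zext. intros z. rewrite in_suc. split.
        + intros Hz. destruct b as [b Lb]. apply (Hb (mkL z (Lc_tr _ _ Lb Hz))). exact Hz.
        + intros Hz. assert (Lz : Lc z) by (destruct Hz as [Hz| ->]; auto; eapply Lc_tr; eauto).
          apply (Hb (mkL z Lz)). exact Hz. }
    destruct (PT natS om) as [w Hw]; [def|auto|intros x Hx; apply natS_om, (a_natS _ x); auto|].
    assert (W : forall n : LN, n ε w <-> val n ε om).
    { intros n. rewrite Hw, <- natS_om. symmetry. apply (a_natS val). }
    exists w. split.
    + exists (mkL emp Lc_emp). split; [apply W, om_0|]. intros z Hz. eapply in_emp; exact Hz.
    + intros x Hx. apply W in Hx. exists (mkL _ (OL _ (om_S _ Hx))). split; [apply W, om_S; auto|].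
      intros z. change (val z ε suc (val x) <-> val z ε val x \/ z = x). rewrite in_suc.
      split; (intros [K|K]; [left; auto|right]); [apply val_inj; exact K|rewrite K; auto].
  - exact LN_sep.
  (* Replacement is used in [M], for the relativized relation that [DefP_good] provides. *)
  - intros R DR FR a. destruct (DefP_good _ DR) as (Q & DQ & _ & EQ).
    set (Q2 x y := Q (x .: (y .: (fun _ => emp)))).
    assert (EQ2 : forall x y : LN, R x y <-> Q2 (val x) (val y)).
    { intros x y. rewrite (EQ (x .: (y .: (fun _ => mkL emp Lc_emp)))). unfold Q2. rewrite !scons_comp. tauto. }
    destruct (zrep (fun x y => Lc x /\ Lc y /\ Q2 x y)) with (a := val a) as [b Hb].
    + apply (DefP_subst _ (fun i => match i with 0 => V 0 | 1 => V 1 | _ => K emp end)) in DQ.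
      assert (D : D2 Q2).
      { apply (DefP_iff _ _) with (2 := DQ). intros e. unfold Q2.
        match goal with |- Q ?a <-> Q ?b => replace b with a; [tauto|] end.
        extensionality i. destruct i as [|[|i]]; reflexivity. }
      def.
    + intros x y y' (L1 & L2 & H1) (_ & L3 & H2).
      specialize (FR (mkL x L1) (mkL y L2) (mkL y' L3)). rewrite !EQ2 in FR. specialize (FR H1 H2).
      apply (f_equal val) in FR. exact FR.
    + apply (PT (fun y => exists x, x ε a /\ R x y) b).
      * def.
      * intros y Hy. apply Hb in Hy as (x & _ & _ & Ly & _). auto.
      * intros y (x & Hx & Rxy). apply Hb. exists (val x). rewrite <- EQ2. split; [exact Hx|].
        split; [apply (proj2_sig x)|]. split; [apply (proj2_sig y)|]. auto.
Qed.
End LModel.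

Section Local.
Context {M : str} (h h' a : M) (Ha : Ord a)
  (H : forall d x, d ε a -> (pin h d x <-> pin h' d x)).
Lemma inA_local w : inA h a w <-> inA h' a w.
Proof. unfold inA. split; intros (d & Hd & K); exists d; split; auto; apply H; auto. Qed.
Lemma New_local b c k : b ε a -> c ε a -> (New h a b c k <-> New h' a b c k).
Proof.
  intros Hb Hc. unfold New. setoid_rewrite inA_local.
  split; intros (x & y & H1 & H2 & H3); exists x, y; (split; [apply H; auto|split; [apply H; auto|]]); auto.
Qed.
Lemma Sel_local b c k : Sel h a b c k <-> Sel h' a b c k.
Proof.
  assert (T : forall b c, b ε a -> c ε b \/ c = b -> c ε a).
  { intros b' c' H1 [H2| ->]; auto. apply (proj1 Ha b'); auto. }
  unfold Sel. split; intros (H1 & H2 & H3 & H4 & H5 & H6); (split; [auto|]); (split; [auto|]);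
    (split; [apply New_local; auto; eapply T; eauto|]); split; [|split| |split].
  1,4: intros b' c' Hb' Hc' (k' & Hk & HN); apply (H4 b' c' Hb' Hc'); exists k'; split; auto;
    assert (b' ε a) by (apply (proj1 Ha b); auto); apply New_local; auto; eapply T; eauto.
  1,3: intros c' Hc' (k' & Hk & HN); apply (H5 c' Hc'); exists k'; split; auto; apply New_local; auto;
    assert (c ε a) by (eapply T; eauto); apply (proj1 Ha c); auto.
  1,2: intros (k' & Hk & HN); apply H6; exists k'; split; auto; apply New_local; auto; eapply T; eauto.
Qed.
(** Only the values of [h] below [a] matter, which lets approximations of different lengths be
    compared. *)
Lemma Gm_local w : Gm h a w <-> Gm h' a w.
Proof.
  unfold Gm. setoid_rewrite Sel_local. rewrite inA_local.
  assert (E : (exists k, k < 16 /\ exists b c, Sel h' a b c k /\ exists x y, pin h b x /\ pin h c y /\ opm k w x y) <->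
    (exists k, k < 16 /\ exists b c, Sel h' a b c k /\ exists x y, pin h' b x /\ pin h' c y /\ opm k w x y)).
  { split; intros (k & Hk & b & c & S & x & y & H1 & H2 & H3); exists k; (split; [auto|]); exists b, c; (split; [auto|]);
    exists x, y; destruct S as (B & C & _);
    (assert (c ε a) by (destruct C as [C| ->]; auto; apply (proj1 Ha b); auto));
    repeat split; auto; apply H; auto. }
  rewrite E. tauto.
Qed.
End Local.

(** * Constructibility inside the inner model *)

Section VL.
Context {M : str} {Z : ZFm M}.
Lemma Att_lam (a : M) : Ord a -> Att (lam a FL) a.
Proof.
  intros Ha. split; [auto|]. split.
  - intros p Hp. apply in_lam in Hp as (b & Hb & ->); [|def]. exists b, (FL b). rewrite isop_op. auto.
  - intros b Hb. exists (FL b). rewrite pinF. split; auto. split; [intros x' Hx'; apply pinF in Hx'; tauto|].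
    assert (Ob : Ord b) by (eapply mem_Ord; eauto).
    intros w. rewrite in_FL by auto. apply Gm_local; auto. intros d x Hd. rewrite !pinF.
    assert (d ε a) by (eapply Ord_trans; eauto). tauto.
Qed.
Lemma Att_FL (f a : M) : Att f a -> forall b x, pin f b x -> b ε a /\ x = FL b.
Proof.
  intros (Ha & H1 & H2).
  assert (D : forall b x, pin f b x -> b ε a).
  { intros b x (p & Hp & Hx). destruct (H1 p Hp) as (b' & x' & Hb & K). apply isop_op in Hx as ->.
    apply isop_op in K. apply op_inj in K as [-> _]. auto. }
  assert (K : forall b, Ord b -> b ε a -> forall x, pin f b x -> x = FL b).
  { apply (Ord_ind (fun b => b ε a -> forall x, pin f b x -> x = FL b)); [def|].
    intros b Ob IH Hb x Hx. destruct (H2 b Hb) as (y & Py & Uy & Ey). rewrite (Uy x Hx).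
    apply zext. intros w. rewrite Ey, in_FL by auto. apply Gm_local; auto. intros d z Hd. rewrite pinF.
    assert (Hda : d ε a) by (eapply Ord_trans; eauto). split.
    - intros Hz. split; auto.
    - intros [_ ->]. destruct (H2 d Hda) as (z & Pz & _). rewrite <- (IH d Hd Hda z Pz). auto. }
  intros b x Hx. split; [eapply D; eauto|]. apply K; auto; [eapply mem_Ord; eauto|]; eapply D; eauto.
Qed.
Lemma Att_eq (f a : M) : Att f a -> f = lam a FL.
Proof.
  intros H. apply zext. intros p. rewrite in_lam by def. split.
  - intros Hp. destruct (proj1 (proj2 H) p Hp) as (b & x & Hb & K). exists b. split; auto.
    assert (Px : pin f b x) by (exists p; auto). apply (Att_FL f a H) in Px as [_ <-]. apply isop_op; auto.
  - intros (b & Hb & ->). destruct (proj2 (proj2 H) b Hb) as (x & Px & _). assert (Qx := Px).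
    apply (Att_FL f a H) in Px as [_ <-]. apply pin_op; auto.
Qed.
End VL.

Section VLN.
Context {M : str} {Z : ZFm M}.
Notation N := (@LN M Z).

(** By induction the members of [a] are constructible, hence covered by a constructible set [B];
    separation inside L has to cut [B] down to [a] without mentioning [a]. *)
Lemma Lc_Ord (a : M) : Ord a -> Lc a.
Proof.
  revert a. apply Ord_ind; [def|]. intros a Ha IH. destruct (Lc_cover a IH) as (B & LB & SB).
  pose proof LN_temb as TE.
  destruct (LN_sep (fun d : N => Ord d)) with (a := mkL B LB) as [x Hx]; [def|].
  (* If [a] is in [x], it is constructible. Otherwise the ordinals in [x] that are subsets of [x]
     are exactly those below [a], because a larger one would contain [a]. *)
  destruct (LN_sep (fun d : N => subs d x)) with (a := x) as [y Hy]; [def|].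
  destruct (classic (a ε val x)) as [K|K]; [apply (Lc_tr (val x)); auto; apply valL|].
  assert (Ix : forall d, d ε a -> d ε val x).
  { intros d Hd. apply (Hx (mkL d (IH d Hd))). split; [apply SB; auto|].
    apply (a_Ord val). apply (mem_Ord a); auto. }
  replace a with (val y); [apply valL|]. apply zext. intros d. split.
  - intros Hd. assert (Ld : Lc d) by (apply (Lc_tr (val y)); auto; apply valL).
    destruct (proj1 (Hy (mkL d Ld)) Hd) as [H1 H2]. pose proof (proj2 (proj1 (Hx _) H1)) as H3.
    apply (a_Ord val) in H3. apply (a_subs val) in H2. assert (Od : Ord d) by exact H3.
    destruct (Ord_tri d a) as [|[Q|Q]]; auto; exfalso; apply K; [subst d; exact H1|apply H2; exact Q].
  - intros Hd. apply (Hy (mkL d (IH d Hd))). split; [apply Ix; auto|]. apply (a_subs val). intros z Hz.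
    apply Ix. eapply Ord_trans; eauto.
Qed.

(** The restriction to [a] is definable over L from the proper restrictions, which are in L by
    induction and are recognised there because [Att] is absolute. *)
Lemma Lc_lam (a : M) : Ord a -> Lc (lam a FL).
Proof.
  pose proof (@F1_FL M Z). pose proof LN_temb as TE.
  revert a. apply (Ord_ind (fun a => Lc (lam a FL))); [def|]. intros a Ha IH.
  assert (LP : forall p, p ε lam a FL -> Lc p).
  { intros p Hp. apply in_lam in Hp as (d & Hd & ->); [|def]. assert (Od : Ord d) by (eapply mem_Ord; eauto).
    apply Lc_pair; [apply Lc_Ord; auto|exists d; auto]. }
  destruct (Lc_cover _ LP) as (B & LB & SB).
  set (a' := mkL a (Lc_Ord a Ha)).
  destruct (LN_sep (fun p : N => exists d f x, d ε a' /\ Att f d /\ isop p d x /\ forall w, w ε x <-> Gm f d w))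
    with (a := mkL B LB) as [g Hg]; [def|].
  replace (lam a FL) with (val g); [apply valL|]. apply zext. intros p. split.
  - intros Hp. assert (Lp : Lc p) by (apply (Lc_tr (val g)); auto; apply valL).
    destruct (proj1 (Hg (mkL p Lp)) Hp) as [_ (d & f & x & H1 & H2 & H3 & H4)].
    apply (a_Att val) in H2. apply (a_isop val), isop_op in H3. change (p = op (val d) (val x)) in H3. rewrite H3.
    apply op_lam; [def|]. split; [exact H1|].
    assert (Od : Ord (val d)) by apply H2.
    apply zext. intros w. rewrite in_FL by auto.
    assert (E : val f = lam (val d) FL).
    { apply Att_eq; auto. }
    rewrite <- E. split.
    + intros Hw. assert (Lw : Lc w) by (apply (Lc_tr (val x)); auto; apply valL).
      apply (a_Gm val f d (mkL w Lw)), H4. exact Hw.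
    + intros Hw. destruct (inA_down val f (val d) w (proj1 Hw)) as [w' ->]. apply (a_Gm val), H4 in Hw. exact Hw.
  - intros Hp. pose proof (LP p Hp) as Lp. assert (Hp' := Hp). apply in_lam in Hp' as (d & Hd & ->); [|def].
    apply (Hg (mkL _ Lp)). split; [apply SB; auto|]. assert (Od : Ord d) by (eapply mem_Ord; eauto).
    exists (mkL d (Lc_Ord d Od)), (mkL _ (IH d Hd)), (mkL (FL d) (ex_intro _ d (conj Od eq_refl))).
    split; [exact Hd|]. split; [apply (a_Att val), Att_lam; auto|].
    split; [apply (a_isop val), isop_op; reflexivity|].
    intros w. rewrite <- (a_Gm val _ _ w). change (val w ε FL d <-> Gm (lam d FL) d (val w)). apply in_FL; auto.
Qed.

Instance LN_Z : ZFm N := LN_ZFm.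
(** L contains the approximation of length [suc a], and absoluteness makes it an approximation in
    the sense of L. *)
Lemma LN_VL (x : N) : Lc x.
Proof.
  pose proof (@LN_temb M Z) as TE. destruct x as [x (a & Ha & E)].
  assert (Oa : Ord (suc a)) by (apply Ord_suc; auto).
  set (f := mkL _ (Lc_lam _ Oa)). set (s := mkL _ (Lc_Ord _ Oa)). set (a' := mkL _ (Lc_Ord a Ha)).
  exists a'. split; [exact (proj1 (a_Ord (@val M Lc (fun _ => False)) a') Ha)|].
  apply (Att_FL f s).
  - exact (proj1 (a_Att (@val M Lc (fun _ => False)) f s) (Att_lam _ Oa)).
  - apply (proj1 (a_pin (@val M Lc (fun _ => False)) f a' (exist _ x (ex_intro _ a (conj Ha E))))), pinF. split; [apply in_suc; right; reflexivity|exact E].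
Qed.
End VLN.

(** * Forcing *)

Class VLm (N : str) {Z : ZFm N} : Prop := { vl : forall x : N, Lc x }.

Section Od.
Context {N : str} {Z : ZFm N} {VL : VLm N}.
(** The place in the enumeration. It serves as a definable well-order of the universe and as a rank,
    since members have a smaller place. *)
Definition od (x : N) := the (fun a => Ord a /\ x = FL a).
Lemma F1_od : F1 od. Proof. unfold od. def. Qed.
Lemma od_spec x : Ord (od x) /\ x = FL (od x).
Proof.
  apply (the_ok (fun a => Ord a /\ x = FL a)); [apply vl|].
  intros a b [H1 ->] [H2 H3]. apply FL_inj; auto.
Qed.
Lemma od_FL a : Ord a -> od (FL a) = a.
Proof. intros Ha. symmetry. apply FL_inj; auto; apply od_spec. Qed.
Lemma od_inj x y : od x = od y -> x = y.
Proof. intros H. rewrite (proj2 (od_spec x)), (proj2 (od_spec y)), H. auto. Qed.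
Lemma od_lt x y : y ε x -> od y ε od x.
Proof.
  intros H. destruct (od_spec x) as [Ox Ex]. rewrite Ex in H. apply FL_tr in H as (d & Hd & ->); auto.
  rewrite od_FL; auto. eapply mem_Ord; eauto.
Qed.
Lemma od_lt_pair z s x : op z s ε x -> od z ε od x /\ od s ε od x.
Proof.
  intros H. destruct (od_spec x) as [Ox _].
  assert (K : od (upair z s) ε od x).
  { apply (Ord_trans _ (od (op z s))); auto; apply od_lt; auto. apply in_upair; auto. }
  split; apply (Ord_trans _ (od (upair z s))); auto; apply od_lt, in_upair; auto.
Qed.
Lemma od_ind (P : N -> Prop) : D1 P -> (forall x, (forall y, od y ε od x -> P y) -> P x) -> forall x, P x.
Proof.
  intros HP H x. pose proof F1_od.
  assert (K : forall a, Ord a -> forall x, od x = a -> P x); [|apply (K (od x)); auto; apply od_spec].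
  apply (Ord_ind (fun a => forall x, od x = a -> P x)); [def|]. intros a Ha IH y <-. apply H. eauto.
Qed.
End Od.
#[export] Hint Resolve F1_od : def.

(** By [le_in] and [le_refl] only conditions are related and each is below itself, so [le p p] says
    that [p] is a condition. *)
Class poset (N : str) := { Pset : N; le : N -> N -> Prop }.
Class posetP (N : str) {Po : poset N} : Prop := {
  le_def : D2 le;
  le_in : forall p q, le p q -> p ε Pset /\ q ε Pset;
  le_refl : forall p, p ε Pset -> le p p;
  le_trans : forall p q r, le p q -> le q r -> le p r;
  Pne : exists p, p ε Pset }.
#[export] Hint Resolve le_def : def.

(** Only dense sets that are elements of [N] are mentioned; definable dense classes are reduced to
    them in [G_meetP]. *)
Class generic {N : str} {Po : poset N} (G : N -> Prop) : Prop := {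
  G_P : forall p, G p -> le p p;
  G_up : forall p q, G p -> le p q -> G q;
  G_dir : forall p q, G p -> G q -> exists r, G r /\ le r p /\ le r q;
  G_ne : exists p, G p;
  G_meet : forall D : N, (forall p, le p p -> exists q, le q p /\ q ε D) -> exists p, G p /\ p ε D }.

(** * Names and the forcing relation *)

Section Forcing.
Context {N : str} {Z : ZFm N} {VL : VLm N} {Po : poset N} {PP : posetP N}.

Lemma le_lP p q : le p q -> p ε Pset. Proof. intros H. apply (le_in p q H). Qed.
Lemma le_l p q : le p q -> le p p. Proof. intros H. apply le_refl, (le_in p q H). Qed.
(** The recursive clause for forced equality, with [X] in place of the relation between components.
    Every set is a name; only its pairs of a name and a condition count. *)
Definition clause (X : N -> N -> N -> Prop) (p x y : N) := le p p /\
  (forall z s q, op z s ε x -> le q p -> le q s -> exists r z' s', le r q /\ op z' s' ε y /\ le r s' /\ X r z z') /\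
  (forall z s q, op z s ε y -> le q p -> le q s -> exists r z' s', le r q /\ op z' s' ε x /\ le r s' /\ X r z' z).
(** Forced equality as a greatest fixed point, witnessed by a set of instances. Coinduction then
    gives symmetry and transitivity without a recursion over pairs of names. *)
Definition FEq (p x y : N) := exists R, op p (op x y) ε R /\
  forall p x y, op p (op x y) ε R -> clause (fun p x y => op p (op x y) ε R) p x y.
Lemma D3_FEq : D3 FEq. Proof. unfold FEq, clause. def. Qed.
Hint Resolve D3_FEq : def.

Lemma clause_mono (X Y : N -> N -> N -> Prop) p x y : (forall p x y, X p x y -> Y p x y) -> clause X p x y -> clause Y p x y.
Proof.
  intros H (H0 & H1 & H2). split; [auto|]. split; intros z s q Hz Hq Hs;
  [destruct (H1 z s q Hz Hq Hs) as (r & z' & s' & K)|destruct (H2 z s q Hz Hq Hs) as (r & z' & s' & K)];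
  exists r, z', s'; intuition.
Qed.

(** A definable invariant becomes a set when restricted to [T], a closure of the two names that
    contains all names reached from them by the clause. *)
Lemma FEq_coind (C : N -> N -> N -> Prop) : D3 C -> (forall p x y, C p x y -> clause C p x y) ->
  forall p x y, C p x y -> FEq p x y.
Proof.
  intros DC H p x y Hp. set (f := fun z : N => uni (uni z)).
  assert (Hf : F1 f) by (unfold f; def).
  destruct (clos_spec (upair x y) f Hf) as (T1 & T2 & _). set (T := clos (upair x y) f) in *.
  assert (T3 : forall x z s, x ε T -> op z s ε x -> z ε T).
  { intros x' z s Hx Hz. apply (T2 x' Hx). unfold f. apply in_uni. exists (upair z s). rewrite in_upair, in_uni.
    split; auto. exists (op z s). split; auto. apply in_upair; auto. }
  exists (sep (prod Pset (prod T T)) (fun t => exists p x y, t = op p (op x y) /\ C p x y)).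
  assert (E : forall p x y, op p (op x y) ε sep (prod Pset (prod T T)) (fun t => exists p x y, t = op p (op x y) /\ C p x y)
     <-> p ε Pset /\ x ε T /\ y ε T /\ C p x y).
  { intros p' x' y'. rewrite in_sep, !op_prod by def. split.
    - intros ((K1 & K2 & K3) & p2 & x2 & y2 & E & K). apply op_inj in E as [-> E]. apply op_inj in E as [-> ->]. auto.
    - intros (K1 & K2 & K3 & K4). split; eauto. }
  split.
  - apply E. pose proof (H p x y Hp) as (L & _). apply le_in in L. repeat split; auto; [tauto| |]; apply T1, in_upair; auto.
  - intros p' x' y' K. apply E in K as (K1 & K2 & K3 & K4). destruct (H _ _ _ K4) as (L & L1 & L2).
    split; [auto|]. split; intros z s q Hz Hq Hs.
    + destruct (L1 z s q Hz Hq Hs) as (r & z' & s' & R1 & R2 & R3 & R4). exists r, z', s'. repeat split; auto.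
      apply E. apply le_in in R1. repeat split; eauto; tauto.
    + destruct (L2 z s q Hz Hq Hs) as (r & z' & s' & R1 & R2 & R3 & R4). exists r, z', s'. repeat split; auto.
      apply E. apply le_in in R1. repeat split; eauto; tauto.
Qed.
Lemma FEq_out p x y : FEq p x y -> clause FEq p x y.
Proof.
  intros (R & H1 & H2). apply (clause_mono (fun p x y => op p (op x y) ε R)); [|auto].
  intros p' x' y' K. exists R. auto.
Qed.
Lemma FEq_in p x y : clause FEq p x y -> FEq p x y.
Proof.
  intros H. apply (FEq_coind (fun p x y => clause FEq p x y)); auto; [unfold clause; def|].
  intros p' x' y' K. apply (clause_mono FEq); auto. apply FEq_out.
Qed.
Lemma FEq_P p x y : FEq p x y -> le p p. Proof. intros H. apply FEq_out in H. apply H. Qed.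
Lemma FEq_mono p q x y : FEq p x y -> le q p -> FEq q x y.
Proof.
  intros H Hq. apply FEq_out in H as (H0 & H1 & H2). apply FEq_in. split; [eapply le_l; eauto|].
  split; intros z s r Hz Hr Hs; [apply (H1 z s)|apply (H2 z s)]; auto; eauto 4 using le_trans.
Qed.
Lemma FEq_refl p x : p ε Pset -> FEq p x x.
Proof.
  intros Hp. apply (FEq_coind (fun p x y => le p p /\ x = y)); [def| |split; auto; apply le_refl; auto].
  intros p' x' y' [H <-]. split; [auto|]. split; intros z s q Hz Hq Hs; exists q, z, s;
  (assert (le q q) by (eapply le_l; eauto)); repeat split; auto.
Qed.
Lemma FEq_sym p x y : FEq p x y -> FEq p y x.
Proof.
  apply (FEq_coind (fun p x y => FEq p y x)); [def|]. intros p' x' y' H. apply FEq_out in H as (H0 & H1 & H2).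
  split; [auto|]. split; auto.
Qed.
Lemma FEq_trans p x y z : FEq p x y -> FEq p y z -> FEq p x z.
Proof.
  intros H1 H2. apply (FEq_coind (fun p x z => exists y, FEq p x y /\ FEq p y z)); [def| |eauto].
  clear H1 H2 p x y z. intros p x z (y & H1 & H2). apply FEq_out in H1 as (H0 & H1 & H1'), H2 as (_ & H2 & H2').
  split; [auto|]. split.
  - intros u s q Hu Hq Hs. destruct (H1 u s q Hu Hq Hs) as (r & u' & s' & R1 & R2 & R3 & R4).
    destruct (H2 u' s' r R2 (le_trans _ _ _ R1 Hq) R3) as (r' & u2 & s2 & Q1 & Q2 & Q3 & Q4).
    exists r', u2, s2. repeat split; auto; [eauto 4 using le_trans|]. exists u'. split; auto. eauto 4 using FEq_mono, le_trans.
  - intros u s q Hu Hq Hs. destruct (H2' u s q Hu Hq Hs) as (r & u' & s' & R1 & R2 & R3 & R4).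
    destruct (H1' u' s' r R2 (le_trans _ _ _ R1 Hq) R3) as (r' & u2 & s2 & Q1 & Q2 & Q3 & Q4).
    exists r', u2, s2. repeat split; auto; [eauto 4 using le_trans|]. exists u'. split; auto. eauto 4 using FEq_mono, le_trans.
Qed.
Lemma FEq_reg p x y : le p p -> (forall q, le q p -> exists r, le r q /\ FEq r x y) -> FEq p x y.
Proof.
  intros Hp H. apply FEq_in. split; [auto|].
  split; intros z s q Hz Hq Hs; destruct (H q Hq) as (r & Hr & Er); apply FEq_out in Er as (_ & E1 & E2).
  - destruct (E1 z s r Hz (le_l _ _ Hr) (le_trans _ _ _ Hr Hs)) as (r' & z' & s' & R1 & R2 & R3 & R4).
    exists r', z', s'. repeat split; auto. eauto 4 using le_trans.
  - destruct (E2 z s r Hz (le_l _ _ Hr) (le_trans _ _ _ Hr Hs)) as (r' & z' & s' & R1 & R2 & R3 & R4).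
    exists r', z', s'. repeat split; auto. eauto 4 using le_trans.
Qed.

Definition FMem (p x y : N) := le p p /\ forall q, le q p ->
  exists r z s, le r q /\ op z s ε y /\ le r s /\ FEq r x z.
Lemma D3_FMem : D3 FMem. Proof. unfold FMem. def. Qed.
Hint Resolve D3_FMem : def.

(** Implication and quantifier need no density condition: it is part of the atomic clauses and is
    inherited, as [Frc_reg] shows. *)
Fixpoint Frc (p : N) (e : nat -> N) (A : pform N) : Prop :=
  match A with
  | pMem s t => FMem p (tval e s) (tval e t)
  | pEq s t => FEq p (tval e s) (tval e t)
  | pPrd _ => False
  | pBot => False
  | pImp A B => forall q, le q p -> Frc q e A -> Frc q e B
  | pAll A => forall x, Frc p (x .: e) A
  end.

Lemma DefP_Frc A : DefP (fun e => Frc (e 0) (fun i => e (S i)) A).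
Proof.
  assert (T : forall t : tm N, DefT (fun e : nat -> N => tval (fun i => e (S i)) t)) by (intros [i|x]; simpl; def).
  induction A; simpl.
  - apply (DefP_app3 FMem); auto; def.
  - apply (DefP_app3 FEq); auto; def.
  - def.
  - def.
  - apply (DefP_all (fun e q => le q (e 0) -> Frc q (fun i => e (S i)) A1 -> Frc q (fun i => e (S i)) A2)).
    apply DefP_imp; [def|]. apply DefP_imp.
    + exact (DefP_ren _ (fun i => match i with 0 => 0 | S k => S (S k) end) IHA1).
    + exact (DefP_ren _ (fun i => match i with 0 => 0 | S k => S (S k) end) IHA2).
  - apply (DefP_all (fun e x => Frc (e 0) (x .: (fun i => e (S i))) A)).
    apply (DefP_ren _ (fun i => match i with 0 => 1 | 1 => 0 | S (S k) => S (S k) end)) in IHA.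
    apply (DefP_iff _ _) with (2 := IHA). intros e.
    match goal with |- Frc ?c ?a _ <-> Frc ?c ?b _ => replace b with a; [tauto|] end.
    extensionality i. destruct i; reflexivity.
Qed.
Lemma Frc_mono A : forall p q e, Frc p e A -> le q p -> Frc q e A.
Proof.
  induction A; simpl; intros p q e H Hq; eauto.
  - destruct H as [H0 H]. split; [eapply le_l; eauto|]. intros r Hr. apply H. eauto 4 using le_trans.
  - eauto 4 using FEq_mono, le_trans.
  - intros r Hr. apply H. eauto 4 using le_trans.
Qed.
Lemma Frc_reg A : forall p e, le p p -> (forall q, le q p -> exists r, le r q /\ Frc r e A) -> Frc p e A.
Proof.
  induction A; simpl; intros p e Hp H.
  - split; auto. intros q Hq. destruct (H q Hq) as (r & Hr & H0 & K).
    destruct (K r H0) as (r' & z & u & R1 & R2). exists r', z, u. split; auto. eauto 4 using le_trans.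
  - apply FEq_reg; auto.
  - destruct (H p Hp) as (r & _ & []).
  - destruct (H p Hp) as (r & _ & []).
  - intros q Hq HA. apply IHA2; [eapply le_l; eauto|]. intros q' Hq'.
    destruct (H q' (le_trans _ _ _ Hq' Hq)) as (r & Hr & K). exists r. split; auto.
    apply K; [eapply le_l; eauto|]. eauto 4 using Frc_mono, le_trans.
  - intros x. apply IHA; auto. intros q Hq. destruct (H q Hq) as (r & Hr & K). eauto.
Qed.

(** * The generic extension and the truth lemma *)

Section Generic.
Context {G : N -> Prop} {GG : generic G}.

(** Adding the conditions incompatible with [p0] makes the class dense everywhere, and separation
    makes it a set of [N]. *)
Lemma G_meetP (X : N -> Prop) : D1 X -> forall p0, G p0 ->
  (forall q, le q p0 -> exists r, le r q /\ X r) -> exists r, G r /\ le r p0 /\ X r.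
Proof.
  intros DX p0 G0 H.
  set (Y := fun r => (le r p0 /\ X r) \/ ~ exists t, le t r /\ le t p0).
  assert (DY : D1 Y) by (unfold Y; def).
  destruct (G_meet (sep Pset Y)) as (p & Gp & Hp).
  - intros p Hp. destruct (classic (exists t, le t p /\ le t p0)) as [(t & T1 & T2)|Nt].
    + destruct (H t T2) as (r & R1 & R2). exists r. split; [eauto 4 using le_trans|]. apply in_sep; auto.
      split; [eapply le_lP; eauto|]. left. split; auto. eauto 4 using le_trans.
    + exists p. split; auto. apply in_sep; auto. split; [eapply le_lP; eauto|]. right. auto.
  - apply in_sep in Hp as [_ [[K1 K2]|K]]; auto.
    + eauto.
    + exfalso. destruct (G_dir p p0 Gp G0) as (r & Gr & R1 & R2). eauto.
Qed.

Definition Qg x y := exists p, G p /\ FEq p x y.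
Definition Eg x y := exists p, G p /\ FMem p x y.
Definition W : str := qstr N Eg Qg.
Definition cl (x : N) : W := cls N Qg x.

Lemma Qg_refl x : Qg x x.
Proof. destruct G_ne as [p Hp]. exists p. split; auto. apply FEq_refl. eapply le_lP, G_P; eauto. Qed.
Lemma Qg_sym x y : Qg x y -> Qg y x.
Proof. intros (p & Hp & H). exists p. split; auto. apply FEq_sym; auto. Qed.
Lemma Qg_trans x y z : Qg x y -> Qg y z -> Qg x z.
Proof.
  intros (p & Hp & H1) (q & Hq & H2). destruct (G_dir p q Hp Hq) as (r & Gr & R1 & R2). exists r. split; auto.
  apply (FEq_trans r x y z); eauto 4 using FEq_mono, le_trans.
Qed.
Lemma Eg_iff x y : Eg x y <-> exists z s, op z s ε y /\ G s /\ Qg x z.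
Proof.
  split.
  - intros (p & Gp & H0 & H).
    destruct (G_meetP (fun r => exists z s, op z s ε y /\ le r s /\ FEq r x z)) with (p0 := p) as (r & Gr & _ & z & s & R1 & R2 & R3);
      [def|auto| |].
    + intros q Hq. destruct (H q Hq) as (r & z & s & K). exists r. split; [apply K|]. exists z, s. tauto.
    + exists z, s. split; auto. split; [eapply G_up; eauto|]. exists r. auto.
  - intros (z & s & H1 & H2 & p & Gp & H3). destruct (G_dir p s Gp H2) as (r & Gr & R1 & R2). exists r. split; auto.
    split; [apply G_P; auto|]. intros q Hq. exists q, z, s. split; [eapply le_l; eauto|]. split; auto.
    split; [eauto 4 using le_trans|]. apply (FEq_mono p); auto. eauto 4 using le_trans.
Qed.
Lemma Eg_cong x y x' y' : Qg x x' -> Qg y y' -> Eg x y -> Eg x' y'.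
Proof.
  intros Hx (p & Gp & Hy) H. apply Eg_iff in H as (z & s & H1 & H2 & H3). apply FEq_out in Hy as (_ & H4 & _).
  destruct (G_dir p s Gp H2) as (r & Gr & R1 & R2).
  destruct (G_meetP (fun r => exists z' s', op z' s' ε y' /\ le r s' /\ FEq r z z')) with (p0 := r) as (t & Gt & _ & z' & s' & T1 & T2 & T3);
    [def|auto| |].
  - intros q Hq. destruct (H4 z s q H1 (le_trans _ _ _ Hq R1) (le_trans _ _ _ Hq R2)) as (u & z' & s' & K1 & K2 & K3 & K4).
    exists u. split; eauto.
  - apply Eg_iff. exists z', s'. split; auto. split; [eapply G_up; eauto|].
    apply (Qg_trans _ x); [apply Qg_sym; auto|]. apply (Qg_trans _ z); auto. exists t. auto.
Qed.

Lemma cl_eq x y : cl x = cl y <-> Qg x y.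
Proof. apply cls_eq; [apply Qg_refl|apply Qg_sym|apply Qg_trans]. Qed.
Lemma cl_surj (w : W) : exists x, w = cl x.
Proof. apply cls_surj. Qed.
Lemma cl_mem x y : cl x ε cl y <-> Eg x y.
Proof. apply cls_mem; [apply Qg_refl|apply Qg_sym|apply Qg_trans|apply Eg_cong]. Qed.
Lemma in_cl w y : w ε cl y <-> exists z s, op z s ε y /\ G s /\ w = cl z.
Proof.
  destruct (cl_surj w) as [x ->]. rewrite cl_mem, Eg_iff. setoid_rewrite cl_eq. tauto.
Qed.

Definition tmap {A B : Type} (f : A -> B) (t : tm A) : tm B := match t with V i => V i | K x => K (f x) end.
Fixpoint pmap {A B : Type} (f : A -> B) (F : pform A) : pform B :=
  match F with
  | pMem s t => pMem (tmap f s) (tmap f t)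
  | pEq s t => pEq (tmap f s) (tmap f t)
  | pPrd s => pPrd (tmap f s)
  | pBot => pBot
  | pImp F H => pImp (pmap f F) (pmap f H)
  | pAll F => pAll (pmap f F)
  end.
Lemma pmap_surj (F : pform W) : exists A, F = pmap cl A.
Proof.
  assert (T : forall t : tm W, exists t', t = tmap cl t').
  { intros [i|x]; [exists (V i)|destruct (cl_surj x) as [y ->]; exists (K y)]; auto. }
  induction F.
  - destruct (T s) as [s' ->], (T t) as [t' ->]. exists (pMem s' t'). auto.
  - destruct (T s) as [s' ->], (T t) as [t' ->]. exists (pEq s' t'). auto.
  - destruct (T s) as [s' ->]. exists (pPrd s'). auto.
  - exists pBot. auto.
  - destruct IHF1 as [A ->], IHF2 as [B ->]. exists (pImp A B). auto.
  - destruct IHF as [A ->]. exists (pAll A). auto.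
Qed.

(** In the cases of implication and quantifier, the conditions that force the formula or settle a
    counterexample to it are dense. *)
Lemma truth A : forall e, @psat W (fun i => cl (e i)) (pmap cl A) <-> exists p, G p /\ Frc p e A.
Proof.
  assert (T : forall e t, tval (fun i => cl (e i)) (tmap cl t) = cl (tval e t)) by (intros e [i|x]; reflexivity).
  induction A; intros e; simpl; rewrite ?T.
  - apply cl_mem.
  - apply cl_eq.
  - split; [tauto|intros (p & _ & [])].
  - split; [tauto|intros (p & _ & [])].
  - rewrite IHA1, IHA2. split.
    + intros H. destruct G_ne as [p0 G0].
      destruct (G_meetP (fun r => (forall q, le q r -> Frc q e A1 -> Frc q e A2) \/ (Frc r e A1 /\ ~ exists q, le q r /\ Frc q e A2)))
        with (p0 := p0) as (r & Gr & _ & [K|[K1 K2]]); auto.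
      * assert (D1' : DefP (fun f => Frc (f 0) e A1))
          by exact (DefP_subst _ (fun i => match i with 0 => V 0 | S k => K (e k) end) (DefP_Frc A1)).
        assert (D2' : DefP (fun f => Frc (f 0) e A2))
          by exact (DefP_subst _ (fun i => match i with 0 => V 0 | S k => K (e k) end) (DefP_Frc A2)).
        def.
      * intros q Hq. destruct (classic (exists r, le r q /\ (Frc r e A1 /\ ~ exists q, le q r /\ Frc q e A2)))
          as [(r & Hr & K)|Nq]; [eauto|].
        exists q. split; [eapply le_l; eauto|]. left. intros r Hr H1. apply Frc_reg; [eapply le_l; eauto|].
        intros t Ht. apply NNPP. intros Nt. apply Nq. exists t. split; [eauto 4 using le_trans|].
        split; [eauto 4 using Frc_mono, le_trans|]. exact Nt.
      * eauto.
      * exfalso. destruct H as (p & Gp & Hp); [eauto|]. destruct (G_dir p r Gp Gr) as (t & Gt & T1 & T2).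
        apply K2. exists t. split; auto. eauto 4 using Frc_mono, le_trans.
    + intros (p & Gp & Hp) (q & Gq & Hq). destruct (G_dir p q Gp Gq) as (r & Gr & R1 & R2). exists r. split; auto.
      apply Hp; auto. eauto 4 using Frc_mono, le_trans.
  - split.
    + intros H. destruct G_ne as [p0 G0].
      destruct (G_meetP (fun r => (forall x, Frc r (x .: e) A) \/ exists x, ~ exists q, le q r /\ Frc q (x .: e) A))
        with (p0 := p0) as (r & Gr & _ & [K|[x K]]); auto.
      * assert (D1' : DefP (fun f => Frc (f 1) (f 0 .: e) A)).
        { pose proof (DefP_subst _ (fun i => match i with 0 => V 1 | 1 => V 0 | S (S k) => K (e k) end) (DefP_Frc A)) as D.
          apply (DefP_iff _ _) with (2 := D). intros f. simpl.
          match goal with |- Frc ?c ?a _ <-> Frc ?c ?b _ => replace b with a; [tauto|] end.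
          extensionality i. destruct i; reflexivity. }
        assert (D2' : DefP (fun f => Frc (f 0) (f 1 .: e) A))
          by exact (DefP_ren _ (fun i => match i with 0 => 1 | _ => 0 end) D1').
        def.
      * intros q Hq. destruct (classic (forall x, Frc q (x .: e) A)) as [K|K].
        -- exists q. split; auto. eapply le_l; eauto.
        -- apply not_all_ex_not in K as [x K].
           assert (K' : ~ forall t, le t q -> exists r, le r t /\ Frc r (x .: e) A).
           { intros K'. apply K, Frc_reg; auto. eapply le_l; eauto. }
           apply not_all_ex_not in K' as [t K']. apply imply_to_and in K' as [Ht K']. eauto.
      * eauto.
      * exfalso. specialize (H (cl x)). rewrite <- (scons_comp cl), IHA in H. destruct H as (p & Gp & Hp).
        destruct (G_dir p r Gp Gr) as (t & Gt & T1 & T2). apply K. exists t. split; auto. eauto 4 using Frc_mono, le_trans.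
    + intros (p & Gp & Hp) w. destruct (cl_surj w) as [x ->]. rewrite <- (scons_comp cl), IHA. eauto.
Qed.

Lemma W_def (P : (nat -> W) -> Prop) : DefP P ->
  exists A, forall e, P (fun i => cl (e i)) <-> exists p, G p /\ Frc p e A.
Proof. intros [F HF]. destruct (pmap_surj F) as [A ->]. exists A. intros e. rewrite HF. apply truth. Qed.
End Generic.
End Forcing.
Arguments W {N Z Po} G. Arguments cl {N Z Po} G.
#[export] Hint Resolve D3_FEq D3_FMem : def.

(** Rasiowa-Sikorski: the enumeration of [N] lists all its dense sets, and the filter is generated
    by a descending sequence that enters each of them when possible. *)
Lemma generic_exists {N : str} {Po : poset N} {PP : posetP N} (en : nat -> N) (Hen : forall x, exists n, en n = x) :
  exists G, generic G.
Proof.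
  destruct Pne as [p0 H0].
  set (nx := fun (n : nat) p => epsilon (inhabits p0) (fun q => le q p /\ ((exists q, le q p /\ q ε en n) -> q ε en n))).
  assert (Hnx : forall n p, le p p -> le (nx n p) p /\ ((exists q, le q p /\ q ε en n) -> nx n p ε en n)).
  { intros n p Hp. apply (epsilon_spec (inhabits p0) (fun q => le q p /\ ((exists q, le q p /\ q ε en n) -> q ε en n))).
    destruct (classic (exists q, le q p /\ q ε en n)) as [(q & H1 & H2)|H]; [exists q; auto|exists p; split; auto; tauto]. }
  set (sq := fix sq n := match n with 0 => p0 | S n => nx n (sq n) end).
  assert (Hsq : forall n, le (sq n) (sq n)).
  { induction n; simpl; [apply le_refl; auto|]. eapply le_l, Hnx; auto. }
  assert (Hmono : forall n m, n <= m -> le (sq m) (sq n)).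
  { induction 1; auto. eapply le_trans; [|exact IHle]. apply Hnx; auto. }
  exists (fun p => exists n, le (sq n) p). split.
  - intros p [n H]. apply le_refl, (le_in _ _ H).
  - intros p q [n H] Hq. exists n. eapply le_trans; eauto.
  - intros p q [n Hn] [m Hm]. exists (sq (n + m)). split; [exists (n + m); auto|].
    split; (eapply le_trans; [apply Hmono|eassumption]); lia.
  - exists p0, 0. simpl. apply le_refl; auto.
  - intros D HD. destruct (Hen D) as [n Hn]. exists (sq (S n)). split; [exists (S n); auto|].
    rewrite <- Hn. apply Hnx; auto. rewrite Hn. auto.
Qed.

(** * The generic extension satisfies ZFC *)

Section WModel.
Context {N : str} {Z : ZFm N} {VL : VLm N} {Po : poset N} {PP : posetP N} {G : N -> Prop} {GG : generic G}.
Notation W := (W G).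
Notation cl := (cl G).

(** A set containing all names that occur in [x], since a component of a pair lies in the union of
    that pair. *)
Definition nm (x : N) := uni (uni x).
Lemma F1_nm : F1 nm. Proof. unfold nm. def. Qed.
Hint Resolve F1_nm : def.
Lemma in_nm z s x : op z s ε x -> z ε nm x.
Proof.
  intros H. apply in_uni. exists (upair z s). rewrite in_upair, in_uni. split; auto.
  exists (op z s). split; auto. apply in_upair; auto.
Qed.
Lemma G_in p : G p -> p ε Pset. Proof. intros H. eapply le_lP, G_P; eauto. Qed.
Lemma in_clP w a : w ε cl (prod a Pset) <-> exists z, z ε a /\ w = cl z.
Proof.
  rewrite in_cl. split.
  - intros (z & s & H1 & H2 & ->). apply op_prod in H1 as [H1 _]. eauto.
  - intros (z & Hz & ->). destruct G_ne as [p Hp]. exists z, p. rewrite op_prod. auto using G_in.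
Qed.

(** The conditions are dense that force the names equal, or that put a member into one name which no
    stronger condition forces into the other. *)
Lemma W_ext (x y : W) : (forall z, z ε x <-> z ε y) -> x = y.
Proof.
  destruct (cl_surj x) as [a ->], (cl_surj y) as [b ->]. intros H. destruct G_ne as [p0 G0].
  set (B := fun (x y p : N) => exists z s, op z s ε x /\ le p s /\ forall q, le q p -> ~ FMem q z y).
  assert (DB : D3 B) by (unfold B; def).
  destruct (G_meetP (fun p => FEq p a b \/ B a b p \/ B b a p)) with (p0 := p0) as (r & Gr & _ & K); [def|auto| |].
  - intros p Hp. assert (Lp : le p p) by (eapply le_l; eauto).
    destruct (classic (FEq p a b)) as [E|E]; [exists p; auto|].
    apply NNPP. intros Nr. apply E, FEq_in. split; [auto|].
    split; intros z s q Hz Hq Hs; apply NNPP; intros Nq; apply Nr; exists q; (split; [auto|]); right;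
      [left|right]; exists z, s; (split; [auto|]); (split; [auto|]); intros t Ht [Lt M]; apply Nq;
      destruct (M t Lt) as (r & z' & s' & R1 & R2 & R3 & R4); exists r, z', s';
      repeat split; eauto 4 using le_trans, FEq_sym.
  - assert (Q : forall x y, (forall z, z ε cl x <-> z ε cl y) -> B x y r -> False).
    { intros x y E (z & s & H1 & H2 & H3). assert (M : cl z ε cl y).
      { apply E, in_cl. exists z, s. split; auto. split; auto. eapply G_up; eauto. }
      apply cl_mem in M as (p & Gp & M). destruct (G_dir p r Gp Gr) as (t & Gt & T1 & T2).
      apply (H3 t T2). destruct M as [M0 M]. split; [eapply le_l; eauto|]. eauto 4 using le_trans. }
    destruct K as [K|[K|K]]; [apply cl_eq; exists r; auto|exfalso; eapply Q; eauto|exfalso; eapply (Q b a); eauto].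
    intros z. symmetry. auto.
Qed.

Lemma W_sep (P : W -> Prop) : D1 P -> forall a : W, exists b : W, forall z, z ε b <-> z ε a /\ P z.
Proof.
  intros DP a. destruct (cl_surj a) as [x ->]. destruct (W_def _ DP) as [A HA].
  set (F p z := Frc p (z .: (fun _ => x)) A).
  assert (DF : D2 F).
  { pose proof (DefP_subst _ (fun i => match i with 0 => V 0 | 1 => V 1 | _ => K x end) (DefP_Frc A)) as D.
    apply (DefP_iff _ _) with (2 := D). intros e. unfold F. simpl.
    match goal with |- Frc ?c ?a _ <-> Frc ?c ?b _ => replace b with a; [tauto|] end.
    extensionality i. destruct i; reflexivity. }
  assert (HF : forall z, P (cl z) <-> exists p, G p /\ F p z).
  { intros z. apply (HA (z .: (fun _ => x))). }
  exists (cl (sep (prod (nm x) Pset) (fun c => exists z p, c = op z p /\ FMem p z x /\ F p z))).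
  intros w. rewrite in_cl. split.
  - intros (z & s & H1 & H2 & ->). apply in_sep in H1 as [_ (z' & p & E & K1 & K2)]; [|def].
    apply op_inj in E as [<- <-]. split; [apply cl_mem; exists s; auto|]. apply HF. eauto.
  - intros [H1 H2]. apply in_cl in H1 as (z & s & H1 & H3 & ->). apply HF in H2 as (p & Gp & Hp).
    destruct (G_dir p s Gp H3) as (r & Gr & R1 & R2). exists z, r. split; auto.
    apply in_sep; [def|]. rewrite op_prod. split; [split; [eapply in_nm; eauto|apply G_in; auto]|].
    exists z, r. split; auto. split; [|eapply Frc_mono; eauto]. split; [apply G_P; auto|].
    intros q Hq. exists q, z, s. split; [eapply le_l; eauto|]. split; auto. split; [eapply le_trans; eauto|].
    apply FEq_refl. eapply le_lP; eauto.
Qed.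
Lemma W_sub (P : W -> Prop) : D1 P -> (exists b : W, forall z, P z -> z ε b) -> exists b : W, forall z, z ε b <-> P z.
Proof.
  intros DP [b Hb]. destruct (W_sep P DP b) as [c Hc]. exists c. intros z. rewrite Hc. intuition.
Qed.

Lemma W_pair (x y : W) : exists p, forall z, z ε p <-> z = x \/ z = y.
Proof.
  destruct (cl_surj x) as [a ->], (cl_surj y) as [b ->]. exists (cl (prod (upair a b) Pset)). intros z.
  rewrite in_clP. setoid_rewrite in_upair. split.
  - intros (w & [-> | ->] & ->); auto.
  - intros [-> | ->]; eauto.
Qed.
Lemma W_uni (a : W) : exists u, forall z, z ε u <-> exists x, x ε a /\ z ε x.
Proof.
  apply W_sub; [def|]. destruct (cl_surj a) as [x ->]. exists (cl (prod (nm (uni (nm x))) Pset)).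
  intros z (y & H1 & H2). apply in_cl in H1 as (y' & s & H1 & _ & ->), H2 as (z' & s' & H2 & _ & ->).
  apply in_clP. exists z'. split; auto. eapply in_nm. apply in_uni. exists y'. split; [eapply in_nm; eauto|eauto].
Qed.
(** Each subset has a name built from names occurring in [x] and conditions, and such names form a
    power set in [N]. *)
Lemma W_pow (a : W) : exists p, forall z, z ε p <-> subs z a.
Proof.
  apply W_sub; [def|]. destruct (cl_surj a) as [x ->]. exists (cl (prod (pow (prod (nm x) Pset)) Pset)).
  intros z Hz. destruct (cl_surj z) as [t ->].
  set (t' := sep (prod (nm x) Pset) (fun c => exists z p, c = op z p /\ FMem p z t)).
  apply in_clP. exists t'. split.
  - apply in_pow. intros c Hc. apply in_sep in Hc; [tauto|def].
  - apply W_ext. intros w. rewrite (in_cl w t'). split.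
    + intros Hw. pose proof (Hz w Hw) as Hw'. apply in_cl in Hw' as (z & s & H1 & H2 & ->).
      apply cl_mem in Hw as (p & Gp & Hp). exists z, p. split; auto. apply in_sep; [def|]. rewrite op_prod.
      split; [split; [eapply in_nm; eauto|apply G_in; auto]|]. eauto.
    + intros (z & s & H1 & H2 & ->). apply in_sep in H1 as [_ (z' & p & E & K)]; [|def].
      apply op_inj in E as [<- <-]. apply cl_mem. exists s. auto.
Qed.
(** Names of values are represented by their [od], an ordinal, so [collect] bounds them for all
    argument names and conditions together. *)
Lemma W_rep (R : W -> W -> Prop) : D2 R -> (forall x y y', R x y -> R x y' -> y = y') ->
  forall a, exists b, forall y, y ε b <-> exists x, x ε a /\ R x y.
Proof.
  intros DR FR a. apply W_sub; [def|]. destruct (cl_surj a) as [x ->]. destruct (W_def _ DR) as [A HA].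
  set (Q := fun e : nat -> N => Frc (e 2) (e 1 .: (FL (e 0) .: (fun _ => x))) A).
  assert (DQ : DefP Q).
  { apply (DefP_sub (fun e y => Frc (e 2) (e 1 .: (y .: (fun _ => x))) A) (fun e => FL (e 0))); [|def].
    pose proof (DefP_subst _ (fun i => match i with 0 => V 3 | 1 => V 2 | 2 => V 0 | _ => K x end) (DefP_Frc A)) as D.
    apply (DefP_iff _ _) with (2 := D). intros e. simpl.
    match goal with |- Frc ?c ?a _ <-> Frc ?c ?b _ => replace b with a; [tauto|] end.
    extensionality i. destruct i as [|[|i]]; reflexivity. }
  destruct (collect (bun (nm x) Pset) Q DQ 2 (fun _ => x)) as (b & Ob & Hb).
  exists (cl (prod (img b FL) Pset)). intros y (w & H1 & H2). apply in_cl in H1 as (z & s & H1 & H3 & ->).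
  destruct (cl_surj y) as [y' ->].
  apply (HA (z .: (y' .: (fun _ => x)))) in H2 as (p & Gp & Hp).
  destruct (Hb p) with (x := z) as (c & Hc & Kc).
  - apply in_bun. right. apply G_in; auto.
  - apply in_bun. left. eapply in_nm; eauto.
  - exists (od y'). split; [apply od_spec|]. unfold Q. simpl. rewrite <- (proj2 (od_spec y')). exact Hp.
  - apply in_clP. exists (FL c). split; [apply in_img; [def|eauto]|]. apply (FR (cl z)).
    + apply (HA (z .: (y' .: (fun _ => x)))). eauto.
    + apply (HA (z .: (FL c .: (fun _ => x)))). exists p. auto.
Qed.
(** Densely many conditions force a name into [a] whose [od] cannot be lowered by strengthening the
    condition; names of its members would have smaller [od]. *)
Lemma W_fnd (a : W) : (exists x, x ε a) -> exists x, x ε a /\ ~ exists z, z ε x /\ z ε a.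
Proof.
  destruct (cl_surj a) as [x ->]. intros [w Hw]. destruct (cl_surj w) as [y ->]. apply cl_mem in Hw as (p & Gp & Hp).
  assert (FM : forall p q z, FMem p z x -> le q p -> FMem q z x).
  { intros p' q' z [H0 H] Hq. split; [eapply le_l; eauto|]. eauto 4 using le_trans. }
  destruct (G_meetP (fun q => exists n, FMem q n x /\ forall r n', le r q -> od n' ε od n -> ~ FMem r n' x))
    with (p0 := p) as (q & Gq & _ & n & Hn & L); [def|auto| |].
  - intros q Hq.
    destruct (Ord_least (fun o => exists r n, le r q /\ od n = o /\ FMem r n x)) with (a := od y)
      as (o & Oo & (r & n & Hr & <- & Hn) & _ & L); [def|apply od_spec| |].
    + exists q, y. split; [eapply le_l; eauto|]. eauto.
    + exists r. split; auto. exists n. split; auto. intros r' n' Hr' Ho Hn'. apply (L _ Ho).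
      exists r', n'. eauto 4 using le_trans.
  - exists (cl n). split; [apply cl_mem; exists q; auto|]. intros (z & H1 & H2).
    apply in_cl in H1 as (z' & s & H1 & H3 & ->). apply cl_mem in H2 as (r & Gr & Hr).
    destruct (G_dir r q Gr Gq) as (t & Gt & T1 & T2). apply (L t z' T2); eauto. apply (od_lt_pair z' s n H1).
Qed.

(** Check names by recursion on [od]. The domain of [h] is [od x], so [FL] of the domain is [x], and
    the test selects its members. They are paired with all conditions because the poset has no
    distinguished greatest element. *)
Definition chkO := rec (fun h => prod (img (sep h (fun t => FL (pi1 t) ε FL (img h pi1))) pi2) Pset).
Lemma F1_chkG : F1 (fun h : N => prod (img (sep h (fun t => FL (pi1 t) ε FL (img h pi1))) pi2) Pset).
Proof. def. Qed.
Lemma F1_chkO : F1 chkO. Proof. apply F1_rec, F1_chkG. Qed.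
Hint Resolve F1_chkO : def.
Definition chk x := chkO (od x).
Lemma F1_chk : F1 chk. Proof. unfold chk. def. Qed.
Hint Resolve F1_chk : def.
Lemma in_chk x z s : op z s ε chk x <-> s ε Pset /\ exists y, y ε x /\ z = chk y.
Proof.
  unfold chk at 1, chkO. destruct (od_spec x) as [Ox Ex]. rewrite (rec_eq _ F1_chkG) by auto. fold chkO.
  replace (img (lam (od x) chkO) pi1) with (od x).
  2: { apply zext. intros d. rewrite in_img by def. split.
    - intros Hd. exists (op d (chkO d)). rewrite pi1_op. split; auto. apply op_lam; [def|auto].
    - intros (p & Hp & ->). apply in_lam in Hp as (y & Hy & ->); [|def]. rewrite pi1_op. auto. }
  rewrite <- Ex, op_prod, in_img by def. split.
  - intros [(t & Ht & ->) H2]. split; auto. apply in_sep in Ht as [H3 H4]; [|def].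
    apply in_lam in H3 as (d & Hd & ->); [|def]. rewrite pi1_op in H4. exists (FL d). split; auto.
    rewrite pi2_op. unfold chk. rewrite od_FL; auto. eapply mem_Ord; eauto.
  - intros (H1 & y & H2 & ->). split; auto. exists (op (od y) (chkO (od y))). rewrite pi2_op. split; auto.
    apply in_sep; [def|]. rewrite pi1_op, <- (proj2 (od_spec y)). split; auto. apply op_lam; [def|].
    split; auto. apply od_lt; auto.
Qed.
Definition jW (x : N) : W := cl (chk x).
Lemma in_jW w x : w ε jW x <-> exists y, y ε x /\ w = jW y.
Proof.
  unfold jW. rewrite (in_cl w (chk x)). split.
  - intros (z & s & H1 & H2 & ->). apply in_chk in H1 as (_ & y & Hy & ->). eauto.
  - intros (y & Hy & ->). destruct G_ne as [p Hp]. exists (chk y), p. split; auto.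
    apply in_chk. split; eauto using G_in.
Qed.
#[local] Opaque chk.
Lemma FEq_chk x : forall y p, FEq p (chk x) (chk y) -> x = y.
Proof.
  revert x. apply (od_ind (fun x => forall y p, FEq p (chk x) (chk y) -> x = y)); [def|].
  intros x IH y p H. apply FEq_out in H as (Lp & H1 & H2). pose proof (le_lP _ _ Lp) as Pp.
  apply zext. intros z. split; intros Hz.
  - destruct (H1 (chk z) p p) as (r & z' & s' & R1 & R2 & R3 & R4); auto; [apply in_chk; eauto|].
    apply in_chk in R2 as (_ & y' & Hy' & ->). apply IH in R4 as ->; auto. apply od_lt; auto.
  - destruct (H2 (chk z) p p) as (r & z' & s' & R1 & R2 & R3 & R4); auto; [apply in_chk; eauto|].
    apply in_chk in R2 as (_ & x' & Hx' & ->). apply IH in R4 as <-; auto. apply od_lt; auto.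
Qed.
#[export] Instance jW_temb : temb jW.
Proof.
  assert (I : forall x y, jW x = jW y -> x = y).
  { intros x y H. destruct (proj1 (cl_eq (chk x) (chk y)) H) as (p & _ & K). apply (FEq_chk x y p K). }
  split; auto.
  - intros x y. rewrite in_jW. split; [intros (z & Hz & E); apply I in E as ->; auto|eauto].
  - intros x y H. apply in_jW in H as (z & _ & ->). eauto.
Qed.
#[local] Opaque jW.
Lemma W_inf : exists w : W, (exists o, o ε w /\ forall z, ~ z ε o) /\
  forall x, x ε w -> exists s, s ε w /\ forall z, z ε s <-> z ε x \/ z = x.
Proof.
  exists (jW om). split.
  - exists (jW emp). split; [apply in_jW; eauto using om_0|]. intros z Hz. apply in_jW in Hz as (y & Hy & _).
    eapply in_emp; eauto.
  - intros x Hx. apply in_jW in Hx as (n & Hn & ->). exists (jW (suc n)). split; [apply in_jW; eauto using om_S|].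
    intros z. rewrite !in_jW. setoid_rewrite in_suc. split.
    + intros (y & [Hy| ->] & ->); eauto.
    + intros [(y & Hy & ->)| ->]; eauto.
Qed.
#[export] Instance W_ZFm : ZFm W.
Proof.
  split.
  - apply W_ext.
  - apply W_fnd.
  - apply W_pair.
  - apply W_uni.
  - apply W_pow.
  - apply W_inf.
  - apply W_sep.
  - apply W_rep.
Qed.

Lemma cl_upair x y : cl (prod (upair x y) Pset) = upair (cl x) (cl y).
Proof.
  apply W_ext. intros w. rewrite in_clP, in_upair. setoid_rewrite in_upair. split.
  - intros (z & [-> | ->] & ->); auto.
  - intros [-> | ->]; eauto.
Qed.
Definition opn (x y : N) := prod (upair (prod (upair x x) Pset) (prod (upair x y) Pset)) Pset.
Lemma cl_op x y : cl (opn x y) = op (cl x) (cl y).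
Proof. unfold opn, op, sg. rewrite !cl_upair. reflexivity. Qed.
Lemma F2_opn : F2 opn. Proof. unfold opn. def. Qed.
Hint Resolve F2_opn : def.

(** Members of [a] are found from their names, and the places of the names in the well-order of [N]
    are ordinals of [W]. *)
Lemma W_enum (a : W) : exists E : W, (forall x, x ε a -> exists o, Ord o /\ op o x ε E) /\
  forall o x x', op o x ε E -> op o x' ε E -> x = x'.
Proof.
  destruct (cl_surj a) as [x ->].
  exists (cl (prod (img (nm x) (fun z => opn (chk (od z)) z)) Pset)). split.
  - intros w Hw. apply in_cl in Hw as (z & s & H1 & H2 & ->). exists (jW (od z)). split.
    + apply (a_Ord jW), od_spec.
    + apply in_clP. exists (opn (chk (od z)) z). rewrite cl_op. split; auto. apply in_img; [def|].
      exists z. split; auto. eapply in_nm; eauto.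
  - intros o w w' H1 H2. apply in_clP in H1 as (t & H1 & E1), H2 as (t' & H2 & E2).
    apply in_img in H1 as (z & _ & ->); [|def]. apply in_img in H2 as (z' & _ & ->); [|def].
    rewrite cl_op in *. apply op_inj in E1 as [-> ->], E2 as [E ->].
    assert (E' : jW (od z) = jW (od z')) by exact E. apply t_inj, od_inj in E'. rewrite E'. auto.
Qed.
Lemma W_choice (a : W) : (forall x, x ε a -> exists z, z ε x) ->
  (forall x y, x ε a -> y ε a -> (exists z, z ε x /\ z ε y) -> x = y) ->
  exists c, forall x, x ε a -> exists z, (z ε x /\ z ε c) /\ forall y, y ε x /\ y ε c -> y = z.
Proof.
  intros H1 H2. destruct (W_enum (uni a)) as (E & HE & FE).
  set (P := fun z => exists x, x ε a /\ z ε x /\ exists o, op o z ε E /\ Ord o /\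
     forall o' z', o' ε o -> z' ε x -> ~ op o' z' ε E).
  assert (DP : D1 P) by (unfold P; def).
  exists (sep (uni a) P). intros x Hx. destruct (H1 x Hx) as [z Hz].
  assert (U : forall z, z ε x -> z ε uni a) by (intros; apply in_uni; eauto).
  destruct (HE z (U z Hz)) as (o & Oo & Ho).
  destruct (Ord_least (fun o => exists z, z ε x /\ op o z ε E)) with (a := o) as (o1 & O1 & (z1 & Hz1 & K1) & _ & L);
    [def|auto|eauto|].
  exists z1. split.
  - split; auto. apply in_sep; auto. split; auto. exists x. split; auto. split; auto. exists o1. split; [auto|]. split; [auto|].
    intros o' z' Ho' Hz' K. apply (L o' Ho'). eauto.
  - intros y [Hy Ky]. apply in_sep in Ky as [_ (x' & Hx' & Hyx & o2 & K2 & O2 & L2)]; auto.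
    assert (x = x') as <- by (apply H2; eauto).
    destruct (Ord_tri o1 o2) as [Q|[<-|Q]]; auto.
    + exfalso. apply (L2 o1 z1); auto.
    + eapply FE; eauto.
    + exfalso. apply (L o2 Q). eauto.
Qed.
End WModel.
#[export] Hint Resolve F1_nm F1_chk F2_opn : def.
#[global] Opaque chk jW cl.

(** * Small sets *)

Section Small.
Context {N : str} {Z : ZFm N} {VL : VLm N}.

(* The element of [P] of least index: a definable choice function. *)
Definition chs (P : N -> Prop) : N := the (fun x => P x /\ forall y, P y -> od x ε od y \/ x = y).
Lemma chs_ok P : D1 P -> (exists x, P x) -> P (chs P).
Proof.
  intros DP [x Hx].
  destruct (Ord_least (fun o => exists x, P x /\ od x = o)) with (a := od x) as (o & Oo & (y & Hy & <-) & _ & L);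
    [def|apply od_spec|eauto|].
  assert (Q : forall z, P z -> od y ε od z \/ y = z).
  { intros z Hz. destruct (Ord_tri (od y) (od z) (proj1 (od_spec y)) (proj1 (od_spec z))) as [K|[K|K]];
      [left; auto|right; apply od_inj; auto|].
    exfalso. apply (L _ K). eauto. }
  apply (the_ok (fun x => P x /\ forall y, P y -> od x ε od y \/ x = y)); [eauto|].
  intros u v [H1 H2] [H3 H4]. destruct (H2 v H3) as [A|]; auto. destruct (H4 u H1) as [B|]; auto.
  exfalso. eapply mem_asym; eauto.
Qed.
Lemma DefT_chs (P : (nat -> N) -> N -> Prop) : DefP (fun e => P (fun i => e (S i)) (e 0)) -> DefT (fun e => chs (P e)).
Proof.
  intros H. unfold chs. apply DefT_the.
  assert (H2 : DefP (fun e : nat -> N => P (fun i => e (S (S i))) (e 0)))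
      by exact (DefP_ren _ (fun i => match i with 0 => 0 | S k => S (S k) end) H).
  def.
Qed.
End Small.
Ltac defhook ::=
  lazymatch goal with
  | |- DefT (fun e => the (@?P e)) => apply (DefT_the P)
  | |- DefT (fun e => chs (@?P e)) => apply (DefT_chs P)
  | |- DefT (fun e => sep (@?a e) (@?P e)) => apply (DefT_sep a P)
  | |- DefT (fun e => img (@?a e) (@?P e)) => apply (DefT_img a P)
  | |- DefT (fun e => lam (@?a e) (@?P e)) => apply (DefT_lam a P)
  | |- DefP (fun e => exists k, k < ?n /\ @?P k e) => apply (DefP_fin _ n (fun k e => P k e)); intro
  | |- DefP (fun e => forall k, k < ?n -> @?P k e) => apply (DefP_finall _ n (fun k e => P k e)); intro
  | |- _ => defhook2
  end.

Section Small2.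
Context {N : str} {Z : ZFm N} {VL : VLm N}.

Definition seqs (A : N) : N := sep (pow (prod om A)) (fun f => Fn f om).
Lemma F1_seqs : F1 seqs. Proof. unfold seqs. def. Qed.
Hint Resolve F1_seqs : def.
Lemma seqs_lam A f : F1 f -> (forall n, n ε om -> f n ε A) -> lam om f ε seqs A.
Proof.
  intros Hf H. apply in_sep; [def|]. split; [|apply Fn_lam; auto]. apply in_pow. intros p Hp.
  apply in_lam in Hp as (n & Hn & ->); auto. apply op_prod; auto.
Qed.
Lemma seqs_app A f n : f ε seqs A -> n ε om -> app f n ε A.
Proof.
  intros Hf Hn. apply in_sep in Hf as [H1 H2]; [|def]. apply in_pow in H1.
  pose proof (H1 _ (Fn_app f om n H2 Hn)) as K. apply op_prod in K. tauto.
Qed.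
Lemma uni_suc n : Ord n -> uni (suc n) = n.
Proof.
  intros On. apply zext. intros z. rewrite in_uni. setoid_rewrite in_suc. split.
  - intros (x & [Hx| ->] & Hz); auto. eapply Ord_trans; eauto.
  - intros Hz. exists n. auto.
Qed.
Definition tl (f : N) : N := lam om (fun n => app f (suc n)).
Lemma F1_tl : F1 tl. Proof. unfold tl. def. Qed.
Hint Resolve F1_tl : def.
Lemma seqs_cons A a f : a ε A -> f ε seqs A -> exists g, g ε seqs A /\ app g emp = a /\ tl g = f.
Proof.
  intros Ha Hf. set (F n := the (fun y => (n = emp /\ y = a) \/ (n <> emp /\ y = app f (uni n)))).
  assert (DF : F1 F) by (unfold F; def).
  assert (F0 : F emp = a) by (apply the_eq; [auto|intros y [[_ ->]|[K _]]; [auto|congruence]]).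
  assert (FS : forall n, n ε om -> F (suc n) = app f n).
  { intros n Hn. assert (Nn : suc n <> emp) by (intros E; apply (in_emp n); rewrite <- E; apply in_suc; auto).
    apply the_eq; [right; rewrite uni_suc by (apply om_Ord; auto); auto|]. intros y [[K _]|[_ ->]]; [congruence|].
    rewrite uni_suc by (apply om_Ord; auto). auto. }
  exists (lam om F). split; [|split].
  - apply seqs_lam; auto. intros n Hn. destruct (om_cases n Hn) as [->|(m & Hm & ->)]; [rewrite F0; auto|].
    rewrite FS by auto. apply (seqs_app A); auto.
  - rewrite app_lam by (auto using om_0). auto.
  - unfold tl. assert (Ff : Fn f om) by (apply in_sep in Hf; [tauto|def]).
    apply (Fn_ext _ _ om); [apply Fn_lam; def|auto|]. intros n Hn. rewrite app_lam by (auto; def).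
    rewrite app_lam by (auto using om_S). auto.
Qed.

(** Smallness means being covered by an image of A^ω. Sequences rather than elements of [A] are used
    because an element can be put in front of a sequence, which gives closure under [A]-indexed
    unions. *)
Definition sm (A X : N) := exists g, forall x, x ε X -> exists b, b ε seqs A /\ x = app g b.
Lemma D2_sm : D2 sm. Proof. unfold sm. def. Qed.
Hint Resolve D2_sm : def.
Lemma sm_sub A X Y : subs X Y -> sm A Y -> sm A X.
Proof. intros H [g K]. exists g. auto. Qed.
(** The first entry of a sequence names a piece, the rest names an element of that piece. *)
Lemma sm_union A X (R : N -> N -> Prop) : D2 R -> (forall x, x ε X -> exists a, a ε A /\ R a x) ->
  (forall a, a ε A -> sm A (sep X (fun x => R a x))) -> sm A X.
Proof.
  intros DR H1 H2.
  set (gg a := chs (fun g => forall x, x ε sep X (fun x => R a x) -> exists b, b ε seqs A /\ x = app g b)).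
  assert (Dg : F1 gg) by (unfold gg; def).
  assert (Hg : forall a, a ε A -> forall x, x ε X -> R a x -> exists b, b ε seqs A /\ x = app (gg a) b).
  { intros a Ha x Hx Rx. apply (chs_ok (fun g => forall x, x ε sep X (fun x => R a x) -> exists b, b ε seqs A /\ x = app g b)).
    - def.
    - apply H2; auto.
    - apply in_sep; [def|auto]. }
  exists (lam (seqs A) (fun b => app (gg (app b emp)) (tl b))). intros x Hx. destruct (H1 x Hx) as (a & Ha & Rx).
  destruct (Hg a Ha x Hx Rx) as (b & Hb & ->). destruct (seqs_cons A a b Ha Hb) as (c & Hc & E1 & E2).
  exists c. split; auto. rewrite app_lam by (auto; def). rewrite E1, E2. auto.
Qed.
Lemma sm_one A x : (exists a, a ε A) -> sm A (sg x).
Proof.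
  intros [a Ha]. exists (lam (seqs A) (fun _ => x)). intros y Hy. apply in_sg in Hy as ->.
  exists (lam om (fun _ => a)). assert (K : lam om (fun _ => a) ε seqs A) by (apply seqs_lam; auto; def).
  split; auto. rewrite app_lam by (auto; def). auto.
Qed.
Lemma pigeon A X (R : N -> N -> Prop) : D2 R -> ~ sm A X -> (forall x, x ε X -> exists a, a ε A /\ R a x) ->
  exists a, a ε A /\ ~ sm A (sep X (fun x => R a x)).
Proof.
  intros DR NX H. apply NNPP. intros K. apply NX, (sm_union A X R); auto. intros a Ha. apply NNPP. eauto.
Qed.

(** Hartogs' argument: covering an ordinal by sequences induces a relation on sequences from which
    the ordinal can be read off. If all ordinals were small, replacement would collect them into a
    set. *)
Lemma sm_hart A : exists a, Ord a /\ ~ sm A a.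
Proof.
  set (B := seqs A). apply NNPP. intros NE.
  set (T := fun r a => exists g, Ord a /\ (forall x, x ε a -> exists b, b ε B /\ x = app g b) /\
     forall b b', op b b' ε r <-> b ε B /\ b' ε B /\ app g b ε a /\ app g b' ε a /\ subs (app g b) (app g b')).
  assert (DT : D2 T) by (unfold T; def).
  destruct (zrep T DT) with (a := pow (prod B B)) as [s Hs].
  - assert (Q : forall r a a' g g', Ord a -> Ord a' ->
      (forall x, x ε a -> exists b, b ε B /\ x = app g b) -> (forall x, x ε a' -> exists b, b ε B /\ x = app g' b) ->
      (forall b b', op b b' ε r <-> b ε B /\ b' ε B /\ app g b ε a /\ app g b' ε a /\ subs (app g b) (app g b')) ->
      (forall b b', op b b' ε r <-> b ε B /\ b' ε B /\ app g' b ε a' /\ app g' b' ε a' /\ subs (app g' b) (app g' b')) ->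
      subs a a').
    { intros r a a' g g' Oa Oa' S S' H H'.
      assert (DD : forall b, b ε B -> (app g b ε a <-> app g' b ε a')).
      { intros b Hb. assert (E1 : op b b ε r <-> app g b ε a) by (rewrite H; unfold subs; tauto).
        assert (E2 : op b b ε r <-> app g' b ε a') by (rewrite H'; unfold subs; tauto). tauto. }
      assert (SS : forall b b', b ε B -> b' ε B -> app g b ε a -> app g b' ε a -> (app g b ε app g b' <-> app g' b ε app g' b')).
      { intros b b' Hb Hb' K K'.
        assert (O1 : Ord (app g b)) by (eapply mem_Ord; eauto). assert (O2 : Ord (app g b')) by (eapply mem_Ord; eauto).
        assert (L : app g' b ε a') by (apply DD; auto). assert (L' : app g' b' ε a') by (apply DD; auto).
        assert (O3 : Ord (app g' b)) by (eapply mem_Ord; eauto). assert (O4 : Ord (app g' b')) by (eapply mem_Ord; eauto).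
        assert (E : subs (app g b') (app g b) <-> subs (app g' b') (app g' b)).
        { specialize (H b' b). specialize (H' b' b). intuition. }
        assert (X : forall u v : N, Ord u -> Ord v -> (u ε v <-> ~ subs v u)).
        { intros u v Ou Ov. split; [intros Hu Hv; apply (mem_irr u); auto|]. intros Hn.
          destruct (Ord_tri u v Ou Ov) as [Q|[Q|Q]]; [auto| |]; exfalso; apply Hn; intros z Hz.
          - congruence.
          - apply (Ord_trans u v); auto. }
        rewrite !X by auto. tauto. }
      (* Both maps induce the same order on sequences and are onto ordinals, so they agree, by
         induction on the value. *)
      assert (Id : forall x, Ord x -> x ε a -> forall b, b ε B -> app g b = x -> app g' b = x).
      { apply (Ord_ind (fun x => x ε a -> forall b, b ε B -> app g b = x -> app g' b = x)); [def|].
        intros x Ox IH Hx b Hb E. assert (L : app g' b ε a') by (apply DD; auto; congruence).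
        apply zext. intros z. split; intros Hz.
        - destruct (S' z) as (c & Hc & ->); [eapply Ord_trans; eauto|].
          assert (Kc : app g c ε a) by (apply DD; auto; eapply Ord_trans; eauto).
          apply SS in Hz; auto; [|congruence]. rewrite E in Hz. rewrite (IH _ Hz Kc c Hc eq_refl). auto.
        - destruct (S z) as (c & Hc & ->); [eapply Ord_trans; eauto|].
          assert (Kc : app g c ε a) by (eapply Ord_trans; eauto).
          rewrite <- (IH _ Hz Kc c Hc eq_refl). apply SS; auto; congruence. }
      intros x Hx. destruct (S x Hx) as (b & Hb & ->). rewrite <- (Id (app g b)) with (b := b); auto;
        [apply DD; auto|eapply mem_Ord; eauto]. }
    intros r a a' (g & Oa & S & H) (g' & Oa' & S' & H'). apply zext. intros z. split; eapply Q; eauto.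
  - apply (no_Ord_set s). intros a Oa. apply Hs. destruct (classic (sm A a)) as [[g Hg]|K]; [|exfalso; eauto].
    set (r := sep (prod B B) (fun p => exists b b', p = op b b' /\ app g b ε a /\ app g b' ε a /\ subs (app g b) (app g b'))).
    assert (Hr : forall b b', op b b' ε r <-> b ε B /\ b' ε B /\ app g b ε a /\ app g b' ε a /\ subs (app g b) (app g b')).
    { intros b b'. unfold r. rewrite in_sep, op_prod by def. split.
      - intros [H (c & c' & E & K)]. apply op_inj in E as [<- <-]. tauto.
      - intros (H1 & H2 & K). split; eauto 6. }
    exists r. split; [apply in_pow; intros p Hp; apply in_sep in Hp; [tauto|def]|]. exists g. auto.
Qed.

(** In usual terms, the cardinal successor of the size of A^ω. *)
Definition KK (A : N) : N := the (fun k => Ord k /\ ~ sm A k /\ forall a, a ε k -> sm A a).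
Lemma F1_KK : F1 KK. Proof. unfold KK. def. Qed.
Lemma KK_spec A : Ord (KK A) /\ ~ sm A (KK A) /\ forall a, a ε KK A -> sm A a.
Proof.
  apply (the_ok (fun k => Ord k /\ ~ sm A k /\ forall a, a ε k -> sm A a)).
  - destruct (sm_hart A) as (a & Oa & Na).
    destruct (Ord_least (fun a => ~ sm A a)) with (a := a) as (k & Ok & Nk & _ & L); auto; [def|].
    exists k. split; auto. split; auto. intros b Hb. apply NNPP. auto.
  - intros x y (O1 & N1 & L1) (O2 & N2 & L2). destruct (Ord_tri x y) as [K|[K|K]]; auto; exfalso; auto.
Qed.
(** A union of [A]-many small ordinals is again a small ordinal, so it stays below [KK A]. *)
Lemma KK_reg A f : F1 f -> subs om A -> (forall a, a ε A -> f a ε KK A) -> exists b, b ε KK A /\ forall a, a ε A -> subs (f a) b.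
Proof.
  intros Hf HA H. destruct (KK_spec A) as (OK & NK & LK). set (X := uni (img A f)).
  assert (OX : Ord X). { apply Ord_uni. intros y Hy. apply in_img in Hy as (a & Ha & ->); auto. eapply mem_Ord; eauto. }
  assert (SX : sm A X).
  { apply (sm_union A X (fun a x => x ε f a)); [def| |].
    - intros x Hx. apply in_uni in Hx as (y & Hy & Hx). apply in_img in Hy as (a & Ha & ->); eauto.
    - intros a Ha. apply (sm_sub A _ (f a)); [intros z Hz; apply in_sep in Hz; [tauto|def]|]. auto. }
  exists X. split.
  - destruct (Ord_sub X (KK A)) as [K|K]; auto; [|congruence].
    intros x Hx. apply in_uni in Hx as (y & Hy & Hx). apply in_img in Hy as (a & Ha & ->); auto. eapply Ord_trans; eauto.
  - intros a Ha x Hx. apply in_uni. exists (f a). split; auto. apply in_img; eauto.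
Qed.
Lemma KK_lim A a : subs om A -> a ε KK A -> suc a ε KK A.
Proof.
  intros HA Ha. destruct (KK_spec A) as (OK & NK & LK). assert (Oa : Ord a) by (eapply mem_Ord; eauto).
  destruct (Ord_tri (suc a) (KK A) (Ord_suc a Oa) OK) as [K|[K|K]]; [auto| |]; exfalso.
  - apply NK. rewrite <- K. apply (sm_union A _ (fun i x => (i = emp /\ x ε a) \/ (i = suc emp /\ x = a))); [def| |].
    + intros x Hx. apply in_suc in Hx as [Hx| ->]; [exists emp|exists (suc emp)]; split; auto; apply HA; auto using om_0, om_S.
    + intros i Hi. destruct (classic (i = emp)) as [->|Ni].
      * apply (sm_sub A _ a); auto. intros z Hz. apply in_sep in Hz as [_ [[_ Hz]|[E _]]]; [auto| |def].
        exfalso. assert (Q : (emp : N) ε suc emp) by (apply in_suc; auto). rewrite <- E in Q. eapply in_emp; eauto.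
      * apply (sm_sub A _ (sg a)); [|apply sm_one; eauto]. intros z Hz. apply in_sg.
        apply in_sep in Hz as [_ [[E _]|[_ Hz]]]; [congruence|auto|def].
  - apply in_suc in K as [K|K]; [eapply mem_asym; eauto|]. rewrite K in Ha. eapply mem_irr; eauto.
Qed.
Lemma KK_ne A : subs om A -> emp ε KK A.
Proof.
  intros HA. destruct (KK_spec A) as (OK & NK & _). destruct (Ord_tri emp (KK A) Ord_emp OK) as [K|[K|K]]; [auto| |].
  - exfalso. apply NK. exists emp. rewrite <- K. intros x Hx. exfalso. eapply in_emp; eauto.
  - exfalso. eapply in_emp; eauto.
Qed.
Lemma not_sm_two A X x : (exists a, a ε A) -> ~ sm A X -> exists y, y ε X /\ y <> x.
Proof.
  intros HA NX. apply NNPP. intros K. apply NX, (sm_sub A _ (sg x)); [|apply sm_one; auto].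
  intros y Hy. apply in_sg, NNPP. eauto.
Qed.
End Small2.
#[export] Hint Resolve F1_seqs D2_sm F1_KK : def.

(** * Trees and finite assignments *)

Section Trees.
Context {N : str} {Z : ZFm N} {VL : VLm N}.

(** A binary sequence is coded by its length and the set of positions that carry a one; [ex] is the
    initial segment relation. *)
Definition Tr (k : N) := sep (prod k (pow k)) (fun s => subs (pi2 s) (pi1 s)).
Definition ex (s t : N) := subs (pi1 s) (pi1 t) /\ forall z, z ε pi1 s -> (z ε pi2 s <-> z ε pi2 t).
Definition cmp (s t : N) := ex s t \/ ex t s.
Lemma F1_Tr : F1 Tr. Proof. unfold Tr. def. Qed.
Lemma D2_ex : D2 ex. Proof. unfold ex. def. Qed.
Hint Resolve F1_Tr D2_ex : def.
Lemma D2_cmp : D2 cmp. Proof. unfold cmp. def. Qed.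
Hint Resolve D2_cmp : def.

Lemma in_Tr k s : Ord k -> (s ε Tr k <-> exists a x, a ε k /\ subs x a /\ s = op a x).
Proof.
  intros Ok. unfold Tr. rewrite in_sep by def. split.
  - intros [H1 H2]. apply in_prod in H1 as (a & x & Ha & _ & ->). rewrite pi1_op, pi2_op in H2. eauto.
  - intros (a & x & Ha & Hx & ->). rewrite pi1_op, pi2_op, op_prod, in_pow. split; auto. split; auto.
    intros z Hz. apply (Ord_trans k a); auto.
Qed.
Lemma ex_refl s : ex s s. Proof. split; [intros z; auto|tauto]. Qed.
Lemma ex_trans s t u : ex s t -> ex t u -> ex s u.
Proof.
  intros [H1 H2] [H3 H4]. split; [intros z Hz; auto|]. intros z Hz. rewrite H2, H4 by auto. tauto.
Qed.
Lemma ex_antisym k s t : Ord k -> s ε Tr k -> t ε Tr k -> ex s t -> ex t s -> s = t.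
Proof.
  intros Ok Hs Ht [H1 H2] [H3 H4]. apply in_Tr in Hs as (a & x & Ha & Hx & ->); auto.
  apply in_Tr in Ht as (b & y & Hb & Hy & ->); auto. rewrite !pi1_op, !pi2_op in *.
  assert (a = b) as <- by (apply zext; intros z; split; auto).
  f_equal. apply zext. intros z. split; intros Hz.
  - apply H2; auto.
  - apply H2; auto.
Qed.
Lemma ex_cmp k s t u : Ord k -> s ε Tr k -> t ε Tr k -> ex s u -> ex t u -> cmp s t.
Proof.
  intros Ok Hs Ht [H1 H2] [H3 H4]. apply in_Tr in Hs as (a & x & Ha & Hx & ->); auto.
  apply in_Tr in Ht as (b & y & Hb & Hy & ->); auto. unfold cmp, ex. rewrite !pi1_op, !pi2_op in *.
  assert (Oa : Ord a) by (eapply mem_Ord; eauto). assert (Ob : Ord b) by (eapply mem_Ord; eauto).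
  assert (Q : subs a b \/ subs b a).
  { destruct (Ord_tri a b Oa Ob) as [K|[->|K]]; [left|left|right]; intros z Hz; auto; eapply Ord_trans; eauto. }
  destruct Q as [Q|Q]; [left|right]; (split; [auto|]); intros z Hz.
  - rewrite (H2 z Hz), (H4 z (Q z Hz)). tauto.
  - rewrite (H4 z Hz), (H2 z (Q z Hz)). tauto.
Qed.
Lemma cmp_down k s t u : Ord k -> s ε Tr k -> t ε Tr k -> ex s t -> cmp u t -> u ε Tr k -> cmp u s.
Proof.
  intros Ok Hs Ht H [K|K] Hu; [eapply ex_cmp; eauto|]. right. eapply ex_trans; eauto.
Qed.
Lemma cmp_bit s t z : cmp s t -> z ε pi1 s -> z ε pi1 t -> (z ε pi2 s <-> z ε pi2 t).
Proof. intros [[_ H]|[_ H]] H1 H2; [|symmetry]; auto. Qed.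

(** The union of a chain is an upper bound; it is a node only because [b] keeps its length below
    [k]. *)
Lemma sup_Tr k S b : Ord k -> (forall s, s ε S -> s ε Tr k) -> (forall s t, s ε S -> t ε S -> cmp s t) ->
  b ε k -> (forall s, s ε S -> subs (pi1 s) b) ->
  op (uni (img S pi1)) (uni (img S pi2)) ε Tr k /\ forall s, s ε S -> ex s (op (uni (img S pi1)) (uni (img S pi2))).
Proof.
  intros Ok HS HC Hb HB.
  assert (I1 : forall z, z ε uni (img S pi1) <-> exists s, s ε S /\ z ε pi1 s).
  { intros z. rewrite in_uni. split.
    - intros (y & Hy & Hz). apply in_img in Hy as (s & Hs & ->); [eauto|def].
    - intros (s & Hs & Hz). exists (pi1 s). split; auto. apply in_img; [def|eauto]. }
  assert (I2 : forall z, z ε uni (img S pi2) <-> exists s, s ε S /\ z ε pi2 s).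
  { intros z. rewrite in_uni. split.
    - intros (y & Hy & Hz). apply in_img in Hy as (s & Hs & ->); [eauto|def].
    - intros (s & Hs & Hz). exists (pi2 s). split; auto. apply in_img; [def|eauto]. }
  assert (SP : forall s, s ε S -> Ord (pi1 s) /\ subs (pi2 s) (pi1 s)).
  { intros s Hs. apply HS, in_Tr in Hs as (a & x & Ha & Hx & ->); auto. rewrite pi1_op, pi2_op. split; auto. eapply mem_Ord; eauto. }
  split.
  - apply in_Tr; auto. exists (uni (img S pi1)), (uni (img S pi2)). split; [|split; auto].
    + assert (OU : Ord (uni (img S pi1))).
      { apply Ord_uni. intros a Ha. apply in_img in Ha as (s & Hs & ->); [apply SP; auto|def]. }
      assert (Ob : Ord b) by (eapply mem_Ord; eauto).
      destruct (Ord_sub _ b OU Ob) as [->|K]; auto; [|eapply Ord_trans; eauto].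
      intros z Hz. apply I1 in Hz as (s & Hs & Hz). eapply HB; eauto.
    + intros z Hz. apply I2 in Hz as (s & Hs & Hz). apply I1. exists s. split; auto. apply SP; auto.
  - intros s Hs. unfold ex. rewrite pi1_op, pi2_op. split; [intros z Hz; apply I1; eauto|].
    intros z Hz. rewrite I2. split; [eauto|]. intros (t & Ht & K).
    apply (cmp_bit s t z); auto. apply SP; auto.
Qed.

(* [s] lengthened with zeros, up to and including a position [a], where the bit [b] is put. *)
Lemma ext_bit k s a (b : Prop) : Ord k -> (forall x, x ε k -> suc x ε k) -> s ε Tr k -> a ε k -> ~ a ε pi1 s ->
  exists t, t ε Tr k /\ ex s t /\ a ε pi1 t /\ (a ε pi2 t <-> b).
Proof.
  intros Ok Lk Hs Ha Na. assert (Hs' := Hs). apply in_Tr in Hs as (c & x & Hc & Hx & ->); auto. rewrite !pi1_op in *.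
  assert (Oa : Ord a) by (eapply mem_Ord; eauto). assert (Oc : Ord c) by (eapply mem_Ord; eauto).
  assert (Sc : subs c (suc a)).
  { intros z Hz. apply in_suc. destruct (Ord_tri c a Oc Oa) as [K|[->|K]]; [left; eapply Ord_trans; eauto|auto|contradiction]. }
  set (y := sep (suc a) (fun z => z ε x \/ (z = a /\ b))).
  assert (Iy : forall z, z ε y <-> z ε suc a /\ (z ε x \/ (z = a /\ b))) by (intros z; unfold y; rewrite in_sep by def; tauto).
  exists (op (suc a) y). unfold ex. rewrite !pi1_op, !pi2_op. split; [|split; [split|split]].
  - apply in_Tr; auto. exists (suc a), y. split; auto. split; auto. intros z Hz. apply Iy in Hz. tauto.
  - auto.
  - intros z Hz. rewrite Iy. split; [auto|]. intros [_ [K|[-> _]]]; [auto|contradiction].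
  - apply in_suc; auto.
  - rewrite Iy, in_suc. assert (~ a ε x) by auto. tauto.
Qed.
End Trees.
#[export] Hint Resolve F1_Tr D2_ex D2_cmp : def.

(** * Literals, finite assignments and their chain condition *)

Section Base.
Context {N : str} {Z : ZFm N} {VL : VLm N}.

(** Chosen for [preserve]: [mu] is not small with respect to ω, and [la] is not small with respect
    to ω ∪ μ. *)
Definition mu : N := KK om.
Definition la : N := KK (bun om mu).
Definition b1 : N := sg emp.
Definition two : N := upair emp b1.
(** [c] is a pair of some ξ < λ and a natural number, [b] the truth value. The leading [emp]
    separates literals from tree nodes [op i s], whose first component is a nonempty index. *)
Definition lit (c b : N) := op emp (op c b).
Definition LitS : N := img (prod (prod la om) two) (fun p => op emp p).
Definition flip (b : N) := sep b1 (fun _ => b = emp).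
Definition lneg (l : N) := lit (pi1 (pi2 l)) (flip (pi2 (pi2 l))).
Lemma F2_lit : F2 lit. Proof. unfold lit. def. Qed.
Lemma F1_flip : F1 flip. Proof. unfold flip. def. Qed.
Hint Resolve F2_lit F1_flip : def.
Lemma F1_lneg : F1 lneg. Proof. unfold lneg. def. Qed.
Hint Resolve F1_lneg : def.
Lemma flip0 : flip emp = b1.
Proof. apply zext. intros z. unfold flip. rewrite in_sep by def. tauto. Qed.
Lemma b1_ne : b1 <> emp.
Proof. intros H. apply (in_emp emp). rewrite <- H at 2. apply in_sg; auto. Qed.
Lemma flip1 : flip b1 = emp.
Proof.
  apply zext. intros z. unfold flip. rewrite in_sep by def. split; [intros [_ K]; exfalso; apply b1_ne; auto|].
  intros K. exfalso. eapply in_emp; eauto.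
Qed.
Lemma lneg_lit c b : lneg (lit c b) = lit c (flip b).
Proof. unfold lneg, lit. rewrite !pi2_op, !pi1_op. auto. Qed.
Lemma lit_inj c b c' b' : lit c b = lit c' b' -> c = c' /\ b = b'.
Proof. unfold lit. intros H. apply op_inj in H as [_ H]. apply op_inj in H. auto. Qed.
Lemma in_LitS l : l ε LitS <-> exists x n b, x ε la /\ n ε om /\ b ε two /\ l = lit (op x n) b.
Proof.
  unfold LitS. rewrite in_img by def. split.
  - intros (p & Hp & ->). apply in_prod in Hp as (c & b & Hc & Hb & ->). apply in_prod in Hc as (x & n & Hx & Hn & ->).
    exists x, n, b. auto.
  - intros (x & n & b & Hx & Hn & Hb & ->). exists (op (op x n) b). rewrite !op_prod. auto.
Qed.
Lemma in_two b : b ε two <-> b = emp \/ b = b1. Proof. apply in_upair. Qed.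
Lemma lneg_LitS l : l ε LitS -> lneg l ε LitS /\ lneg (lneg l) = l /\ lneg l <> l.
Proof.
  intros H. apply in_LitS in H as (x & n & b & Hx & Hn & Hb & ->). rewrite !lneg_lit. apply in_two in Hb as [-> | ->].
  - rewrite flip0, flip1. split; [apply in_LitS; exists x, n, b1; rewrite in_two; auto|]. split; auto.
    intros E. apply lit_inj in E as [_ E]. apply b1_ne; auto.
  - rewrite flip1, flip0. split; [apply in_LitS; exists x, n, emp; rewrite in_two; auto|]. split; auto.
    intros E. apply lit_inj in E as [_ E]. apply b1_ne; auto.
Qed.

Definition fin (b : N) := exists n e, n ε om /\ forall l, l ε b -> exists i, i ε n /\ l = app e i.
Definition cons (b : N) := forall l, l ε b -> ~ lneg l ε b.
(** Cohen's conditions for adding λ reals. *)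
Definition Base : N := sep (pow LitS) (fun b => fin b /\ cons b).
Lemma D1_fin : D1 fin. Proof. unfold fin. def. Qed.
Lemma D1_cons : D1 cons. Proof. unfold cons. def. Qed.
Hint Resolve D1_fin D1_cons : def.
Lemma in_Base b : b ε Base <-> subs b LitS /\ fin b /\ cons b.
Proof. unfold Base. rewrite in_sep, in_pow by def. tauto. Qed.
Lemma fin_add b x : fin b -> fin (bun b (sg x)).
Proof.
  intros (n & e & Hn & H).
  set (E i := the (fun y => (i = n /\ y = x) \/ (i <> n /\ y = app e i))).
  assert (DE : F1 E) by (unfold E; def). exists (suc n), (lam (suc n) E). split; [apply om_S; auto|].
  intros l Hl. apply in_bun in Hl as [Hl|Hl].
  - destruct (H l Hl) as (i & Hi & ->). exists i. split; [apply in_suc; auto|]. rewrite app_lam; [|auto|apply in_suc; auto].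
    assert (Ni : i <> n) by (intros ->; eapply mem_irr; eauto).
    symmetry. apply the_eq; [auto|]. intros y [[K _]|[_ ->]]; [contradiction|auto].
  - apply in_sg in Hl as ->. exists n. split; [apply in_suc; auto|]. rewrite app_lam; [|auto|apply in_suc; auto].
    symmetry. apply the_eq; [auto|]. intros y [[_ ->]|[K _]]; [auto|congruence].
Qed.
Lemma fin_sub b c : subs b c -> fin c -> fin b.
Proof. intros H (n & e & Hn & K). exists n, e. auto. Qed.
Lemma fin_bun b c : fin b -> fin c -> fin (bun b c).
Proof.
  intros Hb (n & e & Hn & Hc).
  assert (K : forall m, m ε om -> fin (bun b (img m (app e)))).
  { apply om_ind; [def| |].
    - apply (fin_sub _ b); auto. intros z Hz. apply in_bun in Hz as [|Hz]; auto.
      apply in_img in Hz as (i & Hi & _); [|def]. exfalso. eapply in_emp; eauto.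
    - intros m Hm IH. apply (fin_sub _ (bun (bun b (img m (app e))) (sg (app e m)))); [|apply fin_add; auto].
      intros z Hz. rewrite !in_bun, in_sg. apply in_bun in Hz as [|Hz]; auto.
      apply in_img in Hz as (i & Hi & ->); [|def]. apply in_suc in Hi as [Hi| ->]; auto.
      left. right. apply in_img; [def|eauto]. }
  apply (fin_sub _ (bun b (img n (app e)))); auto. intros z Hz. apply in_bun. apply in_bun in Hz as [|Hz]; auto.
  right. destruct (Hc z Hz) as (i & Hi & ->). apply in_img; [def|eauto].
Qed.

Lemma suc_inj (i j : N) : suc i = suc j -> i = j.
Proof.
  intros E. assert (H1 : i ε suc j) by (rewrite <- E; apply in_suc; auto).
  assert (H2 : j ε suc i) by (rewrite E; apply in_suc; auto).
  apply in_suc in H1 as [H1|H1], H2 as [H2|H2]; auto. exfalso. eapply mem_asym; eauto.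
Qed.

Section CCC.
Context (A : N) (HA : subs om A) (C : N -> N) (DC : F1 C).
(* If the remaining parts of the conditions have size [n] and all conditions contain [r], then fixing
   one condition and one of its literals whose negation occurs in "many" others reduces [n]. *)
Lemma ccc_n n : n ε om -> forall U r, ~ sm A U -> subs r LitS ->
  (forall x, x ε U -> C x ε Base /\ subs r (C x) /\ exists e, forall l, l ε C x -> l ε r \/ exists i, i ε n /\ l = app e i) ->
  exists x y, x ε U /\ y ε U /\ x <> y /\ cons (bun (C x) (C y)).
Proof.
  assert (NA : exists a, a ε A) by (exists emp; apply HA, om_0).
  revert n. apply (om_ind (fun n => forall U r, ~ sm A U -> subs r LitS ->
    (forall x, x ε U -> C x ε Base /\ subs r (C x) /\ exists e, forall l, l ε C x -> l ε r \/ exists i, i ε n /\ l = app e i) ->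
    exists x y, x ε U /\ y ε U /\ x <> y /\ cons (bun (C x) (C y)))).
  { def. }
  - intros U r NU Hr H. destruct (not_sm_two A U emp NA NU) as (x & Hx & _).
    destruct (not_sm_two A U x NA NU) as (y & Hy & Nxy). exists x, y.
    split; [auto|]. split; [auto|]. split; [auto|].
    assert (E : forall z, z ε U -> C z = r).
    { intros z Hz. destruct (H z Hz) as (_ & H1 & e & H2). apply zext. intros l. split; auto.
      intros Hl. destruct (H2 l Hl) as [K|(i & Hi & _)]; auto. exfalso. eapply in_emp; eauto. }
    destruct (H x Hx) as (H0 & _). apply in_Base in H0 as (_ & _ & H0). rewrite (E x Hx) in *. rewrite (E y Hy).
    intros l Hl Hl'. apply (H0 l); [apply in_bun in Hl|apply in_bun in Hl']; tauto.
  - intros n Hn IH U r NU Hr H. destruct (not_sm_two A U emp NA NU) as (x0 & Hx0 & _).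
    destruct (H x0 Hx0) as (B0 & R0 & _). apply in_Base in B0 as (L0 & (m & e0 & Hm & He0) & C0).
    apply NNPP. intros NG.
    (* The label [emp] stands for [x0] itself, and [suc i] for the conditions that contain the
       negation of literal number [i] of [C x0]. *)
    destruct (pigeon A U (fun k x => (k = emp /\ x = x0) \/
      exists i, k = suc i /\ x <> x0 /\ app e0 i ε C x0 /\ lneg (app e0 i) ε C x)) as (k & Hk & NK); [def|auto| |].
    { intros x Hx. destruct (classic (x = x0)) as [->|Nx]; [exists emp; split; [apply HA, om_0|auto]|].
      assert (I : exists l, l ε C x0 /\ lneg l ε C x).
      { apply NNPP. intros NI. apply NG. exists x0, x. split; [auto|]. split; [auto|]. split; [auto|]. destruct (H x Hx) as (B1 & _).
        apply in_Base in B1 as (L1 & _ & C1). intros l Hl Hl'.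
        apply in_bun in Hl, Hl'. destruct Hl as [Hl|Hl]; destruct Hl' as [Hl'|Hl'].
        - apply (C0 l); auto.
        - apply NI. eauto.
        - apply NI. exists (lneg l). split; auto. destruct (lneg_LitS l (L1 l Hl)) as (_ & -> & _). auto.
        - apply (C1 l); auto. }
      destruct I as (l & Hl & Hl'). destruct (He0 l Hl) as (i & Hi & ->).
      exists (suc i). split; [apply HA, om_S; eapply om_tr; eauto|]. right. eauto 6. }
    destruct (classic (exists i, k = suc i)) as [(i & ->)|Nk].
    2: { apply NK. apply (sm_sub A _ (sg x0)); [|apply sm_one; auto]. intros z Hz. apply in_sg.
         apply in_sep in Hz as [_ [[_ K]|(i & K & _)]]; [auto|exfalso; eauto|def]. }
    set (U' := sep U (fun x => x <> x0 /\ app e0 i ε C x0 /\ lneg (app e0 i) ε C x)).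
    assert (NU' : ~ sm A U').
    { intros K. apply NK. apply (sm_sub A _ U'); auto. intros z Hz. apply in_sep in Hz as [H1 K1]; [|def].
      apply in_sep; [def|]. split; auto. destruct K1 as [[K1 _]|(i' & K1 & K2)].
      - exfalso. apply (in_emp i). rewrite <- K1. apply in_suc; auto.
      - apply suc_inj in K1 as ->. auto. }
    assert (IU : forall x, x ε U' -> x ε U /\ x <> x0 /\ app e0 i ε C x0 /\ lneg (app e0 i) ε C x).
    { intros x Hx. apply in_sep in Hx; [auto|def]. }
    set (l0 := app e0 i) in *. set (l' := lneg l0) in *.
    destruct (not_sm_two A U' emp NA NU') as (x1 & Hx1 & _). destruct (IU x1 Hx1) as (_ & _ & Hl0 & _).
    (* [C x0] contains both [r] and [l0] and is consistent, so [l'] is outside [r]; adding it to [r]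
       lets each remaining part shrink by one. *)
    assert (Nl : ~ l' ε r) by (intros K; apply (C0 l0); auto; apply R0; auto).
    apply NG. destruct (IH U' (bun r (sg l'))) as (x & y & Hx & Hy & K); auto.
    { intros z Hz. apply in_bun in Hz as [Hz|Hz]; auto. apply in_sg in Hz as ->. apply lneg_LitS; auto. }
    2: { exists x, y. apply IU in Hx, Hy. tauto. }
    intros x Hx. destruct (IU x Hx) as (HxU & _ & _ & Hl'). destruct (H x HxU) as (BX & RX & e & He). split; auto. split.
    { intros z Hz. apply in_bun in Hz as [Hz|Hz]; auto. apply in_sg in Hz as ->. auto. }
    destruct (He l' Hl') as [K|(i1 & Hi1 & E1)]; [contradiction|].
    (* The slot [i1] that held [l'] takes over the entry of the last slot [n]. *)
    set (E j := the (fun y => (j = i1 /\ y = app e n) \/ (j <> i1 /\ y = app e j))).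
    assert (DE : F1 E) by (unfold E; def). exists (lam n E). intros l Hl. rewrite in_bun, in_sg.
    destruct (He l Hl) as [K|(j & Hj & Ej)]; auto.
    destruct (classic (j = i1)) as [->|Nj]; [left; right; congruence|].
    destruct (classic (j ε n)) as [Hjn|Njn].
    + right. exists j. split; auto. rewrite app_lam by auto. rewrite Ej. symmetry. apply the_eq; [auto|].
      intros y [[K _]|[_ ->]]; [contradiction|auto].
    + assert (j = n) as -> by (apply in_suc in Hj as [Hj|Hj]; [contradiction|auto]).
      assert (Hi2 : i1 ε n) by (apply in_suc in Hi1 as [K|K]; [auto|congruence]).
      right. exists i1. split; auto. rewrite app_lam by auto. rewrite Ej. symmetry. apply the_eq; [auto|].
      intros y [[_ ->]|[K _]]; [auto|congruence].
Qed.
Lemma ccc U : ~ sm A U -> (forall x, x ε U -> C x ε Base) ->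
  exists x y, x ε U /\ y ε U /\ x <> y /\ cons (bun (C x) (C y)).
Proof.
  intros NU H.
  destruct (pigeon A U (fun n x => n ε om /\ exists e, forall l, l ε C x -> exists i, i ε n /\ l = app e i)) as (n & Hn & NK);
    [def|auto| |].
  - intros x Hx. apply H, in_Base in Hx as (_ & (n & e & Hn & K) & _). exists n. eauto.
  - set (U' := sep U (fun x => n ε om /\ exists e, forall l, l ε C x -> exists i, i ε n /\ l = app e i)) in *.
    assert (IU : forall x, x ε U' -> x ε U /\ n ε om /\ exists e, forall l, l ε C x -> exists i, i ε n /\ l = app e i).
    { intros x Hx. apply in_sep in Hx; [auto|def]. }
    destruct (not_sm_two A U' emp) as (x0 & Hx0 & _); [exists emp; apply HA, om_0|auto|].
    destruct (ccc_n n) with (U := U') (r := emp : N) as (x & y & Hx & Hy & K); auto.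
    + apply (IU x0 Hx0).
    + intros z Hz. exfalso. eapply in_emp; eauto.
    + intros x Hx. destruct (IU x Hx) as (K1 & _ & e & K2). split; auto.
      split; [intros z Hz; exfalso; eapply in_emp; eauto|]. exists e. auto.
    + exists x, y. apply IU in Hx, Hy. tauto.
Qed.
End CCC.
End Base.
#[export] Hint Resolve F2_lit F1_flip F1_lneg D1_fin D1_cons : def.

(** * The poset *)

Section Cond.
Context {N : str} {Z : ZFm N} {VL : VLm N}.

Definition A0 : N := bun (bun la mu) two.
(** A crude bound for the parts of conditions below a stage [o], where [h] is [kap] restricted to
    [o]: literals, and assignments of nodes to sets constructed before [o]. *)
Definition LowH (h : N) := prod Base (pow (prod (img (img h pi1) FL) (prod (uni (ran h)) (pow (uni (ran h)))))).
(** The data that a tree must outnumber: an element of [A0] or a position in an earlier tree,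
    together with a part of a condition below the stage. [KK] of this set is at once too large to be
    predicted by such data and regular for families indexed by them. *)
Definition AA (h : N) := bun (bun om A0) (prod (bun A0 (uni (ran h))) (LowH h)).
Lemma F1_LowH : F1 LowH. Proof. unfold LowH. def. Qed.
Hint Resolve F1_LowH : def.
Lemma F1_AA : F1 AA. Proof. unfold AA. def. Qed.
Hint Resolve F1_AA : def.
Lemma F1_kapG : F1 (fun h => KK (AA h)). Proof. def. Qed.
Definition kap := rec (fun h => KK (AA h)).
Lemma F1_kap : F1 kap. Proof. apply F1_rec, F1_kapG. Qed.
Hint Resolve F1_kap : def.
Lemma kap_eq o : Ord o -> kap o = KK (AA (lam o kap)).
Proof. intros Oo. unfold kap at 1. rewrite (rec_eq _ F1_kapG) by auto. reflexivity. Qed.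
Lemma AA_om h : subs om (AA h). Proof. intros z Hz. apply in_bun. left. apply in_bun. auto. Qed.
Lemma kap_Ord o : Ord o -> Ord (kap o). Proof. intros. rewrite kap_eq by auto. apply KK_spec. Qed.
Lemma kap_lim o a : Ord o -> a ε kap o -> suc a ε kap o.
Proof. intros Oo. rewrite kap_eq by auto. apply KK_lim, AA_om. Qed.
Lemma kap_ne o : Ord o -> emp ε kap o.
Proof. intros Oo. rewrite kap_eq by auto. apply KK_ne, AA_om. Qed.

Definition TrI (i : N) := Tr (kap (od i)).
Definition kids (i : N) := img (TrI i) (fun s => op i s).
Lemma F1_TrI : F1 TrI. Proof. unfold TrI. def. Qed.
Hint Resolve F1_TrI : def.
Lemma F1_kids : F1 kids. Proof. unfold kids. def. Qed.
Definition Ix : N := clos LitS kids.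
Lemma Ix_lit l : l ε LitS -> l ε Ix.
Proof. apply (clos_spec LitS kids F1_kids). Qed.
Lemma Ix_kid i s : i ε Ix -> s ε TrI i -> op i s ε Ix.
Proof.
  intros Hi Hs. apply (proj1 (proj2 (clos_spec LitS kids F1_kids)) i Hi). apply in_img; [def|eauto].
Qed.
Lemma Ix_cases j : j ε Ix -> j ε LitS \/ exists i s, i ε Ix /\ s ε TrI i /\ j = op i s.
Proof.
  intros Hj. destruct (proj2 (proj2 (clos_spec LitS kids F1_kids)) j Hj) as [K|(i & Hi & K)]; auto.
  apply in_img in K as (s & Hs & ->); [eauto 6|def].
Qed.
Lemma op_ne x y : op x y <> (emp : N).
Proof. intros E. apply (in_emp (sg x)). rewrite <- E. apply in_upair; auto. Qed.
Lemma Ix_ne i : i ε Ix -> i <> emp.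
Proof.
  intros Hi. apply Ix_cases in Hi as [Hi|(i' & s & _ & _ & ->)]; [|apply op_ne].
  apply in_LitS in Hi as (x & n & b & _ & _ & _ & ->). apply op_ne.
Qed.
Lemma lit_kid l i s : l ε LitS -> i ε Ix -> l <> op i s.
Proof.
  intros Hl Hi E. apply in_LitS in Hl as (x & n & b & _ & _ & _ & ->). apply op_inj in E as [E _]. apply (Ix_ne i); auto.
Qed.
Lemma TrI_Ord i : Ord (kap (od i)). Proof. apply kap_Ord, od_spec. Qed.
Lemma od_op (i s : N) : od i ε od (op i s).
Proof. apply (Ord_trans _ (od (sg i))); [apply od_lt, in_sg; auto|apply od_lt, in_upair; auto|apply od_spec]. Qed.
Lemma Ix_ind (P : N -> Prop) : D1 P -> (forall l, l ε LitS -> P l) ->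
  (forall i s, i ε Ix -> s ε TrI i -> P i -> P (op i s)) -> forall j, j ε Ix -> P j.
Proof.
  intros DP HL HK. apply (od_ind (fun j => j ε Ix -> P j)); [def|]. intros j IH Hj.
  apply Ix_cases in Hj as [Hj|(i & s & Hi & Hs & ->)]; auto. apply HK; auto. apply IH; auto. apply od_op.
Qed.

(** Every index carries a promise; the root is the empty one. The support is unrestricted, so unions
    of long chains are possible coordinate by coordinate. *)
Definition UU : N := sep (pow (prod Ix (uni (img Ix TrI)))) (fun u => Fn u Ix /\ forall i, i ε Ix -> app u i ε TrI i).
Lemma in_UU u : u ε UU <-> Fn u Ix /\ forall i, i ε Ix -> app u i ε TrI i.
Proof.
  unfold UU. rewrite in_sep by def. split; [tauto|]. intros [H1 H2]. split; auto. apply in_pow. intros p Hp.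
  destruct (proj1 H1 p Hp) as (i & y & Hi & ->). apply op_prod. split; auto.
  destruct (Fn_op u Ix i y H1 Hp) as [_ ->]. apply in_uni. exists (TrI i). split; auto. apply in_img; [def|eauto].
Qed.
Lemma UU_lam f : F1 f -> (forall i, i ε Ix -> f i ε TrI i) -> lam Ix f ε UU.
Proof.
  intros Hf H. apply in_UU. split; [apply Fn_lam; auto|]. intros i Hi. rewrite app_lam; auto.
Qed.
Definition Qs : N := prod Base UU.
Definition bq (q : N) := pi1 q.
Definition uq (q i : N) := app (pi2 q) i.
Lemma F1_bq : F1 bq. Proof. unfold bq. def. Qed.
Lemma F2_uq : F2 uq. Proof. unfold uq. def. Qed.
Hint Resolve F1_bq F2_uq : def.
Lemma Qs_b q : q ε Qs -> bq q ε Base.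
Proof. intros H. apply in_prod in H as (b & u & Hb & Hu & ->). unfold bq. rewrite pi1_op. auto. Qed.
Lemma Qs_u q i : q ε Qs -> i ε Ix -> uq q i ε TrI i.
Proof.
  intros H Hi. apply in_prod in H as (b & u & Hb & Hu & ->). unfold uq. rewrite pi2_op. apply in_UU in Hu. apply Hu; auto.
Qed.
Definition mkq (b : N) (f : N -> N) := op b (lam Ix f).
Lemma mkq_Qs b f : F1 f -> b ε Base -> (forall i, i ε Ix -> f i ε TrI i) -> mkq b f ε Qs.
Proof. intros Hf Hb H. apply op_prod. split; auto. apply UU_lam; auto. Qed.
Lemma mkq_b b f : bq (mkq b f) = b. Proof. apply pi1_op. Qed.
Lemma mkq_u b f i : F1 f -> i ε Ix -> uq (mkq b f) i = f i.
Proof. intros Hf Hi. unfold uq, mkq. rewrite pi2_op. apply app_lam; auto. Qed.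

(** * Indices that a condition switches on or leaves possible *)

Section LFP.
Context (L0 : N -> Prop) (Kd : N -> N -> Prop) (DL : D1 L0) (DK : D2 Kd).
(** The least set of indices that contains the literals in [L0] and passes from [i] to its child [s]
    when [Kd i s]; written as an intersection to be visibly definable. *)
Definition lf (j : N) := forall z, (forall l, l ε LitS -> L0 l -> l ε z) ->
  (forall i s, i ε z -> i ε Ix -> s ε TrI i -> Kd i s -> op i s ε z) -> j ε z.
Lemma lf_z : forall j, lf j -> j ε Ix /\ ((j ε LitS /\ L0 j) \/ exists i s, i ε Ix /\ s ε TrI i /\ j = op i s /\ lf i /\ Kd i s).
Proof.
  intros j Hj. assert (Dl : D1 lf) by (unfold lf; def).
  set (P := fun j => (j ε LitS /\ L0 j) \/ exists i s, i ε Ix /\ s ε TrI i /\ j = op i s /\ lf i /\ Kd i s).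
  assert (DP : D1 P) by (unfold P; def).
  apply (in_sep Ix P DP). apply Hj.
  - intros l Hl Ll. apply in_sep; auto. split; [apply Ix_lit; auto|left; auto].
  - intros i s Hi HiI Hs K. apply in_sep in Hi as [_ Hi]; auto. apply in_sep; auto. split; [apply Ix_kid; auto|].
    right. exists i, s. repeat split; auto. intros z Z1 Z2. destruct Hi as [[H1 H2]|(i' & s' & H1 & H2 & -> & H3 & H4)]; [auto|].
    apply Z2; auto.
Qed.
Lemma lf_lit l : l ε LitS -> (lf l <-> L0 l).
Proof.
  intros Hl. split; [|intros K z Z1 Z2; auto]. intros K. apply lf_z in K as [_ [K|(i & s & Hi & _ & E & _)]]; [tauto|].
  exfalso. eapply lit_kid; eauto.
Qed.
Lemma lf_kid i s : i ε Ix -> s ε TrI i -> (lf (op i s) <-> lf i /\ Kd i s).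
Proof.
  intros Hi Hs. split.
  - intros K. apply lf_z in K as [_ [[K _]|(i' & s' & _ & _ & E & K)]]; [exfalso; eapply lit_kid; eauto|].
    apply op_inj in E as [<- <-]. auto.
  - intros [K1 K2] z Z1 Z2. apply Z2; auto.
Qed.
End LFP.

(** What [q] commits to the generic set: its literals and, below an index already on, the nodes
    along the promised segment. *)
Definition on (q : N) := lf (fun l => l ε bq q) (fun i s => ex s (uq q i)).
(** What a stronger condition may still switch on; [poss_on] justifies the name. *)
Definition poss (q : N) := lf (fun l => ~ lneg l ε bq q) (fun i s => cmp s (uq q i)).
Lemma D2_on : D2 on. Proof. unfold on, lf. def. Qed.
Lemma D2_poss : D2 poss. Proof. unfold poss, lf. def. Qed.
Hint Resolve D2_on D2_poss : def.
Lemma on_lit q l : l ε LitS -> (on q l <-> l ε bq q).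
Proof. intros H. apply (lf_lit (fun l => l ε bq q) (fun i s => ex s (uq q i))); auto; def. Qed.
Lemma poss_lit q l : l ε LitS -> (poss q l <-> ~ lneg l ε bq q).
Proof. intros H. apply (lf_lit (fun l => ~ lneg l ε bq q) (fun i s => cmp s (uq q i))); auto; def. Qed.
Lemma on_kid q i s : i ε Ix -> s ε TrI i -> (on q (op i s) <-> on q i /\ ex s (uq q i)).
Proof. apply (lf_kid (fun l => l ε bq q) (fun i s => ex s (uq q i))); def. Qed.
Lemma poss_kid q i s : i ε Ix -> s ε TrI i -> (poss q (op i s) <-> poss q i /\ cmp s (uq q i)).
Proof. apply (lf_kid (fun l => ~ lneg l ε bq q) (fun i s => cmp s (uq q i))); def. Qed.
Lemma on_Ix q j : on q j -> j ε Ix. Proof. intros H. apply (lf_z (fun l => l ε bq q) (fun i s => ex s (uq q i))) in H; [tauto|def|def]. Qed.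

(** A promise has to be kept only where [q'] leaves the index possible. Excluding an index thereby
    frees all coordinates at and below it. *)
Definition ple (q' q : N) := q' ε Qs /\ q ε Qs /\ subs (bq q) (bq q') /\
  forall j, j ε Ix -> poss q' j -> ex (uq q j) (uq q' j).
Lemma D2_ple : D2 ple. Proof. unfold ple. def. Qed.
Hint Resolve D2_ple : def.
Lemma on_poss q j : q ε Qs -> j ε Ix -> on q j -> poss q j.
Proof.
  intros Hq. revert j. apply (Ix_ind (fun j => on q j -> poss q j)); [def| |].
  - intros l Hl K. apply on_lit in K; auto. apply poss_lit; auto. apply Qs_b, in_Base in Hq. apply Hq; auto.
  - intros i s Hi Hs IH K. apply on_kid in K as [K1 K2]; auto. apply poss_kid; auto. split; auto. left. auto.
Qed.
Lemma ple_poss q q' j : ple q' q -> j ε Ix -> poss q' j -> poss q j.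
Proof.
  intros (Q1 & Q2 & HB & HU). revert j. apply (Ix_ind (fun j => poss q' j -> poss q j)); [def| |].
  - intros l Hl K. rewrite poss_lit in * by auto. auto.
  - intros i s Hi Hs IH K. rewrite poss_kid in * by auto. destruct K as [K1 K2]. split; auto.
    apply (cmp_down (kap (od i)) (uq q i) (uq q' i)); auto using TrI_Ord; apply Qs_u; auto.
Qed.
Lemma ple_on q q' j : ple q' q -> on q j -> on q' j.
Proof.
  intros H K. pose proof (on_Ix q j K) as Hj. revert j Hj K. destruct H as (Q1 & Q2 & HB & HU).
  apply (Ix_ind (fun j => on q j -> on q' j)); [def| |].
  - intros l Hl K. rewrite on_lit in * by auto. auto.
  - intros i s Hi Hs IH K. rewrite on_kid in * by auto. destruct K as [K1 K2]. split; auto.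
    eapply ex_trans; eauto. apply HU; auto. apply on_poss; auto.
Qed.
Lemma ple_refl q : q ε Qs -> ple q q.
Proof. intros H. repeat split; auto; try (intros z; auto; fail); intros; auto; tauto. Qed.
Lemma ple_trans q q' q'' : ple q'' q' -> ple q' q -> ple q'' q.
Proof.
  intros H1 H2. assert (H1' := H1). destruct H1 as (A1 & A2 & A3 & A4), H2 as (B1 & B2 & B3 & B4).
  split; [auto|]. split; [auto|]. split; [intros z Hz; auto|]. intros j Hj K.
  eapply ex_trans; [apply B4|apply A4]; auto. eapply ple_poss; eauto.
Qed.
(* Pointwise extension; coordinates that can no longer be switched on play no role in [ple]. *)
Definition pte (q' q : N) := q' ε Qs /\ q ε Qs /\ subs (bq q) (bq q') /\ forall j, j ε Ix -> ex (uq q j) (uq q' j).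
Lemma pte_ple q' q : pte q' q -> ple q' q.
Proof. intros (H1 & H2 & H3 & H4). repeat split; auto; apply H4; auto. Qed.
(** Possibility depends on the literals and on the promises at possible indices alone, so promises
    elsewhere may be changed at will. *)
Lemma ple_eqv q' q : q' ε Qs -> q ε Qs -> bq q = bq q' -> (forall j, j ε Ix -> poss q j -> uq q j = uq q' j) ->
  ple q' q /\ ple q q'.
Proof.
  intros H1 H2 HB HU.
  assert (P1 : forall j, j ε Ix -> poss q' j -> poss q j).
  { apply (Ix_ind (fun j => poss q' j -> poss q j)); [def| |].
    - intros l Hl K. rewrite poss_lit in * by auto. rewrite HB. auto.
    - intros i s Hi Hs IH K. rewrite poss_kid in * by auto. destruct K as [K1 K2]. split; auto. rewrite HU; auto. }
  split; (split; [auto|]); (split; [auto|]); (split; [rewrite HB; intros z; auto|]); intros j Hj K; rewrite HU; auto using ex_refl.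
Qed.
(** Resetting the impossible coordinates to their values in [q] gives a condition equivalent to [q']
    that extends [q] at every coordinate, as unions of chains require. *)
Lemma ple_lift q' q : ple q' q -> exists q'', pte q'' q /\ ple q'' q' /\ ple q' q'' /\
  forall j, j ε Ix -> ~ poss q' j -> uq q'' j = uq q j.
Proof.
  intros (H1 & H2 & H3 & H4).
  set (f j := the (fun y => (poss q' j /\ y = uq q' j) \/ (~ poss q' j /\ y = uq q j))).
  assert (Df : F1 f) by (unfold f; def).
  assert (f1 : forall j, poss q' j -> f j = uq q' j).
  { intros j K. apply the_eq; [auto|]. intros y [[_ ->]|[K' _]]; [auto|contradiction]. }
  assert (f2 : forall j, ~ poss q' j -> f j = uq q j).
  { intros j K. apply the_eq; [auto|]. intros y [[K' _]|[_ ->]]; [contradiction|auto]. }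
  assert (Qm : mkq (bq q') f ε Qs).
  { apply mkq_Qs; auto using Qs_b. intros i Hi. destruct (classic (poss q' i)) as [K|K]; [rewrite f1|rewrite f2]; auto; apply Qs_u; auto. }
  assert (EV : ple (mkq (bq q') f) q' /\ ple q' (mkq (bq q') f)).
  { apply ple_eqv; auto; [rewrite mkq_b; auto|]. intros j Hj K. rewrite mkq_u, f1; auto. }
  exists (mkq (bq q') f). split; [|split; [apply EV|split; [apply EV|]]].
  - split; [auto|]. split; [auto|]. rewrite mkq_b. split; [auto|]. intros j Hj. rewrite mkq_u by auto.
    destruct (classic (poss q' j)) as [K|K]; [rewrite f1|rewrite f2]; auto using ex_refl.
  - intros j Hj K. rewrite mkq_u, f2; auto.
Qed.
End Cond.
#[export] Hint Resolve F1_LowH F1_AA F1_kap F1_TrI F1_kids F1_bq F2_uq D2_on D2_poss D2_ple : def.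
#[global] Opaque kap FL od.

(** * Deciding below a coordinate *)

Section Ite.
Context {N : str} {Z : ZFm N}.
Definition ite (P : Prop) (x y : N) : N := the (fun z => (P /\ z = x) \/ (~ P /\ z = y)).
Lemma ite_t (P : Prop) x y : P -> ite P x y = x.
Proof. intros H. apply the_eq; [auto|]. intros z [[_ ->]|[K _]]; [auto|contradiction]. Qed.
Lemma ite_f (P : Prop) x y : ~ P -> ite P x y = y.
Proof. intros H. apply the_eq; [auto|]. intros z [[K _]|[_ ->]]; [contradiction|auto]. Qed.
Lemma DefT_ite P (x y : (nat -> N) -> N) : DefP P -> DefT x -> DefT y -> DefT (fun e => ite (P e) (x e) (y e)).
Proof. intros. unfold ite. def. Qed.
End Ite.
Ltac defhook2 ::=
  match goal with
  | |- DefT (fun e => ite (@?P e) (@?x e) (@?y e)) => apply (DefT_ite P x y)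
  | |- DefP (fun e => New (@?s e) (@?t e) (@?u e) (@?v e) ?k) => apply (DefP_New k s t u v)
  | |- DefP (fun e => Sel (@?s e) (@?t e) (@?u e) (@?v e) ?k) => apply (DefP_Sel k s t u v)
  end.

Section Cut.
Context {N : str} {Z : ZFm N} {VL : VLm N}.
Context (o : N) (Oo : Ord o).
Definition Io : N := sep Ix (fun j => od j ε o).
Definition Lw : N := sep (LowH (lam o kap)) (fun w => Fn (pi2 w) Io /\ forall j, j ε Io -> app (pi2 w) j ε TrI j).
Definition vw (w j : N) := app (pi2 w) j.
Lemma F2_vw : F2 vw. Proof. unfold vw. def. Qed.
Hint Resolve F2_vw : def.
(** Stage [o] itself is neither lower nor upper; the hypothesis [Hno] makes an index at that stage
    impossible. *)
Definition upp (j : N) := od j <> o /\ ~ od j ε o.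
Lemma D1_upp : D1 upp. Proof. unfold upp. def. Qed.
Hint Resolve D1_upp : def.
Definition low (q : N) := op (bq q) (lam Io (fun j => uq q j)).
Lemma F1_low : F1 low. Proof. unfold low. def. Qed.
Definition lle (w' w : N) := subs (pi1 w) (pi1 w') /\ forall j, j ε Io -> ex (vw w j) (vw w' j).
Lemma D2_lle : D2 lle. Proof. unfold lle. def. Qed.
Definition comb (w V : N) := mkq (pi1 w) (fun j => ite (od j ε o) (vw w j) (app V j)).
Lemma F2_comb : F2 comb. Proof. unfold comb, mkq. def. Qed.
Hint Resolve F1_low D2_lle F2_comb : def.
Lemma in_Io j : j ε Io <-> j ε Ix /\ od j ε o. Proof. unfold Io. rewrite in_sep by def. tauto. Qed.

Lemma in_Lw b v : op b v ε Lw <-> b ε Base /\ Fn v Io /\ forall j, j ε Io -> app v j ε TrI j.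
Proof.
  unfold Lw, LowH. rewrite in_sep, op_prod, pi2_op by def. split; [tauto|]. intros (H1 & H2 & H3). split; auto. split; auto.
  apply in_pow. intros p Hp. destruct (proj1 H2 p Hp) as (j & y & Hj & ->). destruct (Fn_op v Io j y H2 Hp) as [_ ->].
  pose proof (H3 j Hj) as Ht. apply in_Io in Hj as [Hj Hjo]. apply op_prod. split.
  - apply in_img; [def|]. exists (od j). split; [|apply od_spec]. apply in_img; [def|]. exists (op (od j) (kap (od j))).
    rewrite pi1_op. split; auto. apply op_lam; [def|auto].
  - destruct (proj1 (in_Tr (kap (od j)) _ (TrI_Ord j)) Ht) as (a & x & Ha & Hx & Et). rewrite Et.
    assert (K : kap (od j) ε ran (lam o kap)) by (apply in_ran_lam; [def|eauto]).
    assert (K' : forall z, z ε kap (od j) -> z ε uni (ran (lam o kap))) by (intros z Hz; apply in_uni; eauto).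
    apply op_prod. split; auto. apply in_pow. intros z Hz. apply K'. apply (Ord_trans _ a); auto. apply TrI_Ord.
Qed.
Lemma Lw_inv w : w ε Lw -> exists b v, w = op b v.
Proof. intros H. apply in_sep in H as [H _]; [|def]. apply in_prod in H as (b & v & _ & _ & ->). eauto. Qed.
Lemma Lw_b w : w ε Lw -> pi1 w ε Base.
Proof. intros H. destruct (Lw_inv w H) as (b & v & ->). apply in_Lw in H. rewrite pi1_op. tauto. Qed.
Lemma Lw_v w j : w ε Lw -> j ε Io -> vw w j ε TrI j.
Proof. intros H Hj. destruct (Lw_inv w H) as (b & v & ->). apply in_Lw in H. unfold vw. rewrite pi2_op. apply H; auto. Qed.
Lemma low_Lw q : q ε Qs -> low q ε Lw.
Proof.
  intros Hq. apply in_Lw. split; [apply Qs_b; auto|]. split; [apply Fn_lam; def|]. intros j Hj.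
  rewrite app_lam by (auto; def). apply in_Io in Hj as [Hj _]. apply Qs_u; auto.
Qed.
Lemma low_v q j : j ε Io -> vw (low q) j = uq q j.
Proof. intros Hj. unfold vw, low. rewrite pi2_op, app_lam by (auto; def). auto. Qed.
Lemma low_b q : pi1 (low q) = bq q. Proof. apply pi1_op. Qed.

Lemma comb_Qs w V : w ε Lw -> V ε UU -> comb w V ε Qs.
Proof.
  intros Hw HV. apply mkq_Qs; [def|apply Lw_b; auto|]. intros j Hj. apply in_UU in HV as [_ HV].
  destruct (classic (od j ε o)) as [K|K]; [rewrite ite_t by auto; apply Lw_v; auto; apply in_Io; auto|rewrite ite_f; auto].
Qed.
Lemma comb_b w V : bq (comb w V) = pi1 w. Proof. apply mkq_b. Qed.
Lemma comb_lo w V j : j ε Ix -> od j ε o -> uq (comb w V) j = vw w j.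
Proof. intros Hj K. unfold comb. rewrite mkq_u by (auto; def). apply ite_t; auto. Qed.
Lemma comb_up w V j : j ε Ix -> ~ od j ε o -> uq (comb w V) j = app V j.
Proof. intros Hj K. unfold comb. rewrite mkq_u by (auto; def). apply ite_f; auto. Qed.
Definition Vle (V V' : N) := forall j, j ε Ix -> ex (app V j) (app V' j).
Lemma D2_Vle : D2 Vle. Proof. unfold Vle. def. Qed.
Hint Resolve D2_Vle : def.
Lemma comb_pte w w' V V' : w ε Lw -> w' ε Lw -> V ε UU -> V' ε UU -> lle w' w -> Vle V V' -> pte (comb w' V') (comb w V).
Proof.
  intros H1 H2 H3 H4 [L1 L2] H6. split; [apply comb_Qs; auto|]. split; [apply comb_Qs; auto|]. rewrite !comb_b.
  split; auto. intros j Hj. destruct (classic (od j ε o)) as [K|K]; [rewrite !comb_lo by auto; apply L2, in_Io; auto|].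
  rewrite !comb_up by auto. auto.
Qed.

(** The setting of [cut]: each [Dcd e] is open and is dense below [q0]. A task is a pair of some [e]
    and a lower part, and [Hsz] says that the length of each upper tree is regular for families
    indexed by tasks. *)
Context (IX q0 : N) (Hq0 : q0 ε Qs) (Dcd : N -> N -> Prop) (DD : D2 Dcd)
  (Hno : forall i, i ε Ix -> od i = o -> ~ poss q0 i)
  (Hsz : forall j, j ε Ix -> upp j -> forall t, t ε prod IX Lw -> t ε AA (lam (od j) kap))
  (Hden : forall q, ple q q0 -> forall e, e ε IX -> exists q', ple q' q /\ Dcd e q')
  (Hopen : forall e q q', Dcd e q -> ple q' q -> Dcd e q').

Definition Vgood (V : N) := V ε UU /\ forall j, j ε Ix -> ex (uq q0 j) (app V j) /\ (~ upp j -> app V j = uq q0 j).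
Lemma D1_Vgood : D1 Vgood. Proof. unfold Vgood. def. Qed.
Hint Resolve D1_Vgood : def.
Definition achieves (t V : N) := forall e w, t = op e w -> e ε IX -> w ε Lw -> lle w (low q0) ->
  exists w', w' ε Lw /\ lle w' w /\ Dcd e (comb w' V).
Lemma D2_achieves : D2 achieves. Proof. unfold achieves. def. Qed.
Hint Resolve D2_achieves : def.

Lemma Vgood_pte w V : w ε Lw -> lle w (low q0) -> Vgood V -> pte (comb w V) q0.
Proof.
  intros Hw [L1 L2] [V1 V2]. split; [apply comb_Qs; auto|]. split; [auto|]. rewrite comb_b. rewrite low_b in L1.
  split; auto. intros j Hj. destruct (classic (od j ε o)) as [K|K].
  - rewrite comb_lo by auto. rewrite <- (low_v q0) by (apply in_Io; auto). apply L2, in_Io; auto.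
  - rewrite comb_up by auto. apply V2; auto.
Qed.
(** Strengthen the combination of [w] and [S] into [Dcd e], keep the upper half as [V] and use the
    lower half as the answer [w']. The coordinate at stage [o] may be put back because it is
    impossible. *)
Lemma Vstep S t : Vgood S -> exists V, Vgood V /\ Vle S V /\ achieves t V.
Proof.
  intros HS. destruct (classic (exists e w, t = op e w /\ e ε IX /\ w ε Lw /\ lle w (low q0))) as [(e & w & -> & He & Hw & Lww)|Nt].
  2: { exists S. split; auto. split; [intros j _; apply ex_refl|]. intros e w H1 H2 H3 H4. exfalso. eauto 8. }
  pose proof (Vgood_pte w S Hw Lww HS) as P0.
  destruct (Hden (comb w S) (pte_ple _ _ P0) e He) as (q1 & Q1 & D1).
  destruct (ple_lift q1 _ Q1) as (q2 & P2 & E1 & E2 & _).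
  assert (D2' : Dcd e q2) by (eapply Hopen; eauto).
  assert (Qq2 : q2 ε Qs) by apply P2.
  set (V := lam Ix (fun j => ite (upp j) (uq q2 j) (uq q0 j))).
  assert (VU : V ε UU).
  { apply UU_lam; [def|]. intros j Hj. destruct (classic (upp j)); [rewrite ite_t|rewrite ite_f]; auto; apply Qs_u; auto. }
  assert (V1 : forall j, j ε Ix -> upp j -> app V j = uq q2 j).
  { intros j Hj K. unfold V. rewrite app_lam by (auto; def). apply ite_t; auto. }
  assert (V2 : forall j, j ε Ix -> ~ upp j -> app V j = uq q0 j).
  { intros j Hj K. unfold V. rewrite app_lam by (auto; def). apply ite_f; auto. }
  destruct P2 as (_ & _ & PB & PU). destruct HS as [SU S2].
  assert (EX : forall j, j ε Ix -> upp j -> ex (app S j) (uq q2 j)).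
  { intros j Hj K. specialize (PU j Hj). rewrite comb_up in PU by (auto; apply K). auto. }
  exists V. split; [|split].
  - split; auto. intros j Hj. destruct (classic (upp j)) as [K|K].
    + rewrite V1 by auto. split; [|tauto]. eapply ex_trans; [apply S2; auto|auto].
    + rewrite V2 by auto. split; auto using ex_refl.
  - intros j Hj. destruct (classic (upp j)) as [K|K]; [rewrite V1 by auto; auto|].
    rewrite V2 by auto. destruct (S2 j Hj) as [_ K']. rewrite K' by auto. apply ex_refl.
  - intros e' w' E _ _ _. apply op_inj in E as [<- <-]. exists (low q2). split; [apply low_Lw; auto|]. split.
    + split; [rewrite low_b; rewrite comb_b in PB; auto|]. intros j Hj. rewrite low_v by auto. apply in_Io in Hj as [Hj Hjo].
      specialize (PU j Hj). rewrite comb_lo in PU; auto.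
    + apply (Hopen e q2); auto.
      refine (proj1 (ple_eqv (comb (low q2) V) q2 _ _ _ _)); [apply comb_Qs; auto; apply low_Lw; auto|auto|rewrite comb_b, low_b; auto|].
      intros j Hj K. destruct (classic (od j ε o)) as [Ko|Ko]; [rewrite comb_lo, low_v; auto; apply in_Io; auto|].
      rewrite comb_up by auto. symmetry. apply V1; auto. split; auto. intros E. apply (Hno j Hj E).
      apply (ple_poss q0 q2); auto. eapply ple_trans; [exact E1|]. eapply ple_trans; [exact Q1|]. apply pte_ple; auto.
Qed.

(** Unions are taken coordinate by coordinate; [KK_reg] keeps their lengths below the height of each
    upper tree. *)
Lemma Vsup T (F : N -> N) : F1 F -> subs T (prod IX Lw) -> (forall t, t ε T -> Vgood (F t)) ->
  (forall t t', t ε T -> t' ε T -> Vle (F t) (F t') \/ Vle (F t') (F t)) ->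
  exists S, Vgood S /\ forall t, t ε T -> Vle (F t) S.
Proof.
  intros DF HT HF HC.
  set (X j := bun (sg (uq q0 j)) (img T (fun t => app (F t) j))).
  set (Sj j := op (uni (img (X j) pi1)) (uni (img (X j) pi2))).
  assert (DX : F1 X) by (unfold X; def). assert (DS : F1 Sj) by (unfold Sj; def).
  assert (IX' : forall j s, s ε X j <-> s = uq q0 j \/ exists t, t ε T /\ s = app (F t) j).
  { intros j s. unfold X. rewrite in_bun, in_sg, in_img by def. tauto. }
  assert (XT : forall j, j ε Ix -> forall s, s ε X j -> s ε TrI j).
  { intros j Hj s Hs. apply IX' in Hs as [->|(t & Ht & ->)]; [apply Qs_u; auto|].
    destruct (HF t Ht) as [K _]. apply in_UU in K. apply K; auto. }
  assert (SUP : forall j, j ε Ix -> upp j -> Sj j ε TrI j /\ forall s, s ε X j -> ex s (Sj j)).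
  { intros j Hj Uj. set (k := kap (od j)). assert (Ok : Ord k) by apply TrI_Ord. assert (Oj : Ord (od j)) by apply od_spec.
    assert (LT : forall s, s ε TrI j -> pi1 s ε k).
    { intros s Hs. destruct (proj1 (in_Tr k s Ok) Hs) as (a & x & Ha & Hx & ->). rewrite pi1_op. exact Ha. }
    (* The family must be defined on all of [AA]; outside [T] the length at [q0] fills in. *)
    destruct (KK_reg (AA (lam (od j) kap)) (fun t => ite (t ε T) (pi1 (app (F t) j)) (pi1 (uq q0 j)))) as (b & Hb & Kb).
    - def.
    - apply AA_om.
    - intros a _. rewrite <- kap_eq by auto. destruct (classic (a ε T)) as [K|K]; [rewrite ite_t by auto|rewrite ite_f by auto].
      + apply LT, XT; auto. apply IX'. eauto.
      + apply LT, Qs_u; auto.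
    - rewrite <- kap_eq in Hb by auto. fold k in Hb.
      assert (Hb0 : pi1 (uq q0 j) ε k) by (apply LT, Qs_u; auto).
      assert (OB : Ord b) by (eapply mem_Ord; eauto). assert (OB0 : Ord (pi1 (uq q0 j))) by (eapply mem_Ord; eauto).
      assert (BB : exists c, c ε k /\ subs b c /\ subs (pi1 (uq q0 j)) c).
      { destruct (Ord_tri b _ OB OB0) as [K|[K|K]].
        - exists (pi1 (uq q0 j)). split; auto. split; intros z Hz; auto. apply (Ord_trans _ b); auto.
        - exists b. rewrite K. split; auto. split; intros z; auto.
        - exists b. split; auto. split; intros z Hz; auto. apply (Ord_trans _ (pi1 (uq q0 j))); auto. }
      destruct BB as (c & Hc & Bc & Bc0).
      refine (sup_Tr k (X j) c Ok _ _ Hc _).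
      + apply XT; auto.
      + intros s t Hs Ht. apply IX' in Hs as [->|(t1 & H1 & ->)], Ht as [->|(t2 & H2 & ->)].
        * left. apply ex_refl.
        * left. apply HF; auto.
        * right. apply HF; auto.
        * destruct (HC t1 t2 H1 H2) as [K|K]; [left|right]; apply K; auto.
      + intros s Hs. apply IX' in Hs as [->|(t & Ht & ->)]; auto.
        intros z Hz. apply Bc. apply (Kb t); [apply (Hsz j); auto|]. rewrite ite_t; auto. }
  exists (lam Ix (fun j => ite (upp j) (Sj j) (uq q0 j))).
  assert (E1 : forall j, j ε Ix -> upp j -> app (lam Ix (fun j => ite (upp j) (Sj j) (uq q0 j))) j = Sj j).
  { intros j Hj K. rewrite app_lam by (auto; def). apply ite_t; auto. }
  assert (E2 : forall j, j ε Ix -> ~ upp j -> app (lam Ix (fun j => ite (upp j) (Sj j) (uq q0 j))) j = uq q0 j).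
  { intros j Hj K. rewrite app_lam by (auto; def). apply ite_f; auto. }
  split; [split|].
  - apply UU_lam; [def|]. intros j Hj. destruct (classic (upp j)) as [K|K]; [rewrite ite_t by auto; apply SUP; auto|].
    rewrite ite_f by auto. apply Qs_u; auto.
  - intros j Hj. destruct (classic (upp j)) as [K|K]; [rewrite E1 by auto|rewrite E2 by auto].
    + split; [|tauto]. apply SUP; auto. apply IX'; auto.
    + split; auto using ex_refl.
  - intros t Ht j Hj. destruct (classic (upp j)) as [K|K]; [rewrite E1 by auto|rewrite E2 by auto].
    + apply SUP; auto. apply IX'. eauto.
    + destruct (HF t Ht) as [_ K']. destruct (K' j Hj) as [_ K2]. rewrite K2 by auto. apply ex_refl.
Qed.

(** [h] lists the choices for tasks of smaller [od]. Its domain is the [od] of the present task, so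
    [FL] of the domain is the task itself. *)
Definition OKV (h V : N) := Vgood V /\ (forall t V', t ε prod IX Lw -> op (od t) V' ε h -> Vle V' V) /\ achieves (FL (img h pi1)) V.
Lemma D2_OKV : D2 OKV. Proof. unfold OKV. def. Qed.
Hint Resolve D2_OKV : def.
Lemma F1_VG : F1 (fun h => chs (fun V => OKV h V)). Proof. def. Qed.
Definition VV := rec (fun h => chs (fun V => OKV h V)).

Lemma dom_lam a f : F1 f -> img (lam a f) pi1 = a.
Proof.
  intros Hf. apply zext. intros d. rewrite in_img by def. split.
  - intros (p & Hp & ->). apply in_lam in Hp as (y & Hy & ->); auto. rewrite pi1_op. auto.
  - intros Hd. exists (op d (f d)). rewrite pi1_op. split; auto. apply op_lam; auto.
Qed.

(** A fusion argument: tasks are handled in the order of their [od], and only the upper half is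
    carried along. As every lower part occurs in some task, the final [V] reduces each [Dcd e] to a
    strengthening of the lower part. *)
Lemma cut : exists V, Vgood V /\ forall e w, e ε IX -> w ε Lw -> lle w (low q0) ->
  exists w', w' ε Lw /\ lle w' w /\ Dcd e (comb w' V).
Proof.
  assert (DV : F1 VV) by (apply F1_rec, F1_VG).
  assert (Main : forall d, Ord d -> forall t, t ε prod IX Lw -> od t = d -> OKV (lam d VV) (VV d)).
  { apply (Ord_ind (fun d => forall t, t ε prod IX Lw -> od t = d -> OKV (lam d VV) (VV d))); [def|].
    intros d Od IH t Ht Et. unfold VV at 2. rewrite (rec_eq _ F1_VG) by auto. fold VV.
    apply (chs_ok (fun V => OKV (lam d VV) V)); [def|].
    destruct (Vsup (sep (prod IX Lw) (fun t => od t ε d)) (fun t => VV (od t))) as (S & GS & LS).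
    - def.
    - intros z Hz. apply in_sep in Hz; [tauto|def].
    - intros t' Ht'. apply in_sep in Ht' as [H1 H2]; [|def]. apply (IH _ H2 t'); auto.
    - intros t1 t2 H1 H2. apply in_sep in H1 as [H1 K1], H2 as [H2 K2]; try def.
      destruct (Ord_tri (od t1) (od t2)) as [K|[K|K]]; try apply od_spec.
      + left. destruct (IH _ K2 t2 H2 eq_refl) as (_ & Q & _). apply (Q t1); auto. apply op_lam; auto.
      + left. rewrite K. intros j _. apply ex_refl.
      + right. destruct (IH _ K1 t1 H1 eq_refl) as (_ & Q & _). apply (Q t2); auto. apply op_lam; auto.
    - destruct (Vstep S (FL d) GS) as (V & V1 & V2 & V3). exists V. split; [auto|]. split; [|rewrite dom_lam; auto].
      intros t' V' Ht' K. apply op_lam in K as [K ->]; auto. intros j Hj. eapply ex_trans; [apply (LS t')|apply V2]; auto.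
      apply in_sep; [def|auto]. }
  destruct (Vsup (prod IX Lw) (fun t => VV (od t))) as (S & GS & LS).
  - def.
  - intros z; auto.
  - intros t Ht. apply (Main (od t) (proj1 (od_spec t)) t); auto.
  - intros t1 t2 H1 H2. destruct (Ord_tri (od t1) (od t2)) as [K|[K|K]]; try apply od_spec.
    + left. destruct (Main _ (proj1 (od_spec t2)) t2 H2 eq_refl) as (_ & Q & _). apply (Q t1); auto. apply op_lam; auto.
    + left. rewrite K. intros j _. apply ex_refl.
    + right. destruct (Main _ (proj1 (od_spec t1)) t1 H1 eq_refl) as (_ & Q & _). apply (Q t2); auto. apply op_lam; auto.
  - exists S. split; auto. intros e w He Hw Lww. set (t := op e w).
    assert (Ht : t ε prod IX Lw) by (apply op_prod; auto).
    destruct (Main _ (proj1 (od_spec t)) t Ht eq_refl) as (V1 & _ & V3).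
    rewrite dom_lam in V3 by auto. rewrite <- (proj2 (od_spec t)) in V3.
    destruct (V3 e w eq_refl He Hw Lww) as (w' & W1 & W2 & W3). exists w'. split; auto. split; auto.
    apply (Hopen e (comb w' (VV (od t)))); auto. apply pte_ple, comb_pte; auto; [apply V1|apply GS|].
    split; [intros z; auto|]. intros; apply ex_refl.
Qed.
End Cut.

#[export] Hint Resolve F2_vw D1_upp F1_low D2_lle F2_comb : def.
#[global] Opaque sep img pow uni lam prod ran app UU Ix Base KK seqs.

(** * No branches below off indices, and no new injections *)

Section OffPreserve.
Context {N : str} {Z : ZFm N} {VL : VLm N}.

Lemma LowH_mono o o' : subs o o' -> subs (LowH (lam o kap)) (LowH (lam o' kap)).
Proof.
  intros H z Hz. unfold LowH in *. apply in_prod in Hz as (b & v & Hb & Hv & ->). apply op_prod. split; [exact Hb|].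
  rewrite in_pow in *. intros p Hp. apply Hv in Hp. apply in_prod in Hp as (c & s & Hc & Hs & ->). apply op_prod.
  assert (R : subs (ran (lam o kap)) (ran (lam o' kap))).
  { intros y Hy. rewrite in_ran_lam in * by def. destruct Hy as (a & Ha & ->). eauto. }
  assert (U : subs (uni (ran (lam o kap))) (uni (ran (lam o' kap)))).
  { intros y Hy. rewrite in_uni in *. destruct Hy as (a & Ha & Hy). eauto. }
  split.
  - rewrite in_img in * by def. destruct Hc as (d & Hd & ->). exists d. split; auto. rewrite in_img in * by def.
    destruct Hd as (q & Hq & ->). exists q. split; auto. apply in_lam in Hq as (a & Ha & ->); [|def]. apply op_lam; [def|auto].
  - apply in_prod in Hs as (d & x & Hd & Hx & ->). apply op_prod. split; auto. rewrite in_pow in *. intros y Hy. auto.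
Qed.
Lemma Lw_AA o o' e w : subs o o' -> (e ε A0 \/ e ε uni (ran (lam o' kap))) -> w ε Lw o -> op e w ε AA (lam o' kap).
Proof.
  intros Ho He Hw. apply in_bun. right. apply op_prod. split; [apply in_bun; auto|].
  apply (LowH_mono o o'); auto. apply in_sep in Hw; [tauto|def].
Qed.
Lemma lle_refl o w : lle o w w. Proof. split; [intros z; auto|]. intros; apply ex_refl. Qed.
Lemma upp_sub o j : Ord o -> upp o j -> o ε od j.
Proof. intros Oo [H1 H2]. destruct (Ord_tri (od j) o (proj1 (od_spec j)) Oo) as [K|[K|K]]; tauto. Qed.

Definition dns (i D : N) := subs D (TrI i) /\ forall s, s ε TrI i -> exists t, t ε D /\ ex s t.
Lemma D2_dns : D2 dns. Proof. unfold dns. def. Qed.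

(** If [Y] named a generic branch, [cut] would let the bit at each position be settled by a lower
    part. Lower parts are too few for the length of the tree, so a single one predicts the bits at a
    non-small, hence unbounded, set of positions; the nodes that refute the prediction are dense. *)
Lemma off i q0 (Y : N -> N -> Prop) : D2 Y -> i ε Ix -> q0 ε Qs -> ~ poss q0 i ->
  (forall q q' s, Y q s -> ple q' q -> Y q' s) ->
  (forall q D, ple q q0 -> dns i D -> exists q' s, ple q' q /\ s ε D /\ Y q' s) ->
  (forall q s t, ple q q0 -> Y q s -> Y q t -> cmp s t) -> False.
Proof.
  intros DY Hi Hq0 Np Hop H1 H2. set (o := od i). assert (Oo : Ord o) by apply od_spec.
  set (k := kap o). assert (Ok : Ord k) by (apply kap_Ord; auto).
  assert (Ek : k = KK (AA (lam o kap))) by (apply kap_eq; auto).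
  assert (Lk : forall x, x ε k -> suc x ε k) by (intros x; apply kap_lim; auto).
  assert (T1 : forall s, s ε TrI i -> pi1 s ε k).
  { intros s Hs. destruct (proj1 (in_Tr k s Ok) Hs) as (a & x & Ha & Hx & ->). rewrite pi1_op. exact Ha. }
  (* The task [a] asks for a node of the branch that has a bit at position [a]. *)
  destruct (cut o k q0 Hq0 (fun a q => exists s, s ε TrI i /\ Y q s /\ a ε pi1 s)) as (V & GV & HV).
  - def.
  - intros j Hj E. apply od_inj in E as ->. auto.
  - intros j Hj Uj t Ht. apply upp_sub in Uj; auto. apply in_prod in Ht as (a & w & Ha & Hw & ->).
    apply (Lw_AA o); auto; [intros z Hz; apply (Ord_trans _ o); auto; apply od_spec|].
    right. apply in_uni. exists k. split; auto. apply in_ran_lam; [def|eauto].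
  - intros q Hq a Ha. set (D := sep (TrI i) (fun t => a ε pi1 t)).
    destruct (H1 q D Hq) as (q' & s & Q1 & Q2 & Q3).
    + split; [intros t Ht; apply in_sep in Ht; [tauto|def]|]. intros s Hs. destruct (classic (a ε pi1 s)) as [K|K].
      * exists s. split; [apply in_sep; [def|auto]|apply ex_refl].
      * destruct (ext_bit k s a True Ok Lk Hs Ha K) as (t & K1 & K2 & K3 & _). exists t. split; auto. apply in_sep; [def|auto].
    + apply in_sep in Q2 as [Q2 Q4]; [|def]. eauto 8.
  - intros a q q' (s & S1 & S2 & S3) K. eauto.
  - set (h := lam o kap) in *. pose proof (KK_spec (AA h)) as (_ & NS & SM). rewrite <- Ek in NS, SM.
    set (R := fun p a => exists b w s, p = op b w /\ w ε Lw o /\ lle o w (low o q0) /\ s ε TrI i /\ Y (comb o w V) s /\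
       a ε pi1 s /\ (a ε pi2 s <-> b = b1)).
    assert (DR : D2 R) by (unfold R; def).
    destruct (pigeon (AA h) k R) as (p & Hp & NZ); [auto|auto| |].
    { intros a Ha. destruct (HV a (low o q0) Ha (low_Lw o q0 Hq0) (lle_refl o _)) as (w & W1 & W2 & s & S1 & S2 & S3).
      destruct (classic (a ε pi2 s)) as [K|K].
      - exists (op b1 w). split; [|exists b1, w, s; repeat (split; [auto; fail|]); tauto].
        apply (Lw_AA o); [intros z; auto| |auto]. left. apply in_bun. right. apply in_two; auto.
      - exists (op emp w). split; [|exists emp, w, s; repeat (split; [auto; fail|]); split; [tauto|]; intros E; exfalso; apply b1_ne; auto].
        apply (Lw_AA o); [intros z; auto| |auto]. left. apply in_bun. right. apply in_two; auto. }
    (* The positions at which one fixed lower part settles one fixed bit. *)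
    set (ZZ := sep k (fun a => R p a)) in *.
    assert (iZ : forall a, a ε ZZ <-> a ε k /\ R p a) by (intros a; unfold ZZ; rewrite in_sep by def; tauto).
    assert (NE : exists a, a ε ZZ).
    { apply NNPP. intros K. apply NZ. apply (sm_sub _ _ emp); [intros z Hz; exfalso; eauto|]. apply SM. apply kap_ne; auto. }
    destruct NE as (a0 & Ha0). apply iZ in Ha0 as (_ & b & w & s0 & -> & Hw & Lww & _).
    (* Nodes that disagree with the prediction somewhere. This is dense: the length of a node is
       small, so some position of [ZZ] lies beyond it, and there the wrong bit can be put. *)
    set (D := sep (TrI i) (fun t => exists a, a ε ZZ /\ a ε pi1 t /\ ~ (a ε pi2 t <-> b = b1))).
    assert (P0 : ple (comb o w V) q0) by (apply pte_ple; apply (Vgood_pte o q0); auto).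
    destruct (H1 (comb o w V) D P0) as (q' & t & Q1 & Q2 & Q3).
    + split; [intros t Ht; apply in_sep in Ht; [tauto|def]|]. intros s Hs.
      assert (NS' : exists a, a ε ZZ /\ ~ a ε pi1 s).
      { apply NNPP. intros K. apply NZ. apply (sm_sub _ _ (pi1 s)); [|apply SM, T1; auto].
        intros z Hz. apply NNPP. eauto. }
      destruct NS' as (a & Za & Na). assert (Ka : a ε k) by (apply iZ in Za; tauto).
      destruct (ext_bit k s a (b <> b1) Ok Lk Hs Ka Na) as (t & K1 & K2 & K3 & K4). exists t. split; auto.
      apply in_sep; [def|]. split; [exact K1|]. exists a. split; [auto|]. split; [auto|]. tauto.
    + apply in_sep in Q2 as (Q2 & a & Za & Q4 & Q5); [|def]. apply iZ in Za as (_ & b' & w' & s & E & _ & _ & S1 & S2 & S3 & S4).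
      apply op_inj in E as [<- <-]. apply Q5. rewrite <- S4. symmetry. apply cmp_bit; auto.
      apply (H2 q'); [apply (ple_trans q0 (comb o w V)); auto|apply (Hop (comb o w V)); auto|auto].
Qed.

(** Cutting at stage [emp] leaves only the literals below, so a set of literals settles the value of
    each [x]. Non-small many [x] share a value [y]; by the chain condition the literals for two of
    them are compatible, and a common extension identifies the two. *)
Lemma preserve X Y A q0 (J : N -> N -> N -> Prop) : D3 J -> q0 ε Qs -> subs om A -> subs Y A -> subs X A0 -> ~ sm A X ->
  (forall q q' x y, J q x y -> ple q' q -> J q' x y) ->
  (forall q x, ple q q0 -> x ε X -> exists q' y, ple q' q /\ y ε Y /\ J q' x y) ->
  (forall q x x' y, ple q q0 -> J q x y -> J q x' y -> x = x') -> False.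
Proof.
  intros DJ Hq0 HA HY HX NS Hop H1 H2. set (o := (emp : N)). assert (Oo : Ord o) by apply Ord_emp.
  destruct (cut o X q0 Hq0 (fun x q => exists y, y ε Y /\ J q x y)) as (V & GV & HV).
  - def.
  - intros j Hj E. exfalso. apply (Ix_ne j Hj). apply zext. intros z. split; intros K; [|exfalso; eapply in_emp; eauto].
    exfalso. apply (in_emp (od z)). fold o. rewrite <- E. apply od_lt; auto.
  - intros j Hj Uj t Ht. apply in_prod in Ht as (a & w & Ha & Hw & ->).
    apply (Lw_AA o); auto. intros z Hz. exfalso. eapply in_emp; eauto.
  - intros q Hq x Hx. destruct (H1 q x Hq Hx) as (q' & y & K1 & K2 & K3). eauto.
  - intros e q q' (y & Hy & K) K'. eauto.
  - set (R := fun y x => y ε Y /\ exists w, w ε Lw o /\ lle o w (low o q0) /\ J (comb o w V) x y).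
    destruct (pigeon A X R) as (y & Hy & NU); [unfold R; def|auto| |].
    { intros x Hx. destruct (HV x (low o q0) Hx (low_Lw o q0 Hq0) (lle_refl o _)) as (w & W1 & W2 & y & S1 & S2).
      exists y. split; auto. split; eauto. }
    set (U := sep X (fun x => R y x)) in *.
    set (P x w := w ε Lw o /\ lle o w (low o q0) /\ J (comb o w V) x y).
    assert (DP : D2 P) by (unfold P; def).
    assert (CP : forall x, x ε U -> P x (chs (P x))).
    { intros x Hx. apply chs_ok; [def|]. apply in_sep in Hx as (_ & _ & Hx); [exact Hx|unfold R; def]. }
    destruct (ccc A HA (fun x => pi1 (chs (P x)))) with (U := U) as (x & x' & Hx & Hx' & Nx & CC); [def|auto| |].
    { intros x Hx. apply (Lw_b o). apply CP; auto. }
    apply Nx. destruct (CP x Hx) as (W1 & W2 & W3), (CP x' Hx') as (W1' & W2' & W3').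
    set (w1 := chs (P x)) in *. set (w2 := chs (P x')) in *.
    (* The union of both sets of literals; [Io o] is empty, so the second component is the empty
       function. *)
    set (w := op (bun (pi1 w1) (pi1 w2)) (lam (Io o) (fun z => z))).
    assert (NI : forall j, ~ j ε Io o) by (intros j Hj; apply in_Io in Hj as [_ Hj]; eapply in_emp; eauto).
    assert (Hw : w ε Lw o).
    { apply in_Lw. split; [|split; [apply Fn_lam; def|intros j Hj; exfalso; eapply NI; eauto]].
      destruct (proj1 (in_Base _) (Lw_b o _ W1)) as (B1 & B2 & _), (proj1 (in_Base _) (Lw_b o _ W1')) as (B1' & B2' & _).
      apply in_Base. split; [intros z Hz; apply in_bun in Hz as [Hz|Hz]; auto|]. split; [apply fin_bun; auto|auto]. }
    assert (L1 : lle o w w1).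
    { split; [unfold w; rewrite pi1_op; intros z Hz; apply in_bun; auto|intros j Hj; exfalso; eapply NI; eauto]. }
    assert (L2 : lle o w w2).
    { split; [unfold w; rewrite pi1_op; intros z Hz; apply in_bun; auto|intros j Hj; exfalso; eapply NI; eauto]. }
    assert (VU : V ε UU) by apply GV.
    assert (VR : Vle V V) by (intros j _; apply ex_refl).
    assert (C1 : ple (comb o w V) (comb o w1 V)) by (apply pte_ple, comb_pte; auto).
    assert (C2 : ple (comb o w V) (comb o w2 V)) by (apply pte_ple, comb_pte; auto).
    apply (H2 (comb o w V) x x' y); [|apply (Hop (comb o w1 V)); auto|apply (Hop (comb o w2 V)); auto].
    eapply ple_trans; [exact C1|]. apply pte_ple. apply (Vgood_pte o q0); auto.
Qed.
End OffPreserve.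
#[export] Hint Resolve D2_dns : def.

(** * The generic set *)

#[global] Opaque upair op sg bun suc pi1 pi2 Tr kids LitS lneg flip bq uq mkq on poss Qs A0 AA LowH FL od la mu.

(** A propositional theory with atoms [I]: implications into disjunctions, plain disjunctions and
    exclusions. It is stated with [pin], so that a level of Imp can evaluate it. *)
Definition sol {M : str} (S : M -> Prop) (I R P E : M) :=
  (forall x, S x -> x ε I) /\ (forall t D, pin R t D -> S t -> exists d, d ε D /\ S d) /\
  (forall D, D ε P -> exists d, d ε D /\ S d) /\ (forall u v, pin E u v -> S u -> S v -> False).

Section QPoset.
Context {N : str} {Z : ZFm N} {VL : VLm N}.
#[export] Instance Qpo : poset N := { Pset := Qs; le := ple }.
Lemma Tr_root i : op emp emp ε TrI i.
Proof.
  refine (proj2 (in_Tr (kap (od i)) _ (TrI_Ord i)) _). exists emp, emp. split; [apply kap_ne, od_spec|]. split; [intros z; auto|auto].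
Qed.
#[export] Instance QpoP : posetP N.
Proof.
  split.
  - exact D2_ple.
  - intros p q H. split; apply H.
  - exact ple_refl.
  - intros p q r H1 H2. exact (ple_trans r q p H1 H2).
  - exists (mkq emp (fun _ => op emp emp)). apply mkq_Qs; [def| |intros; apply Tr_root].
    assert (NE : forall z : N, ~ z ε emp) by (intros z; apply in_emp).
    apply in_Base. split; [intros z Hz; exfalso; eapply NE; eauto|]. split; [|intros z Hz; exfalso; eapply NE; eauto].
    exists emp, emp. split; [apply om_0|]. intros l Hl; exfalso; eapply NE; eauto.
Qed.

Lemma D2_leQ : D2 (@le N Qpo). Proof. exact D2_ple. Qed.
Lemma D3_FMemQ : D3 (@FMem N Z Qpo). Proof. apply D3_FMem. Qed.
Hint Resolve D2_leQ D3_FMemQ : def.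

Lemma add_lit q l : q ε Qs -> l ε LitS -> ~ lneg l ε bq q -> exists q', ple q' q /\ bq q' = bun (bq q) (sg l).
Proof.
  intros Hq Hl Nl. exists (mkq (bun (bq q) (sg l)) (uq q)). split; [|apply mkq_b].
  destruct (proj1 (in_Base _) (Qs_b q Hq)) as (B1 & B2 & B3). destruct (lneg_LitS l Hl) as (L1 & L2 & L3).
  assert (Qm : mkq (bun (bq q) (sg l)) (uq q) ε Qs).
  { apply mkq_Qs; [def| |intros; apply Qs_u; auto]. apply in_Base.
    split; [intros z Hz; apply in_bun in Hz as [Hz|Hz]; [auto|apply in_sg in Hz as ->; auto]|].
    split; [apply fin_add; auto|]. intros z Hz Hn. rewrite in_bun, in_sg in *. destruct Hz as [Hz| ->], Hn as [Hn|Hn]; [| |exact (Nl Hn)|exact (L3 Hn)].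
    - exact (B3 z Hz Hn).
    - apply Nl. rewrite <- Hn. rewrite (proj1 (proj2 (lneg_LitS z (B1 z Hz)))). auto. }
  apply pte_ple. split; [auto|]. split; [auto|]. rewrite mkq_b. split; [intros z Hz; apply in_bun; auto|].
  intros j Hj. rewrite mkq_u by (auto; def). apply ex_refl.
Qed.
Lemma set_u q i s : q ε Qs -> i ε Ix -> s ε TrI i -> ex (uq q i) s ->
  exists q', ple q' q /\ bq q' = bq q /\ uq q' i = s /\ forall j, j ε Ix -> j <> i -> uq q' j = uq q j.
Proof.
  intros Hq Hi Hs He. set (f j := ite (j = i) s (uq q j)). assert (Df : F1 f) by (unfold f; def).
  assert (f1 : f i = s) by (apply ite_t; auto). assert (f2 : forall j, j <> i -> f j = uq q j) by (intros; apply ite_f; auto).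
  exists (mkq (bq q) f).
  split; [|split; [apply mkq_b|split; [rewrite mkq_u; auto|intros j Hj Nj; rewrite mkq_u; auto]]].
  apply pte_ple. split; [|split; [auto|]].
  - apply mkq_Qs; [exact Df|exact (Qs_b q Hq)|]. intros j Hj. destruct (classic (j = i)) as [->|K]; [rewrite f1; exact Hs|rewrite (f2 j K); exact (Qs_u q j Hq Hj)].
  - rewrite mkq_b. split; [intros z; auto|]. intros j Hj. rewrite mkq_u by auto.
    destruct (classic (j = i)) as [->|K]; [rewrite f1; exact He|rewrite (f2 j K); apply ex_refl].
Qed.
(** Only the promises at proper ancestors matter, and these have smaller [od]. *)
Lemma poss_local q q' : bq q = bq q' -> forall i, i ε Ix -> (forall j, j ε Ix -> od j ε od i -> uq q j = uq q' j) -> poss q i -> poss q' i.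
Proof.
  intros EB. apply (Ix_ind (fun i => (forall j, j ε Ix -> od j ε od i -> uq q j = uq q' j) -> poss q i -> poss q' i)); [def| |].
  - intros l Hl _ K. rewrite poss_lit in * by auto. rewrite <- EB. auto.
  - intros i s Hi Hs IH H K. rewrite poss_kid in * by auto. destruct K as [K1 K2]. rewrite <- (H i Hi (od_op i s)). split; auto.
    apply IH; auto. intros j Hj Hji. apply H; auto. apply (Ord_trans _ (od i)); [auto|apply od_op|apply od_spec].
Qed.
(** Lengthen the promise at the parent so that it passes through [s], then switch the parent on; by
    [poss_local] the first change does not endanger the second. *)
Lemma poss_on i : i ε Ix -> forall q, q ε Qs -> poss q i -> exists r, ple r q /\ on r i.
Proof.
  revert i. apply (Ix_ind (fun i => forall q, q ε Qs -> poss q i -> exists r, ple r q /\ on r i)); [def| |].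
  - intros l Hl q Hq K. apply poss_lit in K; auto. destruct (add_lit q l Hq Hl K) as (r & R1 & R2). exists r. split; auto.
    apply on_lit; auto. rewrite R2. apply in_bun. right. apply in_sg; auto.
  - intros i s Hi Hs IH q Hq K. apply poss_kid in K as [K1 K2]; auto.
    assert (E : exists t, t ε TrI i /\ ex (uq q i) t /\ ex s t).
    { destruct K2 as [K2|K2]; [exists (uq q i)|exists s]; auto using Qs_u, ex_refl. }
    destruct E as (t & T1 & T2 & T3). destruct (set_u q i t Hq Hi T1 T2) as (q1 & Q1 & Q2 & Q3 & Q4).
    destruct (IH q1) as (r & R1 & R2); [apply Q1| |].
    + apply (poss_local q q1); auto. intros j Hj Hji. symmetry. apply Q4; auto. intros ->. eapply mem_irr; eauto.
    + exists r. split; [apply (ple_trans q q1); auto|]. apply on_kid; auto. split; auto.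
      apply (ex_trans _ t); auto. rewrite <- Q3. apply R1; auto. apply on_poss; auto. apply R1.
Qed.
Lemma fin_bd b f : F1 f -> fin b -> exists k, k ε om /\ forall l, l ε b -> f l ε om -> f l ε k.
Proof.
  intros Df (n & e & Hn & He).
  assert (K : exists k, k ε om /\ forall i, i ε n -> f (app e i) ε om -> f (app e i) ε k).
  { clear He. revert n Hn. apply (om_ind (fun n => exists k, k ε om /\ forall i, i ε n -> f (app e i) ε om -> f (app e i) ε k)); [def| |].
    - exists emp. split; [apply om_0|]. intros i Hi. exfalso. eapply in_emp; eauto.
    - intros n Hn (k & Hk & IH). destruct (classic (f (app e n) ε om)) as [K|K].
      + assert (Os : Ord (suc (f (app e n)))) by (apply Ord_suc, om_Ord; auto).
        destruct (Ord_tri k (suc (f (app e n))) (om_Ord k Hk) Os) as [Q|[Q|Q]].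
        * exists (suc (f (app e n))). split; [apply om_S; auto|]. intros i Hi Hf. apply in_suc in Hi as [Hi| ->]; [|apply in_suc; auto].
          exact (Ord_trans _ k _ (IH i Hi Hf) Q Os).
        * exists k. split; auto. intros i Hi Hf. apply in_suc in Hi as [Hi| ->]; [auto|]. rewrite Q. apply in_suc; auto.
        * exists k. split; auto. intros i Hi Hf. apply in_suc in Hi as [Hi| ->]; [auto|].
          refine (Ord_trans _ (suc (f (app e n))) _ _ Q (om_Ord k Hk)). apply in_suc; auto.
      + exists k. split; auto. intros i Hi Hf. apply in_suc in Hi as [Hi| ->]; [auto|tauto]. }
  destruct K as (k & Hk & K). exists k. split; auto. intros l Hl Hf. destruct (He l Hl) as (i & Hi & ->). auto.
Qed.

(** A branch that meets this dense set either passes through [s] or leaves it visibly; [Gam_uniq]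
    relies on this. *)
Lemma dns_below j s : s ε TrI j -> dns j (sep (TrI j) (fun t => ex s t \/ ~ cmp s t)).
Proof.
  intros Hs. split; [intros t Ht; apply in_sep in Ht; [tauto|def]|]. intros u Hu. destruct (classic (cmp s u)) as [[K|K]|K].
  - exists u. split; [apply in_sep; [def|auto]|apply ex_refl].
  - exists s. split; [apply in_sep; [def|]|auto]. split; [auto|]. left. apply ex_refl.
  - exists u. split; [apply in_sep; [def|auto]|apply ex_refl].
Qed.
(** Three kinds of implication: from a node to the index above it, from an index into every dense
    subset of its tree that lies in the ground model, and from a node to its initial segments. The
    second expresses genericity of the branch. *)
Definition Rn : N := sep (prod Ix (pow Ix)) (fun p => exists t D, p = op t D /\
  ((exists i s, i ε Ix /\ s ε TrI i /\ t = op i s /\ D = sg i) \/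
   (exists D', dns t D' /\ D = img D' (fun s => op t s)) \/
   (exists i s u, i ε Ix /\ s ε TrI i /\ u ε TrI i /\ ex s u /\ t = op i u /\ D = sg (op i s)))).
Definition Pn : N := sep (pow Ix) (fun D => exists x n, x ε la /\ n ε om /\ D = upair (lit (op x n) emp) (lit (op x n) b1)).
Definition En : N := sep (prod Ix Ix) (fun p => exists u v, p = op u v /\
  ((exists x n, x ε la /\ n ε om /\ u = lit (op x n) emp /\ v = lit (op x n) b1) \/
   (exists i s t, i ε Ix /\ s ε TrI i /\ t ε TrI i /\ ~ cmp s t /\ u = op i s /\ v = op i t))).
Lemma subs_sg i : i ε Ix -> subs (sg i) Ix. Proof. intros H z Hz. apply in_sg in Hz as ->. auto. Qed.
Lemma lit_Ix x n b : x ε la -> n ε om -> b ε two -> lit (op x n) b ε Ix.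
Proof. intros. apply Ix_lit, in_LitS. eauto 8. Qed.
Lemma two0 : emp ε two. Proof. apply in_two; auto. Qed.
Lemma two1 : b1 ε two. Proof. apply in_two; auto. Qed.
Lemma Rn_par i s : i ε Ix -> s ε TrI i -> op (op i s) (sg i) ε Rn.
Proof.
  intros Hi Hs. unfold Rn. rewrite in_sep by def. rewrite op_prod. split; [split; [apply Ix_kid; auto|apply in_pow, subs_sg; auto]|].
  exists (op i s), (sg i). split; auto. left. eauto 6.
Qed.
Lemma Rn_gen i D : i ε Ix -> dns i D -> op i (img D (fun s => op i s)) ε Rn.
Proof.
  intros Hi HD. unfold Rn. rewrite in_sep by def. rewrite op_prod. split.
  - split; auto. apply in_pow. intros z Hz. apply in_img in Hz as (s & Hs & ->); [|def]. apply Ix_kid; auto. apply HD; auto.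
  - exists i, (img D (fun s => op i s)). split; auto. right. left. eauto.
Qed.
Lemma Rn_down i s u : i ε Ix -> s ε TrI i -> u ε TrI i -> ex s u -> op (op i u) (sg (op i s)) ε Rn.
Proof.
  intros Hi Hs Hu He. unfold Rn. rewrite in_sep by def. rewrite op_prod. split; [split; [apply Ix_kid; auto|apply in_pow, subs_sg, Ix_kid; auto]|].
  exists (op i u), (sg (op i s)). split; auto. right. right. exists i, s, u. auto 8.
Qed.
Lemma Pn_in x n : x ε la -> n ε om -> upair (lit (op x n) emp) (lit (op x n) b1) ε Pn.
Proof.
  intros Hx Hn. unfold Pn. rewrite in_sep by def. split; [|eauto 6]. apply in_pow. intros z Hz.
  apply in_upair in Hz as [->| ->]; apply lit_Ix; auto using two0, two1.
Qed.
Lemma En_lit x n : x ε la -> n ε om -> op (lit (op x n) emp) (lit (op x n) b1) ε En.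
Proof.
  intros Hx Hn. unfold En. rewrite in_sep by def. rewrite op_prod. split; [split; apply lit_Ix; auto using two0, two1|].
  exists (lit (op x n) emp), (lit (op x n) b1). split; auto. left. eauto 6.
Qed.
Lemma En_kid i s t : i ε Ix -> s ε TrI i -> t ε TrI i -> ~ cmp s t -> op (op i s) (op i t) ε En.
Proof.
  intros Hi Hs Ht Nc. unfold En. rewrite in_sep by def. rewrite op_prod. split; [split; apply Ix_kid; auto|].
  exists (op i s), (op i t). split; auto. right. exists i, s, t. auto 8.
Qed.

Context {G : N -> Prop} {GG : generic G}.
Notation W := (W G).
Notation cl := (cl G).
Notation jW := (@jW N Z Qpo G).
Lemma G_Qs q : G q -> q ε Qs. Proof. exact (G_in q). Qed.
Definition Gam : W := cl (sep (prod (img Ix chk) Qs) (fun t => exists i q, t = op (chk i) q /\ i ε Ix /\ on q i)).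
Definition onG (i : N) := exists q, G q /\ on q i.
Lemma onG_Ix i : onG i -> i ε Ix. Proof. intros (q & _ & H). eapply on_Ix; eauto. Qed.
Lemma in_Gam w : w ε Gam <-> exists i, onG i /\ w = jW i.
Proof.
  unfold Gam. rewrite in_cl. split.
  - intros (z & s & H1 & H2 & ->). apply in_sep in H1 as [_ (i & q & E & Hi & K)]; [|def]. apply op_inj in E as [-> ->].
    exists i. split; [exists q; auto|reflexivity].
  - intros (i & (q & Gq & Hq) & ->). exists (chk i), q. split; [|split; [auto|reflexivity]].
    pose proof (on_Ix q i Hq) as Hi. apply in_sep; [def|]. rewrite op_prod. split; [split; [apply in_img; [def|eauto]|exact (G_Qs q Gq)]|]. eauto 6.
Qed.
Lemma jW_cl x : jW x = cl (chk x). Proof. exact eq_refl. Qed.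
Lemma jW_Gam i : jW i ε Gam <-> onG i.
Proof. rewrite in_Gam. split; [|intros H; exists i; auto]. intros (i' & H & E). apply t_inj in E as ->. auto. Qed.
Lemma jW_op x y : jW (op x y) = op (jW x) (jW y).
Proof. apply isop_op, (a_isop jW), isop_op. auto. Qed.
Lemma in_jWop x y R : op x y ε jW R <-> exists a b, x = jW a /\ y = jW b /\ op a b ε R.
Proof.
  rewrite in_jW. split.
  - intros (p & Hp & E). assert (K : isop (jW p) x y) by (apply isop_op; auto).
    apply isop_down in K as (a & b & -> & -> & K); [|apply jW_temb]. apply isop_op in K as ->. exists a, b. split; [reflexivity|]. split; [reflexivity|exact Hp].
  - intros (a & b & -> & -> & H). exists (op a b). rewrite jW_op. auto.
Qed.

Lemma G_two p q i j : G p -> G q -> on p i -> on q j -> exists r, G r /\ on r i /\ on r j.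
Proof.
  intros Gp Gq Hp Hq. destruct (G_dir p q Gp Gq) as (r & Gr & R1 & R2). exists r. split; auto.
  split; [apply (ple_on p r i)|apply (ple_on q r j)]; auto.
Qed.
Lemma onG_par i s : i ε Ix -> s ε TrI i -> onG (op i s) -> onG i.
Proof. intros Hi Hs (q & Gq & K). apply on_kid in K as [K _]; auto. exists q. auto. Qed.
Lemma onG_down i s u : i ε Ix -> s ε TrI i -> u ε TrI i -> ex s u -> onG (op i u) -> onG (op i s).
Proof.
  intros Hi Hs Hu He (q & Gq & K). apply on_kid in K as [K1 K2]; auto. exists q. split; auto. apply on_kid; auto.
  split; auto. eapply ex_trans; eauto.
Qed.
Lemma onG_cmp i s t : i ε Ix -> s ε TrI i -> t ε TrI i -> onG (op i s) -> onG (op i t) -> cmp s t.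
Proof.
  intros Hi Hs Ht (p & Gp & Kp) (q & Gq & Kq). destruct (G_two p q _ _ Gp Gq Kp Kq) as (r & Gr & R1 & R2).
  apply on_kid in R1 as [_ R1]; auto. apply on_kid in R2 as [_ R2]; auto.
  apply (ex_cmp (kap (od i)) s t (uq r i)); auto. apply TrI_Ord.
Qed.
Lemma onG_gen i D : onG i -> dns i D -> exists s, s ε D /\ onG (op i s).
Proof.
  intros (p & Gp & Kp) [D1 D2]. pose proof (on_Ix p i Kp) as Hi.
  destruct (G_meetP (fun q => exists s, s ε D /\ on q (op i s))) with (p0 := p) as (r & Gr & _ & s & S1 & S2); [def|auto| |].
  - intros q Hq. assert (Qq : q ε Qs) by apply Hq. destruct (D2 (uq q i)) as (s & S1 & S2); [apply Qs_u; auto|].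
    destruct (set_u q i s Qq Hi (D1 s S1) S2) as (q' & Q1 & _ & Q3 & _). exists q'. split; [exact Q1|]. exists s. split; auto.
    apply on_kid; auto. split; [|rewrite Q3; apply ex_refl]. apply (ple_on q q'); auto. apply (ple_on p q); auto.
  - exists s. split; auto. exists r. auto.
Qed.
Lemma onG_lit1 x n : x ε la -> n ε om -> onG (lit (op x n) emp) \/ onG (lit (op x n) b1).
Proof.
  intros Hx Hn. destruct G_ne as [p Gp]. set (l0 := lit (op x n) emp). set (l1 := lit (op x n) b1).
  assert (L0 : l0 ε LitS) by (apply in_LitS; exists x, n, emp; auto using two0).
  assert (L1 : l1 ε LitS) by (apply in_LitS; exists x, n, b1; auto using two1).
  assert (E : lneg l0 = l1) by (unfold l0; rewrite lneg_lit, flip0; auto).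
  destruct (G_meetP (fun q => on q l0 \/ on q l1)) with (p0 := p) as (r & Gr & _ & [K|K]); [def|auto| | |].
  - intros q Hq. assert (Qq : q ε Qs) by apply Hq. destruct (classic (l1 ε bq q)) as [K|K].
    + exists q. split; [apply ple_refl; auto|]. right. apply on_lit; auto.
    + rewrite <- E in K. destruct (add_lit q l0 Qq L0 K) as (r & R1 & R2). exists r. split; [exact R1|]. left. apply on_lit; auto.
      rewrite R2. apply in_bun. right. apply in_sg. auto.
  - left. exists r; auto.
  - right. exists r; auto.
Qed.
Lemma onG_lit2 x n : x ε la -> n ε om -> onG (lit (op x n) emp) -> onG (lit (op x n) b1) -> False.
Proof.
  intros Hx Hn (p & Gp & Kp) (q & Gq & Kq). destruct (G_two p q _ _ Gp Gq Kp Kq) as (r & Gr & R1 & R2).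
  rewrite on_lit in * by (apply in_LitS; eauto 8 using two0, two1).
  pose proof (G_Qs r Gr) as Qr. apply Qs_b, in_Base in Qr as (_ & _ & C). apply (C _ R1). rewrite lneg_lit, flip0. auto.
Qed.
Lemma onG_dec i : i ε Ix -> onG i \/ exists q, G q /\ ~ poss q i.
Proof.
  intros Hi. destruct G_ne as [p Gp].
  destruct (G_meetP (fun q => on q i \/ ~ poss q i)) with (p0 := p) as (r & Gr & _ & [K|K]); [def|auto| | |].
  - intros q Hq. assert (Qq : q ε Qs) by apply Hq. destruct (classic (poss q i)) as [K|K].
    + destruct (poss_on i Hi q Qq K) as (r & R1 & R2). exists r. split; [exact R1|]. auto.
    + exists q. split; [apply ple_refl; auto|]. auto.
  - left. exists r; auto.
  - eauto.
Qed.
Lemma FMem_mono p q x y : FMem p x y -> le q p -> FMem q x y.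
Proof. intros [H0 H] Hq. split; [eapply le_l; eauto|]. intros r Hr. apply H. eapply le_trans; eauto. Qed.

#[local] Opaque FMem FEq opn.
(* Below some condition in the generic filter, everything true in [W] about the predicate is forced. *)
Lemma G_good (p0 : N) (Bad : N -> Prop) : D1 Bad -> G p0 -> (forall q, G q -> ~ Bad q) ->
  exists q1, G q1 /\ le q1 p0 /\ forall r, le r q1 -> ~ Bad r.
Proof.
  intros DB G0 NB.
  destruct (G_meetP (fun q => Bad q \/ forall r, le r q -> ~ Bad r)) with (p0 := p0) as (q & Gq & L & [K|K]); [def|auto| | |].
  - intros q Hq. destruct (classic (exists r, le r q /\ Bad r)) as [(r & R1 & R2)|K]; [eauto|].
    exists q. split; [eapply le_l; eauto|]. right. intros r Hr HB. eauto.
  - exfalso. eapply NB; eauto.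
  - eauto.
Qed.

(** Some condition in the filter excludes [i], and a stronger one has nothing below it that violates
    the two properties of the name of [B]; [off] applies to the latter. *)
Lemma offW i (B : W) : i ε Ix -> ~ onG i ->
  (forall D, dns i D -> exists s, s ε D /\ jW (op i s) ε B) ->
  (forall s t, s ε TrI i -> t ε TrI i -> jW (op i s) ε B -> jW (op i t) ε B -> cmp s t) -> False.
Proof.
  intros Hi Ni F1' F2'. destruct (onG_dec i Hi) as [K|(q0 & G0 & N0)]; [auto|]. destruct (cl_surj B) as [b ->].
  set (Y := fun q s => s ε TrI i /\ FMem q (chk (op i s)) b).
  assert (DY : D2 Y) by (unfold Y; def).
  assert (OY : forall q q' s, Y q s -> ple q' q -> Y q' s).
  { intros q q' s [K1 K2] L. split; auto. apply (FMem_mono q); auto. }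
  set (Bad q := (exists D, dns i D /\ forall q' s, ple q' q -> s ε D -> ~ Y q' s) \/ (exists s t, Y q s /\ Y q t /\ ~ cmp s t)).
  destruct (G_good q0 Bad) as (q1 & G1 & L1 & NB); [unfold Bad; def|auto| |].
  - intros q Gq [(D & HD & K)|(s & t & [S1 S2] & [T1 T2] & K)].
    + destruct (F1' D HD) as (s & Hs & M). rewrite jW_cl in M. apply cl_mem in M as (p & Gp & M). destruct (G_dir p q Gp Gq) as (r & Gr & R1 & R2).
      apply (K r s R2 Hs). split; [apply HD; auto|]. apply (FMem_mono p); auto.
    + apply K. apply F2'; auto; rewrite jW_cl; apply cl_mem; exists q; auto.
  - apply (off i q1 Y); auto.
    + exact (G_Qs q1 G1).
    + intros K. apply N0. apply (ple_poss q0 q1); auto.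
    + intros q D Hq HD. apply NNPP. intros K. apply (NB q Hq). left. exists D. split; auto. intros q' s Q1 Q2 Q3. apply K. eauto.
    + intros q s t Hq Hs Ht. apply NNPP. intros K. apply (NB q Hq). right. eauto.
Qed.

Lemma preserveW X Y A (f : W) : subs om A -> subs Y A -> subs X A0 -> ~ sm A X ->
  (forall x, x ε X -> exists y, y ε Y /\ op (jW x) (jW y) ε f) ->
  (forall x x' y, op (jW x) (jW y) ε f -> op (jW x') (jW y) ε f -> x = x') -> False.
Proof.
  intros HA HY HX NS F1' F2'. destruct (cl_surj f) as [b ->]. destruct G_ne as [q0 G0].
  assert (EJ : forall x y, op (jW x) (jW y) = cl (opn (chk x) (chk y))) by (intros; rewrite cl_op; reflexivity).
  set (J := fun q x y => FMem q (opn (chk x) (chk y)) b).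
  assert (DJ : D3 J) by (unfold J; def).
  assert (OJ : forall q q' x y, J q x y -> ple q' q -> J q' x y).
  { intros q q' x y K L. apply (FMem_mono q); auto. }
  set (Bad q := (exists x, x ε X /\ forall q' y, ple q' q -> y ε Y -> ~ J q' x y) \/ (exists x x' y, J q x y /\ J q x' y /\ x <> x')).
  assert (DB : D1 Bad) by (unfold Bad; clearbody J; clear - DJ; def).
  destruct (G_good q0 Bad) as (q1 & G1 & L1 & NB); [exact DB|auto| |].
  - intros q Gq [(x & Hx & K)|(x & x' & y & K1 & K2 & K)].
    + destruct (F1' x Hx) as (y & Hy & M). rewrite EJ in M. apply cl_mem in M as (p & Gp & M).
      destruct (G_dir p q Gp Gq) as (r & Gr & R1 & R2). apply (K r y R2 Hy). apply (FMem_mono p); auto.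
    + apply K. apply (F2' x x' y); [rewrite (EJ x y); exact (proj2 (cl_mem (opn (chk x) (chk y)) b) (ex_intro _ q (conj Gq K1)))|rewrite (EJ x' y); exact (proj2 (cl_mem (opn (chk x') (chk y)) b) (ex_intro _ q (conj Gq K2)))].
  - apply (preserve X Y A q1 J); auto.
    + exact (G_Qs q1 G1).
    + intros q x Hq Hx. apply NNPP. intros K. apply (NB q Hq). left. exists x. split; auto. intros q' y Q1 Q2 Q3. apply K. exists q', y. auto.
    + intros q x x' y Hq K1 K2. apply NNPP. intros K. apply (NB q Hq). right. exists x, x', y. auto.
Qed.

(** The literals of a condition are finite in number, so some natural number occurs in none of them
    and both bits there are free. *)
Lemma onG_diff x x' : x ε la -> x' ε la -> x <> x' -> exists n, n ε om /\ onG (lit (op x n) b1) /\ ~ onG (lit (op x' n) b1).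
Proof.
  intros Hx Hx' Nx. destruct G_ne as [p Gp].
  destruct (G_meetP (fun q => exists n, n ε om /\ on q (lit (op x n) b1) /\ on q (lit (op x' n) emp))) with (p0 := p)
    as (r & Gr & _ & n & Hn & K1 & K2); [def|auto| |].
  - intros q Hq. assert (Qq : q ε Qs) by apply Hq. destruct (proj1 (in_Base _) (Qs_b q Qq)) as (B1 & B2 & B3).
    destruct (fin_bd (bq q) (fun l => pi2 (pi1 (pi2 l)))) as (n & Hn & Kn); [def|auto|].
    assert (FR : forall x b, ~ lit (op x n) b ε bq q).
    { intros y b K. apply (mem_irr n). specialize (Kn _ K). unfold lit in Kn. rewrite !pi2_op, pi1_op, pi2_op in Kn. auto. }
    assert (L1 : lit (op x n) b1 ε LitS) by (apply in_LitS; exists x, n, b1; auto using two1).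
    assert (L2 : lit (op x' n) emp ε LitS) by (apply in_LitS; exists x', n, emp; auto using two0).
    destruct (add_lit q _ Qq L1) as (q1 & Q1 & E1); [rewrite lneg_lit; apply FR|].
    destruct (add_lit q1 (lit (op x' n) emp)) as (q2 & Q2 & E2); [apply Q1|auto| |].
    + rewrite E1, in_bun, in_sg, lneg_lit. intros [K|K]; [eapply FR; eauto|]. apply lit_inj in K as [K _].
      apply op_inj in K as [K _]. auto.
    + exists q2. split; [apply (ple_trans q q1); auto|]. exists n. split; auto. rewrite !on_lit by auto.
      rewrite E2, E1, !in_bun, !in_sg. auto.
  - exists n. split; auto. split; [exists r; auto|]. intros K. apply (onG_lit2 x' n); auto. exists r; auto.
Qed.

Lemma Gam_sol : sol (fun x => x ε Gam) (jW Ix) (jW Rn) (jW Pn) (jW En).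
Proof.
  split; [|split; [|split]].
  - intros w Hw. apply in_Gam in Hw as (i & Hi & ->). apply in_jW. exists i. split; auto. apply onG_Ix; auto.
  - intros t D K Ht. apply pin_op, in_jWop in K as (t' & D' & -> & -> & K). apply jW_Gam in Ht. unfold Rn in K.
    apply in_sep in K as [_ (t2 & D2 & E & K)]; [|def]. apply op_inj in E as [<- <-].
    assert (Q : exists d, d ε D' /\ onG d).
    { destruct K as [(i & s & Hi & Hs & -> & ->)|[(D2 & HD & ->)|(i & s & u & Hi & Hs & Hu & He & -> & ->)]].
      - exists i. split; [apply in_sg; auto|]. apply (onG_par i s); auto.
      - destruct (onG_gen t' D2 Ht HD) as (s & Hs & K). exists (op t' s). split; auto. apply in_img; [def|eauto].
      - exists (op i s). split; [apply in_sg; auto|]. apply (onG_down i s u); auto. }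
    destruct Q as (d & Hd & K'). exists (jW d). rewrite jW_Gam. split; auto. apply in_jW; eauto.
  - intros D HD. apply in_jW in HD as (D' & HD & ->). unfold Pn in HD. apply in_sep in HD as [_ (x & n & Hx & Hn & ->)]; [|def].
    destruct (onG_lit1 x n Hx Hn) as [K|K]; [exists (jW (lit (op x n) emp))|exists (jW (lit (op x n) b1))];
      (split; [apply in_jW|apply jW_Gam; auto]); eexists; (split; [apply in_upair|reflexivity]); auto.
  - intros u v K Hu Hv. apply pin_op, in_jWop in K as (u' & v' & -> & -> & K). apply jW_Gam in Hu, Hv. unfold En in K.
    apply in_sep in K as [_ (u2 & v2 & E & K)]; [|def]. apply op_inj in E as [<- <-].
    destruct K as [(x & n & Hx & Hn & -> & ->)|(i & s & t & Hi & Hs & Ht & Nc & -> & ->)].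
    + apply (onG_lit2 x n); auto.
    + apply Nc. apply (onG_cmp i s t); auto.
Qed.

(** Below each of its members [S] has a generic branch, so by [offW] all members are on. Conversely,
    consider an on index outside [S] of least [od]. For a literal, [S] would contain the opposite
    one; for a node, its parent is in [S] by minimality and the branch of [S] there must run along
    the branch of the generic set. *)
Lemma Gam_uniq (S : W) : sol (fun x => x ε S) (jW Ix) (jW Rn) (jW Pn) (jW En) -> S = Gam.
Proof.
  intros (S1 & S2 & S3 & S4).
  assert (sel : forall t D, op t D ε Rn -> jW t ε S -> exists d, d ε D /\ jW d ε S).
  { intros t D HR Ht. destruct (S2 (jW t) (jW D)) as (d & D1 & D2); [|exact Ht|].
    - apply pin_op, in_jWop. exists t, D. split; [reflexivity|]. split; [reflexivity|exact HR].
    - apply in_jW in D1 as (d' & D1 & ->). exists d'. split; assumption. }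
  assert (par : forall i s, i ε Ix -> s ε TrI i -> jW (op i s) ε S -> jW i ε S).
  { intros i s Hi Hs K. destruct (sel _ _ (Rn_par i s Hi Hs) K) as (d & D1 & D2). apply in_sg in D1 as ->. exact D2. }
  assert (gen : forall i D, i ε Ix -> dns i D -> jW i ε S -> exists s, s ε D /\ jW (op i s) ε S).
  { intros i D Hi HD K. destruct (sel _ _ (Rn_gen i D Hi HD) K) as (d & D1 & D2).
    apply in_img in D1 as (s & Hs & ->); [exists s; split; assumption|def]. }
  assert (down : forall i s u, i ε Ix -> s ε TrI i -> u ε TrI i -> ex s u -> jW (op i u) ε S -> jW (op i s) ε S).
  { intros i s u Hi Hs Hu He K. destruct (sel _ _ (Rn_down i s u Hi Hs Hu He) K) as (d & D1 & D2). apply in_sg in D1 as ->. exact D2. }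
  assert (lit1 : forall x n, x ε la -> n ε om -> jW (lit (op x n) emp) ε S \/ jW (lit (op x n) b1) ε S).
  { intros x n Hx Hn. destruct (S3 (jW (upair (lit (op x n) emp) (lit (op x n) b1)))) as (d & D1 & D2).
    - apply in_jW. eexists; split; [|reflexivity]. apply Pn_in; auto.
    - apply in_jW in D1 as (d' & D1 & ->). apply in_upair in D1 as [->| ->]; [left|right]; exact D2. }
  assert (excl : forall i s t, i ε Ix -> s ε TrI i -> t ε TrI i -> jW (op i s) ε S -> jW (op i t) ε S -> cmp s t).
  { intros i s t Hi Hs Ht K1 K2. apply NNPP. intros Nc. refine (S4 (jW (op i s)) (jW (op i t)) _ K1 K2).
    apply pin_op, in_jWop. eexists _, _. split; [reflexivity|]. split; [reflexivity|]. apply En_kid; auto. }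
  assert (sub : forall i, i ε Ix -> jW i ε S -> onG i).
  { intros i Hi K. apply NNPP. intros Ni. apply (offW i S Hi Ni).
    - intros D HD. exact (gen i D Hi HD K).
    - intros s t Hs Ht. exact (excl i s t Hi Hs Ht). }
  apply zext. intros w. split.
  - intros Hw. pose proof (S1 w Hw) as K. apply in_jW in K as (i & Hi & ->). exact (proj2 (jW_Gam i) (sub i Hi Hw)).
  - intros Hw. apply NNPP. intros Nw. apply in_Gam in Hw as (i & Hi & ->).
    (* [od] belongs to the ground model; its table on [Ix] is transported by [jW] so that the least
       counterexample can be sought in [W]. *)
    set (P := fun o => exists w, w ε Gam /\ ~ w ε S /\ op w o ε jW (lam Ix od)).
    destruct (Ord_least P) with (a := jW (od i)) as (o & Oo & (w & W1 & W2 & W3) & _ & L).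
    + unfold P. def.
    + apply (a_Ord jW), od_spec.
    + exists (jW i). split; [exact (proj2 (jW_Gam i) Hi)|]. split; [exact Nw|]. apply in_jWop. exists i, (od i). split; [reflexivity|]. split; [reflexivity|].
      apply op_lam; [def|]. split; [exact (onG_Ix i Hi)|reflexivity].
    + apply in_jWop in W3 as (k & o' & -> & -> & K). apply op_lam in K as [Hk ->]; [|def]. apply jW_Gam in W1.
      assert (MIN : forall j, j ε Ix -> od j ε od k -> onG j -> jW j ε S).
      { intros j Hj Hjk Gj. apply NNPP. intros Nj. apply (L (jW (od j))); [apply t_mem; auto|].
        exists (jW j). split; [exact (proj2 (jW_Gam j) Gj)|]. split; [exact Nj|]. apply in_jWop. exists j, (od j).
        split; [reflexivity|]. split; [reflexivity|]. apply op_lam; [def|]. split; [exact Hj|reflexivity]. }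
      destruct (Ix_cases k Hk) as [Hl|(j & s & Hj & Hs & ->)].
      * apply in_LitS in Hl as (x & n & b & Hx & Hn & Hb & ->). apply in_two in Hb as [->| ->].
        -- destruct (lit1 x n Hx Hn) as [K|K]; [exact (W2 K)|]. apply sub in K; [|apply lit_Ix; auto using two1].
           exact (onG_lit2 x n Hx Hn W1 K).
        -- destruct (lit1 x n Hx Hn) as [K|K]; [|exact (W2 K)]. apply sub in K; [|apply lit_Ix; auto using two0].
           exact (onG_lit2 x n Hx Hn K W1).
      * pose proof (onG_par j s Hj Hs W1) as Gj. pose proof (MIN j Hj (od_op j s) Gj) as Sj.
        (* [S] contains a node [t] that extends [s] or is incomparable with it. Both nodes are on,
           hence comparable, so [t] extends [s]. *)
        destruct (gen j _ Hj (dns_below j s Hs) Sj) as (t & Ht & K). apply in_sep in Ht as [Ht Kt]; [|def].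
        assert (Gt : onG (op j t)) by exact (sub _ (Ix_kid j t Hj Ht) K).
        pose proof (onG_cmp j s t Hj Hs Ht W1 Gt) as C. destruct Kt as [Kt|Kt]; [|destruct (Kt C)].
        exact (W2 (down j s t Hj Hs Ht Kt K)).
Qed.
End QPoset.

(** * Evaluating formulas *)

#[global] Opaque upair op sg bun suc pi1 pi2 sep img pow uni lam prod ran app.

(** One evaluation of the vocabulary serves formulas read in the whole model and formulas
    relativized to Imp; [C] is the range of the quantifiers. *)
Class relz (M : str) (rl : form -> form) (C : M -> Prop) : Prop := {
  rl_mem : forall i j, rl (fMem i j) = fMem i j;
  rl_eq : forall i j, rl (fEq i j) = fEq i j;
  rl_bot : rl fBot = fBot;
  rl_imp : forall A B, rl (fImp A B) = fImp (rl A) (rl B);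
  rl_all : forall r A, sat M r (rl (fAll A)) <-> forall x, C x -> sat M (x .: r) (rl A) }.

Section Eval.
Context {M : str} {rl : form -> form} {C : M -> Prop} {RZ : relz M rl C}.
(** The number of binders passed and the current assignment; the variable of level [k] is found at
    index [fst s - S k]. *)
Definition scope := (nat * (nat -> M))%type.
Implicit Types s : scope.
Definition ext s s' := fst s <= fst s' /\ forall i, snd s' (i + (fst s' - fst s)) = snd s i.
Lemma ext_refl s : ext s s.
Proof. split; auto. intros i. rewrite Nat.sub_diag, Nat.add_0_r. auto. Qed.
Lemma ext_trans s s' s'' : ext s s' -> ext s' s'' -> ext s s''.
Proof.
  intros [H1 H2] [H3 H4]. split; [lia|]. intros i. rewrite <- H2, <- H4. f_equal. lia.
Qed.
Definition Vd s (x : lvar) (v : M) := exists k, x = Lvl k /\ k < fst s /\ snd s (fst s - S k) = v /\ C v.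
Lemma Vd_ext s s' x v : ext s s' -> Vd s x v -> Vd s' x v.
Proof.
  intros [H1 H2] (k & -> & Hk & E & HC). exists k. split; auto. split; [lia|]. split; auto.
  rewrite <- E, <- H2. f_equal. lia.
Qed.
(* The phantom argument [C] lets the class of the relativization be inferred from a goal. *)
Definition FR s (A : fml) (P : Prop) := let _ := C in forall s', ext s s' -> (sat M (snd s') (rl (A (fst s'))) <-> P).
(** Denotation in continuation form, matching [bind]: whatever follows may be evaluated with a bound
    variable that stands for [v]. *)
Definition TV s (t : term) (v : M) := C v /\ forall s0, ext s s0 -> forall K P,
  (forall s' x, ext s0 s' -> Vd s' x v -> FR s' (K x) P) -> FR s0 (bind t K) P.
Lemma FR_ext s s' A P : ext s s' -> FR s A P -> FR s' A P.
Proof. intros E H s2 E2. apply H. eapply ext_trans; eauto. Qed.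
Lemma TV_ext s s' t v : ext s s' -> TV s t v -> TV s' t v.
Proof. intros E [H1 H2]. split; auto. intros s0 E0. apply H2. eapply ext_trans; eauto. Qed.
Lemma FR_iff s A P P' : FR s A P -> (P <-> P') -> FR s A P'.
Proof. intros H E s' E'. rewrite (H s' E'). auto. Qed.
Lemma FR_bot s : FR s botF False.
Proof. intros s' _. unfold botF. rewrite rl_bot. simpl. tauto. Qed.
Lemma FR_imp s A B P Q : FR s A P -> (P -> FR s B Q) -> FR s (A ⇒ B)%fml (P -> Q).
Proof.
  intros HA HB s' E. unfold implF. rewrite rl_imp. simpl. rewrite (HA s' E).
  split; intros H p; apply (HB p s' E); auto.
Qed.
Lemma FR_all s Q (P : M -> Prop) : (forall s' x v, ext s s' -> Vd s' x v -> FR s' (Q x) (P v)) ->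
  FR s (allF Q) (forall v, C v -> P v).
Proof.
  intros H s' E. unfold allF. rewrite rl_all.
  assert (K : forall v, C v -> (sat M (v .: snd s') (rl (Q (Lvl (fst s')) (S (fst s')))) <-> P v)).
  { intros v Cv. assert (E' : ext s' (S (fst s'), v .: snd s')).
    { split; cbn [fst snd]; [lia|]. intros i. replace (i + (S (fst s') - fst s')) with (S i) by lia. reflexivity. }
    refine (H (S (fst s'), v .: snd s') (Lvl (fst s')) v _ _ (S (fst s'), v .: snd s') _).
    - eapply ext_trans; eauto.
    - exists (fst s'). split; auto. split; cbn [fst snd]; [lia|]. split; [|auto]. rewrite Nat.sub_diag. reflexivity.
    - apply ext_refl. }
  split; intros L v Cv; apply K; auto.
Qed.
Lemma FR_allT s Q (P : M -> Prop) : (forall v, C v) -> (forall s' x v, ext s s' -> Vd s' x v -> FR s' (Q x) (P v)) ->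
  FR s (allF Q) (forall v, P v).
Proof. intros HC H. eapply FR_iff; [apply FR_all, H|]. split; auto. Qed.
Lemma FR_not s A P : FR s A P -> FR s (¬ A)%fml (~ P).
Proof. intros H. apply FR_imp; auto. intros _. apply FR_bot. Qed.
(** The second conjunct is evaluated under the first, since some of its terms may denote only
    then. *)
Lemma FR_and s A B P Q : FR s A P -> (P -> FR s B Q) -> FR s (A ∧ B)%fml (P /\ Q).
Proof.
  intros HA HB. eapply FR_iff; [apply FR_not, FR_imp; [exact HA|]|].
  - intros p. apply FR_not, HB, p.
  - tauto.
Qed.
Lemma FR_or s A B P Q : FR s A P -> FR s B Q -> FR s (A ∨ B)%fml (P \/ Q).
Proof. intros HA HB. eapply FR_iff; [apply FR_imp; [apply FR_not, HA|intros _; exact HB]|]. tauto. Qed.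
Lemma FR_iffF s A B P Q : FR s A P -> FR s B Q -> FR s (A ⇔ B)%fml (P <-> Q).
Proof.
  intros HA HB. unfold iffF. eapply FR_iff; [apply FR_and; [apply FR_imp; [exact HA|intros _; exact HB]|]|].
  - intros _. apply FR_imp; [exact HB|intros _; exact HA].
  - tauto.
Qed.
Lemma FR_ex s Q (P : M -> Prop) : (forall s' x v, ext s s' -> Vd s' x v -> FR s' (Q x) (P v)) ->
  FR s (exF Q) (exists v, C v /\ P v).
Proof.
  intros H. eapply FR_iff; [apply FR_not, FR_all; intros s' x v E Hv; apply FR_not, H; eauto|].
  split.
  - intros K. apply NNPP. intros L. apply K. intros v Cv Pv. eauto.
  - intros (v & Cv & Pv) K. eapply K; eauto.
Qed.
Lemma FR_exT s Q (P : M -> Prop) : (forall v, C v) -> (forall s' x v, ext s s' -> Vd s' x v -> FR s' (Q x) (P v)) ->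
  FR s (exF Q) (exists v, P v).
Proof. intros HC H. eapply FR_iff; [apply FR_ex, H|]. split; [intros (v & _ & K)|intros (v & K)]; eauto. Qed.
Lemma TV_C s t v : TV s t v -> C v. Proof. intros H. apply H. Qed.
Lemma Vd_C s x v : Vd s x v -> C v. Proof. intros (k & _ & _ & _ & H). auto. Qed.
Lemma TV_var s x v : Vd s x v -> TV s (Var x) v.
Proof. intros H. split; [eapply Vd_C; eauto|]. intros s0 E K P HK. simpl. apply HK; [apply ext_refl|]. eapply Vd_ext; eauto. Qed.
Lemma TV_The s Q v : C v -> (forall s' x m, ext s s' -> Vd s' x m -> FR s' (Q x) (m = v)) -> TV s (The Q) v.
Proof.
  intros Cv H. split; auto. intros s0 E0 K P HK. simpl.
  eapply FR_iff with (P := exists m, C m /\ (m = v /\ P)).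
  - apply FR_ex. intros s' x m E Hm. apply FR_and; [apply H; auto; eapply ext_trans; eauto|]. intros ->. apply HK; auto.
  - split; [intros (m & _ & _ & p); auto|eauto].
Qed.
Lemma FR_bind s t v K P : TV s t v -> (forall s' x, ext s s' -> Vd s' x v -> FR s' (K x) P) -> FR s (bind t K) P.
Proof. intros [_ H] HK. apply H; auto. apply ext_refl. Qed.
(** Russell's convention: with a description that nothing satisfies, the atom is false. *)
Lemma FR_none s Q K : (forall s' x m, ext s s' -> Vd s' x m -> FR s' (Q x) False) -> FR s (bind (The Q) K) False.
Proof.
  intros H. simpl. eapply FR_iff with (P := exists m, C m /\ (False /\ False)); [|split; [intros (m & _ & [] & _)|tauto]].
  apply FR_ex. intros s' x m E Hm. apply FR_and; [eapply H; eauto|intros []].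
Qed.
Lemma FR_mem s t u v w : TV s t v -> TV s u w -> FR s (t ∈ u)%fml (v ε w).
Proof.
  intros Ht Hu. eapply FR_bind; [exact Ht|]. intros s1 x E1 Hx. eapply FR_bind; [eapply TV_ext; eauto|].
  intros s2 y E2 Hy s3 E3. simpl. rewrite rl_mem. simpl.
  assert (Hx' : Vd s3 x v) by exact (Vd_ext _ _ _ _ (ext_trans _ _ _ E2 E3) Hx).
  assert (Hy' : Vd s3 y w) by exact (Vd_ext _ _ _ _ E3 Hy).
  destruct Hx' as (k & -> & _ & <- & _), Hy' as (l & -> & _ & <- & _). simpl. tauto.
Qed.
Lemma FR_eq s t u v w : TV s t v -> TV s u w -> FR s (t ≡ u)%fml (v = w).
Proof.
  intros Ht Hu. eapply FR_bind; [exact Ht|]. intros s1 x E1 Hx. eapply FR_bind; [eapply TV_ext; eauto|].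
  intros s2 y E2 Hy s3 E3. simpl. rewrite rl_eq. simpl.
  assert (Hx' : Vd s3 x v) by exact (Vd_ext _ _ _ _ (ext_trans _ _ _ E2 E3) Hx).
  assert (Hy' : Vd s3 y w) by exact (Vd_ext _ _ _ _ E3 Hy).
  destruct Hx' as (k & -> & _ & <- & _), Hy' as (l & -> & _ & <- & _). simpl. tauto.
Qed.
Lemma FR_exu s Q (P : M -> Prop) : (forall s' x v, ext s s' -> Vd s' x v -> FR s' (Q x) (P v)) ->
  FR s (exuF Q) (exists v, C v /\ (P v /\ forall w, C w -> P w -> w = v)).
Proof.
  intros H. apply FR_ex. intros s1 x v E1 Hv. apply FR_and; [apply H; auto|]. intros _. apply FR_all.
  intros s2 y w E2 Hw. apply FR_imp; [apply H; auto; eapply ext_trans; eauto|]. intros _.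
  apply FR_eq; apply TV_var; auto. eapply Vd_ext; eauto.
Qed.

Context (Ctr : forall x y, C x -> y ε x -> C y).
Lemma FR_allin s t w (Q : lvar -> fml) (P : M -> Prop) : TV s t w ->
  (forall s' x v, ext s s' -> Vd s' x v -> v ε w -> FR s' (Q x) (P v)) -> FR s (allF (fun x => memF x t ⇒ Q x)%fml) (forall v, v ε w -> P v).
Proof.
  intros Ht H. eapply FR_iff with (P := forall v, C v -> (v ε w -> P v)).
  - apply FR_all. intros s' x v E Hv. apply FR_imp; [|auto]. apply FR_mem; [apply TV_var; auto|eapply TV_ext; eauto].
  - split; intros K v Hv; auto. apply K; auto. eapply Ctr; eauto. eapply TV_C; eauto.
Qed.
Lemma FR_exin s t w (Q : lvar -> fml) (P : M -> Prop) : TV s t w ->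
  (forall s' x v, ext s s' -> Vd s' x v -> v ε w -> FR s' (Q x) (P v)) -> FR s (exF (fun x => memF x t ∧ Q x)%fml) (exists v, v ε w /\ P v).
Proof.
  intros Ht H. eapply FR_iff with (P := exists v, C v /\ (v ε w /\ P v)).
  - apply FR_ex. intros s' x v E Hv. apply FR_and; [|auto]. apply FR_mem; [apply TV_var; auto|eapply TV_ext; eauto].
  - split; [intros (v & _ & K); eauto|]. intros (v & K1 & K2). exists v. split; auto. eapply Ctr; eauto. eapply TV_C; eauto.
Qed.
End Eval.
Arguments scope : clear implicits.

Ltac lift E :=
  lazymatch type of E with
  | ext ?s ?s' =>
    repeat match goal with
    | H : Vd s ?x ?v |- _ => apply (Vd_ext _ _ _ _ E) in H
    | H : TV s ?x ?v |- _ => apply (TV_ext _ _ _ _ E) in H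
    | H : FR s ?x ?v |- _ => apply (FR_ext _ _ _ _ E) in H
    end; clear E
  end.
Ltac tvhook := fail.
Ltac tv := cbv beta; lazymatch goal with
  | |- TV ?s (Var ?x) _ => match goal with H : Vd s x ?v |- _ => exact (TV_var s x v H) end
  | |- TV ?s ?t _ => first [match goal with H : TV s t ?v |- _ => exact H end | tvhook] end.
Ltac frhook := fail.
Ltac bnd := let s := fresh "s" in let x := fresh "x" in let v := fresh "v" in let E := fresh "E" in let H := fresh "H" in
  intros s x v E H; lift E.
Ltac frstep :=
  lazymatch goal with
  | |- FR _ _ _ => first
    [ match goal with H : FR ?s ?A ?P |- FR ?s ?A _ => exact H end | frhook
    | lazymatch goal with
      | |- FR _ botF _ => apply FR_bot
      | |- FR _ (memF _ _) _ => eapply FR_mem; [tv|tv]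
      | |- FR _ (eqF _ _) _ => eapply FR_eq; [tv|tv]
      | |- FR _ (bind _ _) _ => eapply FR_bind; [tv|let s := fresh "s" in let x := fresh "x" in let E := fresh "E" in let H := fresh "H" in intros s x E H; lift E]
      | |- FR _ (exuF _) _ => eapply FR_exu; bnd
      | |- FR _ (iffF _ _) _ => eapply FR_iffF
      | |- FR _ (andF _ _) _ => eapply FR_and; [|intros ?]
      | |- FR _ (orF _ _) _ => eapply FR_or
      | |- FR _ (implF _ botF) _ => eapply FR_not
      | |- FR _ (allF (fun x => implF (memF (Var x) _) _)) _ =>
          eapply FR_allin; [assumption|tv|let H := fresh "H" in bnd; intros H]
      | |- FR _ (exF (fun x => andF (memF (Var x) _) _)) _ =>
          eapply FR_exin; [assumption|tv|let H := fresh "H" in bnd; intros H]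
      | |- FR _ (implF _ _) _ => eapply FR_imp; [|intros ?]
      | |- FR _ (allF _) _ => first [eapply FR_allT; [assumption|bnd] | eapply FR_all; bnd]
      | |- FR _ (exF _) _ => first [eapply FR_exT; [assumption|bnd] | eapply FR_ex; bnd]
      end ]
  end.
Ltac fr := repeat (cbv beta; frstep).

Definition FnT {M} {Z : ZFm M} (f X Y : M) := Fn f X /\ forall x y, op x y ε f -> y ε Y.
Definition inj {M} {Z : ZFm M} (f X Y : M) := FnT f X Y /\ forall x x' y, op x y ε f -> op x' y ε f -> x = x'.
Definition isLim {M} {Z : ZFm M} (a : M) := Ord a /\ a <> emp /\ ~ exists x, a = suc x.

(** * Set-theoretic vocabulary in a transitive class *)

Section Vocab.
Context {M : str} {Z : ZFm M} {rl : form -> form} {C : M -> Prop} {RZ : relz M rl C}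
  (Ctr : forall x y, C x -> y ε x -> C y) (Ce : C emp) (Cp : forall x y, C x -> C y -> C (upair x y))
  (Cs : forall x, C x -> C (suc x)) (Co : C om).
Implicit Types s : scope M.
Local Notation FR := (@FR M rl C).
Local Notation TV := (@TV M rl C).
Local Notation Vd := (@Vd M C).
Lemma C_op x y : C x -> C y -> C (op x y). Proof. Transparent op sg. unfold op, sg. Opaque op sg. auto. Qed.
Lemma C_op1 x y p : C p -> op x y ε p -> C x /\ C y.
Proof.
  intros Hp H. assert (K : C (op x y)) by eauto. Transparent op sg. unfold op, sg in K. Opaque op sg.
  assert (K2 : C (upair x y)) by (eapply Ctr; [exact K|]; apply in_upair; auto).
  split; eapply Ctr; eauto; apply in_upair; auto.
Qed.
Lemma C_ext m v : C m -> C v -> (forall z, C z -> (z ε m <-> z ε v)) -> m = v.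
Proof. intros Cm Cv H. apply zext. intros z. split; intros K; (apply H; [|exact K]); [exact (Ctr _ _ Cm K)|exact (Ctr _ _ Cv K)]. Qed.
Lemma FR_subset s t u v w : TV s t v -> TV s u w -> FR s (subset t u) (subs v w).
Proof. intros. unfold subset. fr. Qed.
Lemma TV_Empty s : TV s Empty emp.
Proof.
  apply TV_The; auto. bnd. eapply FR_iff; [fr|]. split; [|intros ->; intros z Hz; exact (in_emp z Hz)].
  intros K. apply C_ext; [eapply Vd_C; eauto|auto|]. intros z Cz. split; intros L; exfalso; [eapply K|eapply in_emp]; eauto.
Qed.
Lemma TV_UPair s t u v w : TV s t v -> TV s u w -> TV s (UPair t u) (upair v w).
Proof.
  intros Ht Hu. apply TV_The; [apply Cp; eapply TV_C; eauto|]. bnd. eapply FR_iff; [fr|].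
  split; [|intros ->; intros; apply in_upair].
  intros K. apply C_ext; [eapply Vd_C; eauto|apply Cp; eapply TV_C; eauto|]. intros z Cz. rewrite in_upair. auto.
Qed.
Lemma TV_OPair s t u v w : TV s t v -> TV s u w -> TV s (OPair t u) (op v w).
Proof.
  intros Ht Hu. assert (C v) by (eapply TV_C; eauto). assert (C w) by (eapply TV_C; eauto).
  apply TV_The; [apply C_op; auto|]. bnd. eapply FR_bind; [exact Ht|]. intros s1 x1 E1 G1. lift E1.
  eapply FR_bind; [exact Hu|]. intros s2 x2 E2 G2. lift E2.
  apply FR_eq; [apply TV_var; auto|]. Transparent op sg. unfold op, sg. Opaque op sg.
  apply TV_UPair; apply TV_UPair; apply TV_var; auto.
Qed.
Lemma TV_Succ s t v : TV s t v -> TV s (Succ t) (suc v).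
Proof.
  intros Ht. apply TV_The; [apply Cs; eapply TV_C; eauto|]. bnd. eapply FR_iff; [fr|].
  split; [|intros ->; intros; apply in_suc].
  intros K. apply C_ext; [eapply Vd_C; eauto|apply Cs; eapply TV_C; eauto|]. intros z Cz. rewrite in_suc. auto.
Qed.
Ltac tvhook ::= lazymatch goal with
  | |- TV _ Empty _ => apply TV_Empty
  | |- TV _ (UPair _ _) _ => eapply TV_UPair; [tv|tv]
  | |- TV _ (OPair _ _) _ => eapply TV_OPair; [tv|tv]
  | |- TV _ (Succ _) _ => eapply TV_Succ; tv
  end.
Ltac frhook ::= lazymatch goal with |- FR _ (subset _ _) _ => eapply FR_subset; [tv|tv] end.
Lemma FR_transitive s t v : TV s t v -> FR s (transitive t) (tr v).
Proof. intros. unfold transitive. fr. Qed.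
Lemma FR_ordinal s t v : TV s t v -> FR s (ordinal t) (Ord v).
Proof.
  intros. unfold ordinal. apply FR_and; [apply FR_transitive; auto|]. intros _. eapply FR_allin; [auto|tv|].
  bnd. intros _. apply FR_transitive. tv.
Qed.
Lemma FR_successor s t v : TV s t v -> FR s (successor t) (exists x, v = suc x).
Proof.
  intros Ht. unfold successor. eapply FR_iff; [fr|]. split; [intros (x & _ & E); eauto|]. intros (x & ->).
  exists x. split; auto. eapply Ctr; [eapply TV_C; eauto|]. apply in_suc; auto.
Qed.
Lemma FR_limit s t v : TV s t v -> FR s (limit t) (isLim v).
Proof.
  intros. unfold limit. apply FR_and; [apply FR_ordinal; auto|]. intros _. apply FR_and; [fr|]. intros _.
  apply FR_not, FR_successor; auto.
Qed.
Lemma FR_natural s t v : TV s t v -> FR s (natural t) (v ε om).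
Proof.
  intros Ht. eapply FR_iff with (P := Ord v /\ forall x, x ε suc v -> x = emp \/ exists y, x = suc y).
  - unfold natural. apply FR_and; [apply FR_ordinal; auto|]. intros _. eapply FR_allin; [auto|tv|]. bnd. intros _.
    apply FR_or; [fr|]. apply FR_successor. tv.
  - rewrite <- natS_om. unfold natS. split; intros [H1 H2]; (split; [auto|]); intros x Hx.
    + destruct (H2 x) as [->|(y & ->)]; [apply in_suc; auto|left; apply in_emp|right; exists y; apply in_suc].
    + apply in_suc in Hx. destruct (H2 x Hx) as [K|(y & K)].
      * left. apply zext. intros z. split; intros L; exfalso; [eapply K|eapply in_emp]; eauto.
      * right. exists y. apply zext. intros z. rewrite in_suc. apply K.
Qed.
Lemma TV_Omega s : TV s Omega om.
Proof.
  apply TV_The; auto. bnd. eapply FR_iff with (P := forall n, C n -> (n ε v <-> n ε om)).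
  - apply FR_all. bnd. apply FR_iffF; [fr|]. apply FR_natural. tv.
  - split; [|intros ->; tauto]. intros K. apply C_ext; auto. eapply Vd_C; eauto.
Qed.
Lemma FR_function_on s f D v w : TV s f v -> TV s D w -> FR s (function_on f D) (Fn v w).
Proof.
  intros Hf HD. pose proof (TV_C _ _ _ Hf) as Cv. pose proof (TV_C _ _ _ HD) as Cw. unfold function_on. eapply FR_iff; [fr|].
  split; intros [H1 H2]; split.
  - intros p Hp. destruct (H1 p Hp) as (x & Hx & y & _ & ->). eauto.
  - intros x Hx. destruct (H2 x Hx) as (y & _ & Hy & K). exists y. split; auto. intros y' Hy'. apply K; auto.
    eapply C_op1; [|exact Hy']; auto.
  - intros p Hp. destruct (H1 p Hp) as (x & y & Hx & ->). exists x. split; auto. exists y. split; auto. eapply C_op1; [|exact Hp]; auto.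
  - intros x Hx. destruct (H2 x Hx) as (y & Hy & K). exists y. split; [eapply C_op1; [|exact Hy]; auto|]. auto.
Qed.
Ltac frhook ::= lazymatch goal with
  | |- FR _ (subset _ _) _ => eapply FR_subset; [tv|tv]
  | |- FR _ (function_on _ _) _ => eapply FR_function_on; [tv|tv]
  end.
Lemma FR_function s f D Y v w y : TV s f v -> TV s D w -> TV s Y y -> FR s (function f D Y) (FnT v w y).
Proof.
  intros Hf HD HY. pose proof (TV_C _ _ _ Hf) as Cv. unfold function. eapply FR_iff; [fr|].
  unfold FnT. split; intros [H1 H2]; (split; [auto|]).
  - intros x z Hx. destruct (C_op1 _ _ _ Cv Hx). eauto.
  - intros x _ z _ Hx. eauto.
Qed.
Ltac frhook ::= lazymatch goal with
  | |- FR _ (subset _ _) _ => eapply FR_subset; [tv|tv]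
  | |- FR _ (function_on _ _) _ => eapply FR_function_on; [tv|tv]
  | |- FR _ (function _ _ _) _ => eapply FR_function; [tv|tv|tv]
  end.
Lemma FR_injection s f D Y v w y : TV s f v -> TV s D w -> TV s Y y -> FR s (injection f D Y) (inj v w y).
Proof.
  intros Hf HD HY. pose proof (TV_C _ _ _ Hf) as Cv. unfold injection. eapply FR_iff; [fr|].
  unfold inj. split; intros [H1 H2]; (split; [auto|]).
  - intros x x' z Hx Hx'. destruct (C_op1 _ _ _ Cv Hx), (C_op1 _ _ _ Cv Hx'). eauto.
  - intros x _ x' _ z _ Hx Hx'. eauto.
Qed.
Lemma FR_countable s t v : TV s t v -> FR s (countable t) (exists f, C f /\ inj f v om).
Proof. intros Ht. unfold countable. apply FR_ex. bnd. apply FR_injection; [tv|tv|apply TV_Omega]. Qed.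
Lemma TV_Pow s t v p : TV s t v -> C p -> (forall z, z ε p <-> C z /\ subs z v) -> TV s (Pow t) p.
Proof.
  intros Ht Cp' H. apply TV_The; auto. bnd. eapply FR_iff; [fr|]. split.
  - intros K. apply C_ext; [eapply Vd_C; eauto|auto|]. intros z Cz. rewrite H, K by auto. tauto.
  - intros ->. intros z Cz. rewrite H. tauto.
Qed.

Definition Om1 (k : M) := Ord k /\ ~ (exists f, C f /\ inj f k om) /\ forall b, b ε k -> exists f, C f /\ inj f b om.
(** If nothing in the class satisfied [Om1], the term [Omega1] would not denote and no value of [f]
    could be said to lie in it, although [f] has a value at [emp]. Of the bijection only injectivity
    is extracted. *)
Lemma CH_inv s P : C P -> (forall z, z ε P <-> C z /\ subs z om) -> sat M (snd s) (rl (CH (fst s))) ->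
  exists f k, C f /\ C k /\ Om1 k /\ inj f P k.
Proof.
  intros CP HP H. apply NNPP. intros NE.
  assert (O1 : forall s x m, Vd s x m -> FR s (ordinal x ∧ ¬ countable x ∧ ∀[b ∈ x] countable b)%fml (Om1 m)).
  { intros s0 x m Hm. unfold Om1. apply FR_and; [apply FR_ordinal; tv|]. intros _. apply FR_and; [apply FR_not, FR_countable; tv|]. intros _.
    eapply FR_allin; [auto|tv|]. bnd. intros _. apply FR_countable. tv. }
  assert (F : FR s CH False); [|apply (F s (ext_refl s)); exact H].
  assert (TP : forall s, TV s (Pow Omega) P) by (intros; eapply TV_Pow; eauto; apply TV_Omega).
  unfold CH. eapply FR_iff with (P := exists f, C f /\ (False /\ True)); [|split; [intros (f & _ & [] & _)|tauto]].
  apply FR_ex. bnd. apply FR_and; [|intros []].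
  destruct (classic (exists k, C k /\ Om1 k)) as [(k & Ck & Hk)|Nk].
  - eapply FR_iff; [apply FR_injection; [tv|apply TP|]|].
    + apply (TV_The _ _ k Ck). intros s1 x1 m E1 H1. eapply FR_iff; [apply O1; eauto|].
      assert (Cm : C m) by (eapply Vd_C; eauto).
      split; [|intros ->; auto]. intros (A1 & A2 & A3). destruct Hk as (B1 & B2 & B3).
      destruct (Ord_tri m k A1 B1) as [L|[L|L]]; auto; exfalso; [apply A2, B3|apply B2, A3]; auto.
    + split; [|tauto]. intros K. apply NE. exists v, k. split; [eapply Vd_C; eauto|auto].
  - assert (K : FR s0 (injection x (Pow Omega) Omega1) False); [|exact K].
    unfold injection, function. eapply FR_iff with (P := False /\ True); [|tauto]. apply FR_and; [|intros []].
    eapply FR_iff with (P := Fn v P /\ (forall x, C x -> forall y, C y -> op x y ε v -> False)).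
    + apply FR_and; [apply FR_function_on; [tv|apply TP]|]. intros _. apply FR_all. bnd. apply FR_all. bnd. apply FR_imp; [fr|].
      intros _. unfold memF. simpl. apply FR_none. intros s3 x3 m E3 H3. eapply FR_iff; [apply O1; eauto|].
      split; [|tauto]. intros K. apply Nk. exists m. split; [eapply Vd_C; eauto|auto].
    + split; [|tauto]. intros [K1 K2]. destruct (proj2 K1 emp) as (y & Hy & _).
      * apply HP. split; auto. intros z Hz. exfalso. eapply in_emp; eauto.
      * assert (Cv : C v) by (eapply Vd_C; eauto). destruct (C_op1 _ _ _ Cv Hy) as [C1 C2]. exact (K2 _ C1 _ C2 Hy).
Qed.
End Vocab.

(** * The theory ZF in a model *)

Definition CT {M : str} (_ : M) := True.
#[export] Instance relz_id (M : str) : relz M (fun A => A) (@CT M).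
Proof. split; auto. intros r A. simpl. unfold CT. split; auto. Qed.

Lemma sat_iter M n A : (forall r, sat M r (Nat.iter n fAll A)) <-> forall r, sat M r A.
Proof.
  induction n; [tauto|]. rewrite <- IHn. simpl. split; intros H r.
  - rewrite <- (scons_eta r). apply H.
  - intros x. apply H.
Qed.
Lemma bound_iter n A : bound (Nat.iter n fAll A) = bound A - n.
Proof. induction n; simpl; [lia|]. rewrite IHn. lia. Qed.
Lemma ZF_bound A : ZF A -> bound A = 0.
Proof. intros []; try reflexivity; unfold uclose; rewrite bound_iter; lia. Qed.

Section ZFinModels.
Context {M : str}.
Local Notation FR := (@FR M (fun A => A) (@CT M)).
Local Notation TV := (@TV M (fun A => A) (@CT M)).
Local Notation Vd := (@Vd M (@CT M)).
Lemma CT_all : forall v, @CT M v. Proof. intros v. exact I. Qed.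
Lemma CT_tr : forall x y : M, CT x -> y ε x -> CT y. Proof. intros. exact I. Qed.
Ltac ini := pose proof CT_all as AC; pose proof CT_tr as Ctr.

Lemma FR_memThe s (Q : lvar -> fml) u (P : M -> Prop) w : (forall s' x v, ext s s' -> Vd s' x v -> FR s' (Q x) (P v)) -> TV s u w ->
  FR s (memF (The Q) u) (exists m, P m /\ m ε w).
Proof.
  intros H Hu. unfold memF. simpl. apply FR_exT; [apply CT_all|]. intros s' x v E Hv. apply FR_and; [auto|]. intros _.
  refine (FR_mem s' (Var x) u v w _ _); [apply TV_var; auto|eapply TV_ext; eauto].
Qed.
Lemma FR_ext_ax s : FR s extensionality (forall x y : M, (forall z, z ε x <-> z ε y) -> x = y).
Proof. ini. unfold extensionality. fr. Qed.
Lemma FR_fnd_ax s : FR s foundation (forall a : M, (exists x, x ε a) -> exists x, x ε a /\ ~ exists z, z ε x /\ z ε a).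
Proof. ini. unfold foundation. fr. Qed.
Lemma FR_pair_ax s : FR s pairing (forall x y : M, exists p, forall z, z ε p <-> z = x \/ z = y).
Proof. ini. unfold pairing. fr. Qed.
Lemma FR_union_ax s : FR s union (forall a : M, exists u, forall z, z ε u <-> exists x, x ε a /\ z ε x).
Proof. ini. unfold union. fr. Qed.
Lemma FR_pow_ax s : FR s powerset (forall a : M, exists p, forall z, z ε p <-> subs z a).
Proof. ini. unfold powerset, subset. fr. Qed.
Lemma FR_inf_ax s : FR s infinity (exists w : M, (exists o, o ε w /\ forall z, ~ z ε o) /\
           forall x, x ε w -> exists s, s ε w /\ forall z, z ε s <-> z ε x \/ z = x).
Proof.
  ini. eapply FR_iff with (P := exists w : M, (exists o, (forall z, z ε o -> False) /\ o ε w) /\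
           forall x, x ε w -> exists s, (forall z, z ε s <-> z ε x \/ z = x) /\ s ε w).
  - unfold infinity. apply FR_exT; auto. bnd. apply FR_and.
    + apply FR_memThe; [|tv]. bnd. fr.
    + intros _. eapply FR_allin; [auto|tv|]. bnd. intros _. apply FR_memThe; [|tv]. bnd. fr.
  - split; intros (w & (o & H1 & H2) & H3); exists w; (split; [exists o; auto|]); intros x Hx;
      destruct (H3 x Hx) as (u & K1 & K2); exists u; auto.
Qed.
Lemma FR_choice_ax s : FR s choice (forall a : M, (forall x, x ε a -> exists z, z ε x) ->
  (forall x, x ε a -> forall y, y ε a -> (exists z, z ε x /\ z ε y) -> x = y) ->
  exists c, forall x, x ε a -> exists z, CT z /\ ((z ε x /\ z ε c) /\ forall y, CT y -> y ε x /\ y ε c -> y = z)).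
Proof. ini. unfold choice. fr. Qed.
Lemma FR_subst1 r s A x v : ext (0, r) s -> Vd s x v -> FR s (subst A [x]) (sat M (v .: r) A).
Proof.
  intros E Hx s' E'. unfold subst. rewrite sat_ren.
  assert (K : (fun i => snd s' (nth i (map (idx (fst s')) [x]) (fst s' + (i - length [x])))) = v .: r); [|rewrite K; tauto].
  pose proof (ext_trans _ _ _ E E') as [_ E2]. cbn [fst snd] in E2. pose proof (Vd_ext _ _ _ _ E' Hx) as (k & -> & _ & Ek & _).
  extensionality i. destruct i as [|i]; cbn [nth map length scons idx]; [exact Ek|]. rewrite <- (E2 i).
  destruct i; cbn [nth]; f_equal; lia.
Qed.
Lemma FR_subst2 r s A x y v w : ext (0, r) s -> Vd s x v -> Vd s y w -> FR s (subst A [x; y]) (sat M (v .: (w .: r)) A).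
Proof.
  intros E Hx Hy s' E'. unfold subst. rewrite sat_ren.
  assert (K : (fun i => snd s' (nth i (map (idx (fst s')) [x; y]) (fst s' + (i - length [x; y])))) = v .: (w .: r)); [|rewrite K; tauto].
  pose proof (ext_trans _ _ _ E E') as [_ E2]. cbn [fst snd] in E2. pose proof (Vd_ext _ _ _ _ E' Hx) as (k & -> & _ & Ek & _).
  pose proof (Vd_ext _ _ _ _ E' Hy) as (l & -> & _ & El & _).
  extensionality i. destruct i as [|[|i]]; cbn [nth map length scons idx]; [exact Ek|exact El|]. rewrite <- (E2 i).
  destruct i; cbn [nth]; f_equal; lia.
Qed.
Lemma sat_separation r A : sat M r (separation A 0) <-> forall a : M, exists b, forall z, z ε b <-> z ε a /\ sat M (z .: r) A.
Proof.
  cut (FR (0, r) (separation A) (forall a : M, exists b, forall z, z ε b <-> z ε a /\ sat M (z .: r) A)).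
  { intros K. exact (K (0, r) (ext_refl _)). }
  ini. unfold separation. apply FR_allT; auto. intros s1 x1 v1 E1 V1. apply FR_exT; auto. intros s2 x2 v2 E2 V2.
  apply FR_allT; auto. intros s3 x3 v3 E3 V3. assert (E : ext (0, r) s3) by eauto using ext_trans.
  pose proof (Vd_ext _ _ _ _ (ext_trans _ _ _ E2 E3) V1). pose proof (Vd_ext _ _ _ _ E3 V2).
  apply FR_iffF; [fr|]. apply FR_and; [fr|]. intros _. apply FR_subst1; auto.
Qed.
Lemma sat_replacement r A : sat M r (replacement A 0) <->
  ((forall x y y' : M, sat M (x .: (y .: r)) A -> sat M (x .: (y' .: r)) A -> y = y') ->
   forall a : M, exists b, forall y, y ε b <-> exists x, x ε a /\ sat M (x .: (y .: r)) A).
Proof.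
  cut (FR (0, r) (replacement A) ((forall x y y' : M, sat M (x .: (y .: r)) A -> sat M (x .: (y' .: r)) A -> y = y') ->
   forall a : M, exists b, forall y, y ε b <-> exists x, x ε a /\ sat M (x .: (y .: r)) A)).
  { intros K. exact (K (0, r) (ext_refl _)). }
  ini. unfold replacement. apply FR_imp; [|intros _].
  - apply FR_allT; auto. intros s1 x1 v1 E1 V1. apply FR_allT; auto. intros s2 x2 v2 E2 V2.
    apply FR_allT; auto. intros s3 x3 v3 E3 V3. assert (E : ext (0, r) s3) by eauto using ext_trans.
    pose proof (Vd_ext _ _ _ _ (ext_trans _ _ _ E2 E3) V1). pose proof (Vd_ext _ _ _ _ E3 V2).
    apply FR_imp; [apply FR_subst2; auto|intros _]. apply FR_imp; [apply FR_subst2; auto|intros _]. fr.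
  - apply FR_allT; auto. intros s1 x1 v1 E1 V1. apply FR_exT; auto. intros s2 x2 v2 E2 V2.
    apply FR_allT; auto. intros s3 x3 v3 E3 V3. assert (E : ext (0, r) s3) by eauto using ext_trans.
    pose proof (Vd_ext _ _ _ _ (ext_trans _ _ _ E2 E3) V1). pose proof (Vd_ext _ _ _ _ E3 V2).
    apply FR_iffF; [fr|]. eapply FR_exin; [auto|tv|]. intros s4 x4 v4 E4 V4 _. apply FR_subst2; auto; [eauto using ext_trans|eapply Vd_ext; eauto].
Qed.
Lemma FR_sentence A P : (forall s, FR s A P) -> forall r, sat M r (sentence A) <-> P.
Proof. intros H r. exact (H (0, r) (0, r) (ext_refl _)). Qed.

Section ToForm.
Context (en : nat -> M) (Hen : forall x, exists n, en n = x) (NP : forall x : M, ~ prd x).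
Definition pos (x : M) : nat := proj1_sig (constructive_indefinite_description _ (Hen x)).
Lemma en_pos x : en (pos x) = x. Proof. apply (proj2_sig (constructive_indefinite_description _ (Hen x))). Qed.
(** Under [d] binders the parameter [x] becomes the variable [d + pos x], so the assignment [en]
    provides all parameters at once. Variables out of scope are sent to the position of [en 0]. *)
Definition trt (d : nat) (t : tm M) : nat :=
  match t with V i => if i <? d then i else d + pos (en 0) | K x => d + pos x end.
Fixpoint trf (d : nat) (A : pform M) : form :=
  match A with
  | pMem s t => fMem (trt d s) (trt d t)
  | pEq s t => fEq (trt d s) (trt d t)
  | pPrd _ | pBot => fBot
  | pImp A B => fImp (trf d A) (trf d B)
  | pAll A => fAll (trf (S d) A)
  end.
Lemma sat_trf A : forall d r e, (forall i, i < d -> r i = e i) -> (forall k, r (d + k) = en k) -> (forall i, d <= i -> e i = en 0) ->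
  (sat M r (trf d A) <-> psat e A).
Proof.
  assert (T : forall d r e t, (forall i, i < d -> r i = e i) -> (forall k, r (d + k) = en k) -> (forall i, d <= i -> e i = en 0) ->
    r (trt d t) = tval e t).
  { intros d r e [i|x] H1 H2 H3; simpl; [|rewrite H2; apply en_pos]. destruct (Nat.ltb_spec i d); auto.
    rewrite H2, H3, en_pos; auto. }
  induction A; intros d r e H1 H2 H3; simpl; rewrite ?(T d r e) by auto; try tauto.
  - pose proof (NP (tval e s)). tauto.
  - rewrite (IHA1 d r e), (IHA2 d r e) by auto. tauto.
  - split; intros H x; specialize (H x); revert H; apply (IHA (S d) (x .: r) (x .: e)).
    1,4: intros [|i] Hi; simpl; auto; apply H1; lia.
    1,3: intros k; simpl; auto.
    1,2: intros [|i] Hi; simpl; [lia|apply H3; lia].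
Qed.
Lemma ZF_ZFm : (forall A r, ZF A -> sat M r A) -> ZFm M.
Proof.
  intros H. set (r := fun _ : nat => en 0). split.
  - exact (proj1 (FR_sentence _ _ FR_ext_ax r) (H _ r ZF_extensionality)).
  - exact (proj1 (FR_sentence _ _ FR_fnd_ax r) (H _ r ZF_foundation)).
  - exact (proj1 (FR_sentence _ _ FR_pair_ax r) (H _ r ZF_pairing)).
  - exact (proj1 (FR_sentence _ _ FR_union_ax r) (H _ r ZF_union)).
  - exact (proj1 (FR_sentence _ _ FR_pow_ax r) (H _ r ZF_powerset)).
  - exact (proj1 (FR_sentence _ _ FR_inf_ax r) (H _ r ZF_infinity)).
  - intros P [A HA] a. set (B := trf 1 A).
    assert (K : forall r, sat M r (separation B 0)) by (apply (sat_iter M (bound (separation B 0))); intros r'; apply H, ZF_separation).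
    destruct (proj1 (sat_separation en B) (K en) a) as (b & Hb). exists b. intros z. rewrite Hb.
    rewrite (HA (z .: (fun _ => en 0))). simpl. unfold B. rewrite (sat_trf A 1 (z .: en) (z .: (fun _ => en 0))); [tauto| | |].
    + intros [|i] Hi; [auto|lia].
    + intros k. reflexivity.
    + intros [|i] Hi; [lia|auto].
  - intros R [A HA] HR a. set (B := trf 2 A).
    assert (K : forall r, sat M r (replacement B 0)) by (apply (sat_iter M (bound (replacement B 0))); intros r'; apply H, ZF_replacement).
    assert (E : forall x y, sat M (x .: (y .: en)) B <-> R x y).
    { intros x y. rewrite (HA (x .: (y .: (fun _ => en 0)))). unfold B. apply sat_trf.
      + intros [|[|i]] Hi; auto; lia.
      + intros k. reflexivity.
      + intros [|[|i]] Hi; auto; lia. }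
    destruct (proj1 (sat_replacement en B) (K en)) with (a := a) as (b & Hb).
    + intros x y y'. rewrite !E. apply HR.
    + exists b. intros y. rewrite Hb. setoid_rewrite E. tauto.
Qed.
End ToForm.

Lemma DefP_sat A : DefP (fun e : nat -> M => sat M e A).
Proof.
  induction A; simpl; try (def; fail).
  - apply (DefP_all (fun e x => sat M (x .: e) A)). apply (DefP_iff (fun e => sat M e A)); auto.
    intros e. rewrite scons_eta. tauto.
Qed.
Context {Z : ZFm M}.
Lemma ZFm_ZF A : ZF A -> forall r, sat M r A.
Proof.
  intros [| | | | | |B|B] r.
  - apply (FR_sentence _ _ FR_ext_ax), zext.
  - apply (FR_sentence _ _ FR_fnd_ax), zfnd.
  - apply (FR_sentence _ _ FR_pair_ax), zpair.
  - apply (FR_sentence _ _ FR_union_ax), zuni.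
  - apply (FR_sentence _ _ FR_pow_ax), zpow.
  - apply (FR_sentence _ _ FR_inf_ax), zinf.
  - revert r. apply (sat_iter M (bound (separation B 0))). intros r. apply sat_separation. intros a. apply (zsep (fun z => sat M (z .: r) B)).
    pose proof (DefP_subst _ (fun i => match i with 0 => V 0 | S k => K (r k) end) (DefP_sat B)) as D.
    apply (DefP_iff _ _) with (2 := D). intros e. match goal with |- sat _ ?a _ <-> sat _ ?b _ => replace b with a; [tauto|] end.
    extensionality i. destruct i; reflexivity.
  - revert r. apply (sat_iter M (bound (replacement B 0))). intros r. apply sat_replacement. intros HR a.
    apply (zrep (fun x y => sat M (x .: (y .: r)) B)); auto.
    pose proof (DefP_subst _ (fun i => match i with 0 => V 0 | 1 => V 1 | S (S k) => K (r k) end) (DefP_sat B)) as D.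
    apply (DefP_iff _ _) with (2 := D). intros e. match goal with |- sat _ ?a _ <-> sat _ ?b _ => replace b with a; [tauto|] end.
    extensionality i. destruct i as [|[|i]]; reflexivity.
Qed.
Lemma sat_choice : (forall a : M, (forall x, x ε a -> exists z, z ε x) ->
  (forall x y, x ε a -> y ε a -> (exists z, z ε x /\ z ε y) -> x = y) ->
  exists c, forall x, x ε a -> exists z, (z ε x /\ z ε c) /\ forall y, y ε x /\ y ε c -> y = z) -> forall r, sat M r (sentence choice).
Proof.
  intros H r. apply (FR_sentence _ _ FR_choice_ax). intros a H1 H2. destruct (H a H1) as (c & Hc); [auto|]. exists c. intros x Hx.
  destruct (Hc x Hx) as (z & Hz & K). exists z. split; [exact I|]. split; auto.
Qed.
End ZFinModels.

(** * Satisfaction and implicit definability *)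

Section Sat.
Context {U : str} {Z : ZFm U}.
(* Sealed, so that unification never unfolds numerals. *)
Lemma num_sig : {f : nat -> U | f 0 = emp /\ forall k, f (S k) = suc (f k)}.
Proof. exists (fix f k := match k with 0 => emp | S k => suc (f k) end). split; reflexivity. Qed.
Definition num : nat -> U := proj1_sig num_sig.
Lemma num_0 : num 0 = emp. Proof. apply (proj2_sig num_sig). Qed.
Lemma num_S k : num (S k) = suc (num k). Proof. apply (proj2_sig num_sig). Qed.
Lemma num_om k : num k ε om. Proof. induction k; [rewrite num_0; apply om_0|rewrite num_S; apply om_S; auto]. Qed.
Lemma num_lt k l : k < l -> num k ε num l.
Proof. induction 1; rewrite num_S; apply in_suc; auto. Qed.
Lemma num_ne k l : k <> l -> num k <> num l.
Proof.
  intros H E. assert (K : k < l \/ l < k) by lia. destruct K as [K|K]; apply num_lt in K; rewrite E in K; eapply mem_irr; eauto.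
Qed.
Definition cM (i j : U) := op (num 0) (op i j).
Definition cE (i j : U) := op (num 1) (op i j).
Definition cP (i : U) := op (num 2) i.
Definition cB : U := op (num 3) emp.
Definition cI (c d : U) := op (num 4) (op c d).
Definition cA (c : U) := op (num 5) c.
Definition snoc (a n x : U) := bun a (sg (op n x)).
Lemma F2_cM : F2 cM. Proof. unfold cM. def. Qed.
Lemma F2_cE : F2 cE. Proof. unfold cE. def. Qed.
Lemma F1_cP : F1 cP. Proof. unfold cP. def. Qed.
Lemma F2_cI : F2 cI. Proof. unfold cI. def. Qed.
Lemma F1_cA : F1 cA. Proof. unfold cA. def. Qed.
Lemma F3_snoc : F3 snoc. Proof. unfold snoc. def. Qed.
Lemma D3_FnT : D3 (@FnT U Z). Proof. unfold FnT. def. Qed.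
Hint Resolve F2_cM F2_cE F1_cP F2_cI F1_cA F3_snoc D3_FnT : def.
Definition cclosed (Z : U) := forall n, n ε om ->
  (forall i, i ε n -> forall j, j ε n -> op n (cM i j) ε Z /\ op n (cE i j) ε Z) /\
  (forall i, i ε n -> op n (cP i) ε Z) /\ op n cB ε Z /\
  (forall c d, op n c ε Z -> op n d ε Z -> op n (cI c d) ε Z) /\
  (forall c, op (suc n) c ε Z -> op n (cA c) ε Z).
Definition FC (n c : U) := forall Z, cclosed Z -> op n c ε Z.
Definition satrel (T X S : U) := forall n, n ε om -> forall a, FnT a n X ->
  (forall i, i ε n -> forall j, j ε n -> (op (cM i j) a ε T <-> app a i ε app a j)) /\
  (forall i, i ε n -> forall j, j ε n -> (op (cE i j) a ε T <-> app a i = app a j)) /\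
  (forall i, i ε n -> (op (cP i) a ε T <-> app a i ε S)) /\
  ~ op cB a ε T /\
  (forall c d, FC n c -> FC n d -> (op (cI c d) a ε T <-> (op c a ε T -> op d a ε T))) /\
  (forall c, FC (suc n) c -> (op (cA c) a ε T <-> forall x, x ε X -> op c (snoc a n x) ε T)).
Definition sats (X S c a : U) := exists T, satrel T X S /\ op c a ε T.
Definition impdef (S X : U) := subs S X /\ exists n, n ε om /\ exists c a, FC n c /\ FnT a n X /\ sats X S c a /\
  forall S', subs S' X -> sats X S' c a -> S' = S.
Lemma D1_cclosed : D1 cclosed. Proof. unfold cclosed. def. Qed.
Hint Resolve D1_cclosed : def.
Lemma D2_FC : D2 FC. Proof. unfold FC. def. Qed.
Hint Resolve D2_FC : def.
Lemma D3_satrel : D3 satrel. Proof. unfold satrel. def. Qed.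
Hint Resolve D3_satrel : def.
Lemma D2_impdef : D2 impdef. Proof. unfold impdef, sats. def. Qed.

(** * Evaluation of the formulas about codes and satisfaction *)

Section Frs.
Local Notation FR := (@FR U (fun A => A) (@CT U)).
Local Notation TV := (@TV U (fun A => A) (@CT U)).
Ltac ini := pose proof (@CT_all U) as AC; pose proof (@CT_tr U) as Ctr.
Ltac cti := try exact I; try (intros; exact I).
Lemma T_Empty s : TV s Empty emp. Proof. apply TV_Empty; cti. Qed.
Lemma T_OPair s t u v w : TV s t v -> TV s u w -> TV s (OPair t u) (op v w).
Proof. intros. apply TV_OPair; auto; cti. Qed.
Lemma T_Succ s t v : TV s t v -> TV s (Succ t) (suc v).
Proof. intros. apply TV_Succ; auto; cti. Qed.
Lemma T_Omega s : TV s Omega om. Proof. apply TV_Omega; cti. Qed.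
Lemma T_Num s k : TV s (Num k) (num k).
Proof. induction k; simpl; [rewrite num_0; apply T_Empty|rewrite num_S; apply T_Succ; auto]. Qed.
Ltac tvhook ::= lazymatch goal with
  | |- TV _ Empty _ => apply T_Empty
  | |- TV _ (OPair _ _) _ => eapply T_OPair; [tv|tv]
  | |- TV _ (Succ _) _ => eapply T_Succ; tv
  | |- TV _ (Num _) _ => apply T_Num
  | |- TV _ Omega _ => apply T_Omega
  end.
Lemma T_Snoc s a n x av nv xv : TV s a av -> TV s n nv -> TV s x xv -> TV s (Snoc a n x) (snoc av nv xv).
Proof.
  intros Ha Hn Hx. ini. apply TV_The; cti. bnd. eapply FR_iff; [fr|]. unfold snoc. split.
  - intros K. apply zext. intros p. rewrite in_bun, in_sg. auto.
  - intros ->. intros p. rewrite in_bun, in_sg. tauto.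
Qed.
Lemma T_App s f x fv xv y : TV s f fv -> TV s x xv -> (forall m, op xv m ε fv <-> m = y) -> TV s (App f x) y.
Proof. intros Hf Hx H. ini. apply TV_The; cti. bnd. eapply FR_iff; [fr|]. auto. Qed.
Lemma Fn_appv f a i : Fn f a -> i ε a -> forall m, op i m ε f <-> m = app f i.
Proof.
  intros Hf Hi m. split; [intros H; apply (Fn_op f a i m Hf H)|intros ->]. destruct (proj2 Hf i Hi) as (y & Hy & _).
  rewrite <- (proj2 (Fn_op f a i y Hf Hy)). auto.
Qed.
Lemma FnT_appv a n X i : FnT a n X -> i ε n -> forall m, op i m ε a <-> m = app a i.
Proof. intros [H _]. apply Fn_appv; auto. Qed.
Ltac tvhook ::= lazymatch goal with
  | |- TV _ Empty _ => apply T_Empty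
  | |- TV _ (OPair _ _) _ => eapply T_OPair; [tv|tv]
  | |- TV _ (Succ _) _ => eapply T_Succ; tv
  | |- TV _ (Num _) _ => apply T_Num
  | |- TV _ Omega _ => apply T_Omega
  | |- TV _ (cMem _ _) _ => unfold cMem; tv
  | |- TV _ (cEq _ _) _ => unfold cEq; tv
  | |- TV _ (cPred _) _ => unfold cPred; tv
  | |- TV _ cBot _ => unfold cBot; tv
  | |- TV _ (cImp _ _) _ => unfold cImp; tv
  | |- TV _ (cAll _) _ => unfold cAll; tv
  | |- TV _ (Snoc _ _ _) _ => eapply T_Snoc; [tv|tv|tv]
  | |- TV _ (App _ _) _ => eapply T_App; [tv|tv|first [eapply FnT_appv; eassumption|eapply Fn_appv; eassumption]]
  end.
Lemma FR_code_closed s t v : TV s t v -> FR s (code_closed t) (cclosed v).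
Proof. intros. ini. unfold code_closed, cclosed, cM, cE, cP, cB, cI, cA. fr. Qed.
Ltac frhook ::= lazymatch goal with
  | |- FR _ (code_closed _) _ => eapply FR_code_closed; tv
  end.
Lemma FR_formula_code s t u v w : TV s t v -> TV s u w -> FR s (formula_code t u) (FC v w).
Proof. intros. ini. unfold formula_code, FC. fr. Qed.
Lemma T_function s f D Y v w y : TV s f v -> TV s D w -> TV s Y y -> FR s (function f D Y) (FnT v w y).
Proof. intros. apply FR_function; auto; cti. Qed.
Ltac frhook ::= lazymatch goal with
  | |- FR _ (formula_code _ _) _ => eapply FR_formula_code; [tv|tv]
  | |- FR _ (function _ _ _) _ => eapply T_function; [tv|tv|tv]
  end.
Lemma FR_satrel s t u w tv0 uv wv : TV s t tv0 -> TV s u uv -> TV s w wv -> FR s (satisfaction_relation t u w) (satrel tv0 uv wv).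
Proof. intros. ini. unfold satisfaction_relation, satrel, cM, cE, cP, cB, cI, cA. fr. Qed.
Ltac frhook ::= lazymatch goal with
  | |- FR _ (formula_code _ _) _ => eapply FR_formula_code; [tv|tv]
  | |- FR _ (function _ _ _) _ => eapply T_function; [tv|tv|tv]
  | |- FR _ (satisfaction_relation _ _ _) _ => eapply FR_satrel; [tv|tv|tv]
  end.
Lemma FR_satisfies s X S c a Xv Sv cv av : TV s X Xv -> TV s S Sv -> TV s c cv -> TV s a av -> FR s (satisfies X S c a) (sats Xv Sv cv av).
Proof. intros. ini. unfold satisfies, sats. fr. Qed.
Ltac frhook ::= lazymatch goal with
  | |- FR _ (formula_code _ _) _ => eapply FR_formula_code; [tv|tv]
  | |- FR _ (function _ _ _) _ => eapply T_function; [tv|tv|tv]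
  | |- FR _ (satisfies _ _ _ _) _ => eapply FR_satisfies; [tv|tv|tv|tv]
  | |- FR _ (subset _ _) _ => eapply FR_subset; [assumption|tv|tv]
  end.
Lemma FR_impdef s S X Sv Xv : TV s S Sv -> TV s X Xv -> FR s (implicitly_definable S X) (impdef Sv Xv).
Proof. intros. ini. unfold implicitly_definable, impdef. fr. Qed.
End Frs.

(** * Codes are hereditarily finite *)

Definition Vs := rec (fun h : U => uni (img h (fun p => pow (pi2 p)))).
Lemma F1_VsG : F1 (fun h : U => uni (img h (fun p => pow (pi2 p)))). Proof. def. Qed.
Lemma F1_Vs : F1 Vs. Proof. apply F1_rec, F1_VsG. Qed.
Hint Resolve F1_Vs : def.
Lemma in_Vs a x : Ord a -> (x ε Vs a <-> exists b, b ε a /\ subs x (Vs b)).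
Proof.
  intros Oa. unfold Vs at 1. rewrite (rec_eq _ F1_VsG) by auto. fold Vs. rewrite in_uni. split.
  - intros (y & Hy & Hx). apply in_img in Hy as (p & Hp & ->); [|def]. apply in_lam in Hp as (b & Hb & ->); [|def].
    rewrite pi2_op in Hx. apply in_pow in Hx. eauto.
  - intros (b & Hb & Hx). exists (pow (Vs b)). split; [|apply in_pow; auto]. apply in_img; [def|]. exists (op b (Vs b)).
    rewrite pi2_op. split; auto. apply op_lam; [def|auto].
Qed.
Definition Vom : U := Vs om.
Lemma om_max a b : a ε om -> b ε om -> exists c, c ε om /\ subs a c /\ subs b c.
Proof.
  intros Ha Hb. destruct (Ord_tri a b (om_Ord a Ha) (om_Ord b Hb)) as [K|[<-|K]].
  - exists b. split; auto. split; [intros z Hz; exact (Ord_trans _ _ _ Hz K (om_Ord b Hb))|intros z; auto].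
  - exists a. split; auto. split; intros z; auto.
  - exists a. split; auto. split; [intros z; auto|intros z Hz; exact (Ord_trans _ _ _ Hz K (om_Ord a Ha))].
Qed.
Lemma Vs_mono a b : Ord a -> Ord b -> subs a b -> subs (Vs a) (Vs b).
Proof. intros Oa Ob H x Hx. rewrite in_Vs in * by auto. destruct Hx as (c & Hc & K). eauto. Qed.
Lemma Vom_upair x y : x ε Vom -> y ε Vom -> upair x y ε Vom.
Proof.
  unfold Vom. intros Hx Hy. rewrite in_Vs in * by apply Ord_om. destruct Hx as (a & Ha & Hx), Hy as (b & Hb & Hy).
  destruct (om_max a b Ha Hb) as (c & Hc & Sa & Sb). exists (suc c). split; [apply om_S; auto|].
  intros z Hz. apply in_Vs; [apply Ord_suc, om_Ord; auto|]. exists c. split; [apply in_suc; auto|].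
  apply in_upair in Hz as [->| ->]; intros w Hw.
  - exact (Vs_mono a c (om_Ord a Ha) (om_Ord c Hc) Sa w (Hx w Hw)).
  - exact (Vs_mono b c (om_Ord b Hb) (om_Ord c Hc) Sb w (Hy w Hw)).
Qed.
Lemma Vom_op x y : x ε Vom -> y ε Vom -> op x y ε Vom.
Proof. Transparent op sg. unfold op, sg. Opaque op sg. auto using Vom_upair. Qed.
Lemma om_Vom n : n ε om -> n ε Vom.
Proof.
  intros Hn. assert (K : subs n (Vs n)).
  { revert n Hn. apply (om_ind (fun n => subs n (Vs n))); [def| |].
    - intros z Hz. exfalso. eapply in_emp; eauto.
    - intros n Hn IH z Hz. apply in_Vs; [apply Ord_suc, om_Ord; auto|]. exists n. split; [apply in_suc; auto|].
      apply in_suc in Hz as [Hz| ->]; auto. intros w Hw. apply IH. exact (Ord_trans _ _ _ Hw Hz (om_Ord n Hn)). }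
  apply in_Vs; [apply Ord_om|]. eauto.
Qed.
Lemma nV n i : n ε om -> i ε n -> i ε Vom. Proof. intros Hn Hi. exact (om_Vom i (om_tr n i Hn Hi)). Qed.
Lemma Vom_cM i j : i ε Vom -> j ε Vom -> cM i j ε Vom. Proof. intros. apply Vom_op; [apply om_Vom, num_om|apply Vom_op; auto]. Qed.
Lemma Vom_cE i j : i ε Vom -> j ε Vom -> cE i j ε Vom. Proof. intros. apply Vom_op; [apply om_Vom, num_om|apply Vom_op; auto]. Qed.
Lemma Vom_cI i j : i ε Vom -> j ε Vom -> cI i j ε Vom. Proof. intros. apply Vom_op; [apply om_Vom, num_om|apply Vom_op; auto]. Qed.
Lemma Vom_cP i : i ε Vom -> cP i ε Vom. Proof. intros. apply Vom_op; [apply om_Vom, num_om|auto]. Qed.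
Lemma Vom_cA i : i ε Vom -> cA i ε Vom. Proof. intros. apply Vom_op; [apply om_Vom, num_om|auto]. Qed.
Lemma Vom_cB : cB ε Vom. Proof. apply Vom_op; [apply om_Vom, num_om|apply om_Vom, om_0]. Qed.

(** The codes in V_ω with the property form a closed set. Existence of some closed set is essential:
    without one, every set would be a formula code vacuously. *)
Lemma FC_ind (P : U -> U -> Prop) : D2 P ->
  (forall n i j, n ε om -> i ε n -> j ε n -> P n (cM i j)) ->
  (forall n i j, n ε om -> i ε n -> j ε n -> P n (cE i j)) ->
  (forall n i, n ε om -> i ε n -> P n (cP i)) -> (forall n, n ε om -> P n cB) ->
  (forall n c d, n ε om -> P n c -> P n d -> P n (cI c d)) ->
  (forall n c, n ε om -> P (suc n) c -> P n (cA c)) ->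
  forall n c, FC n c -> n ε om /\ c ε Vom /\ P n c.
Proof.
  intros DP H1 H2 H3 H4 H5 H6 n c H. set (ZZ := sep (prod om Vom) (fun p => exists n c, p = op n c /\ P n c)).
  assert (iZ : forall n c, op n c ε ZZ <-> n ε om /\ c ε Vom /\ P n c).
  { intros n' c'. unfold ZZ. rewrite in_sep by def. rewrite op_prod. split.
    - intros ((K1 & K2) & n2 & c2 & E & K). apply op_inj in E as [-> ->]. auto.
    - intros (K1 & K2 & K3). eauto 6. }
  apply iZ, H. intros m Hm. assert (OV : forall i, i ε m -> i ε Vom) by (intros i Hi; eapply nV; eauto).
  setoid_rewrite iZ.
  split; [intros i Hi j Hj; split; (split; [auto|]); (split; [|auto]); [apply Vom_cM|apply Vom_cE]; auto|].
  split; [intros i Hi; split; [auto|]; split; [apply Vom_cP|]; auto|].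
  split; [split; [auto|]; split; [apply Vom_cB|auto]|].
  split.
  - intros c1 c2 (_ & K1 & K2) (_ & K3 & K4). split; [auto|]. split; [apply Vom_cI|]; auto.
  - intros c1 (_ & K1 & K2). split; [auto|]. split; [apply Vom_cA|]; auto.
Qed.

Lemma snoc_in a n x i y : op i y ε snoc a n x <-> op i y ε a \/ (i = n /\ y = x).
Proof.
  unfold snoc. rewrite in_bun, in_sg. split; (intros [H|H]; [auto|right]).
  - apply op_inj in H. auto.
  - destruct H as [-> ->]. auto.
Qed.
Lemma snoc_FnT a n X x : FnT a n X -> x ε X -> FnT (snoc a n x) (suc n) X.
Proof.
  intros [[H1 H2] H3] Hx. assert (ND : forall y, ~ op n y ε a).
  { intros y K. destruct (H1 _ K) as (i & z & Hi & E). apply op_inj in E as [<- _]. eapply mem_irr; eauto. }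
  split; [split|].
  - intros p Hp. unfold snoc in Hp. apply in_bun in Hp as [Hp|Hp].
    + destruct (H1 p Hp) as (i & y & Hi & ->). exists i, y. split; auto. apply in_suc; auto.
    + apply in_sg in Hp as ->. exists n, x. split; auto. apply in_suc; auto.
  - intros i Hi. setoid_rewrite snoc_in. apply in_suc in Hi as [Hi| ->].
    + destruct (H2 i Hi) as (y & Hy & K). exists y. split; auto. intros y' [K'|[-> _]]; auto. exfalso. eapply mem_irr; eauto.
    + exists x. split; auto. intros y' [K'|[_ K']]; auto. exfalso. eapply ND; eauto.
  - intros i y Hy. apply snoc_in in Hy as [Hy|[_ ->]]; eauto.
Qed.
Lemma snoc_old a n X x i : FnT a n X -> x ε X -> i ε n -> app (snoc a n x) i = app a i.
Proof.
  intros Ha Hx Hi. symmetry. assert (Hi' : i ε suc n) by (apply in_suc; auto).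
  apply (FnT_appv _ _ _ i (snoc_FnT a n X x Ha Hx) Hi'). apply snoc_in. left. apply (FnT_appv _ _ _ i Ha Hi). auto.
Qed.
Lemma snoc_new a n X x : FnT a n X -> x ε X -> app (snoc a n x) n = x.
Proof.
  intros Ha Hx. symmetry. assert (Hi' : n ε suc n) by (apply in_suc; auto).
  apply (FnT_appv _ _ _ n (snoc_FnT a n X x Ha Hx) Hi'). apply snoc_in. auto.
Qed.
Lemma FnT_dom a n m X : FnT a n X -> FnT a m X -> n = m.
Proof.
  intros [[H1 H2] _] [[K1 K2] _]. apply zext. intros i. split; intros Hi.
  - destruct (H2 i Hi) as (y & Hy & _). destruct (K1 _ Hy) as (i' & y' & Hi' & E). apply op_inj in E as [<- _]. auto.
  - destruct (K2 i Hi) as (y & Hy & _). destruct (H1 _ Hy) as (i' & y' & Hi' & E). apply op_inj in E as [<- _]. auto.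
Qed.

(** * Existence of a satisfaction relation *)

Section Exists.
Context (X S : U).
Definition TB : U := prod Vom (pow (prod om X)).
Definition Step (T p : U) := exists c a n, p = op c a /\ n ε om /\ FnT a n X /\
  ((exists i j, i ε n /\ j ε n /\ c = cM i j /\ app a i ε app a j) \/
   (exists i j, i ε n /\ j ε n /\ c = cE i j /\ app a i = app a j) \/
   (exists i, i ε n /\ c = cP i /\ app a i ε S) \/
   (exists c1 c2, c = cI c1 c2 /\ (op c1 a ε T -> op c2 a ε T)) \/
   (exists c1, c = cA c1 /\ forall x, x ε X -> op c1 (snoc a n x) ε T)).
Lemma D2_Step : D2 Step. Proof. unfold Step. def. Qed.
Hint Resolve D2_Step : def.
(* Stage [k] evaluates a code correctly once [k] exceeds its height, so that the truth
   value of every code is eventually constant, uniformly in the assignment. *)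
Definition Tk := rec (fun h : U => sep TB (fun p => Step (app h (uni (img h pi1))) p)).
Lemma F1_TG : F1 (fun h : U => sep TB (fun p => Step (app h (uni (img h pi1))) p)). Proof. def. Qed.
Lemma F1_Tk : F1 Tk. Proof. apply F1_rec, F1_TG. Qed.
Hint Resolve F1_Tk : def.
Lemma Tk_S k p : k ε om -> (p ε Tk (suc k) <-> p ε TB /\ Step (Tk k) p).
Proof.
  intros Hk. assert (Ok : Ord (suc k)) by (apply Ord_suc, om_Ord; auto).
  unfold Tk at 1. rewrite (rec_eq _ F1_TG) by auto. fold Tk. rewrite in_sep by def.
  (* The domain of the function so far is [suc k], and its union is the predecessor [k]. *)
  replace (app (lam (suc k) Tk) (uni (img (lam (suc k) Tk) pi1))) with (Tk k); [tauto|].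
  replace (img (lam (suc k) Tk) pi1) with (suc k).
  - replace (uni (suc k)) with k; [symmetry; apply app_lam; [def|apply in_suc; auto]|].
    apply zext. intros z. rewrite in_uni. setoid_rewrite in_suc. split.
    + intros Hz. exists k. auto.
    + intros (y & [Hy| ->] & Hz); auto. exact (Ord_trans _ _ _ Hz Hy (om_Ord k Hk)).
  - apply zext. intros d. rewrite in_img by def. split.
    + intros Hd. exists (op d (Tk d)). rewrite pi1_op. split; auto. apply op_lam; [def|auto].
    + intros (q & Hq & ->). apply in_lam in Hq as (y & Hy & ->); [|def]. rewrite pi1_op. auto.
Qed.
Lemma FnT_TB a n c : n ε om -> FnT a n X -> c ε Vom -> op c a ε TB.
Proof.
  intros Hn [[H1 H2] H3] Hc. apply op_prod. split; auto. apply in_pow. intros p Hp. destruct (H1 p Hp) as (i & y & Hi & ->).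
  apply op_prod. split; [exact (om_tr n i Hn Hi)|eauto].
Qed.
Ltac codes := repeat match goal with
  | H : op _ _ = op _ _ |- _ => apply op_inj in H as [? ?]
  | H : num ?k = num ?l |- _ => first [exfalso; refine (num_ne k l _ H); discriminate | clear H]
  end.
Lemma Tk_eq k c a n (Q : Prop) : k ε om -> n ε om -> FnT a n X -> c ε Vom ->
  (((exists i j, i ε n /\ j ε n /\ c = cM i j /\ app a i ε app a j) \/
   (exists i j, i ε n /\ j ε n /\ c = cE i j /\ app a i = app a j) \/
   (exists i, i ε n /\ c = cP i /\ app a i ε S) \/
   (exists c1 c2, c = cI c1 c2 /\ (op c1 a ε Tk k -> op c2 a ε Tk k)) \/
   (exists c1, c = cA c1 /\ forall x, x ε X -> op c1 (snoc a n x) ε Tk k)) <-> Q) -> (op c a ε Tk (suc k) <-> Q).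
Proof.
  intros Hk Hn Ha Hc <-. rewrite Tk_S by auto. split.
  - intros [_ (c' & a' & n' & E & Hn' & Ha' & K)]. apply op_inj in E as [<- <-]. pose proof (FnT_dom _ _ _ _ Ha Ha') as <-. exact K.
  - intros K. split; [eapply FnT_TB; eauto|]. exists c, a, n. auto.
Qed.
Definition Tw : U := sep TB (fun p => exists k0, k0 ε om /\ forall k, k ε om -> subs k0 k -> p ε Tk k).
Lemma in_Tw p : p ε Tw <-> p ε TB /\ exists k0, k0 ε om /\ forall k, k ε om -> subs k0 k -> p ε Tk k.
Proof. unfold Tw. rewrite in_sep by def. tauto. Qed.
Lemma suc_sub k0 k : k ε om -> subs (suc k0) k -> exists k', k' ε om /\ k = suc k' /\ (k0 ε om -> subs k0 k').
Proof.
  intros Hk H. assert (K0 : k0 ε k) by (apply H, in_suc; auto). destruct (om_cases k Hk) as [->|(k' & Hk' & ->)].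
  - exfalso. eapply in_emp; eauto.
  - exists k'. split; auto. split; auto. intros _ z Hz. apply in_suc in K0 as [K0| ->]; auto. exact (Ord_trans _ _ _ Hz K0 (om_Ord k' Hk')).
Qed.
(** From stage [k0] on, the truth value of [p] is constantly [Q]; [Tw] is the limit of the
    stages. *)
Definition ec k0 p (Q : Prop) := forall k, k ε om -> subs k0 k -> (p ε Tk k <-> Q).
Lemma ec_Tw k0 p Q : k0 ε om -> p ε TB -> ec k0 p Q -> (p ε Tw <-> Q).
Proof.
  intros H0 Hp H. rewrite in_Tw. split.
  - intros (_ & k1 & Hk1 & K). destruct (om_max k0 k1 H0 Hk1) as (k & Hk & K1 & K2). apply (H k); auto.
  - intros q. split; auto. exists k0. split; auto. intros k Hk K. apply (H k); auto.
Qed.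
Definition Stab n c := exists k0, k0 ε om /\ forall k, k ε om -> subs k0 k -> forall a, FnT a n X -> (op c a ε Tk k <-> op c a ε Tk k0).
Lemma D2_Stab : D2 Stab. Proof. unfold Stab. def. Qed.
Lemma one_om : suc emp ε (om : U). Proof. apply om_S, om_0. Qed.
Lemma ec_M n a i j : n ε om -> FnT a n X -> i ε n -> j ε n -> ec (suc emp) (op (cM i j) a) (app a i ε app a j).
Proof.
  intros Hn Ha Hi Hj k Hk Hs. destruct (suc_sub emp k Hk Hs) as (k' & Hk' & -> & _). apply (Tk_eq k' _ a n); auto.
  - exact (Vom_cM i j (nV n i Hn Hi) (nV n j Hn Hj)).
  - split; [|intros; left; exists i, j; auto]. unfold cM, cE, cP, cI, cA.
    intros [(i' & j' & _ & _ & E & K)|[(i' & j' & _ & _ & E & K)|[(i' & _ & E & K)|[(i' & j' & E & K)|(i' & E & K)]]]]; codes; subst; auto.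
Qed.
Lemma ec_E n a i j : n ε om -> FnT a n X -> i ε n -> j ε n -> ec (suc emp) (op (cE i j) a) (app a i = app a j).
Proof.
  intros Hn Ha Hi Hj k Hk Hs. destruct (suc_sub emp k Hk Hs) as (k' & Hk' & -> & _). apply (Tk_eq k' _ a n); auto.
  - exact (Vom_cE i j (nV n i Hn Hi) (nV n j Hn Hj)).
  - split; [|intros; right; left; exists i, j; auto]. unfold cM, cE, cP, cI, cA.
    intros [(i' & j' & _ & _ & E & K)|[(i' & j' & _ & _ & E & K)|[(i' & _ & E & K)|[(i' & j' & E & K)|(i' & E & K)]]]]; codes; subst; auto.
Qed.
Lemma ec_P n a i : n ε om -> FnT a n X -> i ε n -> ec (suc emp) (op (cP i) a) (app a i ε S).
Proof.
  intros Hn Ha Hi k Hk Hs. destruct (suc_sub emp k Hk Hs) as (k' & Hk' & -> & _). apply (Tk_eq k' _ a n); auto.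
  - exact (Vom_cP i (nV n i Hn Hi)).
  - split; [|intros; right; right; left; exists i; auto]. unfold cM, cE, cP, cI, cA.
    intros [(i' & j' & _ & _ & E & K)|[(i' & j' & _ & _ & E & K)|[(i' & _ & E & K)|[(i' & j' & E & K)|(i' & E & K)]]]]; codes; subst; auto.
Qed.
Lemma ec_B n a : n ε om -> FnT a n X -> ec (suc emp) (op cB a) False.
Proof.
  intros Hn Ha k Hk Hs. destruct (suc_sub emp k Hk Hs) as (k' & Hk' & -> & _). apply (Tk_eq k' _ a n); auto using Vom_cB.
  split; [|tauto]. unfold cM, cE, cP, cI, cA, cB.
  intros [(i' & j' & _ & _ & E & K)|[(i' & j' & _ & _ & E & K)|[(i' & _ & E & K)|[(i' & j' & E & K)|(i' & E & K)]]]]; codes.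
Qed.
Lemma Tk_I k n a c d : k ε om -> n ε om -> FnT a n X -> c ε Vom -> d ε Vom ->
  (op (cI c d) a ε Tk (suc k) <-> (op c a ε Tk k -> op d a ε Tk k)).
Proof.
  intros Hk Hn Ha Hc Hd. apply (Tk_eq k _ a n); auto using Vom_cI.
  split; [|intros; right; right; right; left; exists c, d; auto]. unfold cM, cE, cP, cI, cA.
  intros [(i' & j' & _ & _ & E & K)|[(i' & j' & _ & _ & E & K)|[(i' & _ & E & K)|[(i' & j' & E & K)|(i' & E & K)]]]]; codes; subst; auto.
Qed.
Lemma Tk_A k n a c : k ε om -> n ε om -> FnT a n X -> c ε Vom ->
  (op (cA c) a ε Tk (suc k) <-> forall x, x ε X -> op c (snoc a n x) ε Tk k).
Proof.
  intros Hk Hn Ha Hc. apply (Tk_eq k _ a n); auto using Vom_cA.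
  split; [|intros; right; right; right; right; exists c; auto]. unfold cM, cE, cP, cI, cA.
  intros [(i' & j' & _ & _ & E & K)|[(i' & j' & _ & _ & E & K)|[(i' & _ & E & K)|[(i' & j' & E & K)|(i' & E & K)]]]]; codes; subst; auto.
Qed.
Lemma subs_refl (x : U) : subs x x. Proof. intros z; auto. Qed.
Lemma stab n c : FC n c -> n ε om /\ c ε Vom /\ Stab n c.
Proof.
  intros H. cut (n ε om /\ c ε Vom /\ (c ε Vom /\ Stab n c)); [tauto|]. revert n c H.
  pose proof D2_Stab. apply (FC_ind (fun n c => c ε Vom /\ Stab n c)); [def| | | | | |].
  - intros n i j Hn Hi Hj. split; [exact (Vom_cM i j (nV n i Hn Hi) (nV n j Hn Hj))|].
    exists (suc emp). split; [apply one_om|]. intros k Hk Ks a Ha.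
    rewrite (ec_M n a i j Hn Ha Hi Hj k Hk Ks), (ec_M n a i j Hn Ha Hi Hj (suc emp) one_om (subs_refl _)). tauto.
  - intros n i j Hn Hi Hj. split; [exact (Vom_cE i j (nV n i Hn Hi) (nV n j Hn Hj))|].
    exists (suc emp). split; [apply one_om|]. intros k Hk Ks a Ha.
    rewrite (ec_E n a i j Hn Ha Hi Hj k Hk Ks), (ec_E n a i j Hn Ha Hi Hj (suc emp) one_om (subs_refl _)). tauto.
  - intros n i Hn Hi. split; [exact (Vom_cP i (nV n i Hn Hi))|].
    exists (suc emp). split; [apply one_om|]. intros k Hk Ks a Ha.
    rewrite (ec_P n a i Hn Ha Hi k Hk Ks), (ec_P n a i Hn Ha Hi (suc emp) one_om (subs_refl _)). tauto.
  - intros n Hn. split; [apply Vom_cB|]. exists (suc emp). split; [apply one_om|]. intros k Hk Ks a Ha.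
    rewrite (ec_B n a Hn Ha k Hk Ks), (ec_B n a Hn Ha (suc emp) one_om (subs_refl _)). tauto.
  - intros n c d Hn [Hc (k1 & Hk1 & S1)] [Hd (k2 & Hk2 & S2)]. split; [apply Vom_cI; auto|].
    destruct (om_max k1 k2 Hk1 Hk2) as (m & Hm & M1 & M2). exists (suc m). split; [apply om_S; auto|]. intros k Hk Ks a Ha.
    destruct (suc_sub m k Hk Ks) as (k' & Hk' & -> & Kk'). specialize (Kk' Hm).
    assert (L1 : subs k1 k') by (intros z Hz; auto). assert (L2 : subs k2 k') by (intros z Hz; auto).
    rewrite !(Tk_I _ n) by auto. rewrite (S1 k' Hk' L1 a Ha), (S2 k' Hk' L2 a Ha), (S1 m Hm M1 a Ha), (S2 m Hm M2 a Ha). tauto.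
  - intros n c Hn [Hc (k1 & Hk1 & S1)]. split; [apply Vom_cA; auto|]. exists (suc k1). split; [apply om_S; auto|]. intros k Hk Ks a Ha.
    destruct (suc_sub k1 k Hk Ks) as (k' & Hk' & -> & Kk'). specialize (Kk' Hk1). rewrite !(Tk_A _ n) by auto.
    split; intros K x Hx; apply (S1 k' Hk' Kk' _ (snoc_FnT a n X x Ha Hx)); auto.
Qed.
Lemma satrel_exists : exists T, satrel T X S.
Proof.
  exists Tw.
  assert (EC : forall n c, n ε om -> FC n c -> exists k0, k0 ε om /\ forall a, FnT a n X -> ec k0 (op c a) (op c a ε Tw)).
  { intros n c Hn H. destruct (stab n c H) as (_ & Hc & k0 & Hk0 & K). exists k0. split; auto. intros a Ha k Hk Ks.
    rewrite (K k Hk Ks a Ha). symmetry.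
    refine (ec_Tw k0 _ _ Hk0 (FnT_TB a n c Hn Ha Hc) _). intros k2 Hk2 Ks2. apply K; auto. }
  intros n Hn a Ha. assert (TBin : forall c, c ε Vom -> op c a ε TB) by (intros; eapply FnT_TB; eauto).
  assert (OV : forall i, i ε n -> i ε Vom) by (intros i Hi; eapply nV; eauto).
  split; [intros i Hi j Hj; apply (ec_Tw (suc emp)); auto using one_om, Vom_cM; apply (ec_M n); auto|].
  split; [intros i Hi j Hj; apply (ec_Tw (suc emp)); auto using one_om, Vom_cE; apply (ec_E n); auto|].
  split; [intros i Hi; apply (ec_Tw (suc emp)); auto using one_om, Vom_cP; apply (ec_P n); auto|].
  split; [intros K; exact (proj1 (ec_Tw (suc emp) _ False one_om (TBin _ Vom_cB) (ec_B n a Hn Ha)) K)|].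
  split.
  - intros c d Hc Hd. destruct (EC n c Hn Hc) as (k1 & Hk1 & S1), (EC n d Hn Hd) as (k2 & Hk2 & S2).
    destruct (stab n c Hc) as (_ & Vc & _), (stab n d Hd) as (_ & Vd & _).
    destruct (om_max k1 k2 Hk1 Hk2) as (m & Hm & M1 & M2). apply (ec_Tw (suc m)); auto using om_S, Vom_cI. intros k Hk Ks.
    destruct (suc_sub m k Hk Ks) as (k' & Hk' & -> & Kk'). specialize (Kk' Hm).
    assert (L1 : subs k1 k') by (intros z Hz; auto). assert (L2 : subs k2 k') by (intros z Hz; auto).
    rewrite (Tk_I _ n) by auto. rewrite (S1 a Ha k' Hk' L1), (S2 a Ha k' Hk' L2). tauto.
  - intros c Hc. destruct (EC (suc n) c (om_S n Hn) Hc) as (k1 & Hk1 & S1). destruct (stab (suc n) c Hc) as (_ & Vc & _).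
    apply (ec_Tw (suc k1)); auto using om_S, Vom_cA. intros k Hk Ks.
    destruct (suc_sub k1 k Hk Ks) as (k' & Hk' & -> & Kk'). specialize (Kk' Hk1). rewrite (Tk_A _ n) by auto.
    split; intros K x Hx; apply (S1 _ (snoc_FnT a n X x Ha Hx) k' Hk' Kk'); auto.
Qed.
End Exists.

(** * From formulas with parameters to codes *)

Section Coding.
Context (X : U).
Notation Xs := {x : U | x ε X}.
Notation XS S := (sub U (fun x => x ε X) (fun x => x ε S)).
Context (x0 : Xs) (ps : Xs -> nat) (n0 : nat).
(** Variables below [n0] hold the parameters, and the binder at depth [d] introduces variable
    [n0 + d]; indices count from the innermost binder, hence the reversal. Variables out of scope
    are read as [x0]. *)
Definition tcd (d : nat) (t : tm Xs) : nat :=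
  match t with V i => if i <? d then n0 + (d - 1 - i) else ps x0 | K x => ps x end.
Fixpoint pcode (d : nat) (A : pform Xs) : U :=
  match A with
  | pMem s t => cM (num (tcd d s)) (num (tcd d t))
  | pEq s t => cE (num (tcd d s)) (num (tcd d t))
  | pPrd s => cP (num (tcd d s))
  | pBot => cB
  | pImp A B => cI (pcode d A) (pcode d B)
  | pAll A => cA (pcode (S d) A)
  end.
Definition tcs (t : tm Xs) : list Xs := match t with V _ => [] | K x => [x] end.
Fixpoint pcs (A : pform Xs) : list Xs :=
  match A with
  | pMem s t | pEq s t => tcs s ++ tcs t
  | pPrd s => tcs s
  | pBot => []
  | pImp A B => pcs A ++ pcs B
  | pAll A => pcs A
  end.
Lemma tcd_lt d t : ps x0 < n0 -> (forall x, In x (tcs t) -> ps x < n0) -> tcd d t < n0 + d.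
Proof.
  intros H0 H. destruct t as [i|x]; simpl; [destruct (Nat.ltb_spec i d); lia|]. specialize (H x (or_introl eq_refl)). lia.
Qed.
Lemma FC_pcode A : forall d, ps x0 < n0 -> (forall x, In x (pcs A) -> ps x < n0) -> FC (num (n0 + d)) (pcode d A).
Proof.
  induction A; intros d H0 H ZZ HZ; pose proof (HZ _ (num_om (n0 + d))) as (Z1 & Z2 & Z3 & Z4 & Z5); simpl in *.
  - apply Z1; apply num_lt, tcd_lt; auto; intros; apply H, in_or_app; auto.
  - apply Z1; apply num_lt, tcd_lt; auto; intros; apply H, in_or_app; auto.
  - apply Z2, num_lt, tcd_lt; auto.
  - apply Z3.
  - apply Z4; [apply IHA1|apply IHA2]; auto; intros; apply H, in_or_app; auto.
  - apply Z5. rewrite <- num_S, <- Nat.add_succ_r. apply IHA; auto.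
Qed.
Lemma pcode_sat T S A : satrel T X S -> forall d a (e : nat -> Xs), FnT a (num (n0 + d)) X -> ps x0 < n0 -> app a (num (ps x0)) = proj1_sig x0 ->
  (forall x, In x (pcs A) -> ps x < n0 /\ app a (num (ps x)) = proj1_sig x) ->
  (forall i, i < d -> app a (num (n0 + (d - 1 - i))) = proj1_sig (e i)) -> (forall i, d <= i -> e i = x0) ->
  (op (pcode d A) a ε T <-> @psat (XS S) e A).
Proof.
  intros HT. assert (TT : forall d a (e : nat -> Xs) t, ps x0 < n0 -> app a (num (ps x0)) = proj1_sig x0 ->
    (forall x, In x (tcs t) -> ps x < n0 /\ app a (num (ps x)) = proj1_sig x) ->
    (forall i, i < d -> app a (num (n0 + (d - 1 - i))) = proj1_sig (e i)) -> (forall i, d <= i -> e i = x0) ->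
    app a (num (tcd d t)) = proj1_sig (tval e t)).
  { intros d a e [i|x] H1 H2 H3 H4 H5; simpl in *; [|apply H3; auto]. destruct (Nat.ltb_spec i d); auto. rewrite H5; auto. }
  induction A; intros d a e Ha L0 E0 H1 H2 H3; pose proof (HT _ (num_om (n0 + d)) a Ha) as (Q1 & Q2 & Q3 & Q4 & Q5 & Q6); simpl pcode; simpl psat; simpl pcs in *.
  - rewrite Q1 by (apply num_lt, tcd_lt; auto; intros; apply H1, in_or_app; auto).
    rewrite !(TT d a e) by (auto; intros; apply H1, in_or_app; auto). tauto.
  - rewrite Q2 by (apply num_lt, tcd_lt; auto; intros; apply H1, in_or_app; auto).
    rewrite !(TT d a e) by (auto; intros; apply H1, in_or_app; auto).
    split; [intros K; apply eq_sig_hprop; [intros; apply proof_irrelevance|exact K]|intros ->; auto].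
  - rewrite Q3 by (apply num_lt, tcd_lt; auto; intros; apply H1; auto). rewrite (TT d a e) by auto. tauto.
  - tauto.
  - assert (I1 : forall x, In x (pcs A1) -> ps x < n0 /\ app a (num (ps x)) = proj1_sig x) by (intros; apply H1, in_or_app; auto).
    assert (I2 : forall x, In x (pcs A2) -> ps x < n0 /\ app a (num (ps x)) = proj1_sig x) by (intros; apply H1, in_or_app; auto).
    rewrite Q5 by (apply FC_pcode; auto; intros; first [apply I1; assumption|apply I2; assumption]).
    rewrite (IHA1 d a e), (IHA2 d a e) by auto. tauto.
  - rewrite Q6 by (rewrite <- num_S, <- Nat.add_succ_r; apply FC_pcode; auto; intros; apply H1; auto).
    assert (IH : forall x : Xs, op (pcode (Datatypes.S d) A) (snoc a (num (n0 + d)) (proj1_sig x)) ε T <-> @psat (XS S) (x .: e) A).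
    { intros x. assert (Hx := proj2_sig x). simpl in Hx. apply IHA; auto.
      - rewrite Nat.add_succ_r, num_S. apply (snoc_FnT a (num (n0 + d)) X); auto.
      - rewrite (snoc_old a (num (n0 + d)) X) by (auto; apply num_lt; lia). auto.
      - intros y Hy. destruct (H1 y Hy) as [K1 K2]. split; auto. rewrite (snoc_old a (num (n0 + d)) X) by (auto; apply num_lt; lia). auto.
      - intros [|i] Hi; simpl.
        + replace (n0 + (d - 0 - 0)) with (n0 + d) by lia. apply (snoc_new a (num (n0 + d)) X); auto.
        + rewrite (snoc_old a (num (n0 + d)) X) by (auto; apply num_lt; lia). rewrite <- (H2 i) by lia. do 3 f_equal. lia.
      - intros [|i] Hi; simpl; [lia|]. apply H3. lia. }
    split.
    + intros K x. apply IH, K. exact (proj2_sig x).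
    + intros K x Hx. apply (IH (exist _ x Hx)). apply K.
Qed.
End Coding.

(** * Criteria for implicit definability *)

Section ImpDef.
Context (X : U).
Notation Xs := {x : U | x ε X}.
Notation XS S := (sub U (fun x => x ε X) (fun x => x ε S)).
Fixpoint tupl (l : list Xs) : U := match l with [] => emp | x :: l => snoc (tupl l) (num (length l)) (proj1_sig x) end.
Lemma tupl_FnT l : FnT (tupl l) (num (length l)) X.
Proof.
  induction l as [|x l IH]; simpl; [rewrite num_0|rewrite num_S; apply snoc_FnT; auto; exact (proj2_sig x)].
  split; [split|]; intros; exfalso; eapply in_emp; eauto.
Qed.
Lemma tupl_in l x : In x l -> exists k, k < length l /\ app (tupl l) (num k) = proj1_sig x.
Proof.
  induction l as [|y l IH]; [intros []|]; intros [<-|H]; simpl.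
  - exists (length l). split; [lia|]. apply (snoc_new _ _ X); [apply tupl_FnT|exact (proj2_sig y)].
  - destruct (IH H) as (k & Hk & E). exists k. split; [lia|].
    rewrite (snoc_old _ _ X); [exact E|apply tupl_FnT|exact (proj2_sig y)|apply num_lt; auto].
Qed.
(** The tuple of parameters lists [x0] and the constants of [A]. As a satisfaction relation exists
    for each [S'], truth of the code agrees with [psat]. *)
Lemma impdef_intro S (x0 : Xs) (A : pform Xs) : subs S X -> @psat (XS S) (fun _ => x0) A ->
  (forall S', subs S' X -> @psat (XS S') (fun _ => x0) A -> S' = S) -> impdef S X.
Proof.
  intros HS H1 H2. split; auto. set (l := x0 :: pcs X A).
  (* Some position at which [x] occurs in the tuple; repetitions make it a matter of choice. *)
  set (ps := fun x : Xs => epsilon (inhabits 0) (fun k => k < length l /\ app (tupl l) (num k) = proj1_sig x)).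
  assert (Hps : forall x, In x l -> ps x < length l /\ app (tupl l) (num (ps x)) = proj1_sig x).
  { intros x Hx. apply (epsilon_spec (inhabits 0) (fun k => k < length l /\ app (tupl l) (num k) = proj1_sig x)), tupl_in; auto. }
  assert (P0 : In x0 l) by (left; auto). assert (PA : forall x, In x (pcs X A) -> In x l) by (intros; right; auto).
  assert (EQ : forall S', sats X S' (pcode X x0 ps (length l) 0 A) (tupl l) <-> @psat (XS S') (fun _ => x0) A).
  { assert (EQ' : forall S' T, satrel T X S' -> (op (pcode X x0 ps (length l) 0 A) (tupl l) ε T <-> @psat (XS S') (fun _ => x0) A)).
    { intros S' T HT. apply pcode_sat; auto.
      - rewrite Nat.add_0_r. apply tupl_FnT.
      - apply Hps; auto.
      - apply Hps; auto.
      - intros i Hi. lia. }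
    intros S'. split.
    - intros (T & HT & K). apply (EQ' S' T); auto.
    - intros K. destruct (satrel_exists X S') as (T & HT). exists T. split; auto. apply (EQ' S' T); auto. }
  exists (num (length l)). split; [apply num_om|]. exists (pcode X x0 ps (length l) 0 A), (tupl l).
  assert (FCA : FC (num (length l)) (pcode X x0 ps (length l) 0 A)).
  { pose proof (FC_pcode X x0 ps (length l) A 0 (proj1 (Hps x0 P0)) (fun x Hx => proj1 (Hps x (PA x Hx)))) as K. rewrite Nat.add_0_r in K. exact K. }
  split; [exact FCA|].
  split; [apply tupl_FnT|]. split; [apply EQ; auto|]. intros S' HS' K. apply H2; auto. apply EQ; auto.
Qed.
(** The predicate is empty in [X0]; replacing it by [pBot] makes the formula mean the same whatever
    [S] is. *)
Fixpoint nop (A : pform Xs) : pform Xs :=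
  match A with
  | pPrd _ => pBot
  | pImp A B => pImp (nop A) (nop B)
  | pAll A => pAll (nop A)
  | _ => A
  end.
Notation X0 := (sub U (fun x => x ε X) (fun _ => False)).
Lemma psat_nop S A : forall e : nat -> Xs, @psat (XS S) e (nop A) <-> @psat X0 e A.
Proof.
  induction A; intros e; simpl; try tauto.
  - rewrite IHA1, IHA2. tauto.
  - split; intros H x; apply IHA, H.
Qed.
(** An explicit definition is an implicit one: [B] says that the predicate and the defining formula
    agree everywhere. *)
Lemma impdef_explicit S (P : X0 -> Prop) : (exists x, x ε X) -> D1 P -> subs S X -> (forall y : X0, val y ε S <-> P y) -> impdef S X.
Proof.
  intros (x0 & Hx0) [A HA] HS H. set (y0 := exist (fun x => x ε X) x0 Hx0 : Xs).
  set (B := pAll (pImp (pImp (pImp (pPrd (V 0)) (nop A)) (pImp (pImp (nop A) (pPrd (V 0))) pBot)) pBot)).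
  assert (EB : forall S', @psat (XS S') (fun _ => y0) B <-> forall y : X0, val y ε S' <-> P y).
  { intros S'. simpl. split; intros K y; specialize (K y); rewrite ?(HA (y .: (fun _ => y0))) in *.
    - pose proof (psat_nop S' A (y .: (fun _ => y0))) as E. unfold val. simpl in *. tauto.
    - pose proof (psat_nop S' A (y .: (fun _ => y0))) as E. pose proof (HA (y .: (fun _ => y0))) as E2. simpl in E2. unfold val in K. simpl in *. tauto. }
  apply (impdef_intro S y0 B); auto; [apply EB; auto|]. intros S' HS' K. rewrite EB in K. apply zext. intros z. split; intros Hz.
  - apply (H (exist _ z (HS' z Hz))), K. exact Hz.
  - apply (K (exist _ z (HS z Hz))), H. exact Hz.
Qed.
End ImpDef.
End Sat.
#[export] Hint Resolve F2_cM F2_cE F1_cP F2_cI F1_cA F3_snoc D3_FnT D1_cclosed D2_FC D3_satrel D2_impdef F1_Vs : def.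

(** * The hierarchy Imp *)

Section Imp.
Context {U : str} {Z : ZFm U}.
Definition Dfn (X : U) := sep (pow X) (fun S => impdef S X).
Lemma F1_Dfn : F1 Dfn. Proof. unfold Dfn. def. Qed.
Hint Resolve F1_Dfn : def.
Lemma in_Dfn X S : S ε Dfn X <-> impdef S X.
Proof. unfold Dfn. rewrite in_sep by def. split; [tauto|]. intros H. split; auto. apply in_pow. apply H. Qed.
(** The union of what is definable over earlier levels, a single equation for all ordinals that
    makes the levels increasing. That this is the given hierarchy is the content of [IF_0], [IF_suc]
    and [IF_lim]. *)
Definition IF := rec (fun h : U => uni (img h (fun p => Dfn (pi2 p)))).
Lemma F1_IG : F1 (fun h : U => uni (img h (fun p => Dfn (pi2 p)))). Proof. def. Qed.
Lemma F1_IF : F1 IF. Proof. apply F1_rec, F1_IG. Qed.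
Hint Resolve F1_IF : def.
Lemma in_IF a x : Ord a -> (x ε IF a <-> exists b, b ε a /\ impdef x (IF b)).
Proof.
  intros Oa. unfold IF at 1. rewrite (rec_eq _ F1_IG) by auto. fold IF. rewrite in_uni. split.
  - intros (y & Hy & Hx). apply in_img in Hy as (p & Hp & ->); [|def]. apply in_lam in Hp as (b & Hb & ->); [|def].
    rewrite pi2_op in Hx. apply in_Dfn in Hx. exists b. auto.
  - intros (b & Hb & Hx). exists (Dfn (IF b)). split; [|apply in_Dfn; auto]. apply in_img; [def|]. exists (op b (IF b)).
    rewrite pi2_op. split; auto. apply op_lam; [def|auto].
Qed.
#[local] Opaque IF.
Lemma IF_subs a b : Ord a -> Ord b -> subs a b -> subs (IF a) (IF b).
Proof. intros Oa Ob H x Hx. apply in_IF in Hx as (c & Hc & K); auto. apply in_IF; auto. exists c. auto. Qed.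
Lemma IF_mono a b : Ord a -> b ε a -> subs (IF b) (IF a).
Proof. intros Oa H. apply IF_subs; auto; [exact (mem_Ord a b H Oa)|]. intros z Hz. exact (Ord_trans a b z Hz H Oa). Qed.
Lemma IF_tr a : Ord a -> forall x y, x ε IF a -> y ε x -> y ε IF a.
Proof. intros Oa x y Hx Hy. apply in_IF in Hx as (b & Hb & K & _); auto. apply (IF_mono a b Oa Hb), K, Hy. Qed.
Definition IC (x : U) := exists a, Ord a /\ x ε IF a.
Lemma D1_IC : D1 IC. Proof. unfold IC. def. Qed.
Hint Resolve D1_IC : def.
Lemma IC_tr x y : IC x -> y ε x -> IC y.
Proof. intros (a & Oa & H) Hy. exists a. split; auto. eapply IF_tr; eauto. Qed.
Lemma IC_def a S : Ord a -> impdef S (IF a) -> IC S.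
Proof.
  intros Oa H. exists (suc a). split; [apply Ord_suc; auto|]. apply in_IF; [apply Ord_suc; auto|]. exists a. split; auto. apply in_suc; auto.
Qed.
Definition rk (x : U) := the (fun a => Ord a /\ x ε IF a /\ forall c, c ε a -> ~ x ε IF c).
Lemma F1_rk : F1 rk. Proof. unfold rk. def. Qed.
Hint Resolve F1_rk : def.
Lemma rk_spec x : IC x -> Ord (rk x) /\ x ε IF (rk x).
Proof.
  intros (a & Oa & Ha). cut (Ord (rk x) /\ x ε IF (rk x) /\ forall c, c ε rk x -> ~ x ε IF c); [tauto|].
  apply (the_ok (fun a => Ord a /\ x ε IF a /\ forall c, c ε a -> ~ x ε IF c)).
  - destruct (Ord_least (fun a => x ε IF a)) with (a := a) as (b & Ob & Hb & _ & L); [def|auto|auto|]. exists b. auto.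
  - intros b c (Ob & B1 & B2) (Oc & C1 & C2). destruct (Ord_tri b c Ob Oc) as [K|[K|K]]; auto; exfalso.
    + exact (C2 b K B1).
    + exact (B2 c K C1).
Qed.
Lemma IF_bound A : (forall x, x ε A -> IC x) -> exists b, Ord b /\ subs A (IF b).
Proof.
  intros H. assert (OR : forall a, a ε img A rk -> Ord a).
  { intros a Ha. apply in_img in Ha as (x & Hx & ->); [|def]. apply rk_spec; auto. }
  exists (uni (img A rk)). split; [apply Ord_uni; auto|]. intros x Hx. destruct (rk_spec x (H x Hx)) as [Or Kr].
  apply (IF_subs (rk x)); auto; [apply Ord_uni; auto|]. intros z Hz. apply in_uni. exists (rk x). split; auto. apply in_img; [def|eauto].
Qed.

(** The level [IF emp] has no elements, so [impdef_intro] does not apply; the code of a tautology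
    without variables defines the only subset. *)
Lemma IC_emp : IC emp.
Proof.
  apply (IC_def emp); [apply Ord_emp|]. assert (E : IF emp = emp).
  { apply zext. intros z. split; intros K; [|exfalso; eapply in_emp; eauto]. apply in_IF in K as (b & Hb & _); [|apply Ord_emp].
    exfalso. eapply in_emp; eauto. }
  rewrite E. assert (N0 : forall z : U, ~ z ε emp) by (intros z; apply in_emp).
  assert (FE : FnT emp emp (emp : U)) by (split; [split|]; intros; exfalso; eapply N0; eauto).
  assert (FE2 : FC emp (cI cB cB)).
  { intros ZZ HZ. destruct (HZ emp om_0) as (_ & _ & Z3 & Z4 & _). auto. }
  split; [intros z; auto|]. exists emp. split; [apply om_0|]. exists (cI cB cB), emp. split; [auto|]. split; [auto|]. split.
  - destruct (satrel_exists emp emp) as (T & HT). exists T. split; auto.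
    destruct (HT emp om_0 emp FE) as (_ & _ & _ & _ & Q & _). apply Q; auto; intros ZZ HZ; apply (HZ emp om_0).
  - intros S' HS' _. apply zext. intros z. split; intros K; [auto|exfalso; eapply N0; eauto].
Qed.

Notation X0 b := (sub U (fun x => x ε IF b) (fun _ => False)).
Lemma temb_X b : Ord b -> temb (@val U (fun x => x ε IF b) (fun _ => False)).
Proof. intros Ob. apply temb_val. apply IF_tr; auto. Qed.
Lemma IC_explicit b S (P : X0 b -> Prop) : Ord b -> (exists x, x ε IF b) -> D1 P -> subs S (IF b) ->
  (forall y : X0 b, val y ε S <-> P y) -> IC S.
Proof. intros Ob Hx DP HS H. apply (IC_def b); auto. apply (impdef_explicit (IF b) S P); auto. Qed.
Definition mkX {b x} (H : x ε IF b) : X0 b := mk (fun _ => False) x H.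
Lemma IC_upair x y : IC x -> IC y -> IC (upair x y).
Proof.
  intros Hx Hy. destruct (IF_bound (upair x y)) as (b & Ob & Hb).
  { intros z Hz. apply in_upair in Hz as [->| ->]; auto. }
  assert (Kx : x ε IF b) by (apply Hb, in_upair; auto). assert (Ky : y ε IF b) by (apply Hb, in_upair; auto).
  apply (IC_explicit b _ (fun z => z = mkX Kx \/ z = mkX Ky)); [auto|eauto|def|auto|].
  intros z. rewrite in_upair. split; intros [K|K]; [left|right|left|right]; [apply val_inj; exact K|apply val_inj; exact K|rewrite K; auto|rewrite K; auto].
Qed.
Lemma IC_suc x : IC x -> IC (suc x).
Proof.
  intros (b & Ob & Kx). apply (IC_explicit b _ (fun z => z ε mkX Kx \/ z = mkX Kx)); [auto|eauto|def| |].
  - intros z Hz. apply in_suc in Hz as [Hz| ->]; auto. eapply IF_tr; eauto.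
  - intros z. rewrite in_suc. split; intros [K|K]; [left; exact K|right; apply val_inj; exact K|left; exact K|right; rewrite K; auto].
Qed.
Lemma IC_op x y : IC x -> IC y -> IC (op x y). Proof. apply C_op. exact IC_upair. Qed.
Lemma IF_op1 b x y : Ord b -> op x y ε IF b -> x ε IF b /\ y ε IF b.
Proof.
  intros Ob H. pose proof (IF_tr b Ob) as T. Transparent op sg. unfold op, sg in H. Opaque op sg.
  assert (K2 : upair x y ε IF b) by (eapply T; [exact H|]; apply in_upair; auto).
  split; eapply T; try exact K2; apply in_upair; auto.
Qed.
(** Take a level that includes [a]; the set [g] of its ordinals is definable over it and is an
    ordinal. It is not below [a], since it would then be an element of that level and of itself. *)
Lemma IC_Ord a : Ord a -> IC a.
Proof.
  revert a. apply (Ord_ind IC); [def|]. intros a Oa IH. destruct (classic (exists z, z ε a)) as [(z & Hz)|N0].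
  2: { replace a with (emp : U); [apply IC_emp|]. apply zext. intros w. split; intros K; [exfalso; eapply in_emp; eauto|exfalso; eauto]. }
  destruct (IF_bound a IH) as (b & Ob & Hb). set (g := sep (IF b) Ord).
  assert (ig : forall x, x ε g <-> x ε IF b /\ Ord x) by (intros x; unfold g; rewrite in_sep by def; tauto).
  assert (Og : Ord g).
  { split; [intros x Hx y Hy|intros x Hx; apply ig in Hx as [_ Hx]; exact (proj1 Hx)]. apply ig in Hx as [K1 K2]. apply ig.
    split; [exact (IF_tr b Ob x y K1 Hy)|exact (mem_Ord x y Hy K2)]. }
  assert (Ig : IC g).
  { apply (IC_explicit b g (fun z => Ord z)); [auto|exists z; auto|def|intros x Hx; apply ig in Hx; tauto|].
    intros y. rewrite ig. pose proof (temb_X b Ob). rewrite (a_Ord val y). split; [tauto|]. intros K. split; auto. exact (proj2_sig y). }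
  destruct (Ord_tri a g Oa Og) as [K|[K|K]].
  - eapply IC_tr; eauto.
  - rewrite K. auto.
  - exfalso. apply (mem_irr g). apply ig. split; auto.
Qed.
(** Over a level that contains the approximation of length [b], the absolute formula [Gm] defines
    the next set. *)
Lemma IC_FL b : Ord b -> IC (lam b FL) -> IC (FL b).
Proof.
  intros Ob Hl. destruct (IF_bound (upair (lam b FL) b)) as (c & Oc & Hc).
  { intros z Hz. apply in_upair in Hz as [->| ->]; auto. apply IC_Ord; auto. }
  assert (Kl : lam b FL ε IF c) by (apply Hc, in_upair; auto). assert (Kb : b ε IF c) by (apply Hc, in_upair; auto).
  pose proof (temb_X c Oc) as TE.
  apply (IC_explicit c _ (fun w => Gm (mkX Kl) (mkX Kb) w)); [auto|eauto|def| |].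
  - intros w Hw. apply FL_tr in Hw as (d & Hd & ->); auto. apply (IF_op1 c d); auto. refine (IF_tr c Oc _ _ Kl _). apply op_lam; [def|auto].
  - intros y. rewrite in_FL by auto. exact (a_Gm val (mkX Kl) (mkX Kb) y).
Qed.
(** A level that contains all proper restrictions, with the pairs needed, defines this one by the
    formula already used inside L. *)
Lemma IC_lam a : Ord a -> IC (lam a FL).
Proof.
  revert a. apply (Ord_ind (fun a => IC (lam a FL))); [def|]. intros a Oa IH.
  assert (OO : forall b, b ε a -> Ord b) by (intros b Hb; exact (mem_Ord a b Hb Oa)).
  destruct (IF_bound (bun (sg a) (bun (img a (fun b => lam b FL)) (img a (fun b => op b (FL b)))))) as (c & Oc & Hc).
  { intros z Hz. rewrite !in_bun, in_sg, !in_img in Hz by def. destruct Hz as [->|[(b & Hb & ->)|(b & Hb & ->)]]; [apply IC_Ord; auto|auto|].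
    apply IC_op; [apply IC_Ord; auto|apply IC_FL; auto]. }
  assert (Ka : a ε IF c) by (apply Hc; rewrite in_bun, in_sg; auto).
  assert (K1 : forall b, b ε a -> lam b FL ε IF c) by (intros b Hb; apply Hc; rewrite !in_bun, !in_img by def; eauto).
  assert (K2 : forall b, b ε a -> op b (FL b) ε IF c) by (intros b Hb; apply Hc; rewrite !in_bun, !in_img by def; eauto).
  pose proof (temb_X c Oc) as TE.
  apply (IC_explicit c _ (fun p => exists b h x, b ε mkX Ka /\ Att h b /\ isop p b x /\ forall w, w ε x <-> Gm h b w)); [auto|eauto|def| |].
  - intros p Hp. apply in_lam in Hp as (b & Hb & ->); [auto|def].
  - intros y. split.
    + intros Hy. apply in_lam in Hy as (b & Hb & Ey); [|def]. destruct (IF_op1 c _ _ Oc (K2 b Hb)) as [L1 L2].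
      exists (mkX L1), (mkX (K1 b Hb)), (mkX L2). split; [exact Hb|]. split; [|split].
      * apply (a_Att val (mkX (K1 b Hb)) (mkX L1)). apply Att_lam; auto.
      * apply (a_isop val y (mkX L1) (mkX L2)). apply isop_op. exact Ey.
      * intros w. rewrite <- (a_Gm val (mkX (K1 b Hb)) (mkX L1) w). rewrite <- (t_mem w (mkX L2)). apply in_FL; auto.
    + intros (b & h & x & Hb & HA & Hp & Hx). apply (a_Att val h b) in HA. apply Att_eq in HA.
      apply (a_isop val y b x) in Hp. apply isop_op in Hp. assert (Hb' : val b ε a) by exact Hb.
      apply in_lam; [def|]. exists (val b). split; auto. rewrite Hp. f_equal. destruct (IF_op1 c _ _ Oc (K2 _ Hb')) as [L1 L2].
      assert (EX : forall w : X0 c, val w ε val x <-> val w ε FL (val b)).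
      { intros w. rewrite in_FL by auto. rewrite <- HA. rewrite (a_Gm val h b w). rewrite <- Hx. apply (t_mem w x). }
      apply zext. intros w. split; intros Hw.
      * apply (EX (mkX (IF_tr c Oc _ _ (proj2_sig x) Hw))). exact Hw.
      * apply (EX (mkX (IF_tr c Oc _ _ L2 Hw))). exact Hw.
Qed.

(** A set defined over an earlier level is an element of [IF a], and is definable over [IF a] with
    itself as parameter. *)
Lemma IF_suc a S : Ord a -> (S ε IF (suc a) <-> impdef S (IF a)).
Proof.
  intros Oa. rewrite in_IF by (apply Ord_suc; auto). split; [|intros H; exists a; split; auto; apply in_suc; auto].
  intros (b & Hb & H). apply in_suc in Hb as [Hb| ->]; auto.
  assert (HS : S ε IF a) by (apply in_IF; eauto).
  apply (impdef_explicit (IF a) S (fun y : X0 a => y ε mkX HS)); [eauto|def| |intros y; reflexivity].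
  intros z Hz. apply (IF_mono a b Oa Hb), H, Hz.
Qed.
Lemma IF_lim a : isLim a -> forall z, z ε IF a <-> exists g, g ε a /\ z ε IF g.
Proof.
  intros (Oa & Na & Ns) z. split.
  - intros H. apply in_IF in H as (b & Hb & K); auto. exists (suc b). assert (Ob : Ord b) by exact (mem_Ord a b Hb Oa).
    split; [|apply IF_suc; auto]. destruct (Ord_tri (suc b) a (Ord_suc b Ob) Oa) as [L|[L|L]]; auto; exfalso.
    + apply Ns. exists b. auto.
    + apply in_suc in L as [L|L]; [eapply mem_asym; eauto|]. rewrite L in Hb. eapply mem_irr; eauto.
  - intros (g & Hg & H). eapply IF_mono; eauto.
Qed.
Lemma IF_0 : IF emp = emp.
Proof.
  apply zext. intros z. split; intros K; [|exfalso; eapply in_emp; eauto]. apply in_IF in K as (b & Hb & _); [|apply Ord_emp].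
  exfalso. eapply in_emp; eauto.
Qed.

(** * Sequences of levels and the formula for Imp *)

Definition isq (f a : U) := Fn f (suc a) /\ forall b Y, op b Y ε f -> (b = emp -> Y = emp) /\
  (forall g X, b = suc g -> op g X ε f -> forall S, S ε Y <-> impdef S X) /\
  (isLim b -> forall z, z ε Y <-> exists g, g ε b /\ z ε app f g).
Lemma isq_IF a : Ord a -> isq (lam (suc a) IF) a.
Proof.
  intros Oa. assert (Os : Ord (suc a)) by (apply Ord_suc; auto). split; [apply Fn_lam; def|]. intros b Y H. apply op_lam in H as [Hb ->]; [|def].
  split; [intros ->; apply IF_0|]. split.
  - intros g X -> HX S. apply op_lam in HX as [Hg ->]; [|def]. apply IF_suc. exact (mem_Ord _ _ Hg Os).
  - intros Lb z. rewrite IF_lim by auto. split; intros (g & Hg & K); exists g; (split; [auto|]); rewrite app_lam in *; auto; try def;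
      exact (Ord_trans _ _ _ Hg Hb Os).
Qed.
Lemma isq_app f a : Ord a -> isq f a -> forall b, b ε suc a -> app f b = IF b.
Proof.
  intros Oa [Hf H]. assert (Os : Ord (suc a)) by (apply Ord_suc; auto).
  assert (FA : forall b, b ε suc a -> op b (app f b) ε f) by (intros b Hb; apply (Fn_appv f (suc a) b Hf Hb); auto).
  intros b Hb. assert (Ob : Ord b) by exact (mem_Ord _ _ Hb Os). revert Hb. revert b Ob.
  apply (Ord_ind (fun b => b ε suc a -> app f b = IF b)); [def|]. intros b Ob IH Hb.
  assert (DN : forall g, g ε b -> g ε suc a) by (intros g Hg; exact (Ord_trans _ _ _ Hg Hb Os)).
  destruct (H b (app f b) (FA b Hb)) as (H0 & HS & HL).
  destruct (classic (b = emp)) as [->|Nb]; [rewrite H0, IF_0; auto|].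
  destruct (classic (exists x, b = suc x)) as [(g & ->)|Ns].
  - assert (Hg : g ε suc g) by (apply in_suc; auto). apply zext. intros S.
    rewrite (HS g (app f g) eq_refl (FA g (DN g Hg))), (IH g Hg (DN g Hg)), IF_suc; [tauto|]. exact (mem_Ord _ _ Hg Ob).
  - assert (Lb : isLim b) by (split; auto). apply zext. intros z. rewrite (HL Lb), IF_lim by auto.
    split; intros (g & Hg & K); exists g; (split; [auto|]); rewrite (IH g Hg (DN g Hg)) in *; auto.
Qed.

Section FrImp.
Local Notation FR := (@FR U (fun A => A) (@CT U)).
Local Notation TV := (@TV U (fun A => A) (@CT U)).
Ltac ini := pose proof (@CT_all U) as AC; pose proof (@CT_tr U) as Ctr.
Ltac cti := try exact I; try (intros; exact I).
Ltac tvhook ::= lazymatch goal with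
  | |- TV _ Empty _ => apply T_Empty
  | |- TV _ (OPair _ _) _ => eapply T_OPair; [tv|tv]
  | |- TV _ (Succ _) _ => eapply T_Succ; tv
  | |- TV _ (App _ _) _ => eapply T_App; [tv|tv|eapply Fn_appv; [eassumption|]]
  end.
Ltac frhook ::= lazymatch goal with
  | |- FR _ (implicitly_definable _ _) _ => eapply FR_impdef; [tv|tv]
  | |- FR _ (limit _) _ => eapply FR_limit; [cti|cti|cti|tv]
  | |- FR _ (ordinal _) _ => eapply FR_ordinal; [cti|tv]
  | |- FR _ (function_on _ _) _ => eapply FR_function_on; [cti|cti|tv|tv]
  end.
Lemma FR_Imp_sequence s f a fv av : Ord av -> TV s f fv -> TV s a av -> FR s (Imp_sequence f a) (isq fv av).
Proof.
  intros Oa Hf Ha. ini. assert (Os : Ord (suc av)) by (apply Ord_suc; auto). unfold Imp_sequence, isq. fr.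
  match goal with H : Fn fv _, K : op ?b _ ε fv, L : ?g ε ?b |- _ => exact (Ord_trans _ _ _ L (proj1 (Fn_op _ _ _ _ H K)) Os) end.
Qed.
Lemma FR_in_Imp s t v : TV s t v -> FR s (in_Imp t) (IC v).
Proof.
  intros Ht. ini. eapply FR_iff with (P := exists a f, Ord a /\ (isq f a /\ v ε app f a)).
  - unfold in_Imp. apply FR_exT; auto. bnd. apply FR_exT; auto. bnd. apply FR_and; [fr|]. intros Oa.
    apply FR_and; [apply FR_Imp_sequence; auto; tv|]. intros Q. apply FR_mem; [tv|]. eapply T_App; [tv|tv|].
    apply (Fn_appv _ _ _ (proj1 Q)). apply in_suc; auto.
  - split.
    + intros (a & f & Oa & Q & K). exists a. split; auto. rewrite (isq_app f a) in K; auto. apply in_suc; auto.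
    + intros (a & Oa & K). exists a, (lam (suc a) IF). split; auto. split; [apply isq_IF; auto|]. rewrite app_lam; auto; [def|apply in_suc; auto].
Qed.
End FrImp.
#[export] Instance relz_Imp : relz U (relativize Imp_class) IC.
Proof.
  split; auto. intros r A. simpl.
  assert (E : forall x, sat U (x .: r) Imp_class <-> IC x).
  { intros x. refine (FR_in_Imp (1, x .: r) (Lvl 0) x _ (1, x .: r) (ext_refl _)). apply TV_var. exists 0.
    split; auto. split; simpl; auto. split; auto. exact I. }
  setoid_rewrite E. tauto.
Qed.
End Imp.
#[export] Hint Resolve F1_Dfn F1_IF D1_IC F1_rk : def.
#[global] Opaque IF.

(** * The continuum hypothesis in Imp *)

#[local] Opaque Rn Pn En Gam.
Section NotCH.
Context {N : str} {Z : ZFm N} {VL : VLm N} {G : N -> Prop} {GG : @generic N Qpo G}.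
Notation W := (@W N Z Qpo G).
Notation jW := (@jW N Z Qpo G).
Notation Gam := (@Gam N Z G).
Notation X0 b := (sub W (fun x => x ε IF b) (fun _ => False)).

(** By absoluteness [jW] maps approximations to approximations, so sets of the ground model are
    constructible in [W]. *)
Lemma jW_IC x : IC (jW x).
Proof.
  assert (Oa : Ord (suc (od x))) by (apply Ord_suc, od_spec). pose proof (Att_lam _ Oa) as HA.
  apply (a_Att jW) in HA. apply Att_eq in HA.
  assert (Ho : Ord (jW (od x))) by (apply (a_Ord jW), od_spec).
  assert (K : op (jW (od x)) (jW x) ε jW (lam (suc (od x)) FL)).
  { rewrite <- jW_op. apply t_mem. apply op_lam; [def|]. split; [apply in_suc; auto|apply od_spec]. }
  rewrite HA in K. apply op_lam in K as [_ K]; [|def]. rewrite K. apply IC_FL; auto. apply IC_lam; auto.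
Qed.
Lemma jW_emp : jW emp = emp.
Proof. apply zext. intros z. rewrite in_jW. split; [intros (y & Hy & _); destruct (in_emp y Hy)|intros Hz; destruct (in_emp z Hz)]. Qed.
Lemma jW_suc x : jW (suc x) = suc (jW x).
Proof.
  apply zext. intros z. rewrite in_suc, !in_jW. setoid_rewrite in_suc. split.
  - intros (y & [Hy| ->] & ->); [left; exists y; auto|right; reflexivity].
  - intros [(y & Hy & ->)| ->]; [exists y; auto|exists x; auto].
Qed.
Lemma jW_om : jW om = om.
Proof.
  apply zext. intros z. split.
  - intros H. apply in_jW in H as (n & Hn & ->). apply natS_om, (a_natS jW), natS_om. exact Hn.
  - revert z. apply (om_ind (fun z => z ε jW om)); [def| |].
    + rewrite <- jW_emp. apply t_mem, om_0.
    + intros n _ H. apply in_jW in H as (m & Hm & ->). rewrite <- jW_suc. apply t_mem, om_S. exact Hm.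
Qed.

(** * The clauses as a formula over a level of Imp *)

Section GamIC.
Context (b : W) (Ob : Ord b) (I R P E : X0 b) (A3 : pform {x : W | x ε IF b})
  (HA3 : forall e : nat -> X0 b, pin (e 0) (e 1) (e 2) <-> psat e A3).
Notation XS S := (sub W (fun x => x ε IF b) (fun x => x ε S)).
Definition pand {T} (A B : pform T) := pImp (pImp A (pImp B pBot)) pBot.
Definition pexd : pform {x : W | x ε IF b} := pImp (pAll (pImp (pMem (V 0) (V 1)) (pImp (pPrd (V 0)) pBot))) pBot.
(** [A3] defines [pin] over the level with empty predicate; [nop] makes it valid for every
    predicate. The substitution fixes the first argument and reads the others off two nested
    binders. *)
Definition ppin (r : X0 b) := psub (fun i => match i with 0 => K r | 1 => V 1 | _ => V 0 end) (nop (IF b) A3).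
Definition psol : pform {x : W | x ε IF b} :=
  pand (pAll (pImp (pPrd (V 0)) (pMem (V 0) (K I))))
    (pand (pAll (pAll (pImp (ppin R) (pImp (pPrd (V 1)) pexd))))
      (pand (pAll (pImp (pMem (V 0) (K P)) pexd))
        (pAll (pAll (pImp (ppin E) (pImp (pPrd (V 1)) (pImp (pPrd (V 0)) pBot))))))).
Lemma psat_pand S (e : nat -> XS S) A B : @psat (XS S) e (pand A B) <-> @psat (XS S) e A /\ @psat (XS S) e B.
Proof. simpl. tauto. Qed.
Lemma psat_pexd S (e : nat -> XS S) : @psat (XS S) e pexd <-> exists d : X0 b, val d ε val (e 0 : X0 b) /\ val d ε S.
Proof.
  simpl. split.
  - intros H. apply NNPP. intros K. apply H. intros d H1 H2. apply K. exists d. split; auto.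
  - intros (d & H1 & H2) K. exact (K d H1 H2).
Qed.
Lemma psat_ppin S (e : nat -> XS S) r : @psat (XS S) e (ppin r) <-> @pin (X0 b) r (e 1) (e 0).
Proof.
  set (t := fun i => match i with 0 => K r | 1 => V 1 | _ => V 0 end : tm {x : W | x ε IF b}).
  etransitivity; [exact (psat_sub (XS S) (nop (IF b) A3) t e)|].
  etransitivity; [exact (psat_nop (IF b) S A3 (fun i => tval e (t i)))|].
  symmetry. exact (HA3 (fun i => tval e (t i))).
Qed.
Lemma psat_psol S (e : nat -> XS S) : subs S (IF b) ->
  (@psat (XS S) e psol <-> sol (fun x => x ε S) (val I) (val R) (val P) (val E)).
Proof.
  intros HS. pose proof (temb_X b Ob) as TE. unfold psol, sol. rewrite !psat_pand.
  assert (Q1 : @psat (XS S) e (pAll (pImp (pPrd (V 0)) (pMem (V 0) (K I)))) <-> forall x, x ε S -> x ε val I).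
  { simpl. split; [intros H x Hx; exact (H (exist _ x (HS x Hx)) Hx)|intros H x Hx; exact (H _ Hx)]. }
  assert (Q2 : @psat (XS S) e (pAll (pAll (pImp (ppin R) (pImp (pPrd (V 1)) pexd)))) <->
    forall t D, pin (val R) t D -> t ε S -> exists d, d ε D /\ d ε S).
  { split.
    - intros H t D HR Ht. apply pin_down in HR as (t' & D' & -> & -> & HR); [|exact TE].
      destruct (proj1 (psat_pexd S (D' .: (t' .: e))) (H t' D' (proj2 (psat_ppin S (D' .: (t' .: e)) R) HR) Ht)) as (d & K1 & K2).
      exists (val d). auto.
    - intros H t D HR Ht. apply psat_ppin in HR. simpl in HR. apply (psat_pexd S (D .: (t .: e))). simpl.
      destruct (H (val (t : X0 b)) (val (D : X0 b)) (proj2 (a_pin val R t D) HR) Ht) as (d & K1 & K2).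
      exists (exist _ d (HS d K2)). auto. }
  assert (Q3 : @psat (XS S) e (pAll (pImp (pMem (V 0) (K P)) pexd)) <-> forall D, D ε val P -> exists d, d ε D /\ d ε S).
  { split.
    - intros H D HD. apply (a_down val) in HD as (D' & -> & HD).
      destruct (proj1 (psat_pexd S (D' .: e)) (H D' HD)) as (d & K1 & K2). exists (val d). auto.
    - intros H D HD. apply (psat_pexd S (D .: e)). destruct (H (val (D : X0 b)) HD) as (d & K1 & K2).
      exists (exist _ d (HS d K2)). auto. }
  assert (Q4 : @psat (XS S) e (pAll (pAll (pImp (ppin E) (pImp (pPrd (V 1)) (pImp (pPrd (V 0)) pBot))))) <->
    forall u v, pin (val E) u v -> u ε S -> v ε S -> False).
  { split.
    - intros H u v HE Hu Hv. apply pin_down in HE as (u' & v' & -> & -> & HE); [|exact TE].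
      exact (H u' v' (proj2 (psat_ppin S (v' .: (u' .: e)) E) HE) Hu Hv).
    - intros H u v HE Hu Hv. apply psat_ppin in HE. simpl in HE.
      exact (H (val (u : X0 b)) (val (v : X0 b)) (proj2 (a_pin val E u v) HE) Hu Hv). }
  rewrite Q1, Q2, Q3, Q4. tauto.
Qed.
End GamIC.

Lemma Gam_IC : IC Gam.
Proof.
  destruct (IF_bound (bun (upair (jW Ix) (jW Rn)) (upair (jW Pn) (jW En)))) as (b & Ob & Hb).
  { intros z Hz. apply in_bun in Hz as [Hz|Hz]; apply in_upair in Hz as [->| ->]; apply jW_IC. }
  assert (KI : jW Ix ε IF b) by (apply Hb, in_bun; left; apply in_upair; left; reflexivity).
  assert (KR : jW Rn ε IF b) by (apply Hb, in_bun; left; apply in_upair; right; reflexivity).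
  assert (KP : jW Pn ε IF b) by (apply Hb, in_bun; right; apply in_upair; left; reflexivity).
  assert (KE : jW En ε IF b) by (apply Hb, in_bun; right; apply in_upair; right; reflexivity).
  destruct (@D3_pin (X0 b)) as (A3 & HA3). apply (IC_def b); auto.
  assert (HS : subs Gam (IF b)).
  { intros w Hw. apply (proj1 Gam_sol) in Hw. exact (IF_tr b Ob _ _ KI Hw). }
  apply (impdef_intro (IF b) Gam (mkX KI) (psol b (mkX KI) (mkX KR) (mkX KP) (mkX KE) A3)); auto.
  - apply psat_psol; auto. exact Gam_sol.
  - intros S' HS' K. apply psat_psol in K; auto. apply Gam_uniq. exact K.
Qed.

(** The real attached to [x]; the nested pairs spell out the image of a literal under [jW]. *)
Definition rr (x : W) : W := sep om (fun n => op (jW emp) (op (op x n) (jW b1)) ε Gam).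
Lemma F1_rr : F1 rr. Proof. unfold rr. def. Qed.
Hint Resolve F1_rr : def.
Lemma in_rr x n : n ε om -> (jW n ε rr (jW x) <-> onG (G := G) (lit (op x n) b1)).
Proof.
  intros Hn. unfold rr. rewrite in_sep by def. rewrite <- !jW_op. fold (lit (op x n) b1). rewrite jW_Gam.
  split; [tauto|]. intros H. split; auto. rewrite <- jW_om. apply t_mem. exact Hn.
Qed.
(** Explicitly definable over a level that contains ω, the generic set and the table of the literals
    for [x]. *)
Lemma rr_IC x : IC (rr (jW x)).
Proof.
  set (g := lam om (fun n => lit (op x n) b1)). assert (Dg : F1 (fun n => lit (op x n) b1)) by (unfold lit; def).
  destruct (IF_bound (bun (upair (jW om) (jW g)) (sg Gam))) as (b & Ob & Hb).
  { intros z Hz. rewrite in_bun, in_sg, in_upair in Hz. destruct Hz as [[->| ->]| ->]; [apply jW_IC|apply jW_IC|apply Gam_IC]. }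
  assert (Ko : jW om ε IF b) by (apply Hb, in_bun; left; apply in_upair; left; reflexivity).
  assert (Kg : jW g ε IF b) by (apply Hb, in_bun; left; apply in_upair; right; reflexivity).
  assert (KG : Gam ε IF b) by (apply Hb, in_bun; right; apply in_sg; reflexivity).
  pose proof (temb_X b Ob) as TE.
  apply (IC_explicit b _ (fun y => y ε mkX Ko /\ exists l, pin (mkX Kg) y l /\ l ε mkX KG)); [auto|eauto|def| |].
  - intros z Hz. unfold rr in Hz. apply in_sep in Hz as [Hz _]; [|def]. rewrite <- jW_om in Hz. exact (IF_tr b Ob _ _ Ko Hz).
  - intros y. split.
    + intros Hy. assert (Hyo : val y ε jW om) by (unfold rr in Hy; apply in_sep in Hy as [Hy _]; [rewrite jW_om; exact Hy|def]).
      split; [exact Hyo|]. apply in_jW in Hyo as (n & Hn & En). rewrite En in Hy. apply in_rr in Hy; auto.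
      assert (KL : jW (lit (op x n) b1) ε Gam) by (apply jW_Gam; auto).
      exists (mkX (IF_tr b Ob _ _ KG KL)). split; [|exact KL]. apply (a_pin val). apply pin_op.
      change (op (val y) (jW (lit (op x n) b1)) ε jW g). rewrite En, <- jW_op. apply t_mem. apply op_lam; auto.
    + intros (Hyo & l & Hp & Hl). apply (a_pin val) in Hp. apply pin_op in Hp. change (op (val y) (val l) ε jW g) in Hp.
      apply in_jWop in Hp as (n & l' & En & El & Hp). apply op_lam in Hp as [Hn ->]; auto. rewrite En. apply in_rr; auto.
      apply jW_Gam. rewrite <- El. exact Hl.
Qed.
#[local] Transparent mu la A0.
Lemma mu_sm : ~ sm om (mu : N). Proof. exact (proj1 (proj2 (KK_spec om))). Qed.
Lemma la_sm : ~ sm (bun om mu) (la : N). Proof. exact (proj1 (proj2 (KK_spec (bun om mu)))). Qed.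
Lemma mu_Ord : Ord (mu : N). Proof. exact (proj1 (KK_spec om)). Qed.
Lemma mu_A0 : subs mu (A0 : N). Proof. intros z Hz. apply in_bun. left. apply in_bun. right. exact Hz. Qed.
Lemma la_A0 : subs la (A0 : N). Proof. intros z Hz. apply in_bun. left. apply in_bun. left. exact Hz. Qed.
#[local] Opaque mu la A0.

Lemma mu_uncountable (f : W) : ~ inj f (jW mu) om.
Proof.
  intros [[HF HY] HI]. apply (preserveW mu om om f); [intros z Hz; exact Hz|intros z Hz; exact Hz|apply mu_A0|apply mu_sm| |].
  - intros x Hx. destruct (proj2 HF (jW x)) as (y & Hy & _); [apply t_mem; exact Hx|]. pose proof (HY _ _ Hy) as K. rewrite <- jW_om in K.
    apply in_jW in K as (n & Hn & ->). exists n. split; [exact Hn|exact Hy].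
  - intros x x' y K1 K2. exact (t_inj x x' (HI _ _ _ K1 K2)).
Qed.

(** Since μ is uncountable in [W], the first uncountable ordinal of Imp is at most μ. An injection
    of the reals of Imp into it would, applied to the reals [rr], inject λ into μ. *)
Lemma Imp_not_CH r : sat W r (Imp_models (¬ CH)%fml).
Proof.
  intros H. change (sat W r (relativize Imp_class (CH 0))) in H.
  set (PP := sep (pow om) (@IC W _)). assert (iP : forall z, z ε PP <-> IC z /\ subs z om).
  { intros z. unfold PP. rewrite in_sep by def. rewrite in_pow. tauto. }
  assert (Io : IC (om : W)) by (rewrite <- jW_om; apply jW_IC).
  assert (IP : IC PP).
  { destruct (IF_bound (bun PP (sg om))) as (b & Ob & Hb).
    { intros z Hz. rewrite in_bun, in_sg in Hz. destruct Hz as [Hz| ->]; auto. apply iP in Hz. tauto. }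
    assert (Ko : om ε IF b) by (apply Hb, in_bun; right; apply in_sg; reflexivity). pose proof (temb_X b Ob) as TE.
    apply (IC_explicit b _ (fun y => subs y (mkX Ko))); [auto|eauto|def|intros z Hz; apply Hb, in_bun; auto|].
    intros y. rewrite iP. rewrite <- (a_subs val y (mkX Ko)). split; [tauto|]. intros K. split; [|exact K]. exists b. split; auto. exact (proj2_sig y). }
  assert (K : exists f k, IC f /\ IC k /\ @Om1 W _ (@IC W _) k /\ inj f PP k).
  { refine (CH_inv (rl := relativize Imp_class) IC_tr IC_emp IC_upair IC_suc Io (0, r) PP IP iP H). }
  destruct K as (f & k & _ & _ & (Ok & _ & Ck) & [[HF HY] HI]).
  assert (Omu : Ord (jW mu)) by (apply (a_Ord jW), mu_Ord).
  assert (SK : subs k (jW mu)).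
  { destruct (Ord_tri k (jW mu) Ok Omu) as [K|[K|K]].
    - intros z Hz. exact (Ord_trans _ _ _ Hz K Omu).
    - rewrite K. intros z; auto.
    - exfalso. destruct (Ck _ K) as (g & _ & Hg). exact (mu_uncountable g Hg). }
  set (F := sep (prod (jW la) (jW mu)) (fun p => exists x y, p = op x y /\ op (rr x) y ε f)).
  assert (iF : forall x y, op x y ε F <-> (x ε jW la /\ y ε jW mu) /\ op (rr x) y ε f).
  { intros x y. unfold F. rewrite in_sep by def. rewrite op_prod. split.
    - intros (K1 & x' & y' & Ee & K2). apply op_inj in Ee as [<- <-]. auto.
    - intros [K1 K2]. split; auto. exists x, y. auto. }
  (* The set ω ∪ μ contains the target μ, and λ was defined as an ordinal not small with respect to
     it. *)
  apply (preserveW la mu (bun om mu) F).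
  - intros z Hz. apply in_bun. left. exact Hz.
  - intros z Hz. apply in_bun. right. exact Hz.
  - apply la_A0.
  - apply la_sm.
  - intros x Hx. destruct (proj2 HF (rr (jW x))) as (y & Hy & _).
    + apply iP. split; [apply rr_IC|]. intros z Hz. unfold rr in Hz. apply in_sep in Hz; [tauto|def].
    + pose proof (SK _ (HY _ _ Hy)) as Ky. assert (Ky' := Ky). apply in_jW in Ky' as (m & Hm & ->). exists m. split; [exact Hm|].
      apply iF. split; [|exact Hy]. split; [|exact Ky]. apply t_mem. exact Hx.
  - intros x x' y K1 K2. apply iF in K1 as [[K1 _] L1], K2 as [[K2 _] L2]. pose proof (HI _ _ _ L1 L2) as Er.
    apply NNPP. intros Nx. destruct (onG_diff x x') as (n & Hn & D1 & D2); [exact (proj1 (t_mem (j := jW) _ _) K1)|exact (proj1 (t_mem (j := jW) _ _) K2)|exact Nx|].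
    apply D2. apply (in_rr x' n Hn). rewrite <- Er. apply (in_rr x n Hn). exact D1.
Qed.
End NotCH.

Lemma sat_noprd (M : str) A : forall r : nat -> M, sat (Str M mem (fun _ => False)) r A <-> sat M r A.
Proof.
  induction A; intros r; simpl; try tauto.
  - rewrite IHA1, IHA2. tauto.
  - split; intros H x; apply IHA, H.
Qed.

Lemma no_refutation {N : str} {Z : ZFm N} {VL : VLm N} (e : nat -> N) (He : forall x, exists n, e n = x) L :
  (forall B, In B L -> extend ZFC (Imp_models (¬ CH)%fml) B) -> ~ prv L fBot.
Proof.
  intros HL Hp. destruct (generic_exists e He) as (G & GG).
  assert (S : forall r, sat (W G) r fBot).
  { intros r. apply (soundness L fBot Hp). intros B HB. destruct (HL B HB) as [[HB'| ->]| ->].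
    - apply ZFm_ZF. exact HB'.
    - apply sat_choice. apply W_choice.
    - apply Imp_not_CH. }
  exact (S (fun _ => emp)).
Qed.

Theorem theorem2p3 :
  consistent ZF -> consistent (extend ZFC (Imp_models (¬ CH)%fml)).
Proof.
  intros Hcon (L & HL & Hp).
  destruct (completeness ZF ZF_bound Hcon) as (M0 & (en & Hen) & HM).
  (* Completeness says nothing about the predicate of the model, while [ZF_ZFm] asks for an empty
     one. *)
  set (M := Str M0 mem (fun _ => False)).
  assert (ZM : ZFm M).
  { apply (@ZF_ZFm M en Hen); [intros x K; exact K|]. intros A r HA. apply sat_noprd. apply HM; auto. }
  assert (VN : @VLm (LN (M := M)) LN_ZFm) by (split; exact (fun x => LN_VL x)).
  (* The enumeration of the model also enumerates its constructible sets, with [emp] in place of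
     sets that are not constructible. *)
  refine (@no_refutation (LN (M := M)) LN_ZFm VN
    (fun n => match excluded_middle_informative (@Lc M ZM (en n)) with
      left H => @mkL M ZM (en n) H | right _ => @emp _ LN_ZFm end) _ L HL Hp).
  intros [x Hx]. destruct (Hen x) as [n En]. exists n. destruct (excluded_middle_informative (@Lc M ZM (en n))) as [K|K].
  - apply val_inj. exact En.
  - exfalso. apply K. rewrite En. exact Hx.
Qed.
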